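(* Let $X$ be a real separable Hilbert space and let $\{U(t,s)\}_{s\le t}$, $\{B(t)\}_{t\in\mathbb R}$ satisfy assumptions (A1)--(A4) of the context. Let $s<t$ and assume that $U(t,s)_{|\mathcal H_s}\ne0$. (i) If $U(t,s):\mathcal H_s\to\mathcal H_t$ is compact and $\|U(t,s)\|_{\mathscr L(\mathcal H_s,\mathcal H_t)}<1$, then $P_{s,t}$ is compact from $L^p(X,\gamma_t)$ into $L^q(X,\gamma_s)$ for every $p\in(1,\infty)$ and every $1\le q<1+(p-1)\|U(t,s)\|^{-2}_{\mathscr L(\mathcal H_s,\mathcal H_t)}$. (ii) If $P_{s,t}:L^p(X,\gamma_t)\to L^1(X,\gamma_s)$ is compact for some $p\in(1,\infty)$, then $U(t,s):\mathcal H_s\to\mathcal H_t$ is compact. (iii) If $P_{s,t}$ is compact from $L^2(X,\gamma_t)$ into $L^2(X,\gamma_s)$, then $U(t,s):\mathcal H_s\to\mathcal H_t$ is compact and $\|U(t,s)\|_{\mathscr L(\mathcal H_s,\mathcal H_t)}<1$.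
   Context: Assumptions. (A1) $\{U(t,s)\}_{s\le t}\subseteq\mathscr L(X)$ is a strongly continuous evolution operator: $(s,t)\mapsto U(t,s)x$ is continuous for every $x\in X$, $U(t,t)=I$ and $U(t,r)U(r,s)=U(t,s)$ for $s\le r\le t$. (A2) $\{B(t)\}_{t\in\mathbb R}\subseteq\mathscr L(X)$, $\sup_{t}\|B(t)\|_{\mathscr L(X)}<\infty$, and $t\mapsto B(t)x$ is measurable for every $x\in X$. (A3) With $Q(r):=B(r)B(r)^\star$, for every $s<t$ the operator $Q(t,s)=\int_s^tU(t,r)Q(r)U(t,r)^\star\,dr$ has finite trace. (A4) For every $t\in\mathbb R$, $\sup_{s<t}\mathrm{Tr}[Q(t,s)]<\infty$, and $\lim_{s\to-\infty}U(t,s)x=0$ for every $x\in X$. $P_{t,t}=I$ and, for $s<t$ and $\varphi$ bounded Borel, $P_{s,t}\varphi(x)=\int_X\varphi(y)\,\mathcal N_{U(t,s)x,Q(t,s)}(dy)$, where $\mathcal N_{a,Q}$ is the Gaussian measure with mean $a$ and covariance $Q$. Put $Q(t,-\infty)=\int_{-\infty}^tU(t,r)Q(r)U(t,r)^\star\,dr$ and $\gamma_t=\mathcal N_{0,Q(t,-\infty)}$. For every $p\in[1,\infty)$, $P_{s,t}$ extends to a bounded operator $L^p(X,\gamma_t)\to L^p(X,\gamma_s)$ with norm $1$, still denoted $P_{s,t}$. $\mathcal H_t$ is the Cameron–Martin space of $\gamma_t$: $\mathcal H_t=Q(t,-\infty)^{1/2}(X)$ with norm $\|h\|_{\mathcal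 H_t}=\|Q(t,-\infty)^{-1/2}h\|_X$, where $Q(t,-\infty)^{-1/2}h$ is the unique $z\in(\ker Q(t,-\infty)^{1/2})^\perp$ with $Q(t,-\infty)^{1/2}z=h$. Under the assumptions $U(t,s)$ maps $\mathcal H_s$ into $\mathcal H_t$, and $\|U(t,s)\|_{\mathscr L(\mathcal H_s,\mathcal H_t)}\le1$ denotes the norm of its restriction. *)

(* Defs.v *)
From mathcomp Require Import all_boot all_order all_algebra sesquilinear.
From mathcomp Require Import all_classical all_reals all_analysis.

Set Implicit Arguments.
Unset Strict Implicit.
Unset Printing Implicit Defensive.
Import Order.TTheory GRing.Theory Num.Theory.
Import numFieldNormedType.Exports.

Local Open Scope classical_set_scope.
Local Open Scope ring_scope.

Definition separable (T : topologicalType) : Prop :=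
  exists2 D : set T, countable D & dense D.

Notation borel T := (g_sigma_algebraType (@open T)).

(* A (semi)normed space is given here by a subset of an ambient type together
   with an extended-real-valued norm. This covers the Cameron-Martin spaces
   (subsets of X with a norm of their own) and the L^p spaces (functions that
   are p-integrable, with the p-seminorm: two functions that are equal almost
   everywhere are at distance 0). *)
Section operators_between_seminormed_spaces.
Context {R : realType} {V : Type} {W : zmodType}.
Variables (DV : set V) (nV : V -> \bar R) (DW : set W) (nW : W -> \bar R).

Definition opnorm (T : V -> W) : \bar R :=
  ereal_sup [set nW (T v) | v in [set v | DV v /\ (nV v <= 1)%E]].

Definition compact_operator (T : V -> W) : Prop :=
  (forall v, DV v -> DW (T v)) /\
  forall u : nat -> V, (forall n, DV (u n)) ->
    (exists M : R, forall n, (nV (u n) <= M%:E)%E) ->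
    exists2 k : nat -> nat, increasing_seq k &
      exists2 w, DW w & nW (T (u (k n)) - w) @[n --> \oo] --> 0%E.

End operators_between_seminormed_spaces.

Definition Lp_norm {d} {T : measurableType d} {R : realType}
    (mu : {measure set T -> \bar R}) (p : R) (f : T -> R) : \bar R :=
  ('N[mu]_p%:E[EFin \o f])%E.

Section hilbert.
Context {R : realType} {X : completeNormedModType R}.
Variable dotp : {dot X for idfun}.

Definition is_inner_product : Prop := forall x : X, dotp x x = `|x| ^+ 2.

Definition bounded_operator (A : X -> X) : Prop := linear A /\ continuous A.

Definition adjoint (A : X -> X) : X -> X :=
  fun y => xget 0 [set z | forall x, dotp (A x) y = dotp x z].

Definition orthonormal_basis (E : set X) : Prop :=
  [/\ forall e, E e -> dotp e e = 1,
      forall e f, E e -> E f -> e <> f -> dotp e f = 0 &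
      forall x, (forall e, E e -> dotp x e = 0) -> x = 0].

(* For a nonnegative operator the value does not depend on the basis. *)
Definition trace (Q : X -> X) : \bar R :=
  (\esum_(e in xget set0 orthonormal_basis) (dotp (Q e) e)%:E)%E.

Definition nonneg_root (Q S : X -> X) : Prop :=
  [/\ bounded_operator S,
      forall x y, dotp (S x) y = dotp x (S y),
      forall x, 0 <= dotp (S x) x &
      forall x, S (S x) = Q x].

Definition sqrt_operator (Q : X -> X) : X -> X :=
  xget (fun=> 0) (nonneg_root Q).

(* The integral of an operator-valued function, taken pointwise in x as a
   weak (Pettis) integral of the X-valued function r |-> F r x. *)
Definition operator_integral (D : set R) (F : R -> X -> X) : X -> X :=
  fun x => xget 0 [set z | forall y,
    (@lebesgue_measure R).-integrable D (fun r => (dotp (F r x) y)%:E) /\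
    dotp z y = \int[@lebesgue_measure R]_(r in D) dotp (F r x) y].

(* normal_prob takes the standard deviation as parameter, and is not a Dirac
   mass when the latter is 0. *)
Definition normal_law (m v : R) (A : set (measurableTypeR R)) : \bar R :=
  if v == 0 then dirac (m : measurableTypeR R) A
  else normal_prob m (Num.sqrt v) A.

Definition is_gaussian (a : X) (Q : X -> X)
    (mu : probability (borel X) R) : Prop :=
  forall (h : X) (A : set (measurableTypeR R)), measurable A ->
    mu ((fun x : X => dotp x h) @^-1` A) =
    normal_law (dotp a h) (dotp (Q h) h) A.

Definition gaussian (a : X) (Q : X -> X) : probability (borel X) R :=
  xget (T := {classic probability (borel X) R})
    [the probability (borel X) R of dirac (0 : borel X)] (is_gaussian a Q).

Definition cm_space (Q : X -> X) : set X := range (sqrt_operator Q).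

Definition inv_sqrt (Q : X -> X) (h : X) : X :=
  xget 0 [set z | (forall k, sqrt_operator Q k = 0 -> dotp z k = 0) /\
                  sqrt_operator Q z = h].

Definition cm_norm (Q : X -> X) (h : X) : \bar R := `|inv_sqrt Q h|%:E.

Section evolution.
Variables (U : R -> R -> X -> X) (B : R -> X -> X).

Definition evolution_operator : Prop :=
  [/\ forall t s, s <= t -> bounded_operator (U t s),
      forall x, {within [set st : R * R | st.1 <= st.2],
                   continuous (fun st : R * R => U st.2 st.1 x)},
      forall t x, U t t x = x &
      forall t r s x, s <= r -> r <= t -> U t r (U r s x) = U t s x].

Definition bounded_measurable_family : Prop :=
  [/\ forall t, bounded_operator (B t),
      (ereal_sup (range (fun t =>
         opnorm setT (fun x : X => `|x|%:E) (fun x : X => `|x|%:E) (B t)))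
       < +oo)%E &
      forall x : X, measurable_fun [set: measurableTypeR R]
        (fun t => B t x : borel X)].

Definition cov_integrand (t r : R) : X -> X :=
  U t r \o B r \o adjoint (B r) \o adjoint (U t r).

Definition cov (t s : R) : X -> X :=
  operator_integral `[s, t] (cov_integrand t).

Definition cov_ninfty (t : R) : X -> X :=
  operator_integral `]-oo, t] (cov_integrand t).

Definition finite_trace_cov : Prop :=
  forall t s, s < t -> (trace (cov t s) < +oo)%E.

Definition stable_evolution : Prop :=
  forall t,
    (ereal_sup [set trace (cov t s) | s in [set s | (s < t)%R]] < +oo)%E /\
    forall x, U t s x @[s --> -oo] --> (0 : X).

Definition gamma (t : R) : probability (borel X) R :=
  gaussian 0 (cov_ninfty t).

(* P_{s,t} on bounded Borel functions; meant for s < t. *)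
Definition ou_transition (s t : R) (phi : borel X -> R) : borel X -> R :=
  fun x => \int[gaussian (U t s x) (cov t s)]_y phi y.

(* The extension of P_{s,t} by density to L^p(gamma_t) -> L^p(gamma_s): a
   function determined up to gamma_s-almost everywhere equality. *)
Definition ou_transition_Lp (s t p : R) (f : borel X -> R) : borel X -> R :=
  xget 0 [set g | g \in Lfun (gamma s) p%:E /\
    exists phi : nat -> borel X -> R,
      [/\ forall n, measurable_fun [set: borel X] (phi n) /\
                    exists M : R, forall x, `|phi n x| <= M,
          Lp_norm (gamma t) p (phi n - f) @[n --> \oo] --> 0%E &
          Lp_norm (gamma s) p (ou_transition s t (phi n) - g) @[n --> \oo] --> 0%E]].

Definition H (t : R) : set X := cm_space (cov_ninfty t).
Definition H_norm (t : R) : X -> \bar R := cm_norm (cov_ninfty t).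

Definition U_H_norm (t s : R) : \bar R :=
  opnorm (H s) (H_norm s) (H_norm t) (U t s).

Definition U_H_compact (t s : R) : Prop :=
  compact_operator (H s) (H_norm s) (H t) (H_norm t) (U t s).

(* Compactness of P_{s,t} from L^p(gamma_t) into L^q(gamma_s). *)
Definition P_compact (s t p q : R) : Prop :=
  compact_operator
    [set f | f \in Lfun (gamma t) p%:E]
    (Lp_norm (gamma t) p)
    [set g | g \in Lfun (gamma s) q%:E]
    (Lp_norm (gamma s) q)
    (ou_transition_Lp s t p).

End evolution.
End hilbert.

(* Main.v *)
(* Write S_r = Q(r,-oo)^(1/2) and kap h = S_s U(t,s)^* h. Since
   Q(t,-oo) = U(t,s) Q(s,-oo) U(t,s)^* + Q(t,s), one has |kap h| <= |S_t h|, and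
   S_t h |-> kap h is, up to the isometries S_r, the adjoint of U(t,s) : H_s -> H_t;
   compactness and norm of U(t,s) are thus read off from kap and S_t.

   The second moment of a trigonometric polynomial under a centered Gaussian measure is a
   power series in the Gram matrix <S h, S k>, whose m-th term is its component in the
   m-th chaos; the transition replaces this Gram matrix by that of kap. By Schur
   products, if rho = ||U(t,s)|| < 1 and kap is a norm limit of finite rank maps, then up
   to a small multiple of the L^2-norm the transition is controlled by finitely many
   linear functionals.

   (i) Truncation and density of trigonometric polynomials turn this into L^1-precompactness
   of the image of an L^p-ball. Hypercontractivity, in the two-function form
   E[P(f^a) g^b] <= (E f)^a (E g)^b, bounds the image in L^(1 + (p-1)/rho^2), and one
   interpolates. The two-function inequality tensorizes: writing a Gaussian vector as
   2^(-m/2) times a sum of 2^m independent copies, it follows from its second order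
   expansion at constants, which is the inequality |Cov(P f, g)| <= rho sigma(f) sigma(g).

   (ii) The transition maps the bounded function e^(|S_t h|^2/2) sin<h,.> to
   e^(|kap h|^2/2) sin<U(t,s)^* h,.>, and two such images are at L^2-distance at least
   |kap (h - k)|; on bounded functions L^1-convergence gives L^2-convergence.

   (iii) If rho = 1, functions cos<h_n,.> with h_n almost isometric for kap and of widely
   separated norms have almost orthogonal images that do not tend to 0. *)

Require Import Defs.
From HB Require Import structures.
From mathcomp Require Import all_boot all_order all_algebra sesquilinear.
From mathcomp Require Import all_classical all_reals all_analysis.
From mathcomp Require Import measurable_realfun.
From mathcomp Require Import ring lra.
Import Order.TTheory GRing.Theory Num.Theory.
Import numFieldNormedType.Exports.
Local Open Scope classical_set_scope.
Local Open Scope ring_scope.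
Set Implicit Arguments.
Unset Strict Implicit.
Unset Printing Implicit Defensive.

(** * Bounded measurable functions *)

(** The square root, the adjoint, the operator integral, the Gaussian measures and the extension to
    L^p are all chosen with a default value, so each means something only once an object with the
    defining property is constructed. For Gaussian measures, independent normals are read off the
    binary digits of one uniform variable and summed along the vectors S e_i. The analysis is done
    on bounded measurable functions, where integrability and Fubini are automatic; identities are
    checked on trigonometric polynomials, dense in L^1 for two probabilities at once. L^p enters
    only through the final extension. The bound on q comes from the two-function inequality with a =
    1/p and b = 1 - 1/q: the condition a b rho^2 <= (1 - a)(1 - b), which makes the second order
    part nonpositive, reads (q - 1) rho^2 <= p - 1. Powers are written with logarithms, so f and g
    are first shifted away from 0. Subsequences come from a free ultrafilter: bounded real sequences
    converge along it, so finitely many functionals are Cauchy on one common set. *)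

Definition bmf d (T : measurableType d) (R : realType) (f : T -> R) :=
  measurable_fun [set: T] f /\ exists M : R, forall x, `|f x| <= M.

Section bounded_measurable.
Context d (T : measurableType d) (R : realType).
Implicit Types f g : T -> R.

Lemma bmf_cst (c : R) : bmf (fun _ : T => c).
Proof. by split; [exact: measurable_cst | exists `|c|]. Qed.

Lemma bmfD f g : bmf f -> bmf g -> bmf (fun x => f x + g x).
Proof.
move=> [mf [M fM]] [mg [N gN]]; split; first exact: measurable_funD.
by exists (M + N) => x; rewrite (le_trans (ler_normD _ _))// lerD.
Qed.

Lemma bmfN f : bmf f -> bmf (fun x => - f x).
Proof.
move=> [mf [M fM]]; split; first exact: measurableT_comp.
by exists M => x; rewrite normrN.
Qed.

Lemma bmfB f g : bmf f -> bmf g -> bmf (fun x => f x - g x).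
Proof. by move=> bf bg; apply: bmfD => //; exact: bmfN. Qed.

Lemma bmfM f g : bmf f -> bmf g -> bmf (fun x => f x * g x).
Proof.
move=> [mf [M fM]] [mg [N gN]]; split; first exact: measurable_funM.
by exists (M * N) => x; rewrite normrM ler_pM.
Qed.

Lemma bmfX f n : bmf f -> bmf (fun x => f x ^+ n).
Proof.
move=> bf; elim: n => [|n IH]; first exact: bmf_cst.
by under eq_fun do rewrite exprS; exact: bmfM.
Qed.

Lemma bmfZ f c : bmf f -> bmf (fun x => c * f x).
Proof. by move=> bf; apply: bmfM => //; exact: bmf_cst. Qed.

Lemma bmf_norm f : bmf f -> bmf (fun x => `|f x|).
Proof.
move=> [mf [M fM]]; split; first exact: measurableT_comp.
by exists M => x; rewrite normr_id.
Qed.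

Lemma bmf_sum I (s : seq I) (F : I -> T -> R) :
  (forall i, bmf (F i)) -> bmf (fun x => \sum_(i <- s) F i x).
Proof.
move=> bF; elim: s => [|i s IH].
  by under eq_fun do rewrite big_nil; exact: bmf_cst.
by under eq_fun do rewrite big_cons; exact: bmfD.
Qed.

Lemma bmf_cos f : measurable_fun [set: T] f -> bmf (fun x => cos (f x)).
Proof.
move=> mf; split; last by exists 1 => x; exact: cos_max.
apply: measurableT_comp => //.
by apply: continuous_measurable_fun; exact: continuous_cos.
Qed.

Lemma bmf_sin f : measurable_fun [set: T] f -> bmf (fun x => sin (f x)).
Proof.
move=> mf; split; last by exists 1 => x; exact: sin_max.
apply: measurableT_comp => //.
by apply: continuous_measurable_fun; exact: continuous_sin.
Qed.

Lemma bmf_indic (A : set T) : measurable A -> bmf (\1_A : T -> R).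
Proof.
move=> mA; split; first exact: measurable_indic.
by exists 1 => x; rewrite indicE; case: (_ \in _); rewrite ?normr1 ?normr0.
Qed.

Variable P : probability T R.

Lemma bmf_integrable f : bmf f -> P.-integrable [set: T] (EFin \o f).
Proof.
move=> [mf [M fM]]; apply: measurable_bounded_integrable => //.
  by rewrite (le_lt_trans (probability_le1 _ _))// ltry.
exists M; split; first exact: num_real.
by move=> y My x _; apply: le_trans (fM x) _; exact: ltW.
Qed.

Lemma expect_cst (c : R) : \int[P]_x c = c.
Proof.
by rewrite Rintegral_cst// [X in fine X](probability_setT P) mulr1.
Qed.

Lemma expectD f g : bmf f -> bmf g ->
  \int[P]_x (f x + g x) = \int[P]_x f x + \int[P]_x g x.
Proof. by move=> bf bg; apply: RintegralD => //; exact: bmf_integrable. Qed.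

Lemma expectB f g : bmf f -> bmf g ->
  \int[P]_x (f x - g x) = \int[P]_x f x - \int[P]_x g x.
Proof. by move=> bf bg; apply: RintegralB => //; exact: bmf_integrable. Qed.

Lemma expectZ f c : bmf f -> \int[P]_x (c * f x) = c * \int[P]_x f x.
Proof. by move=> bf; apply: RintegralZl => //; exact: bmf_integrable. Qed.

Lemma expect_sum I (s : seq I) (F : I -> T -> R) : (forall i, bmf (F i)) ->
  \int[P]_x (\sum_(i <- s) F i x) = \sum_(i <- s) \int[P]_x F i x.
Proof.
move=> bF; elim: s => [|i s IH].
  by rewrite big_nil; under eq_Rintegral do rewrite big_nil; exact: expect_cst.
rewrite big_cons -IH -expectD//; last exact: bmf_sum.
by apply: eq_Rintegral => x _; rewrite big_cons.
Qed.

Lemma expect_le f g : bmf f -> bmf g -> (forall x, f x <= g x) ->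
  \int[P]_x f x <= \int[P]_x g x.
Proof.
by move=> bf bg fg; apply: le_Rintegral => //; exact: bmf_integrable.
Qed.

Lemma expect_norm f : bmf f -> `|\int[P]_x f x| <= \int[P]_x `|f x|.
Proof. by move=> bf; apply: le_normr_Rintegral => //; exact: bmf_integrable. Qed.

Lemma expect_le_cst f c : bmf f -> (forall x, f x <= c) -> \int[P]_x f x <= c.
Proof.
by move=> bf fc; rewrite -[leRHS](expect_cst c); apply: expect_le => //; exact: bmf_cst.
Qed.

Lemma expect_ge_cst f c : bmf f -> (forall x, c <= f x) -> c <= \int[P]_x f x.
Proof.
by move=> bf fc; rewrite -[leLHS](expect_cst c); apply: expect_le => //; exact: bmf_cst.
Qed.

Lemma expect_norm_le f c : bmf f -> (forall x, `|f x| <= c) -> `|\int[P]_x f x| <= c.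
Proof.
move=> bf fc; apply: (le_trans (expect_norm bf)).
by apply: expect_le_cst => //; exact: bmf_norm.
Qed.

Lemma EFin_expect f : bmf f -> (\int[P]_x f x)%:E = (\int[P]_x (f x)%:E)%E.
Proof.
by move=> bf; rewrite /Rintegral fineK//; apply: integrable_fin_num => //; exact: bmf_integrable.
Qed.

Lemma expect_indic (A : set T) : measurable A -> (\int[P]_x \1_A x)%:E = P A.
Proof. by move=> mA; rewrite EFin_expect ?integral_indic ?setIT//; exact: bmf_indic. Qed.

Lemma expect_cvg (f_ : nat -> T -> R) f M :
  (forall n, measurable_fun [set: T] (f_ n)) ->
  (forall n x, `|f_ n x| <= M) -> (forall x, f_ ^~ x @ \oo --> f x) ->
  (\int[P]_x f_ n x) @[n --> \oo] --> \int[P]_x f x.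
Proof.
move=> mf fM ff.
have mf0 : measurable_fun [set: T] f by apply: (measurable_fun_cvg mf).
have [] := @dominated_convergence _ T R P setT measurableT (fun n => EFin \o f_ n)
  (EFin \o f) (EFin \o cst M).
- by move=> n; exact/measurable_EFinP.
- exact/measurable_EFinP.
- by apply: aeW => x _; apply: cvg_EFin; [exact: nearW | exact: ff].
- by apply: bmf_integrable; exact: bmf_cst.
- by apply: aeW => x n _; rewrite /= lee_fin.
move=> ig _ cv.
have := fine_cvg (_ : _ --> (fine (\int[P]_x (f x)%:E))%:E).
by apply; rewrite fineK//; apply: integrable_fin_num.
Qed.

End bounded_measurable.

Section law.
Context d d' (T : measurableType d) (T' : measurableType d') (R : realType).

Definition law (P : probability T R) (f : T -> T')
    (mf : measurable_fun [set: T] f) : probability T' R :=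
  distribution P (mfun_Sub (mem_set mf)).

Lemma bmf_comp (f : T -> T') (g : T' -> R) :
  measurable_fun [set: T] f -> bmf g -> bmf (fun x => g (f x)).
Proof.
move=> mf [mg [M gM]]; split; last by exists M => x.
exact: (measurableT_comp mg mf).
Qed.

Lemma expect_law (P : probability T R) (f : T -> T')
    (mf : measurable_fun [set: T] f) (g : T' -> R) : bmf g ->
  \int[law P mf]_y g y = \int[P]_x g (f x).
Proof.
move=> bg; rewrite /Rintegral; congr fine.
rewrite (@integral_distribution _ _ _ _ _ _ _ (EFin \o g))//=.
  by case: bg => mg _; exact/measurable_EFinP.
by have := @bmf_integrable _ _ _ P _ (bmf_comp mf bg).
Qed.

End law.

Section fubini_bounded.
Context d d' (T : measurableType d) (T' : measurableType d') (R : realType).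
Variables (P : probability T R) (Q : probability T' R) (f : T * T' -> R).
Hypothesis bf : bmf f.

Lemma bmf_section1 x : bmf (fun y => f (x, y)).
Proof. by apply: (bmf_comp (f := fun y : T' => (x, y))) => //; exact: pair1_measurable. Qed.

Lemma bmf_section2 y : bmf (fun x => f (x, y)).
Proof. by apply: (bmf_comp (f := fun x : T => (x, y))) => //; exact: pair2_measurable. Qed.

Lemma bmf_expect1 : bmf (fun x => \int[Q]_y f (x, y)).
Proof.
case: (bf) => mf [M fM]; split; last first.
  by exists M => x; apply: expect_norm_le => //; exact: bmf_section1.
by apply/measurable_EFinP;
  apply: eq_measurable_fun (measurable_fubini_F (bmf_integrable (P \x Q)%E bf))
   => x _; rewrite /fubini_F -EFin_expect//; exact: bmf_section1.
Qed.

Lemma expect_prod1 : \int[(P \x Q)%E]_z f z = \int[P]_x \int[Q]_y f (x, y).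
Proof.
rewrite /Rintegral; congr fine.
have := integral12_prod_meas1 (bmf_integrable (P \x Q)%E bf).
move=> /= <-; apply: eq_integral => x _.
by rewrite /fubini_F -EFin_expect//; exact: bmf_section1.
Qed.

Lemma expect_prod2 : \int[(P \x Q)%E]_z f z = \int[Q]_y \int[P]_x f (x, y).
Proof.
rewrite /Rintegral; congr fine.
have := integral21_prod_meas1 (bmf_integrable (P \x Q)%E bf).
move=> /= <-; apply: eq_integral => x _.
by rewrite /fubini_G -EFin_expect//; exact: bmf_section2.
Qed.

End fubini_bounded.

(** * Density of trigonometric polynomials *)

Section power_limits.
Context (R : realType).
Implicit Types y q : R.

Lemma bernoulli_ge y n : -1 <= y -> 1 + n%:R * y <= (1 + y) ^+ n.
Proof.
move=> y1; elim: n => [|n IH]; first by rewrite mul0r addr0 expr0.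
have h : (1 + n%:R * y) * (1 + y) <= (1 + y) ^+ n * (1 + y).
  by apply: ler_wpM2r => //; rewrite addrC -lerBlDr sub0r.
rewrite exprSr; apply: le_trans h; rewrite -natr1.
have n0 : 0 <= n%:R :> R by rewrite ler0n.
by have := mulr_ge0 n0 (sqr_ge0 y); nra.
Qed.

(** Bernoulli gives [1 + n y <= (1 + y)^n], and [(1 - y)^n (1 + y)^n = (1 - y^2)^n <= 1]. *)
Lemma one_minus_pow_le y n : 0 <= y <= 1 -> (1 - y) ^+ n * (1 + n%:R * y) <= 1.
Proof.
move=> /andP[y0 y1].
have h1 : 1 + n%:R * y <= (1 + y) ^+ n by apply: bernoulli_ge; lra.
apply: le_trans (ler_wpM2l _ h1) _; first by rewrite exprn_ge0// subr_ge0.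
rewrite -exprMn; apply: exprn_ile1; nra.
Qed.

(** Brosowski-Deutsch sequence of the elementary proof of Stone-Weierstrass: polynomials in [q] that
    separate the two sides of 1/2. Bernoulli bounds it below by [1 - (2 q)^n]. *)
Lemma brosowski_lt q : 0 <= q -> q < 1/2 ->
  (fun n => (1 - q ^+ n) ^+ (2 ^ n)) @ \oo --> (1 : R).
Proof.
move=> q0 q2.
have q1 : q <= 1 by lra.
apply: (@squeeze_cvgr _ _ _ _ (fun n => 1 - (2 * q) ^+ n) (fun=> 1)).
- apply: nearW => n; have qn0 : 0 <= q ^+ n by exact: exprn_ge0.
  have qn1 : q ^+ n <= 1 by exact: exprn_ile1.
  apply/andP; split; last by apply: exprn_ile1; lra.
  have := @bernoulli_ge (- q ^+ n) (2 ^ n); rewrite natrX mulrN exprMn.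
  by apply; lra.
- rewrite -[X in _ --> X]subr0; apply: cvgB; first exact: cvg_cst.
  by apply: cvg_expr; rewrite ger0_norm; lra.
- exact: cvg_cst.
Qed.

(** [one_minus_pow_le] at [y = q^n] with exponent [2^n] bounds the sequence above by [(2 q)^-n]. *)
Lemma brosowski_gt q : 1/2 < q -> q <= 1 ->
  (fun n => (1 - q ^+ n) ^+ (2 ^ n)) @ \oo --> (0 : R).
Proof.
move=> q2 q1; have q0 : 0 <= q by lra.
apply: (@squeeze_cvgr _ _ _ _ (fun=> 0) (fun n => ((2 * q)^-1) ^+ n)).
- apply: nearW => n; have qn0 : 0 <= q ^+ n by exact: exprn_ge0.
  have qn1 : q ^+ n <= 1 by exact: exprn_ile1.
  apply/andP; split; first by apply: exprn_ge0; lra.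
  have h := @one_minus_pow_le (q ^+ n) (2 ^ n); rewrite natrX -exprMn in h.
  have {}h := h ltac:(apply/andP; split; lra).
  have t0 : 0 < (2 * q) ^+ n by rewrite exprn_gt0//; lra.
  rewrite exprVn -[leRHS]mul1r ler_pdivlMr//.
  apply: le_trans h; apply: ler_wpM2l; last by lra.
  by apply: exprn_ge0; lra.
- exact: cvg_cst.
- apply: cvg_expr; rewrite ger0_norm ?invr_ge0 ?invf_lt1; lra.
Qed.

End power_limits.

Section algebra_approximation.
Context d (T : measurableType d) (R : realType) (P Q : probability T R).
Variable A : set (T -> R).
Hypothesis Abm : forall f, A f -> bmf f.
Hypothesis Acst : forall c, A (fun=> c).
Hypothesis AD : forall f g, A f -> A g -> A (fun x => f x + g x).
Hypothesis AM : forall f g, A f -> A g -> A (fun x => f x * g x).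

(** One element of the algebra serves both measures: this yields uniqueness of a law, and lets a
    function be approximated together with its composite with a map, whose law is then the second
    measure. Values in [0, 1] keep products and complements under control. *)
Definition approximable (g : T -> R) := forall e : R, 0 < e ->
  exists f, [/\ A f, forall x, 0 <= f x <= 1,
    \int[P]_x `|f x - g x| < e & \int[Q]_x `|f x - g x| < e].

Lemma algebra_exp f n : A f -> A (fun x => f x ^+ n).
Proof.
move=> Af; elim: n => [|n IH]; first exact: Acst.
by under eq_fun do rewrite exprS; exact: AM.
Qed.

Lemma algebra_opp f : A f -> A (fun x => - f x).
Proof. by move=> Af; under eq_fun do rewrite -mulN1r; exact: AM. Qed.

Lemma algebra_sub f g : A f -> A g -> A (fun x => f x - g x).
Proof. by move=> Af Ag; apply: AD => //; exact: algebra_opp. Qed.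

Lemma approximable_cvg (f_ : nat -> T -> R) g : (forall n, A (f_ n)) ->
  (forall n x, 0 <= f_ n x <= 1) -> (forall x, f_ ^~ x @ \oo --> g x) ->
  approximable g.
Proof.
move=> Af f01 fg e e0.
have mf n : measurable_fun setT (f_ n) by case: (Abm (Af n)).
have mg : measurable_fun setT g by apply: (measurable_fun_cvg mf).
have g01 x : 0 <= g x <= 1.
  apply/andP; split.
    by apply: (cvgr_to_ge (fg x)); apply: nearW => n; case/andP: (f01 n x).
  by apply: (cvgr_to_le (fg x)); apply: nearW => n; case/andP: (f01 n x).
have cv (S : probability T R) : (\int[S]_x `|f_ n x - g x|) @[n --> \oo] --> (0 : R).
  rewrite -[X in _ --> X](expect_cst S); apply: (@expect_cvg _ _ _ S _ _ 1).
  - by move=> n; apply: measurableT_comp => //; exact: measurable_funB.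
  - move=> n x; have := f01 n x; have := g01 x.
    by rewrite normr_id ler_norml => /andP[? ?] /andP[? ?]; apply/andP; split; lra.
  - move=> x; rewrite -(normr0 R) -(subrr (g x)).
    by apply: cvg_norm; apply: cvgB => //; exact: cvg_cst.
have abs (S : probability T R) n : `|\int[S]_x `|f_ n x - g x| | =
    \int[S]_x `|f_ n x - g x|.
  by rewrite ger0_norm//; apply: Rintegral_ge0.
have /cvgr0_norm_lt/(_ _ e0) hP := cv P.
have /cvgr0_norm_lt/(_ _ e0) hQ := cv Q.
have [n _ /(_ n (leqnn n)) [hn1 hn2]] := filterI hP hQ.
by exists (f_ n); split => //; rewrite -abs.
Unshelve. all: by end_near. Qed.

(** The affine function [q] of [f] is below 1/2 exactly where [f > c], so the Brosowski sequence
    tends to the indicator off the level set [f = c], where its limit is neither 0 nor 1. The factor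
    [1 - h^n] settles that set: [h] equals 1 there and is smaller elsewhere. *)
Lemma approximable_gt f c : A f -> approximable \1_[set x | c < f x].
Proof.
move=> Af; have [_ [M0 fM0]] := Abm Af.
pose M := `|M0| + `|c| + 1.
have Mp : 0 < M by rewrite /M ltr_pwDr// addr_ge0.
have cM x : `|f x - c| < M.
  rewrite (le_lt_trans (ler_normB _ _))// /M ltr_pwDr// lerD//.
  exact: le_trans (fM0 x) (ler_norm _).
have {}cM x : - M < f x - c < M by rewrite -ltr_norml.
pose q x := (M - (f x - c)) * (2 * M)^-1.
pose h x : R := 1 - ((f x - c) * M^-1) ^+ 2.
have Ag : A (fun x => f x - c) by apply: algebra_sub.
have Aq : A q by apply: AM => //; apply: algebra_sub.
have Ah : A h.
  by apply: (algebra_sub (Acst 1)); apply: algebra_exp; apply: AM.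
have q01 x : 0 <= q x <= 1.
  case/andP: (cM x) => c1 c2;
  rewrite /q; apply/andP; split; first by apply: divr_ge0; lra.
  by rewrite ler_pdivrMr; lra.
have h01 x : 0 <= h x <= 1.
  case/andP: (cM x) => c1 c2;
  have r1 : `|(f x - c) * M^-1| <= 1.
    rewrite normrM normfV (gtr0_norm Mp) ler_pdivrMr// mul1r ler_norml.
    by apply/andP; split; lra.
  have r2 : ((f x - c) * M^-1) ^+ 2 <= 1.
    by rewrite -real_normK ?num_real//; exact: exprn_ile1.
  have := sqr_ge0 ((f x - c) * M^-1).
  by rewrite /h => ?; apply/andP; split; lra.
apply: (approximable_cvg (f_ := fun n x => (1 - q x ^+ n) ^+ (2 ^ n) * (1 - h x ^+ n))).
- move=> n; apply: AM; last by apply: (algebra_sub (Acst 1)); exact: algebra_exp.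
  by apply: algebra_exp; apply: (algebra_sub (Acst 1)); exact: algebra_exp.
- move=> n x; case/andP: (q01 x) => q0 q1; case/andP: (h01 x) => h0 h1.
  have hn0 := exprn_ge0 n h0; have hn1 := exprn_ile1 n h0 h1.
  have qn0 := exprn_ge0 n q0; have qn1 := exprn_ile1 n q0 q1.
  have a0 : 0 <= (1 - q x ^+ n) ^+ (2 ^ n) by apply: exprn_ge0; lra.
  have a1 : (1 - q x ^+ n) ^+ (2 ^ n) <= 1 by apply: exprn_ile1; lra.
  by apply/andP; split; nra.
- move=> x; case/andP: (q01 x) => q0 q1; case/andP: (h01 x) => h0 h1.

  rewrite indicE; case: (ltgtP c (f x)) => fc.
  + rewrite mem_set//= -[X in _ --> X]mulr1; apply: cvgM.
      apply: brosowski_lt => //; rewrite /q ltr_pdivrMr; lra.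
    rewrite -[X in _ --> X]subr0; apply: cvgB; first exact: cvg_cst.
    apply: cvg_expr; rewrite ger0_norm// /h gtrBl exprn_gt0// divr_gt0//.
    by rewrite subr_gt0.
  + rewrite memNset/=; last by apply/negP; rewrite -leNgt ltW.
    rewrite -[X in _ --> X](mul0r (1 - 0)); apply: cvgM.
      by apply: brosowski_gt => //; rewrite /q ltr_pdivlMr; lra.
    apply: cvgB; first exact: cvg_cst.
    apply: cvg_expr; rewrite ger0_norm// /h gtrBl exprn_even_gt0//=.
    by rewrite mulf_neq0 ?invr_neq0 ?(gt_eqF Mp)// lt_eqF// subr_lt0.
  + rewrite memNset/=; last by rewrite -fc ltxx.
    under eq_fun do rewrite /h -fc subrr mul0r expr0n/= subr0 expr1n subrr mulr0.
    exact: cvg_cst.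
Qed.

Lemma approximable_close (g : T -> R) : measurable_fun setT g -> (forall x, 0 <= g x <= 1) ->
  (forall e : R, 0 < e -> exists g', [/\ approximable g', bmf g',
    \int[P]_x `|g' x - g x| < e & \int[Q]_x `|g' x - g x| < e]) -> approximable g.
Proof.
move=> mg g01 ap e e0.
have e20 : 0 < e / 2 by rewrite divr_gt0.
have [g' [ag' bg' Pg Qg]] := ap _ e20; have [h [Ah h01 Ph Qh]] := ag' _ e20.
have bg : bmf g.
  by split => //; exists 1 => x; rewrite ger0_norm//; case/andP: (g01 x).
have bh := Abm Ah.
have tri (S : probability T R) : \int[S]_x `|h x - g x| <=
    \int[S]_x `|h x - g' x| + \int[S]_x `|g' x - g x|.
  rewrite -expectD; [|by apply: bmf_norm; apply: bmfB..].
  apply: expect_le; first by apply: bmf_norm; apply: bmfB.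
    by apply: bmfD; apply: bmf_norm; apply: bmfB.
  by move=> x; apply: ler_distD.
exists h; split => //.
  by apply: le_lt_trans (tri P) _; lra.
by apply: le_lt_trans (tri Q) _; lra.
Qed.

(** The sets with approximable indicator contain the generators and form a sigma-algebra: [1 - f]
    serves complements, [1 - (1 - f)(1 - g)] finite unions, and dominated convergence countable
    ones. *)
Lemma approximable_sigma (E : set T) :
  <<s [set [set x | c.2 < c.1 x] | c in [set c : (T -> R) * R | A c.1] ]>> E ->
  measurable E /\ approximable \1_E.
Proof.
move: E; apply: (@smallest_sub _ _ _ [set E | measurable E /\ approximable \1_E]); last first.
  move=> _ [[f c] /= Af <-]; split; last exact: approximable_gt.
  have [mf _] := Abm Af; rewrite -[X in measurable X]setTI.
  have -> : [set x | c < f x] = f @^-1` `]c, +oo[.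
    by apply/seteqP; split => x /=; rewrite in_itv/= andbT.
  exact: mf.
split.
- split => // e e0; exists (fun=> 0); split => //.
  + by move=> x; rewrite lexx ler01.
  + under eq_Rintegral do rewrite indic0 subrr normr0.
    by rewrite expect_cst.
  + under eq_Rintegral do rewrite indic0 subrr normr0.
    by rewrite expect_cst.
- move=> E [mE aE]; rewrite setTD; split; first exact: measurableC.
  move=> e /aE[f [Af f01 fP fQ]].
  have compl (S : probability T R) : \int[S]_x `|1 - f x - \1_(~` E) x| =
      \int[S]_x `|f x - \1_E x|.
    apply: eq_Rintegral => x _; rewrite -normrN !indicE in_setC.
    by congr `|_|; case: (_ \in _) => /=; ring.
  exists (fun x => 1 - f x); split.
  + exact: algebra_sub.
  + by move=> x; case/andP: (f01 x) => ? ?; apply/andP; split; lra.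
  + by rewrite compl.
  + by rewrite compl.
- move=> E aE; have mE i : measurable (E i) by case: (aE i).
  have mU : measurable (\bigcup_i E i) by exact: bigcup_measurable.
  split => //.
  pose D n := \big[setU/set0]_(i < n) E i.
  have mD n : measurable (D n) by exact: bigsetU_measurable.
  have aD n : approximable \1_(D n).
    elim: n => [|n IH e e0].
      rewrite /D big_ord0 => e e0; exists (fun=> 0); split => //.
      + by move=> x; rewrite lexx ler01.
      + under eq_Rintegral do rewrite indic0 subrr normr0.
        by rewrite expect_cst.
      + under eq_Rintegral do rewrite indic0 subrr normr0.
        by rewrite expect_cst.
    have e20 : 0 < e / 2 by rewrite divr_gt0.
    have [f [Af f01 fP fQ]] := IH _ e20.
    have [g [Ag g01 gP gQ]] := (aE n).2 _ e20.
    pose h x := 1 - (1 - f x) * (1 - g x).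
    have Ah : A h.
      by apply: (algebra_sub (Acst 1)); apply: AM; exact: algebra_sub.
    have hle x : `|h x - \1_(D n.+1) x| <= `|f x - \1_(D n) x| + `|g x - \1_(E n) x|.
      have -> : \1_(D n.+1) x = 1 - (1 - \1_(D n) x) * (1 - \1_(E n) x) :> R.
        rewrite /D big_ord_recr/= !indicE in_setU.
        by case: (_ \in _) => /=; case: (_ \in _) => /=; lra.
      have -> : h x - (1 - (1 - \1_(D n) x) * (1 - \1_(E n) x)) =
          (f x - \1_(D n) x) * (1 - g x) + (g x - \1_(E n) x) * (1 - \1_(D n) x).
        by rewrite /h; ring.
      rewrite (le_trans (ler_normD _ _))// !normrM lerD//.
        rewrite ler_piMr// ler_norml; case/andP: (g01 x) => ? ?.
        by apply/andP; split; lra.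
      rewrite ler_piMr// indicE; case: (_ \in _) => /=.
        by rewrite subrr normr0 ler01.
      by rewrite subr0 normr1.
    have bD : bmf (\1_(D n) : T -> R) by exact: bmf_indic.
    have bE : bmf (\1_(E n) : T -> R) by exact: bmf_indic.
    have bD1 : bmf (\1_(D n.+1) : T -> R) by exact: bmf_indic.
    have bf := Abm Af; have bg := Abm Ag; have bh := Abm Ah.
    have tri (S : probability T R) : \int[S]_x `|h x - \1_(D n.+1) x| <=
        \int[S]_x `|f x - \1_(D n) x| + \int[S]_x `|g x - \1_(E n) x|.
      rewrite -expectD; [|by apply: bmf_norm; apply: bmfB..].
      apply: expect_le => //; first by apply: bmf_norm; apply: bmfB.
      by apply: bmfD; apply: bmf_norm; apply: bmfB.
    exists h; split => //.
    + move=> x; case/andP: (g01 x) => ? ?; case/andP: (f01 x) => ? ?.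
      have p0 : 0 <= (1 - f x) * (1 - g x) by apply: mulr_ge0; lra.
      have p1 : (1 - f x) * (1 - g x) <= 1 by apply: mulr_ile1; lra.
      by rewrite /h; apply/andP; split; lra.
    + by apply: le_lt_trans (tri P) _; lra.
    + by apply: le_lt_trans (tri Q) _; lra.
  have cvD x : (\1_(D n) x : R) @[n --> \oo] --> (\1_(\bigcup_i E i) x : R).
    apply: cvg_near_cst; have [xU|xU] := pselect ((\bigcup_i E i) x).
      have [i _ Ei] := xU.
      near=> n; rewrite !indicE !mem_set//.
      rewrite /D -bigcup_mkord; exists i => //=.
      by near: n; exact: nbhs_infty_gt.
    apply: nearW => n; rewrite !indicE !memNset//.
    by rewrite /D -bigcup_mkord => -[i _ Ei]; apply: xU; exists i.
  apply: approximable_close => //.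
    by move=> x; rewrite indicE; case: (_ \in _); rewrite /= ?lexx ?ler01.
  move=> e e0.
  have cv (S : probability T R) :
      (\int[S]_x `|\1_(D n) x - \1_(\bigcup_i E i) x|) @[n --> \oo] --> (0 : R).
    rewrite -[X in _ --> X](expect_cst S); apply: (@expect_cvg _ _ _ S _ _ 1).
    - move=> n; apply: measurableT_comp => //; apply: measurable_funB;
        exact: measurable_indic.
    - move=> n x; rewrite !indicE; case: (_ \in _); case: (_ \in _);
        rewrite /= ?subrr ?subr0 ?sub0r ?normrN ?normr0 ?normr1 ?normr0 ?normr1 ?ler01//.
    - move=> x; rewrite -(normr0 R) -(subrr (\1_(\bigcup_i E i) x)).
      by apply: cvg_norm; apply: cvgB => //; exact: cvg_cst.
  have abs (S : probability T R) n :
      `|\int[S]_x `|\1_(D n) x - \1_(\bigcup_i E i) x : R| | =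
      \int[S]_x `|\1_(D n) x - \1_(\bigcup_i E i) x|.
    by rewrite ger0_norm//; apply: Rintegral_ge0.
  have /cvgr0_norm_lt/(_ _ e0) hP := cv P.
  have /cvgr0_norm_lt/(_ _ e0) hQ := cv Q.
  have [n _ /(_ n (leqnn n)) [hn1 hn2]] := filterI hP hQ.
  exists \1_(D n); split; [exact: aD | exact: bmf_indic | |].
    by rewrite abs in hn1.
  by rewrite abs in hn2.
Unshelve. all: by end_near. Qed.

Hypothesis Agen : forall E : set T, measurable E ->
  <<s [set [set x | c.2 < c.1 x] | c in [set c : (T -> R) * R | A c.1] ]>> E.

(** Binary expansion of the values: with [E] the set where [g > 1/2], [g = (1_E + g') / 2] and
    [g' = 2 g - 1_E] is again in [0, 1]. Each round halves the distance, starting from the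
    approximation by 0, while the error [e] on the indicators is averaged and does not
    accumulate. *)
Lemma algebra_dense (g : T -> R) : measurable_fun setT g ->
  (forall x, 0 <= g x <= 1) -> approximable g.
Proof.
move=> mg g01; have {}mg := mg.
have step n : forall g : T -> R, measurable_fun setT g -> (forall x, 0 <= g x <= 1) ->
    forall e : R, 0 < e -> exists f, [/\ A f, forall x, 0 <= f x <= 1,
    \int[P]_x `|f x - g x| <= e + (2 ^+ n)^-1 &
    \int[Q]_x `|f x - g x| <= e + (2 ^+ n)^-1].
  elim: n => [|n IH] {mg g01}g mg g01 e e0.
    exists (fun=> 0); split => //; first by move=> x; rewrite lexx ler01.
      apply: expect_le_cst.
        apply: bmf_norm; apply: bmfB; first exact: bmf_cst.
        by split => //; exists 1 => x; rewrite ger0_norm//; case/andP: (g01 x).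
      move=> x; rewrite sub0r normrN ger0_norm; case/andP: (g01 x) => //.
      by rewrite expr0 invr1 => _ h; lra.
    apply: expect_le_cst.
      apply: bmf_norm; apply: bmfB; first exact: bmf_cst.
      by split => //; exists 1 => x; rewrite ger0_norm//; case/andP: (g01 x).
    move=> x; rewrite sub0r normrN ger0_norm; case/andP: (g01 x) => //.
    by rewrite expr0 invr1 => _ h; lra.
  pose E := [set x | 1/2 < g x].
  have mE : measurable E.
    rewrite -[X in measurable X]setTI.
    have -> : E = g @^-1` `]1/2, +oo[.
      by apply/seteqP; split => x /=; rewrite in_itv/= andbT.
    exact: mg.
  have [_ /(_ _ e0) [f1 [Af1 f101 fP fQ]]] := approximable_sigma (Agen mE).
  pose g' x := 2 * g x - \1_E x.
  have mg' : measurable_fun setT g'.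
    apply: measurable_funB; last exact: measurable_indic.
    exact: measurable_funM.
  have g'01 x : 0 <= g' x <= 1.
    rewrite /g' indicE; case/andP: (g01 x) => g0 g1.
    have [xE|xE] := pselect (E x).
      by rewrite mem_set//=; rewrite /E/= in xE; apply/andP; split; lra.
    rewrite memNset//=; move/negP: xE; rewrite -leNgt => ?.
    by apply/andP; split; lra.
  have [f2 [Af2 f201 f2P f2Q]] := IH g' mg' g'01 e e0.
  have bf1 := Abm Af1; have bf2 := Abm Af2.
  have bE : bmf (\1_E : T -> R) by exact: bmf_indic.
  have bg : bmf g.
    by split => //; exists 1 => x; rewrite ger0_norm//; case/andP: (g01 x).
  have bg' : bmf g'.
    by split => //; exists 1 => x; rewrite ger0_norm//; case/andP: (g'01 x).
  pose f x := 2^-1 * f1 x + 2^-1 * f2 x.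
  have Af : A f by apply: AD; apply: AM.
  have tri (S : probability T R) : \int[S]_x `|f x - g x| <=
      2^-1 * \int[S]_x `|f1 x - \1_E x| + 2^-1 * \int[S]_x `|f2 x - g' x|.
    have bn1 : bmf (fun x => `|f1 x - \1_E x|) by apply: bmf_norm; apply: bmfB.
    have bn2 : bmf (fun x => `|f2 x - g' x|) by apply: bmf_norm; apply: bmfB.
    rewrite -!expectZ// -expectD; [|exact: bmfZ..].
    apply: expect_le.
    - by apply: bmf_norm; apply: bmfB => //; exact: Abm.
    - by apply: bmfD; exact: bmfZ.
    - move=> x; have -> : f x - g x = 2^-1 * (f1 x - \1_E x) + 2^-1 * (f2 x - g' x).
        by rewrite /f /g'; field.
      by rewrite (le_trans (ler_normD _ _))// !normrM ger0_norm// invr_ge0.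
  have i2 : (2 ^+ n.+1)^-1 = 2^-1 * (2 ^+ n)^-1 :> R by rewrite exprS invfM.
  exists f; split => //.
  - move=> x; case/andP: (f101 x) => ? ?; case/andP: (f201 x) => ? ?.
    by rewrite /f; apply/andP; split; lra.
  - by apply: le_trans (tri P) _; rewrite i2; lra.
  - by apply: le_trans (tri Q) _; rewrite i2; lra.
move=> e e0; have e20 : 0 < e / 2 by rewrite divr_gt0.
have [n ne] : exists n, (2 ^+ n)^-1 < e / 2.
  have h2 : `|2^-1 : R| < 1 by rewrite ger0_norm ?invr_ge0// invf_lt1//; lra.
  have /cvgr0_norm_lt/(_ _ e20) [n _ /(_ n (leqnn n)) h] := cvg_expr h2.
  exists n; rewrite -exprVn.
  by apply: le_lt_trans h; apply: ler_norm.
have [f [Af f01 fP fQ]] := step n g mg g01 _ e20.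
by exists f; split => //; [apply: le_lt_trans fP _|apply: le_lt_trans fQ _]; lra.
Qed.

Lemma algebra_unique : (forall f, A f -> \int[P]_x f x = \int[Q]_x f x) ->
  forall E, measurable E -> P E = Q E.
Proof.
move=> PQ E mE; have bE : bmf (\1_E : T -> R) by exact: bmf_indic.
rewrite -!(expect_indic _ mE); congr (_%:E); apply/eqP; rewrite -subr_eq0.
rewrite -normr_eq0 eq_le normr_ge0 andbT; apply/ler_addgt0Pl => e e0.
have e20 : 0 < e / 2 by rewrite divr_gt0.
have [_ /(_ _ e20) [f [Af _ fP fQ]]] := approximable_sigma (Agen mE).
have bf := Abm Af.
rewrite addr0.
have -> : \int[P]_x \1_E x - \int[Q]_x \1_E x =
    - (\int[P]_x (f x - \1_E x)) + \int[Q]_x (f x - \1_E x).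
  by rewrite !expectB// (PQ f Af); ring.
apply: le_trans (ler_normD _ _) _; rewrite normrN.
have hP := expect_norm P (bmfB bf bE); have hQ := expect_norm Q (bmfB bf bE).
by lra.
Qed.

End algebra_approximation.

Section real_trigonometry.
Context (R : realType).

(** The point is located only by [|c - a| <= |b - a|], which covers both orders of [a] and [b]. *)
Lemma mean_value (f g : R -> R) : (forall x : R, is_derive x (1 : R) f (g x)) ->
  forall a b, exists2 c, `|c - a| <= `|b - a| & f b - f a = g c * (b - a).
Proof.
move=> fg a b.
have cf : continuous f.
  by move=> x; apply: differentiable_continuous; apply/derivable1_diffP; apply: ex_derive.
have [ab|ba|<-] := ltgtP a b; last first.
- by exists a; rewrite ?subrr ?mulr0.
- have [c] := MVT ba (fun x _ => fg x) (continuous_subspaceT cf).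
  rewrite in_itv/= => /andP[bc ca] e; exists c.
    by rewrite !ltr0_norm ?subr_lt0//; lra.
  by rewrite -opprB e -mulrN opprB.
- have [c] := MVT ab (fun x _ => fg x) (continuous_subspaceT cf).
  rewrite in_itv/= => /andP[bc ca] e; exists c => //.
  by rewrite !gtr0_norm ?subr_gt0//; lra.
Qed.

Lemma cos_lip (a b : R) : `|cos b - cos a| <= `|b - a|.
Proof.
have [c _ ->] := mean_value (@is_derive_cos R) a b.
by rewrite normrM normrN ler_piMl// sin_max.
Qed.

Lemma sin_lip (a b : R) : `|sin b - sin a| <= `|b - a|.
Proof.
have [c _ ->] := mean_value (@is_derive_sin R) a b.
by rewrite normrM ler_piMl// cos_max.
Qed.

Lemma sin_sub_id (z : R) : `|sin z - z| <= z ^+ 2.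
Proof.
have h (x : R) : is_derive x (1 : R) (fun y => sin y - y) (cos x - 1) by apply: is_deriveB.
have [c] := mean_value h 0 z; rewrite sin0 !subr0 => cz ->.
rewrite normrM -[leRHS]real_normK ?num_real// expr2 ler_wpM2r//.
by apply: le_trans cz; rewrite -(@cos0 R) (le_trans (cos_lip _ _))// subr0.
Qed.

(** Recovers a linear form as a limit of trigonometric polynomials, hence its measurability for the
    sigma-algebra that these generate. *)
Lemma cvg_sin_scaled (y : R) : (fun n => n.+1%:R * sin (n.+1%:R^-1 * y)) @ \oo --> y.
Proof.
apply/subr_cvg0; apply/cvgr0Pnorm_le => e e0.
have h : (fun n => y ^+ 2 * @harmonic R n) @ \oo --> (0 : R).
  by rewrite -(mulr0 (y ^+ 2)); apply: cvgM; [exact: cvg_cst | exact: cvg_harmonic].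
move/cvgr0_norm_le : h => /(_ _ e0); apply: filterS => n; apply: le_trans.
have n0 : 0 < n.+1%:R :> R by rewrite ltr0n.
have -> : n.+1%:R * sin (n.+1%:R^-1 * y) - y =
    n.+1%:R * (sin (n.+1%:R^-1 * y) - n.+1%:R^-1 * y).
  by field; rewrite gt_eqF.
rewrite normrM gtr0_norm//; apply: le_trans (ler_wpM2l (ltW n0) (sin_sub_id _)) _.
rewrite [leRHS]ger0_norm; last by rewrite mulr_ge0 ?sqr_ge0// invr_ge0.
rewrite /harmonic /= le_eqVlt; apply/orP; left; apply/eqP.
by field; rewrite gt_eqF.
Qed.

End real_trigonometry.

(* A trigonometric polynomial is encoded by its coefficients: the entry
   [(a, b, v)] stands for [a cos (l v) + b sin (l v)]. *)
Section trigonometric_polynomials.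
Context d (T : measurableType d) (R : realType) (V : lmodType R).
Variable l : V -> T -> R.

Definition trig (s : seq (R * R * V)) (x : T) : R :=
  \sum_(i <- s) (i.1.1 * cos (l i.2 x) + i.1.2 * sin (l i.2 x)).

Lemma trig_cat s t x : trig (s ++ t) x = trig s x + trig t x.
Proof. by rewrite /trig big_cat. Qed.

Lemma trig_cons a b v s x :
  trig ((a, b, v) :: s) x = a * cos (l v x) + b * sin (l v x) + trig s x.
Proof. by rewrite /trig big_cons. Qed.

Lemma trig1 a b v x : trig [:: (a, b, v)] x = a * cos (l v x) + b * sin (l v x).
Proof. by rewrite /trig big_seq1. Qed.

Hypothesis ml : forall v, measurable_fun [set: T] (l v).

Lemma bmf_trig s : bmf (trig s).
Proof.
apply: bmf_sum => i; apply: bmfD; apply: bmfZ; [exact: bmf_cos | exact: bmf_sin].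
Qed.

Hypothesis l_linear : forall a u v x, l (a *: u + v) x = a * l u x + l v x.

Lemma trig_form0 x : l 0 x = 0.
Proof.
have := l_linear 1 0 0 x; rewrite scale1r addr0 mul1r => /eqP.
by rewrite -subr_eq subrr eq_sym => /eqP.
Qed.

Lemma trig_formD u v x : l (u + v) x = l u x + l v x.
Proof. by have := l_linear 1 u v x; rewrite scale1r mul1r. Qed.

Lemma trig_formZ a u x : l (a *: u) x = a * l u x.
Proof. by have := l_linear a u 0 x; rewrite !addr0 trig_form0 addr0. Qed.

Lemma trig_formB u v x : l (u - v) x = l u x - l v x.
Proof. by rewrite trig_formD -scaleN1r trig_formZ mulN1r. Qed.

Definition trig_scale (c : R) (s : seq (R * R * V)) :=
  [seq (c * i.1.1, c * i.1.2, i.2) | i <- s].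

Lemma trig_scaleE c s x : trig (trig_scale c s) x = c * trig s x.
Proof.
rewrite /trig big_map mulr_sumr; apply: eq_bigr => i _ /=.
by rewrite mulrDr !mulrA.
Qed.

Lemma trig_mul s t : exists r, forall x, trig r x = trig s x * trig t x.
Proof.
elim: s => [|[[a b] u] s [r rE]].
  by exists [::] => x; rewrite /trig big_nil mul0r.
have [r' r'E] : exists r', forall x,
    trig r' x = (a * cos (l u x) + b * sin (l u x)) * trig t x.
  elim: t {r rE} => [|[[c e] v] t [r rE]].
    by exists [::] => x; rewrite /trig big_nil mulr0.
  (* Product-to-sum formulas: one entry at frequency [u + v], one at [u - v]. *)
  exists ([:: ((a * c - b * e) / 2, (a * e + b * c) / 2, u + v);
       ((a * c + b * e) / 2, (b * c - a * e) / 2, u - v)] ++ r) => x.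
  rewrite trig_cat rE /trig !big_cons big_nil/= trig_formD trig_formB.
  by rewrite cosD sinD cosB sinB; field.
exists (r' ++ r) => x.
by rewrite trig_cat rE r'E trig_cons [RHS]mulrDl.
Qed.

Let A : set (T -> R) := [set f | exists s, forall x, f x = trig s x].

Let Abm f : A f -> bmf f.
Proof. by move=> [s sE]; rewrite (funext sE); exact: bmf_trig. Qed.

Let Acst (c : R) : A (fun=> c).
Proof.
by exists [:: (c, 0, 0)] => x; rewrite trig1 trig_form0 cos0 mulr1 mul0r addr0.
Qed.

Let AD (f g : T -> R) : A f -> A g -> A (fun x => f x + g x).
Proof. by move=> [s sE] [t tE]; exists (s ++ t) => x; rewrite trig_cat sE tE. Qed.

Let AM (f g : T -> R) : A f -> A g -> A (fun x => f x * g x).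
Proof.
move=> [s sE] [t tE]; have [r rE] := trig_mul s t.
by exists r => x; rewrite rE sE tE.
Qed.

Hypothesis l_generates : forall E : set T, measurable E ->
  <<s [set [set x | c.2 < l c.1 x] | c in [set: V * R] ]>> E.

Let Agen (E : set T) : measurable E ->
  <<s [set [set x | c.2 < c.1 x] | c in [set c : (T -> R) * R | A c.1] ]>> E.
Proof.
move=> /l_generates.
set G := [set [set x | c.2 < c.1 x] | c in [set c : (T -> R) * R | A c.1] ].
move: E; apply: smallest_sub; first exact: smallest_sigma_algebra.
move=> _ [[v c] _ <-] /=.
have mf (f : T -> R) : A f ->
    measurable_fun [set: g_sigma_algebraType G] (f : g_sigma_algebraType G -> R).
  move=> Af; apply: (measurability (@RGenOInfty.G R)).
    exact: RGenOInfty.measurableE.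
  move=> _ [_ [y ->] <-]; rewrite setTI; apply: sub_sigma_algebra.
  exists (f, y) => //=.
  by apply/seteqP; split => x /=; rewrite in_itv/= andbT.
have ml' : measurable_fun [set: g_sigma_algebraType G]
    (l v : g_sigma_algebraType G -> R).
  apply: (measurable_fun_cvg
    (h := fun n => (fun x : g_sigma_algebraType G => n.+1%:R * sin (n.+1%:R^-1 * l v x)))).
    move=> n; apply: mf; exists [:: (0, n.+1%:R, n.+1%:R^-1 *: v)] => x.
    by rewrite trig1 mul0r add0r trig_formZ.
  by move=> x _; exact: cvg_sin_scaled.
have := ml' measurableT [set` `]c, +oo[ ] (measurable_itv _); rewrite setTI.
suff -> : l v @^-1` [set` `]c, +oo[ ] = [set x | c < l v x] by [].
by apply/seteqP; split => x /=; rewrite in_itv/= andbT.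
Qed.

Variables P Q : probability T R.

Lemma trig_dense (g : T -> R) : measurable_fun [set: T] g ->
  (forall x, 0 <= g x <= 1) -> forall e : R, 0 < e -> exists s,
    [/\ forall x, 0 <= trig s x <= 1,
    \int[P]_x `|trig s x - g x| < e & \int[Q]_x `|trig s x - g x| < e].
Proof.
move=> mg g01 e e0.
have [f [[s /funext ->] f01 Pf Qf]] := algebra_dense P Q Abm Acst AD AM Agen mg g01 e0.
by exists s.
Qed.

Lemma trig_unique :
  (forall v, \int[P]_x cos (l v x) = \int[Q]_x cos (l v x)) ->
  (forall v, \int[P]_x sin (l v x) = \int[Q]_x sin (l v x)) ->
  forall E, measurable E -> P E = Q E.
Proof.
move=> hc hs; apply: (algebra_unique Abm Acst AD AM Agen) => f [s /funext ->].
have bt (i : R * R * V) : bmf (fun x => i.1.1 * cos (l i.2 x) + i.1.2 * sin (l i.2 x)).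
  by apply: bmfD; apply: bmfZ; [exact: bmf_cos | exact: bmf_sin].
rewrite /trig !expect_sum//; apply: eq_bigr => i _.
by rewrite !expectD ?expectZ ?hc ?hs//; try apply: bmfZ;
  (try exact: bmf_cos); exact: bmf_sin.
Qed.

End trigonometric_polynomials.

(** * Normal laws *)

Section integral_density.
Context d (T : measurableType d) (R : realType).
Variables (mu nu : {measure set T -> \bar R}) (g : T -> R).
Hypothesis mg : measurable_fun [set: T] g.
Hypothesis g0 : forall x, 0 <= g x.
Hypothesis nuE : forall A, measurable A -> nu A = (\int[mu]_(x in A) (g x)%:E)%E.
Local Open Scope ereal_scope.
Import HBNNSimple.

Let integral_density_indic E : measurable E ->
  \int[nu]_x (\1_E x)%:E = \int[mu]_x ((\1_E x)%:E * (g x)%:E).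
Proof.
move=> mE; rewrite integral_indic// setIT nuE// integral_mkcond.
apply: eq_integral => x _; rewrite patchE indicE.
by case: ifPn => _; rewrite ?mul1e ?mul0e.
Qed.

Let integral_density_nnsfun (f : {nnsfun T >-> R}) :
  \int[nu]_x (f x)%:E = \int[mu]_x ((f x)%:E * (g x)%:E).
Proof.
under [LHS]eq_integral do rewrite fimfunE -fsumEFin//.
rewrite [LHS]ge0_integral_fsum//; last 2 first.
  - by move=> r; exact/measurable_EFinP/measurableT_comp.
  - by move=> n x _; rewrite EFinM nnfun_muleindic_ge0.
under [RHS]eq_integral.
  move=> x xD; rewrite fimfunE -fsumEFin// ge0_mule_fsuml; last first.
    by move=> r; rewrite EFinM nnfun_muleindic_ge0.
  over.
rewrite [RHS]ge0_integral_fsum//; last 2 first.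
  - move=> r; apply: emeasurable_funM; last exact/measurable_EFinP.
    by apply/measurable_EFinP/measurableT_comp.
  - move=> n x _; apply: mule_ge0; last by rewrite lee_fin.
    by rewrite EFinM nnfun_muleindic_ge0.
apply: eq_fsbigr => r _.
under [RHS]eq_integral do rewrite EFinM -muleA.
have [r0|r0] := leP 0%R r.
  have m1 : measurable_fun setT (fun x => (\1_(f @^-1` [set r]) x : R)%:E).
    by apply/measurable_EFinP; exact: measurable_indic.
  have m2 : measurable_fun setT (fun x => (\1_(f @^-1` [set r]) x : R)%:E * (g x)%:E).
    by apply: emeasurable_funM => //; exact/measurable_EFinP.
  have p1 x : setT x -> 0 <= (\1_(f @^-1` [set r]) x : R)%:E by rewrite lee_fin.
  have p2 x : setT x -> 0 <= (\1_(f @^-1` [set r]) x : R)%:E * (g x)%:E.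
    by rewrite mule_ge0 ?lee_fin.
  under [LHS]eq_integral do rewrite EFinM.
  rewrite (ge0_integralZl _ measurableT m1 p1)// (ge0_integralZl _ measurableT m2 p2)//.
  by rewrite integral_density_indic.
rewrite (_ : f @^-1` [set r] = set0); last first.
  apply/seteqP; split => x //= fxr; move: r0; rewrite -fxr ltNge => /negP; apply.
  exact: fun_ge0.
under eq_integral do rewrite indic0 mulr0.
under [RHS]eq_integral do rewrite indic0 mul0e mule0.
by rewrite !integral0.
Qed.

Lemma ge0_integral_density (f : T -> \bar R) : measurable_fun [set: T] f ->
  (forall x, 0 <= f x) -> \int[nu]_x f x = \int[mu]_x (f x * (g x)%:E).
Proof.
move=> mf f0.
pose f_ := nnsfun_approx measurableT mf.
transitivity (lim (\int[nu]_x (f_ n x)%:E @[n --> \oo])).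
  rewrite -monotone_convergence//=.
  - apply: eq_integral => ? /[!inE] xD; apply/esym/cvg_lim => //=.
    exact: cvg_nnsfun_approx.
  - by move=> n; exact/measurable_EFinP/measurable_funTS.
  - by move=> n ? _; rewrite lee_fin.
  - by move=> ? _ ? ? mn; rewrite lee_fin; exact/lefP/nd_nnsfun_approx.
transitivity (lim (\int[mu]_x ((f_ n x)%:E * (g x)%:E) @[n --> \oo])).
  by apply: congr_lim; apply/funext => n; exact: integral_density_nnsfun.
rewrite -monotone_convergence//=.
- apply: eq_integral => x _; apply/cvg_lim => //.
  under eq_fun do rewrite muleC.
  rewrite muleC; apply: cvgeZl => //; exact: cvg_nnsfun_approx.
- move=> n; apply: emeasurable_funM; last exact/measurable_EFinP.
  exact/measurable_EFinP/measurable_funTS.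
- by move=> n ? _; rewrite mule_ge0 ?lee_fin.
- move=> x _ m n mn; rewrite lee_wpmul2r ?lee_fin//.
  exact/lefP/nd_nnsfun_approx.
Qed.

Lemma integral_density (f : T -> R) : measurable_fun [set: T] f ->
  \int[nu]_x (f x)%:E = \int[mu]_x (f x * g x)%:E.
Proof.
move=> mf; have mf' : measurable_fun setT (EFin \o f) by exact/measurable_EFinP.
rewrite [LHS]integralE [RHS]integralE.
have maxM (a b : R) : (0 <= b)%R ->
    Order.max (a * b)%:E 0 = Order.max a%:E 0 * b%:E.
  by move=> b0; rewrite -[in RHS]EFin_max -EFinM maxr_pMl// mul0r EFin_max.
congr (_ - _).
  rewrite ge0_integral_density//; last exact: measurable_funepos.
  by apply: eq_integral => x _; rewrite !funeposE -maxM.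
rewrite ge0_integral_density//; last exact: measurable_funeneg.
by apply: eq_integral => x _; rewrite !funenegE -!EFinN -mulNr maxM.
Qed.

End integral_density.

Section standard_normal.
Context (R : realType).

Definition gauss1 : probability (measurableTypeR R) R := normal_prob 0 1.

Local Notation g := (normal_pdf (0 : R) 1).
Local Notation leb := (@lebesgue_measure R).

Lemma normal_pdf01E (y : R) : g y = normal_peak 1 * expR (- (y ^+ 2) / 2).
Proof.
rewrite normal_pdfE ?oner_neq0// /normal_fun subr0 expr1n.
by rewrite -mulr_natl mulr1.
Qed.

Lemma integral_gauss1 (f : R -> R) : measurable_fun [set: R] f ->
  (\int[gauss1]_x (f x)%:E = \int[leb]_x (f x * g x)%:E)%E.
Proof.
move=> mf; apply: integral_density => //.
- exact: measurable_normal_pdf.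
- by move=> x; exact: normal_pdf_ge0.
Qed.

Lemma ge0_integral_gauss1 (f : R -> \bar R) : measurable_fun [set: R] f ->
  (forall x, 0 <= f x)%E -> (\int[gauss1]_x f x = \int[leb]_x (f x * (g x)%:E))%E.
Proof.
move=> mf f0; apply: ge0_integral_density => //.
- exact: measurable_normal_pdf.
- by move=> x; exact: normal_pdf_ge0.
Qed.

Lemma gauss1_integrable_pow4 :
  gauss1.-integrable [set: R] (EFin \o (fun y : R => y ^+ 4)).
Proof.
have m4 : measurable_fun [set: R] (fun y : R => y ^+ 4) by exact: measurable_funX.
have y40 (y : R) : 0 <= y ^+ 4 by rewrite (_ : y ^+ 4 = (y ^+ 2) ^+ 2) ?sqr_ge0// -exprM.
apply/integrableP; split; first exact/measurable_EFinP.
under eq_integral do rewrite /= ger0_norm//.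
rewrite ge0_integral_gauss1//; last exact/measurable_EFinP.
pose s : R := Num.sqrt 2.
have s2 : s ^+ 2 = 2 by rewrite sqr_sqrtr.
have s0 : s != 0 by rewrite gt_eqF// sqrtr_gt0.
have pk : 0 < normal_peak s by rewrite normal_peak_gt0.
have pk1 : 0 < normal_peak (1 : R) by rewrite normal_peak_gt0// oner_neq0.
(* Comparison with the normal density of variance 2: for [z = y^2 / 4], [y^4 = 16 z^2 <= 32 exp z],
   and [exp (- y^2 / 2) = exp (- z) exp (- z)]. The peaks convert one density into the other. *)
pose c : R := 32 * normal_peak 1 / normal_peak s.
have c0 : 0 <= c by rewrite /c divr_ge0 ?mulr_ge0 ?ltW.
have : (\int[leb]_y (c%:E * (normal_pdf 0 s y)%:E) < +oo)%E.
  rewrite integralZl//; last exact: integrable_normal_pdf.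
  by rewrite integral_normal_pdf mule1 ltry.
apply: le_lt_trans; apply: ge0_le_integral => //.
- by move=> y _; rewrite mule_ge0 ?lee_fin// normal_pdf_ge0.
- apply: emeasurable_funM; first exact/measurable_EFinP.
  by apply/measurable_EFinP; exact: measurable_normal_pdf.
- apply/measurable_EFinP; apply: measurable_funM => //.
  exact: measurable_normal_pdf.
- move=> y _; rewrite -!EFinM lee_fin normal_pdf01E normal_pdfE// /normal_fun subr0 s2.
  set z := y ^+ 2 / 4.
  have z0 : 0 <= z by rewrite divr_ge0 ?sqr_ge0.
  have -> : - y ^+ 2 / (2 *+ 2) = - z by rewrite /z -mulr_natl; field.
  have -> : - y ^+ 2 / 2 = - z + - z by rewrite /z; field.
  have -> : c * (normal_peak s * expR (- z)) = normal_peak 1 * (32 * expR (- z)).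
    by rewrite /c; field; rewrite gt_eqF.
  rewrite mulrCA; apply: ler_wpM2l; first exact: ltW.
  rewrite expRD mulrA ler_wpM2r ?expR_ge0// expRN ler_pdivrMr ?expR_gt0//.
  have := expR_ge1Dxn 1 z0; rewrite (_ : y ^+ 4 = 16 * z ^+ 2); last by rewrite /z; field.
  by rewrite (_ : 2`! = 2%N)//; lra.
Qed.

Lemma gauss1_integrable (f : R -> R) (c : R) : measurable_fun [set: R] f ->
  (forall y, `|f y| <= c * (1 + y ^+ 4)) -> gauss1.-integrable [set: R] (EFin \o f).
Proof.
move=> mf fc; apply: (@le_integrable _ _ _ gauss1 _ measurableT _
  (EFin \o (fun y => c * (1 + y ^+ 4)))).
- exact/measurable_EFinP.
- by move=> x _; rewrite /= lee_fin (le_trans (fc x))// ler_norm.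
- have := integrableZl measurableT c (integrableD measurableT
    (bmf_integrable gauss1 (bmf_cst _ (1 : R))) gauss1_integrable_pow4).
  by apply.
Qed.

Lemma norm_le_1pow4 (y : R) : `|y| <= 1 + y ^+ 4.
Proof.
have h : (`|y| ^+ 2) ^+ 2 = y ^+ 4 by rewrite real_normK ?num_real// -exprM.
have := sqr_ge0 (`|y| - 1 / 2); have := sqr_ge0 (`|y| ^+ 2 - 1 / 2).
by rewrite -h; lra.
Qed.

(** The derivative of [sin (a y + t) exp (- y^2 / 2)], divided by [exp (- y^2 / 2)]. *)
Definition gauss1_deriv (a t y : R) := a * cos (a * y + t) - y * sin (a * y + t).

Lemma measurable_affine (a t : R) : measurable_fun [set: R] (fun y => a * y + t).
Proof. by apply: measurable_funD => //; exact: measurable_funM. Qed.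

Lemma measurable_gauss1_deriv (a t : R) : measurable_fun [set: R] (gauss1_deriv a t).
Proof.
apply: measurable_funB; apply: measurable_funM => //.
  by case: (bmf_cos (measurable_affine a t)).
by case: (bmf_sin (measurable_affine a t)).
Qed.

Lemma gauss1_deriv_le (a t y : R) :
  `|gauss1_deriv a t y| <= (`|a| + 1) * (1 + y ^+ 4).
Proof.
have y40 : 0 <= y ^+ 4 by rewrite (_ : y ^+ 4 = (y ^+ 2) ^+ 2) ?sqr_ge0// -exprM.
rewrite (le_trans (ler_normB _ _))// !normrM.
have c1 : `|a| * `|cos (a * y + t)| <= `|a| by rewrite ler_piMr// cos_max.
have s1 : `|y| * `|sin (a * y + t)| <= `|y| by rewrite ler_piMr// sin_max.
have := norm_le_1pow4 y; have := mulr_ge0 (normr_ge0 a) y40.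
by rewrite mulrDl mul1r mulrDr mulr1; lra.
Qed.

Lemma is_derive_gauss1_prim (a t y : R) :
  is_derive y (1 : R) (fun y => normal_peak 1 * (sin (a * y + t) * expR (- (y ^+ 2) / 2)))
    (gauss1_deriv a t y * g y).
Proof.
have d1 : is_derive y (1 : R) (fun y => a * y + t) a.
  by apply: is_derive_eq; rewrite scaler1 addr0.
have d2 : is_derive y (1 : R) (fun y => sin (a * y + t)) (a * cos (a * y + t)).
  by apply: is_derive_eq (is_derive1_comp (is_derive_sin _) d1) _; rewrite mulrC.
have d3 : is_derive y (1 : R) (fun y => - (y ^+ 2) / 2) (- y).
  by apply: is_derive_eq; rewrite /GRing.scale/=; field.
have d4 : is_derive y (1 : R) (fun y => expR (- (y ^+ 2) / 2)) (- y * expR (- (y ^+ 2) / 2)).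
  by apply: is_derive_eq (is_derive1_comp (is_derive_expR _) d3) _; rewrite mulrC.
apply: is_derive_eq; rewrite normal_pdf01E /gauss1_deriv /GRing.scale/=.
by ring.
Qed.

(** Against the density the integrand is an exact derivative; on [[-(n+1), n+1]] its integral
    reduces to boundary terms of order 1/n, and dominated convergence removes the truncation. *)
Lemma gauss1_stein (a t : R) : \int[gauss1]_y gauss1_deriv a t y = 0.
Proof.
pose F y := normal_peak 1 * (sin (a * y + t) * expR (- (y ^+ 2) / 2)) : R.
pose I n := [set` `[- n.+1%:R, n.+1%:R : R]].
pose f_ n y := gauss1_deriv a t y * \1_(I n) y.
have mf n : measurable_fun [set: R] (f_ n).
  apply: measurable_funM; first exact: measurable_gauss1_deriv.
  by apply: measurable_indic; exact: measurable_itv.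
have iG : gauss1.-integrable [set: R] (EFin \o (fun y => (`|a| + 1) * (1 + y ^+ 4))).
  apply: (@gauss1_integrable _ (`|a| + 1)).
    by apply: measurable_funM => //; apply: measurable_funD => //; exact: measurable_funX.
  move=> y; rewrite ger0_norm// mulr_ge0// ?addr_ge0//.
  by rewrite (_ : y ^+ 4 = (y ^+ 2) ^+ 2) ?sqr_ge0// -exprM.
have iD : gauss1.-integrable [set: R] (EFin \o gauss1_deriv a t).
  apply: gauss1_integrable (measurable_gauss1_deriv a t) (gauss1_deriv_le a t).
have cv : (fun n => \int[gauss1]_y f_ n y) @ \oo --> \int[gauss1]_y gauss1_deriv a t y.
  have [] := @dominated_convergence _ _ R gauss1 setT measurableT (fun n => EFin \o f_ n)
    (EFin \o gauss1_deriv a t) (EFin \o (fun y => (`|a| + 1) * (1 + y ^+ 4))).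
  - by move=> n; apply/measurable_EFinP; exact: mf.
  - apply/measurable_EFinP; exact: measurable_gauss1_deriv.
  - apply: aeW => y _; apply: cvg_EFin; first exact: nearW.
    apply: cvg_near_cst; near=> n.
    rewrite /= /f_ indicE mem_set/= ?mulr1// /I/= in_itv/= -ler_norml.
    apply: (@le_trans _ _ n%:R); last by rewrite ler_nat.
    by near: n; exact: nbhs_infty_ger.
  - exact: iG.
  - apply: aeW => y n _; rewrite /= lee_fin (le_trans _ (gauss1_deriv_le a t y))//.
    rewrite /f_ normrM ler_piMr// indicE; case: (_ \in _); rewrite ?normr0 ?normr1//.
  move=> _ _ cv.
  apply: fine_cvg; rewrite fineK//; exact: integrable_fin_num.
have fE n : \int[gauss1]_y f_ n y = F n.+1%:R - F (- n.+1%:R).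
  rewrite /Rintegral integral_gauss1//.
  under eq_integral do rewrite /f_ mulrAC.
  transitivity (fine (\int[leb]_(y in I n) (gauss1_deriv a t y * g y)%:E)%E).
    congr fine; rewrite [RHS]integral_mkcond; apply: eq_integral => y _.
    by rewrite patchE indicE; case: ifPn => _; rewrite ?mulr1 ?mulr0.
  rewrite (@continuous_FTC2 _ _ F)//.
  - by rewrite (@lt_trans _ _ 0)// oppr_lt0.
  - apply: continuous_subspaceT => y.
    rewrite /gauss1_deriv; apply: cvgM; last exact: continuous_normal_pdf.
    have ca : {for y, continuous (fun y => a * y + t)}.
      by apply: cvgD; [apply: cvgM; [exact: cvg_cst | exact: cvg_id] | exact: cvg_cst].
    apply: cvgB; apply: cvgM; [exact: cvg_cst | | exact: cvg_id |].
      by apply: continuous_comp ca _; exact: continuous_cos.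
    by apply: continuous_comp ca _; exact: continuous_sin.
  - have cF : continuous F.
      move=> y; apply: differentiable_continuous; apply/derivable1_diffP.
      by have [] := is_derive_gauss1_prim a t y.
    split; first by move=> y _; have [] := is_derive_gauss1_prim a t y.
      by apply: cvg_at_right_filter; exact: cF.
    by apply: cvg_at_left_filter; exact: cF.
  - by move=> y _; rewrite derive1E; have [_ ->] := is_derive_gauss1_prim a t y.
have Fle n y : `|y| = n.+1%:R -> `|F y| <= normal_peak 1 * (2 * harmonic n).
  move=> yn; have pk : 0 <= normal_peak (1 : R) by exact: normal_peak_ge0.
  rewrite /F normrM ger0_norm//; apply: ler_wpM2l => //.
  rewrite normrM (ger0_norm (expR_ge0 _)).
  apply: (@le_trans _ _ (expR (- (y ^+ 2) / 2))).
    by rewrite ler_piMl ?expR_ge0// sin_max.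
  have y2 : y ^+ 2 = n.+1%:R ^+ 2 by rewrite -yn real_normK ?num_real.
  have n1 : 1 <= n.+1%:R :> R by rewrite ler1n.
  rewrite mulNr expRN /harmonic -[2 * _]invrK lef_pV2 ?posrE ?expR_gt0//; last first.
    by rewrite invr_gt0 mulr_gt0// invr_gt0; lra.
  apply: le_trans (expR_ge1Dx _); rewrite y2 invfM invrK.
  by have := sqr_ge0 (n.+1%:R - 1 : R); lra.
have F0 : (fun n => F n.+1%:R - F (- n.+1%:R)) @ \oo --> (0 : R).
  apply/norm_cvg0P.
  apply: (@squeeze_cvgr _ _ _ _ (fun=> 0) (fun n => normal_peak 1 * (2 * harmonic n) + normal_peak 1 * (2 * harmonic n))).
  - apply: nearW => n; rewrite normr_ge0/= (le_trans (ler_normB _ _))//.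
    have h1 := Fle n n.+1%:R (normr_nat _ _).
    have h2 : `|F (- n.+1%:R)| <= normal_peak 1 * (2 * harmonic n).
      by apply: Fle; rewrite normrN normr_nat.
    exact: lerD h1 h2.
  - exact: cvg_cst.
  - have hh : (fun n => normal_peak 1 * (2 * @harmonic R n)) @ \oo --> (0 : R).
      rewrite -(mulr0 (normal_peak 1)) -[X in _ * X](mulr0 2).
      apply: cvgM; first exact: cvg_cst.
      by apply: cvgM; [exact: cvg_cst | exact: cvg_harmonic].
    by rewrite -[X in _ --> X](addr0 0); exact: (cvgD hh hh).
move: cv; under eq_fun do rewrite fE.
by move=> cv; apply: cvg_unique cv F0.
Unshelve. all: by end_near. Qed.

(** Differentiation under the integral produces [- y sin (a y + t)], which [gauss1_stein] turns into
    [- a cos (a y + t)]: the differential equation of the Gaussian characteristic function. *)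
Lemma is_derive_gauss1_cos (t a : R) :
  is_derive a (1 : R) (fun a => \int[gauss1]_y cos (a * y + t))
    (- a * \int[gauss1]_y cos (a * y + t)).
Proof.
pose f (x y : R) := cos (x * y + t).
have d1 x y : is_derive x (1 : R) (f ^~ y) (- (y * sin (x * y + t))).
  have d : is_derive x (1 : R) (fun x => x * y + t) y.
    by apply: is_derive_eq; rewrite /GRing.scale/=; ring.
  by apply: is_derive_eq (is_derive1_comp (is_derive_cos _) d) _; rewrite mulrC mulrN.
have p1 x y : partial1of2 f x y = - (y * sin (x * y + t)).
  by rewrite partial1of2E; have [_ ->] := d1 x y.
have ab : `](a - 1), (a + 1)[%classic a.
  by rewrite /= in_itv/=; apply/andP; split; lra.
have bf x : bmf (f x) by apply: bmf_cos; exact: measurable_affine.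
have i1 x : gauss1.-integrable setT (EFin \o f x).
  by apply: (bmf_integrable gauss1 (f := f x)); exact: bf.
have iy : gauss1.-integrable [set: R] (EFin \o (fun y : R => `|y|)).
  apply: (@gauss1_integrable _ 1); first exact: measurableT_comp.
  by move=> y; rewrite normr_id mul1r norm_le_1pow4.
have pG x y : `|partial1of2 f x y| <= `|y|.
  by rewrite p1 normrN normrM ler_piMr// sin_max.
have dU := @derivable_under_integral R _ _ gauss1 f setT measurableT a _ _ ab
  (fun x _ => i1 x) (fun x y _ _ => @ex_derive _ _ _ _ _ _ _ (d1 x y)) (fun y => `|y|)
  (fun y => normr_ge0 y) iy (fun x y _ _ => pG x y).
have eU := @differentiation_under_integral R _ _ gauss1 f setT measurableT a _ _ ab
  (fun x _ => i1 x) (fun x y _ _ => @ex_derive _ _ _ _ _ _ _ (d1 x y)) (fun y => `|y|)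
  (fun y => normr_ge0 y) iy (fun x y _ _ => pG x y).
apply: DeriveDef; first exact: dU.
rewrite -derive1E eU.
under eq_Rintegral do rewrite p1.
have := gauss1_stein a t; rewrite /gauss1_deriv RintegralB//; last 2 first.
- by have := bmf_integrable gauss1 (bmfZ a (bf a)).
- apply: (@gauss1_integrable _ 1).
    apply: measurable_funM => //.
    by case: (bmf_sin (measurable_affine a t)).
  by move=> y; rewrite mul1r normrM (le_trans _ (norm_le_1pow4 y))// ler_piMr// sin_max.
have := expectZ gauss1 a (bf a); rewrite /f => ->.
move=> /eqP; rewrite subr_eq0 => /eqP e.
rewrite mulNr e -mulN1r -RintegralZl//.
  by apply: eq_Rintegral => y _; rewrite mulN1r.
apply: (@gauss1_integrable _ 1).
  apply: measurable_funM => //.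
  by case: (bmf_sin (measurable_affine a t)).
by move=> y; rewrite mul1r normrM (le_trans _ (norm_le_1pow4 y))// ler_piMr// sin_max.
Qed.

Lemma gauss1_cos (a t : R) :
  \int[gauss1]_y cos (a * y + t) = cos t * expR (- (a ^+ 2) / 2).
Proof.
pose h a := \int[gauss1]_y cos (a * y + t) * expR (a ^+ 2 / 2).
have dh (x : R) : is_derive x (1 : R) h 0.
  have d3 : is_derive x (1 : R) (fun y => y ^+ 2 / 2) x.
    by apply: is_derive_eq; rewrite /GRing.scale/=; field.
  have d4 : is_derive x (1 : R) (fun y => expR (y ^+ 2 / 2)) (x * expR (x ^+ 2 / 2)).
    by apply: is_derive_eq (is_derive1_comp (is_derive_expR _) d3) _; rewrite mulrC.
  have d5 := is_derive_gauss1_cos t x.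
  by apply: is_derive_eq; rewrite /GRing.scale/=; ring.
have := is_derive_0_is_cst a 0 dh; rewrite /h.
under [in RHS]eq_Rintegral do rewrite mul0r add0r.
rewrite expect_cst expr0n mul0r expR0 mulr1 => <-.
by rewrite -mulrA -expRD mulNr addrN expR0 mulr1.
Qed.

Lemma gauss1_sin (a t : R) :
  \int[gauss1]_y sin (a * y + t) = sin t * expR (- (a ^+ 2) / 2).
Proof.
rewrite -cosBpihalf -gauss1_cos; apply: eq_Rintegral => y _.
by rewrite addrA cosBpihalf.
Qed.

End standard_normal.

Section normal_law_of_gauss1.
Context (R : realType).
Implicit Types m s v : R.

Lemma measurable_scale m s : measurable_fun [set: R] (fun y => m + s * y).
Proof. by apply: measurable_funD => //; exact: measurable_funM. Qed.

Lemma ge0_expect_normal_prob m s (G : R -> R) : 0 < s -> continuous G ->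
  (forall x, 0 <= G x) ->
  (\int[normal_prob m s]_x (G x)%:E = \int[@gauss1 R]_y (G (m + s * y)%R)%:E)%E.
Proof.
move=> s0 cG G0; have sn0 : s != 0 by rewrite gt_eqF.
have mG : measurable_fun [set: R] G by exact: continuous_measurable_fun.
have mpdf := measurable_normal_pdf m s.
rewrite (@integral_density _ _ _ (@lebesgue_measure R) _ (normal_pdf m s))//; last first.
  by move=> x; exact: normal_pdf_ge0.
rewrite integral_gauss1; last first.
  by apply: (measurableT_comp mG); exact: measurable_scale.
pose F (y : R) : R := (y + m / s) * s.
have FE y : m + s * y = F y by rewrite /F; field.
have dF (y : R) : is_derive y (1 : R) F s.
  by apply: is_derive_eq; rewrite /GRing.scale/=; ring.
have F'E : F^`()%classic = cst s by apply/funext => y; rewrite derive1E; have [_ ->] := dF y.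
rewrite (@increasing_ge0_integration_by_substitutionT _ F).
- apply: eq_integral => y _; congr (_%:E).
  rewrite FE F'E /= !fctE -mulrA; congr (_ * _).
  rewrite !normal_pdfE ?oner_neq0// /normal_fun /normal_peak.
  have -> : - (F y - m) ^+ 2 / (s ^+ 2 *+ 2) = - (y - 0) ^+ 2 / (1 ^+ 2 *+ 2).
    by rewrite /F; field.
  rewrite mulrAC; congr (_ * _).
  rewrite expr1n mul1r -mulrnAr sqrtrM ?sqr_ge0// sqrtr_sqr gtr0_norm//.
  by field; rewrite sn0 gt_eqF// sqrtr_gt0 mulrn_wgt0// pi_gt0.
- by move=> x y xy; rewrite /F ltr_pM2r// ltrD2r.
- by rewrite F'E => x; exact: cvg_cst.
- by rewrite F'E; exact: is_cvg_cst.
- by rewrite F'E; exact: is_cvg_cst.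
- by move=> y; have [] := dF y.
- by apply/gt0_cvgMlNy => //; exact: cvg_addrr_Ny.
- by apply/gt0_cvgMly => //; exact: cvg_addrr.
- by move=> x; apply: cvgM; [exact: cG | exact: continuous_normal_pdf].
- by move=> x; rewrite mulr_ge0// normal_pdf_ge0.
Qed.

Lemma expect_normal_prob m s (G : R -> R) : 0 < s -> continuous G ->
  (forall x, `|G x| <= 1) ->
  \int[normal_prob m s]_x G x = \int[@gauss1 R]_y G (m + s * y).
Proof.
move=> s0 cG G1; have mG : measurable_fun [set: R] G by exact: continuous_measurable_fun.
have bG : bmf G by split => //; exists 1.
(* Adding 1 makes the integrand nonnegative, as the change of variables requires. *)
pose G2 x := G x + 1.
have cG2 : continuous G2 by move=> x; apply: cvgD; [exact: cG | exact: cvg_cst].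
have G20 x : 0 <= G2 x by have := G1 x; rewrite ler_norml /G2 => /andP[? ?]; lra.
have e : \int[normal_prob m s]_x (G x + 1) = \int[@gauss1 R]_y (G (m + s * y) + 1) :=
  congr1 fine (ge0_expect_normal_prob m s0 cG2 G20).
have bG' : bmf (fun y => G (m + s * y)) by apply: bmf_comp bG; exact: measurable_scale.
have h (P : probability (measurableTypeR R) R) (f : R -> R) : bmf f ->
    \int[P]_x (f x + 1) = \int[P]_x f x + 1.
  by move=> bf; rewrite (expectD P bf (bmf_cst _ (1 : R))) expect_cst.
by apply: (addIr 1); exact: (etrans (esym (h _ _ bG)) (etrans e (h _ _ bG'))).
Qed.

Lemma real_line_generated (E : set (measurableTypeR R)) : measurable E ->
  <<s [set [set x | c.2 < c.1 * x] | c in [set: R^o * R] ]>> E.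
Proof.
have -> : (@measurable _ (measurableTypeR R)) = <<s @RGenOInfty.G R >>.
  exact: RGenOInfty.measurableE.
move: E; apply: smallest_sub; first exact: smallest_sigma_algebra.
move=> _ [x ->]; apply: sub_sigma_algebra; exists (1, x) => //=.
by apply/seteqP; split => y /=; rewrite mul1r in_itv/= andbT.
Qed.

Lemma real_law_unique (P Q : probability (measurableTypeR R) R) :
  (forall a, \int[P]_x cos (a * x) = \int[Q]_x cos (a * x)) ->
  (forall a, \int[P]_x sin (a * x) = \int[Q]_x sin (a * x)) ->
  forall E, measurable E -> P E = Q E.
Proof.
move=> hc hs; apply: (@trig_unique _ (measurableTypeR R) R R^o (fun a x => a * x)).
- by move=> v; exact: measurable_funM.
- by move=> a u v x /=; rewrite mulrDl mulrA.
- exact: real_line_generated.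
- exact: hc.
- exact: hs.
Qed.

(** The change of variables holds for continuous integrands; applied to cosines and sines it
    identifies the two laws on all Borel sets. *)
Lemma normal_probE m s (A : set (measurableTypeR R)) : 0 < s -> measurable A ->
  normal_prob m s A = @gauss1 R [set y | A (m + s * y)].
Proof.
move=> s0 mA.
pose Q := law (T := measurableTypeR R) (T' := measurableTypeR R) (@gauss1 R)
  (measurable_scale m s).
suff h : forall E, measurable E -> (normal_prob m s : probability _ R) E = Q E by exact: h.
apply: real_law_unique => a.
- rewrite expect_law; last first.
    by apply: bmf_cos; exact: measurable_funM.
  rewrite expect_normal_prob//.
    move=> x; apply: (continuous_comp (f := fun x => a * x)); last exact: continuous_cos.
    by apply: cvgM; [exact: cvg_cst | exact: cvg_id].
  by move=> x; exact: cos_max.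
- rewrite expect_law; last first.
    by apply: bmf_sin; exact: measurable_funM.
  rewrite expect_normal_prob//.
    move=> x; apply: (continuous_comp (f := fun x => a * x)); last exact: continuous_sin.
    by apply: cvgM; [exact: cvg_cst | exact: cvg_id].
  by move=> x; exact: sin_max.
Qed.

(** Since [Num.sqrt 0 = 0], the image of [gauss1] under an affine map covers the Dirac case and the
    nondegenerate one alike. *)
Lemma normal_lawE m v (A : set (measurableTypeR R)) : 0 <= v -> measurable A ->
  normal_law m v A = @gauss1 R [set y | A (m + Num.sqrt v * y)].
Proof.
move=> v0 mA; rewrite /normal_law; case: eqVneq => [->|vn0].
  rewrite sqrtr0 diracE; have [Am|Am] := pselect (A m).
    rewrite mem_set// (_ : [set _ | _] = setT) ?probability_setT//.
    by apply/seteqP; split => // y _ /=; rewrite mul0r addr0.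
  rewrite memNset// (_ : [set _ | _] = set0) ?measure0//.
  by apply/seteqP; split => // y /=; rewrite mul0r addr0.
by apply: normal_probE => //; rewrite sqrtr_gt0 lt_def vn0.
Qed.

Lemma expect_scale_cos m v : 0 <= v ->
  \int[@gauss1 R]_y cos (m + Num.sqrt v * y) = cos m * expR (- v / 2).
Proof.
move=> v0; under eq_Rintegral do rewrite addrC.
by rewrite gauss1_cos sqr_sqrtr.
Qed.

Lemma expect_scale_sin m v : 0 <= v ->
  \int[@gauss1 R]_y sin (m + Num.sqrt v * y) = sin m * expR (- v / 2).
Proof.
move=> v0; under eq_Rintegral do rewrite addrC.
by rewrite gauss1_sin sqr_sqrtr.
Qed.

Lemma normal_law_unique (P : probability (measurableTypeR R) R) m v : 0 <= v ->
  (forall a, \int[P]_x cos (a * x) = cos (a * m) * expR (- (a ^+ 2 * v) / 2)) ->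
  (forall a, \int[P]_x sin (a * x) = sin (a * m) * expR (- (a ^+ 2 * v) / 2)) ->
  forall E, measurable E -> P E = normal_law m v E.
Proof.
move=> v0 hc hs E mE; rewrite normal_lawE//.
have sq (a : R) : (a * Num.sqrt v) ^+ 2 = a ^+ 2 * v by rewrite exprMn sqr_sqrtr.
pose Q := law (T := measurableTypeR R) (T' := measurableTypeR R) (@gauss1 R)
  (measurable_scale m (Num.sqrt v)).
suff h : forall E, measurable E -> P E = Q E by exact: h.
apply: real_law_unique => a.
- rewrite expect_law; last by apply: bmf_cos; exact: measurable_funM.
  rewrite hc -sq -gauss1_cos; apply: eq_Rintegral => y _; congr cos; ring.
- rewrite expect_law; last by apply: bmf_sin; exact: measurable_funM.
  rewrite hs -sq -gauss1_sin; apply: eq_Rintegral => y _; congr sin; ring.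
Qed.

End normal_law_of_gauss1.

(** * Hilbert spaces *)

Section inner_product.
Context (R : realType) (X : completeNormedModType R).
Variable dotp : {dot X for idfun}.
Hypothesis dotp_norm : is_inner_product dotp.
Implicit Types x y z : X.
Local Notation "<< x , y >>" := (dotp x y) (at level 0, format "<< x ,  y >>").

Lemma dotC x y : <<x, y>> = <<y, x>>.
Proof. by rewrite (@hermC R false idfun X dotp x y) expr0 mul1r. Qed.

Lemma dotDl x y z : <<x + y, z>> = <<x, z>> + <<y, z>>.
Proof. by rewrite linearDl. Qed.

Lemma dotDr x y z : <<z, x + y>> = <<z, x>> + <<z, y>>.
Proof. by rewrite dotC dotDl !(dotC z). Qed.

Lemma dotNl x y : <<- x, y>> = - <<x, y>>.
Proof. by rewrite linearNl. Qed.

Lemma dotNr x y : <<y, - x>> = - <<y, x>>.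
Proof. by rewrite dotC dotNl dotC. Qed.

Lemma dotBl x y z : <<x - y, z>> = <<x, z>> - <<y, z>>.
Proof. by rewrite dotDl dotNl. Qed.

Lemma dotBr x y z : <<z, x - y>> = <<z, x>> - <<z, y>>.
Proof. by rewrite dotDr dotNr. Qed.

Lemma dotZl a x y : <<a *: x, y>> = a * <<x, y>>.
Proof. by rewrite linearZl_LR. Qed.

Lemma dotZr a x y : <<y, a *: x>> = a * <<y, x>>.
Proof. by rewrite dotC dotZl dotC. Qed.

Lemma dot0l x : <<0, x>> = 0.
Proof. by rewrite -(scale0r 0) dotZl mul0r. Qed.

Lemma dot0r x : <<x, 0>> = 0.
Proof. by rewrite dotC dot0l. Qed.

Lemma dot_suml I (s : seq I) (f : I -> X) y :
  <<\sum_(i <- s) f i, y>> = \sum_(i <- s) <<f i, y>>.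
Proof. by elim: s => [|i s IH]; rewrite ?big_nil ?dot0l// !big_cons dotDl IH. Qed.

Lemma dotxx x : <<x, x>> = `|x| ^+ 2.
Proof. exact: dotp_norm. Qed.

Lemma dotxx_ge0 x : 0 <= <<x, x>>.
Proof. by rewrite dotxx sqr_ge0. Qed.

Lemma normB_sqr x y : `|x - y| ^+ 2 = `|x| ^+ 2 - 2 * <<x, y>> + `|y| ^+ 2.
Proof. by rewrite -!dotxx dotBl !dotBr (dotC y x); ring. Qed.

Lemma normD_sqr x y : `|x + y| ^+ 2 = `|x| ^+ 2 + 2 * <<x, y>> + `|y| ^+ 2.
Proof. by rewrite -!dotxx dotDl !dotDr (dotC y x); ring. Qed.

Lemma cauchy_schwarz x y : `|<<x, y>>| <= `|x| * `|y|.
Proof.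
have [->|y0] := eqVneq y 0; first by rewrite dot0r !normr0 mulr0.
have ny : 0 < `|y| by rewrite normr_gt0.
rewrite -ler_sqr ?nnegrE ?mulr_ge0// real_normK ?num_real//.
(* The vector is [|y|^2] times the component of [x] orthogonal to [y]. *)
have := sqr_ge0 `| (`|y| ^+ 2) *: x - <<x, y>> *: y |.
rewrite normB_sqr dotZl dotZr !normrZ !exprMn !real_normK ?num_real//.
set a := `|x|; set b := `|y|; set c := <<x, y>> => h.
have b2 : 0 < b ^+ 2 by rewrite exprn_gt0.
rewrite -(ler_pM2l b2) -subr_ge0; apply: le_trans h _.
by rewrite le_eqVlt; apply/orP; left; apply/eqP; ring.
Qed.

Lemma dot_le x y : <<x, y>> <= `|x| * `|y|.
Proof. exact: le_trans (ler_norm _) (cauchy_schwarz x y). Qed.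

Lemma dot_eq0 x : (forall y, <<x, y>> = 0) -> x = 0.
Proof. by move=> /(_ x); rewrite dotxx => /eqP; rewrite sqrf_eq0 normr_eq0 => /eqP. Qed.

Lemma dot_inj x y : (forall z, <<x, z>> = <<y, z>>) -> x = y.
Proof.
by move=> h; apply/eqP; rewrite -subr_eq0; apply/eqP/dot_eq0 => z; rewrite dotBl h subrr.
Qed.

Lemma cvg_dotl (F : set_system nat) (FF : Filter F) (u : nat -> X) x y :
  u @ F --> x -> (fun n => <<u n, y>>) @ F --> <<x, y>>.
Proof.
move=> ux; apply/subr_cvg0; apply/norm_cvg0P.
apply: (@squeeze_cvgr _ _ _ _ (fun=> 0) (fun n => `|u n - x| * `|y|)).
- by apply: nearW => n; rewrite normr_ge0/= -dotBl cauchy_schwarz.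
- exact: cvg_cst.
- rewrite -(mul0r `|y|); apply: cvgM; last exact: cvg_cst.
  by apply/norm_cvg0P/subr_cvg0.
Qed.

Lemma continuous_dotl y : continuous (fun x => <<x, y>>).
Proof.
move=> x; apply/cvgrPdist_le => e e0.
have h : \forall z \near x, `|x - z| * (`|y| + 1) <= e.
  have e1 : 0 < e / (`|y| + 1) by rewrite divr_gt0// ltr_pwDr.
  have /cvgrPdist_le/(_ _ e1) := @cvg_id _ (nbhs x).
  by apply: filterS => z; rewrite -ler_pdivlMr// ltr_pwDr.
apply: filterS h => z; apply: le_trans; rewrite -dotBl.
apply: (le_trans (cauchy_schwarz _ _)); apply: ler_wpM2l => //.
by rewrite lerDl.
Qed.

(* The minimiser of |S h|^2/2 - phi h over h, in the closure of the range of S. *)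
Lemma variational_riesz (V : lmodType R) (S : V -> X) (phi : V -> R) (C : R) :
  linear S -> (forall a u v, phi (a *: u + v) = a * phi u + phi v) -> 0 <= C ->
  (forall h, `|phi h| <= C * `|S h|) ->
  exists z, [/\ forall h, phi h = <<S h, z>>, `|z| <= C &
    exists u : nat -> V, (fun n => S (u n)) @ \oo --> z].
Proof.
move=> linS linphi C0 phiC.
have S0 : S 0 = 0.
  by have := linS 1 0 0; rewrite !scale1r !addr0 => /eqP; rewrite -subr_eq subrr eq_sym => /eqP.
have phi0 : phi 0 = 0.
  have := linphi 1 0 0; rewrite scale1r addr0 mul1r => /eqP.
  by rewrite -subr_eq subrr eq_sym => /eqP.
have SZ a h : S (a *: h) = a *: S h by have := linS a h 0; rewrite !addr0 S0 addr0.
have phiZ a h : phi (a *: h) = a * phi h by have := linphi a h 0; rewrite !addr0 phi0 addr0.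
have SD u v : S (u + v) = S u + S v by have := linS 1 u v; rewrite !scale1r.
have phiD u v : phi (u + v) = phi u + phi v.
  by have := linphi 1 u v; rewrite !scale1r !mul1r.
pose J h : R := `|S h| ^+ 2 / 2 - phi h.
have Jlb h : - (C ^+ 2 / 2) <= J h.
  have h1 := le_trans (ler_norm _) (phiC h).
  by rewrite /J; have := sqr_ge0 (`|S h| - C); lra.
have hinf : has_inf (range J).
  by split; [exists (J 0); exists 0 | exists (- (C ^+ 2 / 2)) => _ [h _ <-]].
pose m := inf (range J).
have mJ h : m <= J h by apply: ge_inf; [case: hinf | exists h].
have /choice[u uJ] : forall n : nat, exists h, J h < m + n.+1%:R^-1.
  move=> n; have n0 : 0 < n.+1%:R^-1 :> R by rewrite invr_gt0.
  by have [_ [h _ <-] hJ] := inf_adherent n0 hinf; exists h.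
(* [J] at the midpoint is the mean of [J h] and [J k] minus [|S h - S k|^2 / 8], and it is at least
   [m]; minimising sequences are therefore Cauchy after [S]. *)
have key h k : `|S h - S k| ^+ 2 <= 4 * (J h - m) + 4 * (J k - m).
  have := mJ (2^-1 *: (h + k)).
  rewrite /J SZ phiZ SD phiD normrZ ger0_norm ?invr_ge0// exprMn
    (normD_sqr (S h) (S k)) (normB_sqr (S h) (S k)).
  by lra.
have Jd (r : R) n : n.+1%:R^-1 < r -> J (u n) - m < r.
  move=> h; rewrite ltrBlDl; apply: lt_trans (uJ n) _.
  by rewrite ltrD2l.
have cS : cvgn (fun n => S (u n)).
  apply/cauchy_cvgP/cauchy_ballP => e e0; rewrite near_map2.
  have e20 : 0 < e ^+ 2 / 16 by rewrite divr_gt0// exprn_gt0.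
  have /cvgr0_norm_lt/(_ _ e20)[N _ hN] := @cvg_harmonic R.
  exists ([set n | (N <= n)%N], [set n | (N <= n)%N]); first by split; exists N.
  move=> [a b] [/= Na Nb].
  have J1 n : (N <= n)%N -> J (u n) - m < e ^+ 2 / 16.
    move=> Nn; have h2 : n.+1%:R^-1 < e ^+ 2 / 16.
      by apply: le_lt_trans (hN n Nn); exact: ler_norm.
    exact: Jd h2.
  rewrite -ball_normE /= -ltr_sqr ?nnegrE ?normr_ge0 ?ltW//.
  apply: (le_lt_trans (key _ _)); move: (J1 _ Na) (J1 _ Nb).
  have : 0 < e ^+ 2 by rewrite exprn_gt0.
  move: (e ^+ 2) (J (u a)) (J (u b)) => r x y; lra.
pose z := lim (S (u n) @[n --> \oo]).
have uz : (fun n => S (u n)) @ \oo --> z by exact: cS.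
have zk k : phi k = <<S k, z>>.
  pose b := `|S k| ^+ 2.
  (* First variation: [J (u n + t k) >= m] while [J (u n) < m + 1/(n+1)], in the limit. *)
  have ineq t : 0 <= t * (<<z, S k>> - phi k) + t ^+ 2 / 2 * b.
    have cv : (fun n => n.+1%:R^-1 + (t * (<<S (u n), S k>> - phi k) + t ^+ 2 / 2 * b)) @ \oo -->
        0 + (t * (<<z, S k>> - phi k) + t ^+ 2 / 2 * b).
      apply: cvgD; first exact: cvg_harmonic.
      apply: cvgD; last exact: cvg_cst.
      apply: cvgM; first exact: cvg_cst.
      by apply: cvgB; [exact: cvg_dotl | exact: cvg_cst].
    rewrite -[leRHS]add0r; apply: (cvgr_to_ge cv); apply: nearW => n.
    have := mJ (u n + t *: k); have := uJ n.
    rewrite /J SD phiD SZ phiZ normD_sqr dotZr normrZ exprMn real_normK ?num_real// /b.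
    by move: (n.+1%:R^-1) => r; lra.
  set c := <<z, S k>> - phi k in ineq.
  suff : c = 0 by rewrite /c dotC => /eqP; rewrite subr_eq0 => /eqP.
  have b0 : 0 <= b by rewrite sqr_ge0.
  (* Close to the minimiser in [t]; [b + 1] in place of [b] allows [S k = 0]. *)
  have := ineq (- c / (b + 1)).
  have -> : - c / (b + 1) * c + (- c / (b + 1)) ^+ 2 / 2 * b =
      - (c ^+ 2 * (b / 2 + 1)) / (b + 1) ^+ 2.
    by field; lra.
  rewrite mulNr oppr_ge0 => h.
  have : c ^+ 2 * (b / 2 + 1) <= 0.
    have b1 : 0 < (b + 1) ^+ 2 by rewrite exprn_gt0//; lra.
    by move: h; rewrite ler_pdivrMr// mul0r.
  rewrite pmulr_lle0; last by lra.
  by move=> h2; apply/eqP; rewrite -sqrf_eq0 eq_le h2 sqr_ge0.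
exists z; split => //; last by exists u.
have [->|z0] := eqVneq z 0; first by rewrite normr0.
have nz : 0 < `|z| by rewrite normr_gt0.
rewrite -(ler_pM2l nz) -expr2 -dotxx mulrC.
have c1 : (fun n => <<S (u n), z>>) @ \oo --> <<z, z>> by exact: cvg_dotl.
have c2 : (fun n => C * `|S (u n)|) @ \oo --> C * `|z|.
  by apply: cvgM; [exact: cvg_cst | exact: cvg_norm].
apply: (ler_cvg_to c1 c2); apply: nearW => n.
by rewrite -zk (le_trans (ler_norm _) (phiC _)).
Qed.

Lemma riesz (phi : X -> R) (C : R) :
  (forall a u v, phi (a *: u + v) = a * phi u + phi v) -> 0 <= C ->
  (forall h, `|phi h| <= C * `|h|) -> exists z, forall h, phi h = <<h, z>>.
Proof.
move=> lphi C0 phiC; have [//|z [zE _ _]] := variational_riesz (S := id) _ lphi C0 phiC.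
by exists z.
Qed.

Lemma bounded_operator_norm (A : X -> X) : bounded_operator A ->
  exists2 M : R, 0 <= M & forall x, `|A x| <= M * `|x|.
Proof.
move=> [linA cA]; pose L : {linear X -> X} := HB.pack A (GRing.isLinear.Build _ _ _ _ _ linA).
have /linear_boundedP[M [Mr hM]] := continuous_linear_bounded 0 (cA 0 : {for 0, continuous L}).
exists (Num.max 0 (M + 1)); first by rewrite le_max lexx.
move=> x; have := hM (M + 1); rewrite ltrDl ltr01 => /(_ isT x) h.
by apply: (le_trans h); apply: ler_wpM2r => //; rewrite le_max lexx orbT.
Qed.

Lemma bounded_operator_of_norm (A : X -> X) (M : R) : linear A ->
  (forall x, `|A x| <= M * `|x|) -> bounded_operator A.
Proof.
move=> linA AM; split => //.
pose L : {linear X -> X} := HB.pack A (GRing.isLinear.Build _ _ _ _ _ linA).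
apply: (@bounded_linear_continuous _ _ _ L).
apply/linear_boundedP; exists `|M|; split; first exact: num_real.
move=> N MN x; apply: (le_trans (AM x)); apply: ler_wpM2r => //.
exact: le_trans (ler_norm _) (ltW MN).
Qed.

(** [adjoint] is a choice; Riesz shows that the set it chooses from is inhabited. *)
Lemma adjointP (A : X -> X) : bounded_operator A ->
  forall x y, <<A x, y>> = <<x, adjoint dotp A y>>.
Proof.
move=> bA x y; have [M M0 AM] := bounded_operator_norm bA; have [linA _] := bA.
suff : exists z, forall x, <<A x, y>> = <<x, z>>.
  by move=> ex; have /(_ x) := xgetPex 0 ex.
apply: (@riesz _ (M * `|y|)).
- by move=> a u v; rewrite linA dotDl dotZl.
- by rewrite mulr_ge0.
- move=> h; apply: (le_trans (cauchy_schwarz _ _)).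
  by rewrite mulrAC ler_wpM2r.
Qed.

Lemma adjoint_linear (A : X -> X) : bounded_operator A -> linear (adjoint dotp A).
Proof.
move=> bA a u v; apply: dot_inj => z.
rewrite dotC -adjointP// dotDr dotZr [RHS]dotDl dotZl.
by rewrite !(dotC (adjoint _ _ _)) -!adjointP.
Qed.

Lemma adjoint_norm (A : X -> X) (M : R) : bounded_operator A ->
  (forall x, `|A x| <= M * `|x|) -> forall x, `|adjoint dotp A x| <= M * `|x|.
Proof.
move=> bA AM x; set y := adjoint dotp A x.
have [->|y0] := eqVneq y 0.
  by rewrite normr0 (le_trans _ (AM x)).
have ny : 0 < `|y| by rewrite normr_gt0.
rewrite -(ler_pM2l ny) -expr2 -dotxx /y -adjointP// -/y.
apply: (le_trans (dot_le _ _)); rewrite mulrA [X in _ <= X * _]mulrC.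
exact: ler_wpM2r.
Qed.

End inner_product.

Section orthonormal.
Context (R : realType) (X : completeNormedModType R).
Variable dotp : {dot X for idfun}.
Hypothesis dotp_norm : is_inner_product dotp.
Local Notation "<< x , y >>" := (dotp x y) (at level 0, format "<< x ,  y >>").

(** By Zorn there is a maximal orthonormal set; a nonzero vector orthogonal to it, once normalised,
    would enlarge it. *)
Lemma orthonormal_basis_exists : exists E, orthonormal_basis dotp E.
Proof.
pose P (E : set X) := (forall e, E e -> <<e, e>> = 1) /\
  (forall e f, E e -> E f -> e <> f -> <<e, f>> = 0).
have [|E [[E1 E2] Emax]] := @Zorn_bigcup X P.
  move=> F FP tF; split; first by move=> e [A /FP[A1 _]] /A1.
  move=> e f [A FA Ae] [B FB Bf]; have [AB|BA] := tF A B FA FB.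
    by have [_ h] := FP _ FB; apply: h => //; exact: AB.
  by have [_ h] := FP _ FA; apply: h => //; exact: BA.
exists E; split => // x xE; apply: contrapT => x0.
have nx : 0 < `|x| by rewrite normr_gt0; apply/eqP.
pose y := `|x|^-1 *: x.
have yE e : E e -> <<y, e>> = 0 by move=> /xE h; rewrite dotZl h mulr0.
have yy : <<y, y>> = 1.
  by rewrite dotZl dotZr (dotxx dotp_norm); field; rewrite gt_eqF.
have nEy : ~ E y by move=> /yE; rewrite yy => /eqP; rewrite oner_eq0.
apply: (Emax (E `|` [set y])).
  split; first by move=> e Ee; left.
  by move=> /(_ y (or_intror erefl)).
split; first by move=> e [/E1//|->].
move=> e f [Ee|->] [Ef|->] ef //; first exact: E2.
- by rewrite dotC yE.
- by rewrite yE.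
Qed.

Hypothesis Xsep : separable X.

(** Distinct basis vectors are at distance sqrt 2, so points of the countable dense set within 1/2
    of them are distinct. *)
Lemma orthonormal_countable (E : set X) : orthonormal_basis dotp E -> countable E.
Proof.
move=> [E1 E2 _]; have [D cD dD] := Xsep.
have sq2 e f : E e -> E f -> e <> f -> `|e - f| ^+ 2 = 2.
  move=> Ee Ef ef; rewrite (normB_sqr dotp_norm) -!(dotxx dotp_norm) E1// E1// E2//; ring.
have /choice[g gE] : forall e : X, exists d : X, D d /\ `|e - d| < 1 / 2.
  move=> e; have : open (ball e (1 / 2 : R)) by exact: ball_open.
  move=> /(dD _ (ex_intro _ e _)) [|d [ed Dd]].
    by apply: ballxx.
  by exists d; split => //; move: ed; rewrite -ball_normE.
have /countable_injP[h hinj] := cD.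
apply/countable_injP; exists (h \o g) => e f /set_mem Ee /set_mem Ef /= ghef.
have gef : g e = g f.
  by apply: hinj => //; rewrite inE; [case: (gE e) | case: (gE f)].
apply: contrapT => ef; have [_ he] := gE e; have [_ hf] := gE f.
have := sq2 _ _ Ee Ef ef.
have : `|e - f| < 1.
  rewrite (_ : e - f = (e - g e) - (f - g f)); last first.
    by rewrite gef opprB addrA subrK.
  by apply: (le_lt_trans (ler_normB _ _)); lra.
move=> h1 h2; have : `|e - f| ^+ 2 < 1 by rewrite expr_lt1.
by rewrite h2; lra.
Qed.

End orthonormal.

(* An orthonormal basis enumerated by [nat]; the unused indices carry [0]. *)
Definition onb_seq (R : realType) (X : completeNormedModType R)
    (dotp : {dot X for idfun}) (e : nat -> X) :=
  [/\ forall i j, i <> j -> dotp (e i) (e j) = 0,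
      forall i, e i = 0 \/ dotp (e i) (e i) = 1 &
      forall x, (forall i, dotp x (e i) = 0) -> x = 0].

Section orthonormal_sequences.
Context (R : realType) (X : completeNormedModType R).
Variable dotp : {dot X for idfun}.
Hypothesis dotp_norm : is_inner_product dotp.
Local Notation "<< x , y >>" := (dotp x y) (at level 0, format "<< x ,  y >>").

(** The sequence enumerates the basis that [trace] itself selects, so its partial sums compare with
    the trace without any change of basis. Indices outside the enumeration take the default 0 of
    [xget] and contribute nothing. *)
Lemma onb_seq_exists : separable X -> exists2 e, onb_seq dotp e &
  forall (Q : X -> X) (C : R), (forall x, 0 <= <<Q x, x>>) ->
    (trace dotp Q <= C%:E)%E -> forall n, \sum_(i < n) <<Q (e i), e i>> <= C.
Proof.
move=> Xsep; pose E := xget set0 (orthonormal_basis dotp).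
have onE : orthonormal_basis dotp E.
  exact: (xgetPex set0 (orthonormal_basis_exists dotp_norm)).
have /countable_injP[h hinj] := orthonormal_countable dotp_norm Xsep onE.
case: (onE) => E1 E2 E3.
pose e n := xget 0 [set x | E x /\ h x = n].
have eP n : (E (e n) /\ h (e n) = n) \/ e n = 0.
  rewrite /e; case: xgetP => [x -> [Ex hx]|_]; [by left | by right].
have eE x : E x -> e (h x) = x.
  move=> Ex; have [Ee he] : [set y | E y /\ h y = h x] (e (h x)).
    by apply: (@xgetPex _ 0 [set y | E y /\ h y = h x]); exists x.
  by apply: hinj => //; rewrite inE.
exists e; first split.
- move=> i j ij; have [[Ei hi]|->] := eP i; last by rewrite dot0l.
  have [[Ej hj]|->] := eP j; last by rewrite dot0r.
  by apply: E2 => // eij; apply: ij; rewrite -hi -hj eij.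
- by move=> i; have [[Ei _]|->] := eP i; [right; exact: E1 | left].
- by move=> x xe; apply: E3 => y Ey; rewrite -(eE y Ey).
move=> Q C Q0 tQ n; rewrite -lee_fin; apply: le_trans tQ; rewrite /trace -/E.
pose P := [set i | E (e i)].
have EP : E = [set e i | i in P].
  apply/seteqP; split => [x Ex|_ [i Pi <-]//].
  by exists (h x); rewrite /P /= eE.
have einj : set_inj P e.
  move=> i j /set_mem Pi /set_mem Pj ij; have e1 x : E x -> x <> 0.
    by move=> /E1 + x0; rewrite x0 dot0l => /eqP; rewrite eq_sym oner_eq0.
  have [[_ <-]|/(e1 _ Pi)//] := eP i; have [[_ <-]|/(e1 _ Pj)//] := eP j.
  by rewrite ij.
rewrite EP (esum_set_image (fun x => (<<Q x, x>>)%:E)) //; last first.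
  by move=> i _; rewrite lee_fin.
apply: le_trans (nneseries_lim_ge n _); last by move=> i _ _; rewrite lee_fin.
rewrite -sumEFin big_mkord [leRHS]big_mkcond/=; apply: lee_sum => i _.
case: ifPn => // /negP iP; have [[Ei _]|->] := eP i; last by rewrite dot0r.
by exfalso; apply: iP; rewrite inE.
Qed.

Variable e : nat -> X.
Hypothesis onb : onb_seq dotp e.

Definition onb_proj n x := \sum_(i < n) <<x, e i>> *: e i.

Lemma onb_dot_proj n x y :
  <<onb_proj n x, y>> = \sum_(i < n) <<x, e i>> * <<y, e i>>.
Proof.
rewrite /onb_proj dot_suml; apply: eq_bigr => i _.
by rewrite dotZl (dotC _ (e i)).
Qed.

Lemma onb_coef x i : <<x, e i>> * <<e i, e i>> = <<x, e i>>.
Proof.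
case: onb => _ + _ => /(_ i) [->|->]; first by rewrite !dot0r mul0r.
by rewrite mulr1.
Qed.

Lemma onb_proj_coef n x j : (j < n)%N -> <<onb_proj n x, e j>> = <<x, e j>>.
Proof.
move=> jn; rewrite onb_dot_proj (bigD1 (Ordinal jn))//= onb_coef big1 ?addr0//.
move=> i ij; case: onb => + _ _ => /(_ j i) ->; first by rewrite mulr0.
by move=> ji; move/eqP: ij; apply; apply: val_inj; rewrite /= ji.
Qed.

Lemma onb_proj_norm n x : `|onb_proj n x| ^+ 2 = \sum_(i < n) <<x, e i>> ^+ 2.
Proof.
rewrite -(dotxx dotp_norm) onb_dot_proj; apply: eq_bigr => i _.
by rewrite onb_proj_coef// expr2.
Qed.

Lemma onb_proj_dist n x :
  `|x - onb_proj n x| ^+ 2 = `|x| ^+ 2 - \sum_(i < n) <<x, e i>> ^+ 2.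
Proof.
rewrite (normB_sqr dotp_norm) onb_proj_norm dotC onb_dot_proj.
under eq_bigr do rewrite -expr2.
ring.
Qed.

Lemma bessel n x : \sum_(i < n) <<x, e i>> ^+ 2 <= `|x| ^+ 2.
Proof. by rewrite -subr_ge0 -onb_proj_dist sqr_ge0. Qed.

(** Bessel makes the projections Cauchy; their limit has the coefficients of [x], hence is [x] by
    totality. *)
Lemma onb_proj_cvg x : onb_proj ^~ x @ \oo --> x.
Proof.
pose s n := \sum_(i < n) <<x, e i>> ^+ 2.
have snd : nondecreasing_seq s.
  apply/nondecreasing_seqP => n; rewrite /s big_ord_recr/= lerDl sqr_ge0//.
have cs : cvgn s.
  apply: nondecreasing_is_cvgn snd _; exists (`|x| ^+ 2) => _ [n _ <-]; exact: bessel.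
have dist m n : (m <= n)%N -> `|onb_proj m x - onb_proj n x| ^+ 2 = s n - s m.
  move=> mn; rewrite (normB_sqr dotp_norm) !onb_proj_norm -/(s m) -/(s n) onb_dot_proj.
  have -> : \sum_(i < m) <<x, e i>> * <<onb_proj n x, e i>> = s m.
    apply: eq_bigr => i _; rewrite onb_proj_coef ?expr2//.
    exact: leq_trans mn.
  ring.
have cp : cvgn (onb_proj ^~ x).
  apply/cauchy_cvgP/cauchy_ballP => r r0; rewrite near_map2.
  have r20 : 0 < r ^+ 2 / 2 by rewrite divr_gt0// exprn_gt0.
  have /cvgrPdist_lt/(_ _ r20)[N _ hN] : s @ \oo --> lim (s @ \oo) by exact: cs.
  exists ([set n | (N <= n)%N], [set n | (N <= n)%N]); first by split; exists N.
  move=> [a b] [/= Na Nb].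
  have ab : `|s b - s a| < r ^+ 2.
    rewrite (_ : s b - s a = (lim (s @ \oo) - s a) - (lim (s @ \oo) - s b)); last by ring.
    apply: (le_lt_trans (ler_normB _ _)); rewrite [ltRHS]splitr.
    by apply: ltrD; exact: hN.
  rewrite -ball_normE /= -ltr_sqr ?nnegrE ?normr_ge0 ?ltW//.
  have [le_ab|/ltnW le_ba] := leqP a b.
    by rewrite dist//; apply: le_lt_trans ab; exact: ler_norm.
  by rewrite distrC dist//; apply: le_lt_trans ab; rewrite distrC ler_norm.
have [y py] : exists y : X, onb_proj ^~ x @ \oo --> y by exists (lim (onb_proj ^~ x @ \oo)).
suff xy : x = y by rewrite -xy in py.
apply/eqP; rewrite -subr_eq0; apply/eqP; case: onb => _ _; apply => j.
rewrite dotBl; apply/eqP; rewrite subr_eq0; apply/eqP.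
have c1 : (fun n => <<onb_proj n x, e j>>) @ \oo --> <<y, e j>>.
  exact: (cvg_dotl dotp_norm).
have c0 : (fun n => <<onb_proj n x, e j>>) @ \oo --> <<x, e j>>.
  by apply: cvg_near_cst; exists j.+1 => // n /= jn; rewrite onb_proj_coef.
exact: (cvg_unique _ c0 c1).
Qed.

Lemma parseval_dot x y :
  (fun n => \sum_(i < n) <<x, e i>> * <<y, e i>>) @ \oo --> <<x, y>>.
Proof.
under eq_fun do rewrite -onb_dot_proj.
by apply: (cvg_dotl dotp_norm); exact: onb_proj_cvg.
Qed.

Lemma parseval x : (fun n => \sum_(i < n) <<x, e i>> ^+ 2) @ \oo --> `|x| ^+ 2.
Proof. by rewrite -(dotxx dotp_norm); exact: parseval_dot. Qed.

End orthonormal_sequences.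

Section linear_functions.
Context (R : pzRingType) (V W : lmodType R) (f : V -> W).
Hypothesis linf : linear f.

Lemma linfD u v : f (u + v) = f u + f v.
Proof. by have := linf 1 u v; rewrite !scale1r. Qed.

Lemma linfB u v : f (u - v) = f u - f v.
Proof.
by have := linf (-1) v u; rewrite !scaleN1r [in LHS]addrC => ->; rewrite addrC.
Qed.

Lemma linf0 : f 0 = 0.
Proof. by have := linfB 0 0; rewrite !subrr. Qed.

Lemma linfZ a u : f (a *: u) = a *: f u.
Proof. by have := linf a u 0; rewrite !addr0 linf0 addr0. Qed.

End linear_functions.

(** * The positive square root of an operator *)

Section square_root.
Context (R : realType) (X : completeNormedModType R).
Variable dotp : {dot X for idfun}.
Hypothesis dotp_norm : is_inner_product dotp.
Local Notation "<< x , y >>" := (dotp x y) (at level 0, format "<< x ,  y >>").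

Section iteration.
Variable P : X -> X.
Hypothesis linP : linear P.
Hypothesis P1 : forall x, `|P x| <= `|x|.
Hypothesis Psym : forall x y, <<P x, y>> = <<x, P y>>.

(* The fixed point T of T = (P + T^2)/2 satisfies (I - T)^2 = I - P; the iterates
   are dominated by those of the scalar equation with P = 1. *)
Fixpoint root_iter n (x : X) : X :=
  if n is m.+1 then 2^-1 *: (P x + root_iter m (root_iter m x)) else 0.

Fixpoint root_bound n : R := if n is m.+1 then (1 + root_bound m ^+ 2) / 2 else 0.

Lemma root_bound01 n : 0 <= root_bound n <= 1.
Proof.
elim: n => [|n /andP[IH0 IH1]] /=; first by rewrite lexx ler01.
by apply/andP; split; nra.
Qed.

Lemma root_bound_nondecreasing n : root_bound n <= root_bound n.+1.
Proof.
elim: n => [|n IH] /=; first by rewrite expr0n/=; lra.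
have /andP[h _] := root_bound01 n.
have : root_bound n ^+ 2 <= root_bound n.+1 ^+ 2.
  by rewrite ler_sqr ?nnegrE// (le_trans h IH).
by rewrite /=; lra.
Qed.

Lemma root_iter_linear n : linear (root_iter n).
Proof.
elim: n => [|n IH] a u v /=; first by rewrite scaler0 addr0.
rewrite linP !IH addrACA -scalerDr [LHS]scalerDr.
by congr (_ + _); rewrite !scalerA mulrC.
Qed.

Lemma root_iter_norm n x : `|root_iter n x| <= root_bound n * `|x|.
Proof.
elim: n x => [|n IH] x /=; first by rewrite normr0 mul0r.
rewrite normrZ ger0_norm ?invr_ge0// mulrC mulrAC ler_wpM2r ?invr_ge0//.
rewrite (le_trans (ler_normD _ _))// mulrDl mul1r lerD// (le_trans (IH _))//.
by rewrite expr2 -mulrA ler_wpM2l//; case/andP: (root_bound01 n).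
Qed.

(** With T_n the n-th iterate, [T_(n+2) - T_(n+1)] is half of [T_(n+1) (T_(n+1) - T_n) + (T_(n+1) -
    T_n) T_n]; the scalar iterates factor in the same way and dominate term by term. *)
Lemma root_iter_step n x :
  `|root_iter n.+1 x - root_iter n x| <= (root_bound n.+1 - root_bound n) * `|x|.
Proof.
elim: n x => [|n IH] x.
  by rewrite /= subr0 addr0 normrZ ger0_norm ?invr_ge0// expr0n/= addr0 subr0 mul1r ler_wpM2l ?invr_ge0.
have linT := root_iter_linear.
have subT m u v : root_iter m (u - v) = root_iter m u - root_iter m v.
  exact: linfB (linT m) u v.
have -> : root_iter n.+2 x - root_iter n.+1 x = 2^-1 *:
    (root_iter n.+1 (root_iter n.+1 x - root_iter n x) +
     (root_iter n.+1 (root_iter n x) - root_iter n (root_iter n x))).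
  rewrite subT addrA subrK -[root_iter n.+2 x]/(2^-1 *: (P x + root_iter n.+1 (root_iter n.+1 x))).
  rewrite -[X in _ - X]/(2^-1 *: (P x + root_iter n (root_iter n x))).
  by rewrite -scalerBr opprD addrACA subrr add0r.
rewrite normrZ ger0_norm ?invr_ge0// [leRHS](_ : _ = 2^-1 *
   (root_bound n.+1 * ((root_bound n.+1 - root_bound n) * `|x|) +
    (root_bound n.+1 - root_bound n) * (root_bound n * `|x|))); last first.
  rewrite -[root_bound n.+2]/((1 + root_bound n.+1 ^+ 2) / 2).
  rewrite -[X in (_ - X) * `|x| = _]/((1 + root_bound n ^+ 2) / 2).
  by field.
rewrite ler_wpM2l ?invr_ge0// (le_trans (ler_normD _ _))// lerD//.
  rewrite (le_trans (root_iter_norm _ _))// ler_wpM2l//.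
  by case/andP: (root_bound01 n.+1).
rewrite (le_trans (IH _))// ler_wpM2l//.
  by rewrite subr_ge0 root_bound_nondecreasing.
exact: root_iter_norm.
Qed.

Lemma root_iter_dist m n x : (m <= n)%N ->
  `|root_iter n x - root_iter m x| <= (root_bound n - root_bound m) * `|x|.
Proof.
move=> /subnK <-; elim: (n - m)%N => [|k IH]; first by rewrite !subrr normr0 mul0r.
rewrite (_ : _ - _ = (root_iter (k + m).+1 x - root_iter (k + m) x) +
  (root_iter (k + m) x - root_iter m x)); last by rewrite addrA subrK.
rewrite (le_trans (ler_normD _ _))//.
rewrite (_ : _ - _ = (root_bound (k + m).+1 - root_bound (k + m)) +
  (root_bound (k + m) - root_bound m)); last by ring.
by rewrite mulrDl lerD// root_iter_step.
Qed.

Lemma root_iter_sym n x y : <<root_iter n x, y>> = <<x, root_iter n y>>.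
Proof.
elim: n x y => [|n IH] x y /=; first by rewrite dot0l dot0r.
by rewrite dotZl dotZr dotDl dotDr Psym !IH.
Qed.

Lemma root_fixpoint : exists T : X -> X,
  [/\ linear T, forall x, `|T x| <= `|x|, forall x y, <<T x, y>> = <<x, T y>> &
      forall x, T x = 2^-1 *: (P x + T (T x))].
Proof.
have cb : cvgn root_bound.
  apply: nondecreasing_is_cvgn.
    by apply/nondecreasing_seqP; exact: root_bound_nondecreasing.
  by exists 1 => _ [n _ <-]; case/andP: (root_bound01 n).
have cT x : cvgn (root_iter ^~ x).
  apply/cauchy_cvgP/cauchy_ballP => r r0; rewrite near_map2.
  have r20 : 0 < r / 2 / (`|x| + 1) by rewrite !divr_gt0// ltr_pwDr.
  have /cvgrPdist_lt/(_ _ r20)[N _ hN] : root_bound @ \oo --> lim (root_bound @ \oo) by exact: cb.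
  exists ([set n | (N <= n)%N], [set n | (N <= n)%N]); first by split; exists N.
  move=> [a b] [/= Na Nb].
  have ab : `|root_bound b - root_bound a| * `|x| < r.
    have h : `|root_bound b - root_bound a| <= r / (`|x| + 1).
      rewrite (_ : root_bound b - root_bound a = (lim (root_bound @ \oo) - root_bound a)
        - (lim (root_bound @ \oo) - root_bound b)); last by ring.
      apply: (le_trans (ler_normB _ _)); rewrite [leRHS](_ : _ = r / 2 / (`|x| + 1) + r / 2 / (`|x| + 1)).
        by apply: lerD; apply: ltW; exact: hN.
      by field; rewrite gt_eqF// ltr_pwDr.
    apply: (le_lt_trans (ler_wpM2r (normr_ge0 x) h)).
    by rewrite mulrAC ltr_pdivrMr ?ltr_pwDr// ltr_pM2l// ltrDl.
  rewrite -ball_normE /=.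
  have [le_ab|/ltnW le_ba] := leqP a b.
    rewrite distrC; apply: (le_lt_trans (root_iter_dist x le_ab)).
    by apply: le_lt_trans ab; rewrite ler_wpM2r// ler_norm.
  apply: (le_lt_trans (root_iter_dist x le_ba)).
  by apply: le_lt_trans ab; rewrite ler_wpM2r// distrC ler_norm.
pose T x := lim (root_iter ^~ x @ \oo).
have TT x : (root_iter ^~ x) @ \oo --> T x by exact: cT.
have linT : linear T.
  move=> a u v.
  have c1 : (fun n => root_iter n (a *: u + v)) @ \oo --> a *: T u + T v.
    under eq_fun do rewrite root_iter_linear.
    by apply: cvgD; [apply: cvgZr; exact: TT | exact: TT].
  exact: (cvg_unique _ (TT _) c1).
have T1 n x : `|root_iter n x| <= `|x|.
  rewrite (le_trans (root_iter_norm _ _))// ler_piMl//.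
  by case/andP: (root_bound01 n).
exists T; split => //.
- move=> x; have c : (fun n => `|root_iter n x|) @ \oo --> `|T x| by apply: cvg_norm; exact: TT.
  by apply: (cvgr_to_le c); apply: nearW => n; exact: T1.
- move=> x y; have c1 : (fun n => <<root_iter n x, y>>) @ \oo --> <<T x, y>>.
    by apply: (cvg_dotl dotp_norm); exact: TT.
  have c2 : (fun n => <<root_iter n x, y>>) @ \oo --> <<x, T y>>.
    under eq_fun do rewrite root_iter_sym dotC.
    by rewrite dotC; apply: (cvg_dotl dotp_norm); exact: TT.
  exact: (cvg_unique _ c1 c2).
- move=> x.
  have c1 : (fun n => root_iter n.+1 x) @ \oo --> T x.
    by have := TT x; rewrite -(cvg_shiftS (root_iter ^~ x)).
  have c2 : (fun n => root_iter n (root_iter n x)) @ \oo --> T (T x).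
    (* The iterates are contractions, so the inner argument may be replaced by its limit. *)
    have c3 : (fun n => root_iter n (root_iter n x - T x)) @ \oo --> (0 : X).
      apply/norm_cvg0P.
      apply: (@squeeze_cvgr _ _ _ _ (fun=> 0) (fun n => `|root_iter n x - T x|)).
      - by apply: nearW => n; rewrite normr_ge0 T1.
      - exact: cvg_cst.
      - by apply/norm_cvg0P/subr_cvg0; exact: TT.
    rewrite -[X in _ --> X]add0r.
    rewrite (_ : (fun n => _) = (fun n => root_iter n (root_iter n x - T x) + root_iter n (T x))).
      by apply: cvgD; [exact: c3 | exact: TT].
    apply/funext => n; have := root_iter_linear n 1 (root_iter n x - T x) (T x).
    by rewrite !scale1r subrK.
  have c4 : (fun n => root_iter n.+1 x) @ \oo --> 2^-1 *: (P x + T (T x)).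
    by apply: cvgZr; apply: cvgD; [exact: cvg_cst | exact: c2].
  exact: (cvg_unique _ c1 c4).
Qed.

End iteration.

Lemma nonneg_root_exists (Q : X -> X) : bounded_operator Q ->
  (forall x y, <<Q x, y>> = <<x, Q y>>) -> (forall x, 0 <= <<Q x, x>>) ->
  exists S, nonneg_root dotp Q S.
Proof.
move=> bQ Qsym Q0; have [linQ _] := bQ; have [M M0 QM] := bounded_operator_norm bQ.
(* Rescaling to [q = Q / c], which is at most the identity; then [P = I - q] is a contraction and
   [sqrt c (I - T)] is the root, with [T] the fixed point for [P]. *)
pose c := M + 1; have c0 : 0 < c by rewrite /c; lra.
pose q x := c^-1 *: Q x.
have q0 x : 0 <= <<q x, x>> by rewrite /q dotZl mulr_ge0// invr_ge0 ltW.
have qsym x y : <<q x, y>> = <<x, q y>> by rewrite /q dotZl dotZr Qsym.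
have q1 x : `|q x| <= `|x|.
  have ci : 0 <= c^-1 by rewrite invr_ge0 ltW.
  rewrite /q normrZ (ger0_norm ci) mulrC ler_pdivrMr// mulrC.
  by apply: (le_trans (QM x)); rewrite ler_wpM2r// /c; lra.
have linq : linear q.
  by move=> a u v; rewrite /q linQ scalerDr scalerA mulrC -scalerA.
(* Positivity of [q] at [x - q x], together with [|q x| <= |x|]. *)
have qq x : `|q x| ^+ 2 <= <<q x, x>>.
  have := q0 (x - q x).
  rewrite (linfB linq).
  rewrite dotBl !dotBr (qsym (q x) x) (dotxx dotp_norm).
  have h1 : <<q (q x), q x>> <= `|q x| ^+ 2.
    by apply: (le_trans (dot_le dotp_norm _ _)); rewrite expr2 ler_wpM2r.
  lra.
pose P x := x - q x.
have [|||T [linT T1 Tsym TE]] := @root_fixpoint P.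
- move=> a u v; rewrite /P linq scalerBr opprD addrACA //.
- move=> x; rewrite -ler_sqr ?nnegrE// /P (normB_sqr dotp_norm) (dotC _ x).
  by have := qq x; have := q0 x; have := sqr_ge0 `|q x|; lra.
- by move=> x y; rewrite /P dotBl dotBr qsym.
pose S x := Num.sqrt c *: (x - T x).
have linS : linear S.
  move=> a u v; rewrite /S linT opprD addrACA -scalerBr scalerDr.
  by rewrite !scalerA mulrC.
exists S; split.
- apply: (@bounded_operator_of_norm _ _ _ (Num.sqrt c * 2)) linS _ => x.
  rewrite /S normrZ ger0_norm ?sqrtr_ge0// -mulrA ler_wpM2l ?sqrtr_ge0//.
  by rewrite (le_trans (ler_normB _ _))//; have := T1 x; lra.
- by move=> x y; rewrite /S dotZl dotZr dotBl dotBr Tsym.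
- move=> x; rewrite /S dotZl mulr_ge0 ?sqrtr_ge0// dotBl (dotxx dotp_norm) subr_ge0.
  by rewrite (le_trans (dot_le dotp_norm _ _))// expr2 ler_wpM2r.
- move=> x; rewrite /S; rewrite (linfZ linT) (linfB linT) -scalerBr scalerA -expr2 sqr_sqrtr ?ltW//.
  have -> : x - T x - (T x - T (T x)) = q x.
    have := TE x; move/(congr1 (fun z => 2 *: z)); rewrite scalerA divff// scale1r.
    rewrite scaler_nat mulr2n => e.
    by rewrite opprB addrACA -opprD e /P opprD addrACA subrr addr0 opprB addrC subrK.
  by rewrite /q scalerA divff ?gt_eqF// scale1r.
Qed.

End square_root.

(** * Gaussian measures *)

Section normal_random_variables.
Context d (T : measurableType d) (R : realType) (P : probability T R).
Variables (Y : T -> R) (m v : R).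
Hypothesis mY : measurable_fun [set: T] Y.
Hypothesis v0 : 0 <= v.
Hypothesis PY : forall A : set (measurableTypeR R), measurable A ->
  P (Y @^-1` A) = normal_law m v A.

Let Q1 : probability (measurableTypeR R) R := law (T' := measurableTypeR R) P mY.

Let Q2 : probability (measurableTypeR R) R :=
  law (T := measurableTypeR R) (T' := measurableTypeR R) (@gauss1 R)
    (measurable_scale m (Num.sqrt v)).

Let Q12 (A : set (measurableTypeR R)) : measurable A -> Q1 A = Q2 A.
Proof. by move=> mA; rewrite [LHS]PY// normal_lawE. Qed.

Lemma ge0_integral_normal (f : R -> \bar R) : measurable_fun [set: R] f ->
  (forall y, 0 <= f y)%E ->
  (\int[P]_x f (Y x) = \int[@gauss1 R]_y f (m + Num.sqrt v * y)%R)%E.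
Proof.
move=> mf f0.
transitivity (\int[Q1]_y f y)%E; first by rewrite ge0_integral_distribution.
transitivity (\int[Q2]_y f y)%E.
  by apply: eq_measure_integral => A mA _; exact: Q12.
by rewrite ge0_integral_distribution.
Qed.

Lemma expect_normal (f : R -> R) : bmf f ->
  \int[P]_x f (Y x) = \int[@gauss1 R]_y f (m + Num.sqrt v * y).
Proof.
move=> bf; transitivity (\int[Q1]_y f y); first by rewrite expect_law.
transitivity (\int[Q2]_y f y); last by rewrite expect_law.
by rewrite /Rintegral; congr fine; apply: eq_measure_integral => A mA _; exact: Q12.
Qed.

Lemma expect_normal_cos : \int[P]_x cos (Y x) = cos m * expR (- v / 2).
Proof. by rewrite expect_normal ?expect_scale_cos//; apply: bmf_cos. Qed.

Lemma expect_normal_sin : \int[P]_x sin (Y x) = sin m * expR (- v / 2).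
Proof. by rewrite expect_normal ?expect_scale_sin//; apply: bmf_sin. Qed.

End normal_random_variables.

Section borel_hilbert.
Context (R : realType) (X : completeNormedModType R).
Variable dotp : {dot X for idfun}.
Hypothesis dotp_norm : is_inner_product dotp.
Hypothesis Xsep : separable X.
Local Notation "<< x , y >>" := (dotp x y) (at level 0, format "<< x ,  y >>").

Lemma measurable_dot (h : X) : measurable_fun [set: borel X] (fun x : borel X => <<x, h>>).
Proof.
apply: (measurability (@RGenOInfty.G R)); first exact: RGenOInfty.measurableE.
move=> _ [_ [y ->] <-]; rewrite setTI; apply: sub_sigma_algebra.
apply: open_comp; last exact: interval_open.
by move=> x _; exact: (continuous_dotl dotp_norm).
Qed.

(** Parseval makes [|x - a|^2] a limit of polynomials in the linear forms, so balls belong to the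
    sigma-algebra of these forms, and in a separable space an open set is a countable union of
    balls. *)
Lemma borel_generated (E : set (borel X)) : measurable E ->
  <<s [set [set x : borel X | c.2 < <<x, c.1>>] | c in [set: X * R] ]>> E.
Proof.
set G := [set [set x : borel X | c.2 < <<x, c.1>>] | c in [set: X * R] ].
have [e onb _] := onb_seq_exists dotp_norm Xsep.
have md (h : X) : measurable_fun [set: g_sigma_algebraType G]
    (fun x : g_sigma_algebraType G => dotp (x : X) h).
  apply: (measurability (@RGenOInfty.G R)); first exact: RGenOInfty.measurableE.
  move=> _ [_ [y ->] <-]; rewrite setTI; apply: sub_sigma_algebra.
  exists (h, y) => //=.
  by apply/seteqP; split => x /=; rewrite in_itv/= andbT.
have mdist (a : X) : measurable_fun [set: g_sigma_algebraType G]
    (fun x : g_sigma_algebraType G => `|(x : X) - a| ^+ 2).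
  apply: (measurable_fun_cvg (h := fun n (x : g_sigma_algebraType G) =>
    \sum_(i < n) (dotp ((x : X) - a) (e i)) ^+ 2)).
    move=> n; apply: measurable_sum => i; apply: measurable_funX.
    under eq_fun do rewrite dotBl.
    by apply: measurable_funB.
  by move=> x _; exact: (parseval dotp_norm onb).
have mball (a : X) (r : R) : <<s G >> (ball a r).
  have [r0|r0] := leP r 0.
    rewrite (_ : ball a r = set0); first exact: (@measurable0 _ (g_sigma_algebraType G)).
    apply/seteqP; split => // x; rewrite -ball_normE /= => h.
    by have := le_lt_trans (normr_ge0 _) h; rewrite ltNge r0.
  have := mdist a measurableT [set` `]-oo, r ^+ 2[ ] (measurable_itv _); rewrite setTI.
  congr (<<s _ >> _); apply/seteqP; split => x /=; rewrite -ball_normE /= in_itv/= distrC.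
    by rewrite ltr_sqr ?nnegrE// ltW.
  by rewrite ltr_sqr ?nnegrE// ltW.
move: E; apply: smallest_sub; first exact: smallest_sigma_algebra.
move=> O oO; have [D /countable_injP[g ginj] dD] := Xsep.
(* Balls are indexed by a pair of integers: the code [g a] of a centre in the dense set, and [k] for
   the radius [1/(k+1)]; [xget] decodes the centre. *)
pose O' := \bigcup_(ik in [set ik : nat * nat | exists a : X,
  [/\ D a, g a = ik.1 & ball a ik.2.+1%:R^-1 `<=` O]])
  ball (xget (0 : X) [set a | [/\ D a, g a = ik.1 & ball a ik.2.+1%:R^-1 `<=` O]])
    (ik.2.+1%:R^-1 : R).
suff -> : O = O'.
  rewrite /O' bigcup_mkcond.
  apply: (@countable_bigcupT_measurable _ (g_sigma_algebraType G)) => // ik.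
  case: ifP => _; first exact: mball.
  exact: (@measurable0 _ (g_sigma_algebraType G)).
apply/seteqP; split => x; last first.
  move=> [ik ex]; have [_ _ sub] := xgetPex (0 : X) ex.
  by exact: sub.
move=> Ox; have /nbhs_ballP[r /= r0 xrO] := open_nbhs_nbhs (conj oO Ox).
have r20 : 0 < r / 2 by rewrite divr_gt0.
have /cvgr0_norm_lt/(_ _ r20)[k _ /(_ k (leqnn k))] := @cvg_harmonic R.
rewrite ger0_norm; last by rewrite invr_ge0.
rewrite /harmonic/= => kr.
have k0 : 0 < k.+1%:R^-1 :> R by rewrite invr_gt0.
have [a [xa Da]] := dD _ (ex_intro _ x (ballxx x k0)) (ball_open (x : X) k.+1%:R^-1).
have sub : ball a k.+1%:R^-1 `<=` O.
  move=> y ay; apply: xrO; apply: (@le_ball _ _ _ (k.+1%:R^-1 + k.+1%:R^-1)).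
    by rewrite [leRHS]splitr; apply: lerD; exact: ltW.
  by apply: ball_triangle xa ay.
have ex : exists a : X, [/\ D a, g a = (g a, k).1 & ball a (g a, k).2.+1%:R^-1 `<=` O].
  by exists a.
have ex' : exists b : X, [/\ D b, g b = (g a, k).1 & ball b (g a, k).2.+1%:R^-1 `<=` O].
  by exists a.
exists (g a, k) => //.
have [Db gb _] := xgetPex (0 : X) ex'.
suff -> : xget (0 : X) [set b | [/\ D b, g b = (g a, k).1 & ball b (g a, k).2.+1%:R^-1 `<=` O]] = a.
  by apply: ball_sym.
by apply: ginj => //; rewrite inE.
Qed.

Lemma measurable_to_borel d (T : measurableType d) (f : T -> X) :
  (forall h, measurable_fun [set: T] (fun x => <<f x, h>>)) ->
  measurable_fun [set: T] (f : T -> borel X).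
Proof.
move=> mf; apply: (measurability
  [set [set x : borel X | c.2 < <<x, c.1>>] | c in [set: X * R] ]).
  apply/seteqP; split; first by move=> E; exact: borel_generated.
  move=> E; apply: smallest_sub; first exact: smallest_sigma_algebra.
  move=> _ [[h c] _ <-] /=.
  have := @measurable_dot h measurableT [set` `]c, +oo[ ] (measurable_itv _).
  rewrite setTI; congr (measurable _).
  by apply/seteqP; split => x /=; rewrite in_itv/= andbT.
move=> _ [_ [[h c] _ <-] <-] /=; rewrite setTI.
have := mf h measurableT [set` `]c, +oo[ ] (measurable_itv _).
rewrite setTI; congr (measurable _).
by apply/seteqP; split => x /=; rewrite in_itv/= andbT.
Qed.

Lemma borel_unique (P Q : probability (borel X) R) :
  (forall h, \int[P]_x cos (dotp x h) = \int[Q]_x cos (dotp x h)) ->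
  (forall h, \int[P]_x sin (dotp x h) = \int[Q]_x sin (dotp x h)) ->
  forall E, measurable E -> P E = Q E.
Proof.
move=> hc hs.
apply: (@trig_unique _ (borel X) R X (fun h x => <<x, h>>)) => //.
- exact: measurable_dot.
- by move=> a u v x; rewrite dotDr dotZr.
- exact: borel_generated.
Qed.

Lemma expect_eq_measure d (T : measurableType d) (P Q : probability T R) (f : T -> R) :
  (forall E, measurable E -> P E = Q E) -> \int[P]_x f x = \int[Q]_x f x.
Proof.
by move=> PQ; rewrite /Rintegral; congr fine; apply: eq_measure_integral => E mE _; exact: PQ.
Qed.

Section gaussian_measures.
Variables (a : X) (Q : X -> X).
Hypothesis linQ : linear Q.
Hypothesis Q0 : forall h, 0 <= <<Q h, h>>.

Lemma gaussian_cos (mu : probability (borel X) R) : is_gaussian dotp a Q mu ->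
  forall h, \int[mu]_x cos (dotp x h) = cos <<a, h>> * expR (- <<Q h, h>> / 2).
Proof.
by move=> gm h; apply: expect_normal_cos; [exact: measurable_dot | exact: Q0 | exact: gm].
Qed.

Lemma gaussian_sin (mu : probability (borel X) R) : is_gaussian dotp a Q mu ->
  forall h, \int[mu]_x sin (dotp x h) = sin <<a, h>> * expR (- <<Q h, h>> / 2).
Proof.
by move=> gm h; apply: expect_normal_sin; [exact: measurable_dot | exact: Q0 | exact: gm].
Qed.

(** [is_gaussian] constrains one-dimensional marginals, and the values at the multiples [c h] are
    the characteristic function of the marginal along [h]. *)
Lemma is_gaussian_of_cf (mu : probability (borel X) R) :
  (forall h, \int[mu]_x cos (dotp x h) = cos <<a, h>> * expR (- <<Q h, h>> / 2)) ->
  (forall h, \int[mu]_x sin (dotp x h) = sin <<a, h>> * expR (- <<Q h, h>> / 2)) ->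
  is_gaussian dotp a Q mu.
Proof.
move=> hc hs h A mA.
pose P1 : probability (measurableTypeR R) R :=
  law (T' := measurableTypeR R) mu (measurable_dot h).
have Qh c : <<Q (c *: h), c *: h>> = c ^+ 2 * <<Q h, h>>.
  by rewrite (linfZ linQ) dotZl dotZr mulrA expr2.
suff hP : forall E, measurable E -> P1 E = normal_law <<a, h>> <<Q h, h>> E by exact: hP.
apply: normal_law_unique => // c.
- rewrite expect_law; last by apply: bmf_cos; exact: measurable_funM.
  rewrite -Qh -dotZr -hc; apply: eq_Rintegral => x _; by rewrite dotZr.
- rewrite expect_law; last by apply: bmf_sin; exact: measurable_funM.
  rewrite -Qh -dotZr -hs; apply: eq_Rintegral => x _; by rewrite dotZr.
Qed.

Lemma gaussian_unique (mu nu : probability (borel X) R) :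
  is_gaussian dotp a Q mu -> is_gaussian dotp a Q nu ->
  forall E, measurable E -> mu E = nu E.
Proof.
by move=> gm gn; apply: borel_unique => h; rewrite !(gaussian_cos, gaussian_sin).
Qed.

End gaussian_measures.

End borel_hilbert.

(** * Existence of Gaussian measures *)

Section doubling_map.
Context (R : realType).

Definition unif : probability (measurableTypeR R) R := uniform_prob (@ltr01 R).

Local Notation leb := (@lebesgue_measure R).
Implicit Types h f : R -> R.

Lemma unif_expect f : bmf f ->
  \int[unif]_x f x = fine (\int[leb]_(x in `[0%R, 1%R]) (f x)%:E)%E.
Proof.
move=> [mf _]; rewrite /Rintegral; congr fine.
rewrite (@integral_density _ _ _ leb unif (uniform_pdf 0 1))//.
- rewrite [RHS]integral_mkcond; apply: eq_integral => x _.
  rewrite patchE mem_setE /uniform_pdf subr0 invr1.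
  by rewrite in_itv/=; case: ifP => _; rewrite ?mulr1 ?mulr0.
- exact: measurable_uniform_pdf.
- by move=> x; apply: uniform_pdf_ge0; exact: ltr01.
Qed.

Lemma integral_half h (b : R) : continuous h ->
  (\int[leb]_(x in `[(b / 2)%R, ((b + 1) / 2)%R]) (h (2 * x - b)%R)%:E =
   2^-1%:E * \int[leb]_(x in `[0%R, 1%R]) (h x)%:E)%E.
Proof.
move=> ch; pose F (x : R) : R := 2 * x - b.
have dF (x : R) : is_derive x (1 : R) F 2.
  by apply: is_derive_eq; rewrite /GRing.scale/=; ring.
have F'E : F^`()%classic = cst 2 by apply/funext => x; rewrite derive1E; have [_ ->] := dF x.
have cF : continuous F.
  by move=> x; apply: differentiable_continuous; apply/derivable1_diffP; have [] := dF x.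
have F0 : F (b / 2) = 0 by rewrite /F; field.
have F1 : F ((b + 1) / 2) = 1 by rewrite /F; field.
have ab : b / 2 <= (b + 1) / 2 by lra.
have /= := @integration_by_substitution_increasing R F h _ _ ab.
rewrite F0 F1 => ->; last 6 first.
- by move=> x y _ _ xy; rewrite /F; lra.
- by rewrite F'E => x _; exact: cvg_cst.
- by rewrite F'E; exact: is_cvg_cst.
- by rewrite F'E; exact: is_cvg_cst.
- split; first by move=> x _; have [] := dF x.
    by apply: cvg_at_right_filter; exact: cF.
  by apply: cvg_at_left_filter; exact: cF.
- exact: continuous_subspaceT.
rewrite -integralZl//; last first.
  apply: continuous_compact_integrable; first exact: segment_compact.
  apply: continuous_subspaceT => x; rewrite F'E.
  apply: cvgM; last exact: cvg_cst.
  by apply: (continuous_comp (f := F)); [exact: cF | exact: ch].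
by apply: eq_integral => x _; rewrite -EFinM; congr (_%:E); rewrite F'E /F !fctE/=; field.
Qed.

(** [h0] and [h1] are read on the two halves of the unit interval, each stretched to full length;
    [glue id id] is the doubling map. *)
Definition glue (h0 h1 : R -> R) (x : R) : R :=
  if x < 2^-1 then h0 (2 * x) else h1 (2 * x - 1).

Lemma measurable_doubling (b : R) : measurable_fun [set: R] (fun x => 2 * x - b).
Proof. by apply: measurable_funB => //; exact: measurable_funM. Qed.

Lemma bmf_glue h0 h1 : bmf h0 -> bmf h1 -> bmf (glue h0 h1).
Proof.
move=> [m0 [M0 H0]] [m1 [M1 H1]]; split.
  apply: measurable_fun_ifT.
  - by apply: measurable_fun_ltr.
  - apply: (measurableT_comp m0).
    by have := measurable_doubling 0; under eq_fun do rewrite subr0.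
  - by apply: (measurableT_comp m1); exact: measurable_doubling.
exists (Num.max M0 M1) => x; rewrite /glue le_max.
by case: ifP => _; rewrite ?H0 ?H1 ?orbT.
Qed.

Lemma unif_glue_continuous h0 h1 : continuous h0 -> continuous h1 ->
  bmf h0 -> bmf h1 ->
  \int[unif]_x glue h0 h1 x = (\int[unif]_x h0 x + \int[unif]_x h1 x) / 2.
Proof.
move=> c0 c1 b0 b1.
have bg := bmf_glue b0 b1.
have fin0 h : bmf h -> (\int[leb]_(x in `[0%R, 1%R]) (h x)%:E)%E \is a fin_num.
  move=> [mh [M hM]]; apply: integrable_fin_num => //.
  apply: measurable_bounded_integrable => //.
  - have h01 : leb `[0%R, 1%R] = 1%E.
      by rewrite lebesgue_measure_itv/= lte_fin ltr01 oppr0 adde0.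
    by apply: (eq_ind_r (fun z => (z < +oo)%E) _ h01); rewrite ltry.
  - exact: measurable_funTS.
  - exists M; split; first exact: num_real.
    by move=> y My x _; apply: le_trans (hM x) _; exact: ltW.
rewrite !unif_expect//.
have -> : (\int[leb]_(x in `[0%R, 1%R]) (glue h0 h1 x)%:E =
    \int[leb]_(x in `[0%R, (2^-1)%R[) (glue h0 h1 x)%:E +
    \int[leb]_(x in `[(2^-1)%R, 1%R]) (glue h0 h1 x)%:E)%E.
  have -> : `[0%R, 1%R]%classic = `[0%R, 2^-1[%classic `|` `[2^-1, 1%R]%classic :> set R.
    by rewrite -itv_bndbnd_setU ?bnd_simp//; lra.
  rewrite integral_setU_EFin//.
  by apply: measurable_funTS; case: bg.
  apply/disj_setPS => x [] /=; rewrite !in_itv/= => /andP[_ h] /andP[h' _].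
  by move: h; rewrite ltNge h'.
have -> : (\int[leb]_(x in `[0%R, (2^-1)%R[) (glue h0 h1 x)%:E =
    2^-1%:E * \int[leb]_(x in `[0%R, 1%R]) (h0 x)%:E)%E.
  rewrite -(integral_half 0 c0) mul0r add0r div1r.
  rewrite -[RHS]integral_itv_bndo_bndc; last first.
    apply/measurable_EFinP; apply: measurable_funTS.
    by apply: (measurableT_comp (proj1 b0)); exact: measurable_doubling.
  apply: eq_integral => x; rewrite inE/= in_itv/= => /andP[_ x2].
  by rewrite /glue x2 subr0.
have -> : (\int[leb]_(x in `[(2^-1)%R, 1%R]) (glue h0 h1 x)%:E =
    2^-1%:E * \int[leb]_(x in `[0%R, 1%R]) (h1 x)%:E)%E.
  rewrite -(integral_half 1 c1) div1r (_ : (1 + 1) / 2 = 1 :> R); last by field.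
  apply: eq_integral => x; rewrite inE/= in_itv/= => /andP[x2 _].
  by rewrite /glue ltNge x2.
by rewrite fineD ?fin_numM ?fin0// !fineM ?fin0//= -mulrDr mulrC.
Qed.

Lemma continuous_real_trig (s : seq (R * R * R^o)) :
  continuous (trig (fun (a : R^o) (x : R) => a * x) s).
Proof.
elim: s => [|[[a b] v] s IH] x.
  rewrite (_ : trig _ _ = fun=> 0); first exact: cvg_cst.
  by apply/funext => y; rewrite /trig big_nil.
rewrite (_ : trig _ _ = fun y => a * cos (v * y) + b * sin (v * y) +
  trig (fun (a : R^o) (x : R) => a * x) s y); last by apply/funext => y; exact: trig_cons.
have cm : {for x, continuous (fun x : R => v * x)}.
  by apply: cvgM; [exact: cvg_cst | exact: cvg_id].
apply: cvgD; last exact: IH.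
apply: cvgD; (apply: cvgM; first exact: cvg_cst).
  by apply: continuous_comp cm _; exact: continuous_cos.
by apply: continuous_comp cm _; exact: continuous_sin.
Qed.

Lemma unif_glue h0 h1 : bmf h0 -> bmf h1 ->
  \int[unif]_x glue h0 h1 x = (\int[unif]_x h0 x + \int[unif]_x h1 x) / 2.
Proof.
have step (k0 k1 : R -> R) : measurable_fun [set: R] k0 -> measurable_fun [set: R] k1 ->
    (forall x, 0 <= k0 x <= 1) -> (forall x, 0 <= k1 x <= 1) ->
    \int[unif]_x glue k0 k1 x = (\int[unif]_x k0 x + \int[unif]_x k1 x) / 2.
  move=> m0 m1 k001 k101.
  have bk (k : R -> R) : measurable_fun [set: R] k -> (forall x, 0 <= k x <= 1) -> bmf k.
    by move=> mk k01; split => //; exists 1 => x; rewrite ger0_norm; case/andP: (k01 x).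
  have b0 := bk _ m0 k001; have b1 := bk _ m1 k101.
  pose T x : R := glue id id x.
  have mT : measurable_fun [set: R] T.
    apply: measurable_fun_ifT; first exact: measurable_fun_ltr.
      by have := measurable_doubling 0; under eq_fun do rewrite subr0.
    exact: measurable_doubling.
  (* Invariance of the uniform law under doubling is a case of what is being proved, so closeness
     after [T] does not follow from closeness before it: the approximation is made for [unif] and
     for its image [Q] together. *)
  pose Q : probability (measurableTypeR R) R :=
    law (T := measurableTypeR R) (T' := measurableTypeR R) unif mT.
  have approx (k : R -> R) : measurable_fun [set: R] k -> (forall x, 0 <= k x <= 1) ->
    forall e : R, 0 < e -> exists s : R -> R, [/\ continuous s, bmf s,
      \int[unif]_x `|s x - k x| < e & \int[unif]_x `|s (T x) - k (T x)| < e].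
    move=> mk k01 e e0.
    have [|||s [s01 hs1 hs2]] := @trig_dense _ (measurableTypeR R) R R^o (fun a x => a * x)
      _ _ _ unif Q k mk k01 e e0.
    - by move=> v; exact: measurable_funM.
    - by move=> a u v x /=; rewrite mulrDl mulrA.
    - exact: real_line_generated.
    have bs : bmf (trig (fun (a : R^o) (x : measurableTypeR R) => a * x) s).
      by apply: bmf_trig => v; exact: measurable_funM.
    exists (trig (fun (a : R^o) x => a * x) s); split => //.
      exact: continuous_real_trig.
    move: hs2; rewrite (@expect_law _ _ (measurableTypeR R)); last first.
      by apply: bmf_norm; apply: bmfB => //; exact: bk.
    by [].
  apply/eqP; rewrite -subr_eq0 -normr_eq0 eq_le normr_ge0 andbT.
  apply/ler_addgt0Pl => e e0; rewrite addr0.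
  have e4 : 0 < e / 4 by rewrite divr_gt0.
  have [s0 [c0 bs0 d0 t0]] := approx _ m0 k001 _ e4.
  have [s1 [c1 bs1 d1 t1]] := approx _ m1 k101 _ e4.
  have bT (k : R -> R) : bmf k -> bmf (fun x => k (T x)) by exact: bmf_comp mT.
  have := unif_glue_continuous c0 c1 bs0 bs1 => eqs.
  have dglue : `|\int[unif]_x glue s0 s1 x - \int[unif]_x glue k0 k1 x| <= e / 4 + e / 4.
    rewrite -expectB; [|exact: bmf_glue..].
    apply: (le_trans (expect_norm _ _)); first by apply: bmfB; exact: bmf_glue.
    apply: (@le_trans _ _ (\int[unif]_x (`|s0 (T x) - k0 (T x)| + `|s1 (T x) - k1 (T x)|))).
      apply: expect_le.
      - by apply: bmf_norm; apply: bmfB; exact: bmf_glue.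
      - by apply: bmfD; apply: bmf_norm; apply: bmfB; apply: bT.
      - move=> x; rewrite /T /glue; case: ifP => _.
          by rewrite lerDl.
        by rewrite lerDr.
    rewrite expectD; [|by apply: bmf_norm; apply: bmfB; apply: bT..].
    by apply: lerD; exact: ltW.
  have dint (s k : R -> R) : bmf s -> bmf k -> \int[unif]_x `|s x - k x| < e / 4 ->
      `|\int[unif]_x s x - \int[unif]_x k x| <= e / 4.
    move=> bs bk' h; rewrite -expectB//; apply: (le_trans (expect_norm _ _)).
      exact: bmfB.
    exact: ltW.
  have i0 := dint _ _ bs0 b0 d0; have i1 := dint _ _ bs1 b1 d1.
  move: dglue i0 i1; rewrite eqs !ler_norml => /andP[? ?] /andP[? ?] /andP[? ?].
  by apply/andP; split; lra.
move=> b0 b1; have [m0 [M0 H0]] := b0; have [m1 [M1 H1]] := b1.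
pose M := `|M0| + `|M1| + 1.
have Mp : 0 < M by rewrite /M ltr_pwDr// addr_ge0.
have hM0 x : - M <= h0 x <= M.
  rewrite -ler_norml (le_trans (H0 x))// (le_trans (ler_norm _))// /M -addrA lerDl.
  by rewrite addr_ge0.
have hM1 x : - M <= h1 x <= M.
  rewrite -ler_norml (le_trans (H1 x))// (le_trans (ler_norm _))// /M.
  by have := normr_ge0 M0; lra.
pose k (h : R -> R) x : R := (h x + M) * (2 * M)^-1.
have kE h : h = (fun x => 2 * M * k h x - M).
  by apply/funext => x; rewrite /k; field; rewrite gt_eqF.
have k01 h : (forall x, - M <= h x <= M) -> forall x, 0 <= k h x <= 1.
  move=> hM x; case/andP: (hM x) => ? ?; rewrite /k; apply/andP; split.
    by rewrite divr_ge0//; lra.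
  by rewrite ler_pdivrMr; lra.
have bk h : bmf h -> bmf (k h).
  move=> bh; apply: bmfM; last exact: bmf_cst.
  by apply: bmfD => //; exact: bmf_cst.
have ek h : bmf h -> \int[unif]_x h x = 2 * M * \int[unif]_x k h x - M.
  move=> bh; rewrite {1}(kE h) expectB ?expectZ ?expect_cst//; try exact: bk.
    by apply: bmfZ; exact: bk.
  exact: bmf_cst.
have := step (k h0) (k h1) (proj1 (bk _ b0)) (proj1 (bk _ b1)) (k01 _ hM0) (k01 _ hM1).
have -> : glue (k h0) (k h1) = k (glue h0 h1).
  by apply/funext => x; rewrite /glue /k; case: ifP.
rewrite (ek h0)// (ek h1)// (ek (glue h0 h1)); last exact: bmf_glue.
by move=> ->; field.
Qed.

End doubling_map.

(** * Two independent uniform variables from the binary digits of one *)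

Section digit_splitting.
Context (R : realType).
Implicit Types x y : R.

Definition bit x : R := if x < 2^-1 then 0 else 1.

Definition doubling : R -> R := glue id id.

(* [alpha_iter] keeps every other binary digit, starting with the first one. *)
Fixpoint alpha_iter n x : R :=
  if n is m.+1 then (bit x + alpha_iter m (doubling (doubling x))) / 2 else 0.

Lemma bit01 x : 0 <= bit x <= 1.
Proof. by rewrite /bit; case: ifP; rewrite ?lexx ?ler01. Qed.

Lemma alpha_iter01 n x : 0 <= alpha_iter n x <= 1.
Proof.
elim: n x => [|n IH] x /=; first by rewrite lexx ler01.
have /andP[? ?] := bit01 x; have /andP[? ?] := IH (doubling (doubling x)).
by apply/andP; split; lra.
Qed.

Lemma alpha_iter_nondecreasing n x : alpha_iter n x <= alpha_iter n.+1 x.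
Proof.
elim: n x => [|n IH] x; first by case/andP: (alpha_iter01 1 x).
rewrite /= ler_wpM2r ?invr_ge0// lerD2l; exact: IH.
Qed.

Definition alpha x : R := lim (alpha_iter ^~ x @ \oo).

Lemma alpha_cvg x : alpha_iter ^~ x @ \oo --> alpha x.
Proof.
have : cvgn (alpha_iter ^~ x).
  apply: nondecreasing_is_cvgn.
    by apply/nondecreasing_seqP => n; exact: alpha_iter_nondecreasing.
  by exists 1 => _ [n _ <-]; case/andP: (alpha_iter01 n x).
exact.
Qed.

Lemma alphaE x : alpha x = (bit x + alpha (doubling (doubling x))) / 2.
Proof.
have c1 : (fun n => alpha_iter n.+1 x) @ \oo --> alpha x.
  by have := @alpha_cvg x; rewrite -(cvg_shiftS (alpha_iter ^~ x)).
have c2 : (fun n => alpha_iter n.+1 x) @ \oo -->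
    (bit x + alpha (doubling (doubling x))) / 2.
  by apply: cvgM; [apply: cvgD; [exact: cvg_cst | exact: alpha_cvg] | exact: cvg_cst].
exact: (cvg_unique _ c1 c2).
Qed.

Lemma alpha01 x : 0 <= alpha x <= 1.
Proof.
apply/andP; split.
  by apply: (cvgr_to_ge (@alpha_cvg x)); apply: nearW => n; case/andP: (alpha_iter01 n x).
by apply: (cvgr_to_le (@alpha_cvg x)); apply: nearW => n; case/andP: (alpha_iter01 n x).
Qed.

Lemma measurable_doubling_map : measurable_fun [set: R] doubling.
Proof.
apply: measurable_fun_ifT; first exact: measurable_fun_ltr.
  by have := measurable_doubling (0 : R); under eq_fun do rewrite subr0.
exact: measurable_doubling.
Qed.

Lemma measurable_alpha : measurable_fun [set: R] alpha.
Proof.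
apply: (measurable_fun_cvg (h := alpha_iter)) => [n|x _]; last exact: alpha_cvg.
elim: n => [|n IH] /=; first exact: measurable_cst.
apply: measurable_funM => //; apply: measurable_funD.
  by apply: measurable_fun_ifT => //; exact: measurable_fun_ltr.
apply: (measurableT_comp IH); apply: measurableT_comp; exact: measurable_doubling_map.
Qed.

(** The digits in even position: [alpha] after the first digit is dropped. *)
Definition beta x : R := alpha (doubling x).

Lemma measurable_beta : measurable_fun [set: R] beta.
Proof. exact: (measurableT_comp measurable_alpha measurable_doubling_map). Qed.

Definition digits x : R * R := (alpha x, beta x).

Lemma measurable_digits :
  measurable_fun [set: R] (digits : R -> measurableTypeR R * measurableTypeR R).
Proof. by apply/measurable_fun_pairP; split; [exact: measurable_alpha | exact: measurable_beta]. Qed.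

Local Notation U := (@unif R).

Let I2 (f : R * R -> R) := \int[U]_x f (digits x).
Let J2 (f : R * R -> R) := \int[U]_x \int[U]_y f (x, y).
(** Effect on [f] of revealing the leading digit [b]: if [x'] is [x] without it, then
    [alpha x = (b + beta x') / 2] and [beta x = alpha x'], so the coordinates are exchanged. *)
Let fb (b : R) (f : R * R -> R) := fun z : R * R => f ((b + z.2) / 2, z.1).

Let lip (A B : R) (f : R * R -> R) :=
  forall x y x' y', `|f (x, y) - f (x', y')| <= A * `|x - x'| + B * `|y - y'|.

Let bmf2 (f : R * R -> R) :=
  bmf (f : measurableTypeR R * measurableTypeR R -> R).

Let bmf_fb b f : bmf2 f -> bmf2 (fb b f).
Proof.
move=> bf; apply: (bmf_comp (f := fun z : measurableTypeR R * measurableTypeR R =>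
   (((b + z.2) / 2, z.1) : measurableTypeR R * measurableTypeR R))) bf.
apply/measurable_fun_pairP; split => /=; last exact: measurable_fst.
by apply: measurable_funM => //; apply: measurable_funD => //; exact: measurable_snd.
Qed.

Let lip_fb A B b f : lip A B f -> lip B (A / 2) (fb b f).
Proof.
move=> lf x y x' y'; rewrite /fb /=; apply: (le_trans (lf _ _ _ _)).
rewrite (_ : (b + y) / 2 - (b + y') / 2 = (y - y') / 2); last by field.
by rewrite normrM [`|2^-1|]ger0_norm ?invr_ge0//; lra.
Qed.

Let unif_close (g : R -> R) (c r : R) : bmf g ->
  (forall x, 0 <= x <= 1 -> `|g x - c| <= r) -> `|\int[U]_x g x - c| <= r.
Proof.
move=> bg gc; pose g' x : R := if (0 <= x) && (x <= 1) then g x else c.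
have r0 : 0 <= r by apply: le_trans (gc 0 _); rewrite ?normr_ge0// lexx ler01.
have bg' : bmf g'.
  case: bg => mg [M gM]; split.
    apply: measurable_fun_ifT => //; apply: measurable_and; exact: measurable_fun_ler.
  exists (M + `|c|) => x; rewrite /g'; case: ifP => _.
    by rewrite (le_trans (gM x))// lerDl.
  by rewrite lerDr (le_trans (normr_ge0 _) (gM x)).
have -> : \int[U]_x g x = \int[U]_x g' x.
  rewrite !unif_expect//; congr fine; apply: eq_integral => x.
  by rewrite inE/= in_itv/= /g' => ->.
rewrite -[X in `|_ - X|](expect_cst U) -expectB//; last exact: bmf_cst.
apply: expect_norm_le => [|x]; first by apply: bmfB => //; exact: bmf_cst.
by rewrite /g'; case: ifP => [|_]; [exact: gc | rewrite subrr normr0].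
Qed.

Let norm_avg4 (a b c e a' b' c' e' r : R) : `|e - e'| <= r -> `|c - c'| <= r ->
  `|b - b'| <= r -> `|a - a'| <= r ->
  `|((a + b) / 2 + (c + e) / 2) / 2 - ((a' + b') / 2 + (c' + e') / 2) / 2| <= r.
Proof.
rewrite !ler_norml => /andP[? ?] /andP[? ?] /andP[? ?] /andP[? ?].
by apply/andP; split; lra.
Qed.

Let I2_step f : bmf2 f -> I2 f = (I2 (fb 0 f) + I2 (fb 1 f)) / 2.
Proof.
move=> bf; rewrite /I2 -unif_glue; last 2 first.
- apply: (bmf_comp (f := fun x : R => (digits x : measurableTypeR R * measurableTypeR R))).
    exact: measurable_digits.
  exact: bmf_fb.
- apply: (bmf_comp (f := fun x : R => (digits x : measurableTypeR R * measurableTypeR R))).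
    exact: measurable_digits.
  exact: bmf_fb.
apply: eq_Rintegral => x _; rewrite /digits alphaE /beta.
have dE : doubling x = if x < 2^-1 then 2 * x else 2 * x - 1 by [].
by rewrite [in RHS]/glue; move: dE; rewrite /bit; case: ifP => _ ->.
Qed.

Let J2_step f : bmf2 f -> J2 f = (J2 (fb 0 f) + J2 (fb 1 f)) / 2.
Proof.
move=> bf.
have bE1 b : bmf (fun x : measurableTypeR R => \int[U]_y f ((b + x) / 2, y)).
  apply: (bmf_comp (f := fun x : measurableTypeR R => (b + x) / 2)
    (g := fun x : measurableTypeR R => \int[U]_y f (x, y))).
    by apply: measurable_funM => //; exact: measurable_funD.
  exact: (bmf_expect1 U U bf).
have J2E b : J2 (fb b f) = \int[U]_x \int[U]_y f ((b + x) / 2, y).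
  have bfb := bmf_fb b bf.
  rewrite /J2 -(expect_prod1 U U bfb) (expect_prod2 U U bfb).
  by apply: eq_Rintegral => x _.
rewrite !J2E -unif_glue; [|exact: bE1..]; rewrite /J2; apply: eq_Rintegral => x _; rewrite /glue.
case: ifP => _; apply: eq_Rintegral => y _; by congr (f (_, _)); field.
Qed.

(** Both functionals obey the same recursion through [fb], and two rounds of [fb] halve both
    Lipschitz constants; at depth 0 each functional is within [(A + B) / 2] of the value of [f] at
    the centre of the unit square. *)
Let I2_J2 n A B f : bmf2 f -> lip A B f -> 0 <= A -> 0 <= B ->
  `|I2 f - J2 f| <= (A + B) / 2 ^+ n.
Proof.
elim: n A B f => [|n IH] A B f bf lf A0 B0.
  have close x y : 0 <= x <= 1 -> 0 <= y <= 1 ->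
      `|f (x, y) - f (2^-1, 2^-1)| <= (A + B) / 2.
    move=> /andP[? ?] /andP[? ?]; apply: (le_trans (lf _ _ _ _)).
    have h1 : `|x - 2^-1| <= 2^-1 by rewrite ler_norml; apply/andP; split; lra.
    have h2 : `|y - 2^-1| <= 2^-1 by rewrite ler_norml; apply/andP; split; lra.
    by rewrite mulrDl lerD// ler_wpM2l.
  have hI : `|I2 f - f (2^-1, 2^-1)| <= (A + B) / 2.
    apply: unif_close => [|x x01]; last by apply: close; [exact: alpha01 | exact: alpha01].
    apply: (bmf_comp (f := fun x : R => (digits x : measurableTypeR R * measurableTypeR R))) bf.
    exact: measurable_digits.
  have hJ : `|J2 f - f (2^-1, 2^-1)| <= (A + B) / 2.
    apply: unif_close => [|x x01]; first exact: (bmf_expect1 U U bf).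
    apply: unif_close => [|y y01]; first exact: (bmf_section1 bf).
    exact: close.
  rewrite expr0 divr1 (_ : I2 f - J2 f = (I2 f - f (2^-1, 2^-1)) - (J2 f - f (2^-1, 2^-1))).
    by rewrite (le_trans (ler_normB _ _))// (le_trans (lerD hI hJ))// -splitr.
  by rewrite opprB addrA subrK.
have hb b b' : `|I2 (fb b (fb b' f)) - J2 (fb b (fb b' f))| <= (A / 2 + B / 2) / 2 ^+ n.
  by apply: IH; rewrite ?divr_ge0//; [do 2 apply: bmf_fb | do 2 apply: lip_fb].
rewrite (I2_step bf) (J2_step bf) !(I2_step (bmf_fb _ bf)) !(J2_step (bmf_fb _ bf)).
have hAB : (A / 2 + B / 2) / 2 ^+ n = (A + B) / 2 ^+ n.+1.
  by rewrite exprS; field; rewrite expf_neq0.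
rewrite -hAB.
move: (hb 1 1) (hb 0 1) (hb 1 0) (hb 0 0); exact: norm_avg4.
Qed.

Let pair_form (v : (R^o * R^o)%type) (z : measurableTypeR R * measurableTypeR R) : R :=
  v.1 * z.1 + v.2 * z.2.

Let lip_trig (s : seq (R * R * (R^o * R^o))) :
  exists A B, [/\ 0 <= A, 0 <= B & lip A B (trig pair_form s)].
Proof.
elim: s => [|[[a b] v] s [A [B [A0 B0 lAB]]]].
  exists 0, 0; split => // x y x' y'.
  by rewrite /trig !big_nil subrr normr0 !mul0r addr0.
exists ((`|a| + `|b|) * `|v.1| + A), ((`|a| + `|b|) * `|v.2| + B); split.
- by rewrite addr_ge0// mulr_ge0// addr_ge0.
- by rewrite addr_ge0// mulr_ge0// addr_ge0.
move=> x y x' y'; rewrite !trig_cons opprD addrACA.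
apply: (le_trans (ler_normD _ _)); have := lAB x y x' y'.
set c := pair_form v (x, y); set c' := pair_form v (x', y').
have cc : `|c - c'| <= `|v.1| * `|x - x'| + `|v.2| * `|y - y'|.
  rewrite (_ : c - c' = v.1 * (x - x') + v.2 * (y - y')).
    by rewrite (le_trans (ler_normD _ _))// !normrM.
  by rewrite /c /c' /pair_form /=; ring.
have h : `|a * cos c + b * sin c - (a * cos c' + b * sin c')| <= (`|a| + `|b|) * `|c - c'|.
  rewrite opprD addrACA -!mulrBr (le_trans (ler_normD _ _))// !normrM mulrDl.
  by rewrite lerD// ler_wpM2l// ?cos_lip ?sin_lip.
have := ler_wpM2l (addr_ge0 (normr_ge0 a) (normr_ge0 b)) cc.
by move: h; rewrite !mulrDl mulrDr !mulrA => h1 h2 h3; lra.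
Qed.

Lemma real_plane_generated (E : set (measurableTypeR R * measurableTypeR R)) : measurable E ->
  <<s [set [set z | c.2 < pair_form c.1 z] | c in [set: (R^o * R^o) * R] ]>> E.
Proof.
set G := (X in <<s X >>).
have mf (v : (R^o * R^o)%type) : measurable_fun [set: g_sigma_algebraType G]
    (pair_form v : g_sigma_algebraType G -> R).
  apply: (measurability (@RGenOInfty.G R)); first exact: RGenOInfty.measurableE.
  move=> _ [_ [y ->] <-]; rewrite setTI; apply: sub_sigma_algebra.
  exists (v, y) => //=.
  by apply/seteqP; split => x /=; rewrite in_itv/= andbT.
have m1 : measurable_fun [set: g_sigma_algebraType G]
    (fun z : g_sigma_algebraType G => (z : R * R).1 : measurableTypeR R).
  have := mf (1, 0); rewrite (_ : pair_form _ = fun z => z.1)//.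
  by apply/funext => z; rewrite /pair_form/= mul1r mul0r addr0.
have m2 : measurable_fun [set: g_sigma_algebraType G]
    (fun z : g_sigma_algebraType G => (z : R * R).2 : measurableTypeR R).
  have := mf (0, 1); rewrite (_ : pair_form _ = fun z => z.2)//.
  by apply/funext => z; rewrite /pair_form/= mul1r mul0r add0r.
move=> mE.
have mid : measurable_fun [set: g_sigma_algebraType G]
    (fun z : g_sigma_algebraType G => ((z : R * R).1 : measurableTypeR R,
      (z : R * R).2 : measurableTypeR R)).
  by apply/measurable_fun_pairP; split.
have := mid measurableT E mE; rewrite setTI.
suff -> : (fun z : g_sigma_algebraType G => ((z : R * R).1 : measurableTypeR R,
      (z : R * R).2 : measurableTypeR R)) @^-1` E = E by [].
by apply/seteqP; split => -[x y].
Qed.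

(** [I2_J2] at every depth equates the two functionals on trigonometric polynomials, which are
    Lipschitz and determine the law. *)
Lemma digits_law (E : set (measurableTypeR R * measurableTypeR R)) : measurable E ->
  U (digits @^-1` E) = (U \x U)%E E.
Proof.
have mform (v : (R^o * R^o)%type) :
    measurable_fun [set: measurableTypeR R * measurableTypeR R] (pair_form v).
  by apply: measurable_funD; apply: measurable_funM.
have key s : I2 (trig pair_form s) = J2 (trig pair_form s).
  have [A [B [A0 B0 lAB]]] := lip_trig s.
  have bt : bmf2 (trig pair_form s) by exact: bmf_trig.
  apply/eqP; rewrite -subr_eq0 -normr_eq0 eq_le normr_ge0 andbT.
  have cv : (fun n => (A + B) * (2^-1) ^+ n) @ \oo --> (0 : R).
    rewrite -(mulr0 (A + B)); apply: cvgM; first exact: cvg_cst.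
    by apply: cvg_expr; rewrite ger0_norm ?invr_ge0// invf_lt1//; lra.
  apply: (cvgr_to_ge cv); apply: nearW => n; rewrite exprVn.
  exact: I2_J2.
move=> mE.
pose P : probability (measurableTypeR R * measurableTypeR R)%type R :=
  law (T := measurableTypeR R) (T' := (measurableTypeR R * measurableTypeR R)%type)
    U measurable_digits.
suff h : forall E, measurable E -> P E = (U \x U)%E E by exact: h.
apply: (trig_unique mform) => //.
- by move=> a u v x; rewrite /pair_form/=; rewrite /GRing.scale/=; ring.
- exact: real_plane_generated.
- move=> v; have := key [:: (1, 0, v)].
  have E1 z : trig pair_form [:: (1, 0, v)] z = cos (pair_form v z).
    by rewrite trig1 mul1r mul0r addr0.
  rewrite expect_law; last by apply: bmf_cos.
  rewrite expect_prod1; last by apply: bmf_cos.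
  rewrite /I2 /J2; under eq_Rintegral do rewrite E1.
  move=> ->; apply: eq_Rintegral => x _; apply: eq_Rintegral => y _; exact: E1.
- move=> v; have := key [:: (0, 1, v)].
  have E1 z : trig pair_form [:: (0, 1, v)] z = sin (pair_form v z).
    by rewrite trig1 mul1r mul0r add0r.
  rewrite expect_law; last by apply: bmf_sin.
  rewrite expect_prod1; last by apply: bmf_sin.
  rewrite /I2 /J2; under eq_Rintegral do rewrite E1.
  move=> ->; apply: eq_Rintegral => x _; apply: eq_Rintegral => y _; exact: E1.
Qed.

End digit_splitting.

(** * The quantile transform *)

Section quantile_function.
Context (R : realType) (P : probability (measurableTypeR R) R).

Let id_rv : {RV P >-> R} := @mfun_Sub _ _ (measurableTypeR R) R (fun x => x)
  (mem_set (@measurable_id _ (measurableTypeR R) setT)).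

Let F (r : R) : R := fine (cdf id_rv r).

Let FE r : (F r)%:E = P `]-oo, r]%classic.
Proof. by rewrite /F fineK// fin_num_measure. Qed.

Let F_nondecreasing x y : x <= y -> F x <= F y.
Proof. by move=> xy; rewrite fine_le ?fin_num_measure// cdf_nondecreasing. Qed.

Let F01 x : 0 <= F x <= 1.
Proof. by rewrite -!lee_fin FE measure_ge0 probability_le1. Qed.

Let q (u : R) : R := inf [set x | u <= F x].

Let F_lower u : 0 < u -> exists x, forall y, u <= F y -> x <= y.
Proof.
move=> u0; have : F x @[x --> -oo] --> (0 : R) by exact/fine_cvg/cvg_cdfNy0.
move=> /cvgr0_norm_lt/(_ _ u0)[N [_ hN]]; exists (N - 1) => y uF.
rewrite leNgt; apply/negP => yN.
have := hN y (lt_trans yN _); rewrite ltrBlDr ltrDl ltr01 => /(_ isT).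
by rewrite ger0_norm ?ltNge ?uF//; case/andP: (F01 y).
Qed.

Let F_upper u : u < 1 -> exists x, u <= F x.
Proof.
move=> u1; have : F x @[x --> +oo] --> (1 : R) by exact/fine_cvg/cvg_cdfy1.
have u10 : 0 < 1 - u by rewrite subr_gt0.
move=> /cvgrPdist_lt/(_ _ u10)[N [_ hN]]; exists (N + 1).
have := hN (N + 1); rewrite ltrDl ltr01 => /(_ isT).
by rewrite ger0_norm; [lra | rewrite subr_ge0; case/andP: (F01 (N + 1))].
Qed.

(** Galois connection between [q] and the distribution function; right continuity of the latter
    gives the implication from left to right. *)
Let quantile_le u x : 0 < u < 1 -> (q u <= x) = (u <= F x).
Proof.
move=> /andP[u0 u1]; have [l lF] := F_lower u0; have [r rF] := F_upper u1.
have hi : has_inf [set x | u <= F x] by split; [exists r | exists l].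
apply/idP/idP => [qx|uF]; last by apply: ge_inf => //; case: hi.
apply: le_trans (F_nondecreasing qx).
have rc : F y @[y --> (q u)^'+] --> F (q u).
  by apply: fine_cvg; rewrite fineK ?fin_num_measure//; exact: cdf_right_continuous.
apply: (cvgr_to_ge rc); near=> y.
have yq : q u < y by near: y; exact: nbhs_right_gt.
have [a /= ua ay] : exists2 a, u <= F a & a < y.
  have yq0 : 0 < y - q u by rewrite subr_gt0.
  have [a ua ha] := inf_adherent yq0 hi; exists a => //.
  by move: ha; rewrite -/(q u) subrKC.
by apply: le_trans ua (F_nondecreasing (ltW ay)).
Unshelve. all: by end_near. Qed.

(** Outside ]0, 1[ the infimum may run over a set that is empty or unbounded below; a constant value
    there keeps the function measurable on the whole line. *)
Definition quantile (u : R) : R := if (0 < u) && (u < 1) then q u else 0.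

Let preimage_quantile x : quantile @^-1` `]-oo, x]%classic =
  (`]0, 1[%classic `&` `]-oo, F x]%classic) `|`
  (if 0 <= x then ~` `]0, 1[%classic else set0).
Proof.
have inE1 u : (`]0, 1[%classic : set R) u = (0 < u) && (u < 1).
  by rewrite /= in_itv.
have inE2 u c : (`]-oo, c]%classic : set R) u = (u <= c) by rewrite /= in_itv.
apply/seteqP; split => u; rewrite [preimage _ _ _]inE2 /quantile.
  case: ifPn => u01 h.
    by left; split; [rewrite inE1 | rewrite inE2 -quantile_le].
  have nu : (~` `]0, 1[%classic : set R) u.
    by change (~ (`]0, 1[%classic : set R) u); rewrite inE1; exact/negP.
  by right; rewrite h.
have [u01|u01] := boolP ((0 < u) && (u < 1)); move=> [[h1 h2]|h].
- by rewrite quantile_le//; rewrite inE2 in h2.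
- move: h; case: ifP => [_ nu|_ []].
  have nu' : ~ (`]0, 1[%classic : set R) u := nu.
  by exfalso; apply: nu'; rewrite inE1.
- by exfalso; move: h1; rewrite inE1; apply/negP.
- by move: h; case: ifP.
Qed.

Let measurable_preimage_quantile x : measurable (quantile @^-1` `]-oo, x]%classic).
Proof.
rewrite preimage_quantile; apply: measurableU; first exact: measurableI.
by case: ifP => _ //; exact: measurableC.
Qed.

Lemma measurable_quantile : measurable_fun [set: R] quantile.
Proof.
apply: (measurability (@RGenOInfty.G R)); first exact: RGenOInfty.measurableE.
move=> _ [_ [y ->] <-]; rewrite setTI.
have -> : `]y, +oo[%classic = ~` `]-oo, y]%classic.
  by apply/seteqP; split => z /=; rewrite !in_itv/= andbT ltNge => /negP.
by rewrite preimage_setC; apply: measurableC; exact: measurable_preimage_quantile.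
Qed.

Let unif_preimage_quantile x : @unif R (quantile @^-1` `]-oo, x]%classic) = (F x)%:E.
Proof.
have mS := measurable_preimage_quantile x; set S := quantile @^-1` _ in mS *.
rewrite -(expect_indic (@unif R) mS); congr (_%:E).
rewrite unif_expect; last exact: bmf_indic.
have mi (A : set (measurableTypeR R)) : measurable A -> measurable_fun (`]0%R, 1%R[%classic : set (measurableTypeR R)) (fun u => (\1_A u : R)%:E).
  by move=> mA; apply/measurable_EFinP; apply: measurable_funTS; exact: measurable_indic.
have mi' (A : set (measurableTypeR R)) : measurable A -> measurable_fun (`[0%R, 1%R[%classic : set (measurableTypeR R)) (fun u => (\1_A u : R)%:E).
  by move=> mA; apply/measurable_EFinP; apply: measurable_funTS; exact: measurable_indic.
(* The endpoints are removed because [quantile_le] speaks only of ]0, 1[. *)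
have open01 (A : set (measurableTypeR R)) : measurable A ->
    (\int[@lebesgue_measure R]_(u in `[0%R, 1%R]) (\1_A u : R)%:E =
     \int[@lebesgue_measure R]_(u in `]0%R, 1%R[) (\1_A u : R)%:E)%E.
  move=> mA; rewrite -integral_itv_bndo_bndc; last exact: mi'.
  by rewrite -integral_itv_obnd_cbnd//; exact: mi.
have -> : (\int[@lebesgue_measure R]_(u in `[0%R, 1%R]) (\1_S u : R)%:E =
    \int[@lebesgue_measure R]_(u in `[0%R, 1%R]) (\1_(`]-oo, F x]) u : R)%:E)%E.
  rewrite !open01//; apply: eq_integral => u; rewrite inE/= in_itv/= => u01.
  congr (_%:E); rewrite !indicE; congr (_%:R); congr nat_of_bool.
  rewrite /S /quantile; apply/idP/idP => /set_mem h; apply/mem_set; move: h;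
    by rewrite /= !in_itv/= u01 quantile_le.
rewrite integral_indic//.
have -> : `]-oo, F x]%classic `&` `[0%R, 1%R]%classic = `[0%R, F x]%classic :> set R.
  have /andP[F0 F1] := F01 x.
  apply/seteqP; split => u /=; rewrite !in_itv/=; first by move=> [-> /andP[-> _]].
  by move=> /andP[-> uF]; rewrite uF (le_trans uF F1).
apply: (congr1 fine (y := (F x)%:E)); apply: (etrans (@lebesgue_measure_itv R `[0%R, F x])).
rewrite /= lte_fin; have /andP[F0 _] := F01 x.
case: ltP => [_|F0']; first by rewrite -EFinB subr0.
by congr (_%:E); apply/eqP; rewrite eq_le F0 F0'.
Qed.

Lemma quantile_law (E : set (measurableTypeR R)) : measurable E ->
  @unif R (quantile @^-1` E) = P E.
Proof.
pose Q : probability (measurableTypeR R) R :=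
  law (T := measurableTypeR R) (T' := measurableTypeR R) (@unif R) measurable_quantile.
suff h : forall E, measurable E -> Q E = P E by exact: h.
apply: (@measure_unique _ R (measurableTypeR R) (@RGenOInfty.G R) (fun n => `](- n%:R), +oo[%classic)).
- exact: RGenOInfty.measurableE.
- move=> _ _ [x ->] [y ->]; exists (Num.max x y).
  by apply/seteqP; split => z /=; rewrite !in_itv/= !andbT gt_max; [move=> [-> ->]|move=> /andP[]].
- by move=> n; exists (- n%:R).
- apply/seteqP; split => // x _.
  have [n _ /(_ n (leqnn n)) /= h] := nbhs_infty_gtr (- x).
  by exists n => //=; rewrite in_itv/= andbT ltrNl.
- move=> _ [x ->].
  have C (S : probability (measurableTypeR R) R) :
      S `]x, +oo[%classic = (1 - S `]-oo, x]%classic)%E.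
    rewrite -probability_setC//; congr (S _).
    by apply/seteqP; split => z /=; rewrite !in_itv/= andbT ltNge => /negP.
  apply: (etrans (C Q)); apply: (etrans _ (esym (C P))); congr (1 - _)%E.
  by rewrite -FE; exact: unif_preimage_quantile.
- by move=> n; rewrite (le_lt_trans (probability_le1 _ _))// ltry.
Qed.

End quantile_function.

Section independent_normals.
Context (R : realType).

Definition normal_digit (x : R) : R := quantile (@gauss1 R) (alpha x).

Lemma measurable_normal_digit : measurable_fun [set: R] normal_digit.
Proof. exact: (measurableT_comp (measurable_quantile _) (@measurable_alpha R)). Qed.

(** [alpha] and [beta] are independent and uniform by [digits_law], and the quantile turns the first
    into a standard normal. *)
Lemma expect_normal_digit_beta (f : R * R -> R) :
  bmf (T := (measurableTypeR R * measurableTypeR R)%type) f ->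
  \int[@unif R]_x f (normal_digit x, beta x) =
  \int[@gauss1 R]_y (\int[@unif R]_b f (y, b)).
Proof.
move=> bf; pose U : probability (measurableTypeR R) R := @unif R.
have mq : measurable_fun [set: measurableTypeR R * measurableTypeR R]
    (fun z : measurableTypeR R * measurableTypeR R =>
       (quantile (@gauss1 R) z.1, z.2) : measurableTypeR R * measurableTypeR R).
  apply/measurable_fun_pairP; split => /=; last exact: measurable_snd.
  exact: (measurableT_comp (measurable_quantile _) measurable_fst).
pose g (z : measurableTypeR R * measurableTypeR R) : R := f (quantile (@gauss1 R) z.1, z.2).
have bg : bmf g by exact: (bmf_comp mq bf).
transitivity (\int[U]_x g (digits x)) => //.
rewrite -(expect_law (T := measurableTypeR R)
  (T' := (measurableTypeR R * measurableTypeR R)%type) U (@measurable_digits R))//.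
transitivity (\int[(U \x U)%E]_z g z).
  by apply: expect_eq_measure => E mE; exact: digits_law.
rewrite (expect_prod1 U U bg).
pose h (y : measurableTypeR R) : R := \int[U]_b f (y, b).
have bh : bmf h by exact: (bmf_expect1 (@gauss1 R) U bf).
transitivity (\int[U]_a h (quantile (@gauss1 R) a)) => //.
rewrite -(expect_law (T := measurableTypeR R) (T' := measurableTypeR R) U (measurable_quantile (@gauss1 R)))//.
by apply: expect_eq_measure => E mE; exact: quantile_law.
Qed.

(** [beta] is again uniform and independent of the normal just extracted, so splitting it repeatedly
    yields an independent sequence. *)
Definition iid_normal i (x : R) : R := normal_digit (iter i (@beta R) x).

Lemma measurable_iid_normal i : measurable_fun [set: R] (iid_normal i).
Proof.
apply: (measurableT_comp measurable_normal_digit).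
elim: i => [|i IH]; first exact: measurable_id.
exact: (measurableT_comp (@measurable_beta R) IH).
Qed.

(** Induction peels off the first normal; the others depend on [beta] alone. The phase [t] is
    general because conditioning on the first normal shifts it. *)
Lemma iid_normal_cos n (a : nat -> R) t :
  \int[@unif R]_x cos (t + \sum_(i < n) a i * iid_normal i x) =
  cos t * expR (- (\sum_(i < n) a i ^+ 2) / 2).
Proof.
elim: n a t => [|n IH] a t.
  under eq_Rintegral do rewrite big_ord0 addr0.
  by rewrite big_ord0 oppr0 mul0r expR0 mulr1 expect_cst.
have mS : measurable_fun [set: measurableTypeR R]
    (fun b : measurableTypeR R => \sum_(i < n) a i.+1 * iid_normal i b).
  by apply: measurable_sum => i; apply: measurable_funM => //; exact: measurable_iid_normal.
pose f (z : measurableTypeR R * measurableTypeR R) : R :=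
  cos ((a 0 * z.1 + t) + \sum_(i < n) a i.+1 * iid_normal i z.2).
have bf : bmf f.
  apply: bmf_cos; apply: measurable_funD; last exact: (measurableT_comp mS measurable_snd).
  by apply: measurable_funD => //; apply: measurable_funM => //; exact: measurable_fst.
transitivity (\int[@unif R]_x f (normal_digit x, beta x)).
  apply: eq_Rintegral => x _; rewrite /f /=; congr cos.
  rewrite big_ord_recl [a 0 * _ + t]addrC addrA; congr (_ + _).
  by apply: eq_bigr => i _; rewrite /iid_normal iterSr.
rewrite expect_normal_digit_beta//.
pose E := expR (- (\sum_(i < n) a i.+1 ^+ 2) / 2).
transitivity (\int[@gauss1 R]_y (E * cos (a 0 * y + t))).
  by apply: eq_Rintegral => y _; rewrite [RHS]mulrC; have h := IH (fun i => a i.+1) (a 0 * y + t); apply: etrans h _.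
rewrite expectZ; last by apply: bmf_cos; apply: measurable_funD => //; exact: measurable_funM.
rewrite gauss1_cos big_ord_recl opprD mulrDl expRD mulrC -mulrA mulNr.
by [].
Qed.

Lemma iid_normal_sin n (a : nat -> R) t :
  \int[@unif R]_x sin (t + \sum_(i < n) a i * iid_normal i x) =
  sin t * expR (- (\sum_(i < n) a i ^+ 2) / 2).
Proof.
have sinE (x : R) : sin x = cos (x - pi / 2) by rewrite cosBpihalf.
under eq_Rintegral do rewrite sinE addrAC.
by rewrite iid_normal_cos -sinE.
Qed.

Lemma iid_normal_law n (a : nat -> R) (A : set (measurableTypeR R)) : measurable A ->
  @unif R ((fun x => \sum_(i < n) a i * iid_normal i x) @^-1` A) =
  normal_law 0 (\sum_(i < n) a i ^+ 2) A.
Proof.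
move=> mA; set v := \sum_(i < n) _.
have v0 : 0 <= v by apply: sumr_ge0 => i _; exact: sqr_ge0.
have mS : measurable_fun [set: measurableTypeR R]
    (fun b : measurableTypeR R => \sum_(i < n) a i * iid_normal i b).
  by apply: measurable_sum => i; apply: measurable_funM => //; exact: measurable_iid_normal.
pose P1 : probability (measurableTypeR R) R :=
  law (T := measurableTypeR R) (T' := measurableTypeR R) (@unif R) mS.
have sc c : \sum_(i < n) (c * a i) ^+ 2 = c ^+ 2 * v.
  by rewrite mulr_sumr; apply: eq_bigr => i _; rewrite exprMn.
have cE c x : c * \sum_(i < n) a i * iid_normal i x =
    0 + \sum_(i < n) (c * a i) * iid_normal i x.
  by rewrite add0r mulr_sumr; apply: eq_bigr => i _; rewrite mulrA.
suff h : forall E, measurable E -> P1 E = normal_law 0 v E by exact: h.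
apply: normal_law_unique => // c.
- rewrite expect_law; last by apply: bmf_cos; exact: measurable_funM.
  under eq_Rintegral do rewrite cE.
  by rewrite (iid_normal_cos n (fun i => c * a i)) sc mulr0.
- rewrite expect_law; last by apply: bmf_sin; exact: measurable_funM.
  under eq_Rintegral do rewrite cE.
  by rewrite (iid_normal_sin n (fun i => c * a i)) sc mulr0.
Qed.

End independent_normals.

(** The series of the [f k] has finite integral, so it is finite almost everywhere and bounds its
    terms. With a geometric weight inside [f k] this becomes geometric convergence off a null
    set. *)
Lemma bounded_of_summable_integrals d (T : measurableType d) (R : realType)
    (P : probability T R) (f : nat -> T -> R) (c : nat -> R) (C : R) :
  (forall k, measurable_fun [set: T] (f k)) -> (forall k x, 0 <= f k x) ->
  (forall k, \int[P]_x (f k x)%:E <= (c k)%:E)%E ->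
  (forall n, \sum_(k < n) c k <= C) ->
  exists A, [/\ measurable A, P A = 1%E & forall x, A x -> exists M : R, forall k, f k x <= M].
Proof.
move=> mf f0 fc cC; pose g (x : T) : \bar R := (\sum_(0 <= k <oo) (f k x)%:E)%E.
have mg : measurable_fun setT g.
  by apply: ge0_emeasurable_sum => k; [by move=> x _ _; rewrite lee_fin | move=> _; exact/measurable_EFinP].
have g0 x : (0 <= g x)%E by apply: nneseries_ge0 => k _ _; rewrite lee_fin.
have gC : (\int[P]_x g x <= C%:E)%E.
  rewrite /g integral_nneseries//; last 2 first.
    by move=> k; exact/measurable_EFinP.
    by move=> k x _; rewrite lee_fin.
  apply: lime_le; first by apply: is_cvg_nneseries => k _ _; apply: integral_ge0 => x _; rewrite lee_fin.
  apply: nearW => n; rewrite big_mkord.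
  apply: (@le_trans _ _ (\sum_(k < n) (c k)%:E)%E); first by apply: lee_sum => k _; exact: fc.
  by rewrite sumEFin lee_fin.
have ig : P.-integrable setT g.
  apply/integrableP; split => //; under eq_integral do rewrite gee0_abs//.
  by rewrite (le_lt_trans gC)// ltry.
have [N [mN PN gN]] := integrable_ae measurableT ig.
exists (~` N); split; first exact: measurableC.
  by rewrite probability_setC// PN sube0.
move=> x Nx; have gx : g x \is a fin_num.
  by apply: contrapT => h; apply: Nx; apply: gN => /= /(_ I).
exists (fine (g x)) => k; rewrite -lee_fin fineK//.
rewrite /g (@nneseriesD1 _ _ k)//; last by move=> i; rewrite lee_fin.
by rewrite leeDl//; apply: nneseries_ge0 => i _ _; rewrite lee_fin.
Qed.

Lemma geometric_half_sum (R : realType) n : \sum_(k < n) (2^-1 : R) ^+ k = 2 - 2 * 2^-1 ^+ n.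
Proof.
elim: n => [|n IH]; first by rewrite big_ord0 expr0 mulr1 subrr.
by rewrite big_ord_recr /= IH exprS; lra.
Qed.

Lemma cvg_of_geometric_steps (R : realType) (V : completeNormedModType R) (u : nat -> V) (M : R) :
  (forall k, `|u k.+1 - u k| <= M * 2^-1 ^+ k) -> cvgn u.
Proof.
move=> uM; have -> : u = fun n => u 0 + series (telescope u) n.
  by apply/funext => n; rewrite telescopeK/= subrKC.
apply: is_cvgD; first exact: is_cvg_cst.
apply: normed_cvg; apply: (series_le_cvg (v_ := geometric M 2^-1)) => [n|n|n|].
- exact: normr_ge0.
- exact: le_trans (uM n).
- exact: uM.
- by apply: is_cvg_geometric_series; rewrite ger0_norm ?invr_ge0// invf_lt1//; lra.
Qed.

Lemma diagonal_increasing (P : nat -> nat -> Prop) :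
  (forall k, exists N, forall n, (N <= n)%N -> P k n) ->
  exists2 M : nat -> nat, increasing_seq M & forall k n, (M k <= n)%N -> P k n.
Proof.
(* Summing the successors makes the sequence strictly increasing and keeps it above [N k]. *)
move=> /choice[N hN]; exists (fun k => \sum_(j < k.+1) (N j).+1)%N.
  by apply/increasing_seqP => n; rewrite ltEnat/= [X in (_ < X)%N]big_ord_recr/= addnS ltnS leq_addr.
move=> k n h; apply: hN; apply: leq_trans h.
by rewrite big_ord_recr/=; apply: leq_trans (leq_addl _ _); exact: leqnSn.
Qed.

Lemma increasing_seq_ge (k : nat -> nat) n : increasing_seq k -> (n <= k n)%N.
Proof.
by move=> /increasing_seqP inc; elim: n => // n; move/leq_ltn_trans; apply; exact: inc.
Qed.

Lemma cvg_increasing_seq (k : nat -> nat) : increasing_seq k -> k @ \oo --> \oo.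
Proof.
by move=> inc A [N _ hN]; exists N => // n /= Nn; apply: hN; apply: leq_trans Nn (increasing_seq_ge _ inc).
Qed.

Section gaussian_existence.
Context (R : realType) (X : completeNormedModType R).
Variable dotp : {dot X for idfun}.
Hypothesis dotp_norm : is_inner_product dotp.
Hypothesis Xsep : separable X.
Local Notation "<< x , y >>" := (dotp x y) (at level 0, format "<< x ,  y >>").

Let m2 : R := \int[@gauss1 R]_y y ^+ 2.

Let m2E : (\int[@gauss1 R]_y (y ^+ 2)%:E)%E = m2%:E.
Proof.
rewrite /m2 /Rintegral fineK//; apply: integrable_fin_num => //.
apply: (@gauss1_integrable _ _ 1) => [|y]; first exact: measurable_funX.
rewrite mul1r ger0_norm ?sqr_ge0//.
by have := sqr_ge0 (y ^+ 2 - 1); rewrite (_ : y ^+ 4 = (y ^+ 2) ^+ 2) -?exprM//; nra.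
Qed.

Let m2_ge0 : 0 <= m2.
Proof. by rewrite -lee_fin -m2E; apply: integral_ge0 => y _; rewrite lee_fin sqr_ge0. Qed.

Definition normal_sum (v : nat -> X) n (x : R) : X := \sum_(i < n) @iid_normal R i x *: v i.

Lemma dot_normal_sum v n x h :
  <<normal_sum v n x, h>> = \sum_(i < n) <<v i, h>> * iid_normal i x.
Proof. by rewrite dot_suml; apply: eq_bigr => i _; rewrite dotZl mulrC. Qed.

Lemma measurable_dot_normal_sum v n h :
  measurable_fun [set: measurableTypeR R] (fun x => <<normal_sum v n x, h>>).
Proof.
under eq_fun do rewrite dot_normal_sum.
by apply: measurable_sum => i; apply: measurable_funM => //; exact: measurable_iid_normal.
Qed.

Lemma measurable_normal_sum_sqr v n :
  measurable_fun [set: measurableTypeR R] (fun x => `|normal_sum v n x| ^+ 2).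
Proof.
have [e onb _] := onb_seq_exists dotp_norm Xsep.
apply: (@measurable_fun_cvg _ _ _ _
  (fun K x => \sum_(k < K) <<normal_sum v n x, e k>> ^+ 2)) => [K|x _].
  by apply: measurable_sum => k; apply: measurable_funX; exact: measurable_dot_normal_sum.
exact: parseval.
Qed.

(** Coordinate [k] of the sum is normal with variance the sum over [i] of [<v i, e k>^2]; for each
    [i], Bessel bounds the sum over [k]. *)
Lemma normal_sum_sqr_le v n :
  (\int[@unif R]_x (`|normal_sum v n x| ^+ 2)%:E <= (m2 * \sum_(i < n) `|v i| ^+ 2)%:E)%E.
Proof.
have [e onb _] := onb_seq_exists dotp_norm Xsep.
pose s k := \sum_(i < n) <<v i, e k>> ^+ 2.
have mk k : measurable_fun [set: measurableTypeR R]
    (fun x => (<<normal_sum v n x, e k>> ^+ 2)%:E).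
  by apply/measurable_EFinP; apply: measurable_funX; exact: measurable_dot_normal_sum.
have I k : (\int[@unif R]_x (<<normal_sum v n x, e k>> ^+ 2)%:E)%E = (s k * m2)%:E.
  have s0 : 0 <= s k by apply: sumr_ge0 => i _; exact: sqr_ge0.
  apply: etrans (@ge0_integral_normal _ _ _ (@unif R) (fun x => <<normal_sum v n x, e k>>)
    0 (s k) _ _ _ (fun y => (y ^+ 2)%:E) _ _) _.
  - exact: measurable_dot_normal_sum.
  - exact: s0.
  - move=> A mA; under [X in preimage X]eq_fun do rewrite dot_normal_sum.
    exact: (iid_normal_law n (fun i => <<v i, e k>>)).
  - by apply/measurable_EFinP; exact: measurable_funX.
  - by move=> y; rewrite lee_fin sqr_ge0.
  - under eq_integral do rewrite add0r exprMn sqr_sqrtr// EFinM.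
    rewrite ge0_integralZl//.
    + by rewrite m2E.
    + by apply/measurable_EFinP; exact: measurable_funX.
    + by move=> y _; rewrite lee_fin sqr_ge0.
have -> : (\int[@unif R]_x (`|normal_sum v n x| ^+ 2)%:E =
    \int[@unif R]_x \sum_(0 <= k <oo) (<<normal_sum v n x, e k>> ^+ 2)%:E)%E.
  apply: eq_integral => x _; apply/esym/cvg_lim => //.
  under eq_fun do rewrite big_mkord sumEFin.
  by apply: cvg_EFin; [exact: nearW | exact: parseval].
rewrite integral_nneseries//; last by move=> k x _; rewrite lee_fin sqr_ge0.
apply: lime_le.
  by apply: is_cvg_nneseries => k _ _; apply: integral_ge0 => x _; rewrite lee_fin sqr_ge0.
apply: nearW => K; under eq_bigr do rewrite I.
rewrite big_mkord sumEFin lee_fin -mulr_suml mulrC ler_wpM2l// exchange_big.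
by apply: ler_sum => i _; exact: bessel.
Qed.

Lemma normal_sumB v n m x : (n <= m)%N ->
  normal_sum v m x - normal_sum v n x =
  normal_sum (fun i => if (i < n)%N then 0 else v i) m x.
Proof.
move=> nm; rewrite /normal_sum (big_ord_widen _ (fun i => iid_normal i x *: v i) nm).
rewrite [X in _ - X]big_mkcond -sumrB; apply: eq_bigr => i _.
by case: ifP => _; rewrite ?subrr ?subr0 ?scaler0.
Qed.

(** The random vector is [a] plus the series of [xi_i S e_i] with independent standard normals
    [xi_i]. Its covariance is [S S = Q], and the bound on the trace is the convergence of the sum of
    [|S e_i|^2]. *)
Lemma gaussian_exists (a : X) (Q S : X -> X) (e : nat -> X) (C : R) :
  nonneg_root dotp Q S -> onb_seq dotp e -> (forall n, \sum_(i < n) <<Q (e i), e i>> <= C) ->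
  exists mu, is_gaussian dotp a Q mu.
Proof.
move=> [[linS cS] Ssym S0 SS] onb trC.
have QE h : <<Q h, h>> = `|S h| ^+ 2 by rewrite -SS Ssym dotxx.
have Q0 h : 0 <= <<Q h, h>> by rewrite QE sqr_ge0.
have linQ : linear Q by move=> c x y; rewrite -!SS !linS.
pose s n := \sum_(i < n) `|S (e i)| ^+ 2.
have sC n : s n <= C by rewrite /s; under eq_bigr do rewrite -QE; exact: trC.
have cs : cvgn s.
  apply: nondecreasing_is_cvgn; last by exists C => _ [n _ <-]; exact: sC.
  by apply/nondecreasing_seqP => n; rewrite /s big_ord_recr/= lerDl sqr_ge0.
(* Blocks are cut so that the remainders of the trace are at most [8^-k]: weighted by [4^k], the
   squared block increments have integrals of order [2^-k], so off a null set the increments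
   themselves are of order [2^-k]. *)
have [M Minc hM] : exists2 M : nat -> nat, increasing_seq M &
    forall k n, (M k <= n)%N -> forall m, (M k <= m)%N -> `|s n - s m| <= 8^-1 ^+ k.
  have [|M Minc hM] := @diagonal_increasing (fun k n => `|s n - lim (s @ \oo)| <= 8^-1 ^+ k / 2).
    move=> k; have e0 : 0 < (8^-1 : R) ^+ k / 2 by rewrite divr_gt0// exprn_gt0// invr_gt0.
    by have /cvgr_distC_le/(_ _ e0)[N _ hN] := cs; exists N => n /hN.
  exists M => // k n nM m mM; rewrite (splitr (8^-1 ^+ k)).
  have -> : s n - s m = (s n - lim (s @ \oo)) - (s m - lim (s @ \oo)) by rewrite opprB addrA subrK.
  by rewrite (le_trans (ler_normB _ _))// lerD//; exact: hM.
have Mle k : (M k <= M k.+1)%N by have := Minc k k.+1; rewrite !leEnat leqnSn.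
pose G k x := normal_sum (fun i => S (e i)) (M k) x.
pose D k x := `|G k.+1 x - G k x| ^+ 2.
have DE k : D k = fun x => `|normal_sum (fun i => if (i < M k)%N then 0 else S (e i)) (M k.+1) x| ^+ 2.
  by apply/funext => x; rewrite /D /G normal_sumB.
have mD k : measurable_fun [set: measurableTypeR R] (D k).
  by rewrite DE; exact: measurable_normal_sum_sqr.
have ID k : (\int[@unif R]_x (D k x)%:E <= (m2 * 8^-1 ^+ k)%:E)%E.
  rewrite DE (le_trans (normal_sum_sqr_le _ _))// lee_fin ler_wpM2l//.
  have := hM k (M k.+1) (Mle k) (M k) (leqnn _); apply: le_trans; apply: le_trans (ler_norm _).
  rewrite lerBrDr /s (big_ord_widen _ (fun i => `|S (e i)| ^+ 2) (Mle k)).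
  rewrite [X in _ + X]big_mkcond -big_split; apply: ler_sum => i _ /=.
  by case: ifP => _; rewrite ?normr0 ?expr0n ?add0r ?addr0.
have [A [mA PA hA]] : exists A : set (measurableTypeR R), [/\ measurable A, @unif R A = 1%E &
    forall x, A x -> exists K : R, forall k, 4 ^+ k * D k x <= K].
  apply: (@bounded_of_summable_integrals _ (measurableTypeR R) R (@unif R) (fun k x => 4 ^+ k * D k x)
    (fun k => m2 * 2^-1 ^+ k) (m2 * 2)) => [k|k x|k|n].
  - exact: measurable_funM.
  - by rewrite mulr_ge0// ?exprn_ge0// sqr_ge0.
  - under eq_integral do rewrite EFinM.
    rewrite ge0_integralZl//.
    + have -> : (m2 * 2^-1 ^+ k)%:E = ((4 ^+ k)%:E * (m2 * 8^-1 ^+ k)%:E)%E.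
        rewrite -EFinM mulrCA -exprMn; congr (_ * _ ^+ _)%:E.
        by rewrite (_ : 8 = 4 * 2) ?invfM ?mulrA ?mulfV ?mul1r// -natrM.
      by apply: lee_wpmul2l; [rewrite lee_fin exprn_ge0|exact: ID].
    + exact/measurable_EFinP.
    + by move=> x _; rewrite lee_fin sqr_ge0.
  - rewrite -mulr_sumr ler_wpM2l// geometric_half_sum.
    have h0 : 0 <= (2^-1 : R) ^+ n by rewrite exprn_ge0// invr_ge0.
    by lra.
have nA : @unif R (~` A) = 0%E by apply: etrans (probability_setC _ mA) _; rewrite PA subee.
have cG x : A x -> cvgn (G ^~ x).
  move=> /hA[K hK]; apply: (@cvg_of_geometric_steps _ _ _ (Num.sqrt K)) => k.
  have K0 : 0 <= K by apply: le_trans (hK 0); rewrite mulr_ge0// sqr_ge0.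
  rewrite -ler_sqr ?nnegrE// ?mulr_ge0 ?sqrtr_ge0 ?exprn_ge0 ?invr_ge0//.
  rewrite exprMn sqr_sqrtr// -exprM mulnC exprM.
  have k4 : 0 < (4 : R) ^+ k by rewrite exprn_gt0.
  rewrite -(ler_pM2l k4) (le_trans (hK k))// mulrCA -exprMn exprVn -natrX mulfV// expr1n mulr1//.
(* The indicator of the full-measure set makes the sequence converge at every point. *)
pose F k x := \1_A x *: G k x.
have cF x : cvgn (F ^~ x).
  rewrite /F indicE; case: (asboolP (A x)) => Ax; last first.
    by rewrite memNset//; under eq_fun do rewrite scale0r; exact: is_cvg_cst.
  by rewrite mem_set//; under eq_fun do rewrite scale1r; exact: cG.
pose Z x := a + lim (F ^~ x @ \oo).
have dotF h x : (fun k => <<F k x, h>>) @ \oo --> <<lim (F ^~ x @ \oo), h>>.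
  by apply: (cvg_dotl dotp_norm); exact: cF.
have mF k h : measurable_fun [set: measurableTypeR R] (fun x => <<F k x, h>>).
  under eq_fun do rewrite dotZl.
  by apply: measurable_funM; [exact: measurable_indic | exact: measurable_dot_normal_sum].
have mZ : measurable_fun [set: measurableTypeR R] (Z : _ -> borel X).
  apply: (measurable_to_borel dotp_norm Xsep) => h; under eq_fun do rewrite dotDl.
  apply: measurable_funD => //.
  by apply: (@measurable_fun_cvg _ _ _ _ (fun k x => <<F k x, h>>)) => // x _; exact: dotF.
pose mu : probability (borel X) R := law (T := measurableTypeR R) (T' := borel X) (@unif R) mZ.
have eqF k h (f : R -> R) : continuous f ->
    \int[@unif R]_x f (<<a, h>> + <<F k x, h>>) = \int[@unif R]_x f (<<a, h>> + <<G k x, h>>).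
  move=> cf; rewrite /Rintegral; congr fine.
  have mf : measurable_fun setT f by exact: continuous_measurable_fun.
  have mdF : measurable_fun [set: measurableTypeR R] (fun x => (f (<<a, h>> + <<F k x, h>>))%:E).
    by apply/measurable_EFinP; apply: (measurableT_comp mf); exact: measurable_funD.
  have mdG : measurable_fun [set: measurableTypeR R] (fun x => (f (<<a, h>> + <<G k x, h>>))%:E).
    apply/measurable_EFinP; apply: (measurableT_comp mf); apply: measurable_funD => //.
    exact: measurable_dot_normal_sum.
  apply: ae_eq_integral => //; exists (~` A); split; first exact: measurableC.
    exact: nA.
  move=> x /= nx Ax; apply: nx => _; rewrite /F indicE mem_set// scale1r//.
(* The variance of the partial sums along [h] is a Bessel sum of [S h]. *)
have limS h : (fun k => expR (- (\sum_(i < M k) <<S (e i), h>> ^+ 2) / 2)) @ \oo -->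
    expR (- <<Q h, h>> / 2).
  apply: continuous_cvg; first exact: continuous_expR.
  apply: cvgMl; apply: cvgN; rewrite QE.
  have E n : \sum_(i < n) <<S (e i), h>> ^+ 2 = \sum_(i < n) <<S h, e i>> ^+ 2.
    by apply: eq_bigr => i _; rewrite Ssym dotC.
  have lim2 := cvg_comp _ _ (cvg_increasing_seq Minc) (@parseval _ _ _ dotp_norm e onb (S h)).
  by under eq_fun do rewrite E; exact: lim2.
have key (f : R -> R) h : continuous f -> (forall y, `|f y| <= 1) ->
    (forall n (c : nat -> R) t, \int[@unif R]_x f (t + \sum_(i < n) c i * iid_normal i x) =
       f t * expR (- (\sum_(i < n) c i ^+ 2) / 2)) ->
    \int[@unif R]_x f <<Z x, h>> = f <<a, h>> * expR (- <<Q h, h>> / 2).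
  move=> cf f1 fE; have mf : measurable_fun setT f by exact: continuous_measurable_fun.
  have c1 : (fun k => \int[@unif R]_x f (<<a, h>> + <<F k x, h>>)) @ \oo -->
      \int[@unif R]_x f <<Z x, h>>.
    apply: (@expect_cvg _ (measurableTypeR R) R (@unif R) _ _ 1) => [k|k x|x].
    - by apply: (measurableT_comp mf); exact: measurable_funD.
    - exact: f1.
    - rewrite dotDl; apply: continuous_cvg; first exact: cf.
      by apply: cvgD; [exact: cvg_cst | exact: dotF].
  apply: (cvg_unique _ c1) => //.
  have E k : \int[@unif R]_x f (<<a, h>> + <<F k x, h>>) =
      f <<a, h>> * expR (- (\sum_(i < M k) <<S (e i), h>> ^+ 2) / 2).
    rewrite (eqF k h f cf) -(fE (M k) (fun i => <<S (e i), h>>)).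
    by apply: eq_Rintegral => x _; rewrite dot_normal_sum.
  rewrite (_ : (fun k => \int[@unif R]_x _) = (fun k =>
      f <<a, h>> * expR (- (\sum_(i < M k) <<S (e i), h>> ^+ 2) / 2))); last exact/funext.
  by apply: cvgMr; exact: limS.
exists mu; apply: (is_gaussian_of_cf dotp_norm linQ Q0) => h.
- rewrite expect_law; last by apply: bmf_cos; exact: measurable_dot.
  apply: key => [x|y|n c t]; [exact: continuous_cos | exact: cos_max | exact: iid_normal_cos].
- rewrite expect_law; last by apply: bmf_sin; exact: measurable_dot.
  apply: key => [x|y|n c t]; [exact: continuous_sin | exact: sin_max | exact: iid_normal_sin].
Qed.

Lemma gaussianP (a : X) (Q S : X -> X) (e : nat -> X) (C : R) :
  nonneg_root dotp Q S -> onb_seq dotp e -> (forall n, \sum_(i < n) <<Q (e i), e i>> <= C) ->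
  is_gaussian dotp a Q (gaussian dotp a Q).
Proof.
move=> SQ onb trC; have [mu gm] := gaussian_exists a SQ onb trC.
exact: (@xgetPex {classic probability (borel X) R} _ (is_gaussian dotp a Q) (ex_intro _ mu gm)).
Qed.

End gaussian_existence.

(** * Covariance operators of the evolution *)

Section gram_operator.
Context (R : realType) (X : completeNormedModType R).
Variable dotp : {dot X for idfun}.
Hypothesis dotp_norm : is_inner_product dotp.
Local Notation "<< x , y >>" := (dotp x y) (at level 0, format "<< x ,  y >>").
Local Notation leb := (@lebesgue_measure R).

Variables (D : set (measurableTypeR R)) (w F : R -> X -> X) (C : R).
Hypothesis mD : measurable D.
Hypothesis w_linear : forall r, D r -> linear (w r).
Hypothesis mw : forall x y, measurable_fun D (fun r => <<w r x, w r y>>).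
Hypothesis C0 : 0 <= C.
Hypothesis w_bound : forall x,
  (\int[leb]_(r in D) (<<w r x, w r x>>)%:E <= (C * `|x| ^+ 2)%:E)%E.
Hypothesis FE : forall r x y, D r -> <<F r x, y>> = <<w r x, w r y>>.

Lemma gram_integrable x y : leb.-integrable D (EFin \o (fun r => <<w r x, w r y>>)).
Proof.
have sq z : leb.-integrable D (EFin \o (fun r => <<w r z, w r z>>)).
  apply/integrableP; split; first exact/measurable_EFinP.
  under eq_integral do rewrite gee0_abs ?lee_fin ?(dotxx_ge0 dotp_norm)//.
  by rewrite (le_lt_trans (w_bound z))// ltry.
apply: (le_integrable mD _ _ (integrableD mD (sq x) (sq y))) => [|r Dr].
  exact/measurable_EFinP.
rewrite /= lee_fin [leRHS]ger0_norm ?addr_ge0 ?(dotxx_ge0 dotp_norm)//.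
rewrite (le_trans (cauchy_schwarz dotp_norm _ _))// !(dotxx dotp_norm).
by have := sqr_ge0 (`|w r x| - `|w r y|); have := normr_ge0 (w r x); have := normr_ge0 (w r y); nra.
Qed.

Definition gram x y : R := \int[leb]_(r in D) <<w r x, w r y>>.

Lemma gram_sym x y : gram x y = gram y x.
Proof. by apply: eq_Rintegral => r _; rewrite (dotC dotp). Qed.

Lemma gram_linear x a u v : gram x (a *: u + v) = a * gram x u + gram x v.
Proof.
rewrite /gram -RintegralZl//; last exact: gram_integrable.
rewrite -RintegralD//; last 2 first.
- have := integrableZl mD a (gram_integrable x u).
  by apply: eq_integrable => // r _; rewrite /= EFinM.
- exact: gram_integrable.
by apply: eq_Rintegral => r /set_mem Dr; rewrite w_linear// (dotDr dotp) (dotZr dotp).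
Qed.

Lemma gram0 x : gram x 0 = 0.
Proof. by have := gram_linear x 1 0 0; rewrite scale1r addr0 mul1r; lra. Qed.

Lemma gram_ge0 x : 0 <= gram x x.
Proof. by apply: Rintegral_ge0 => r _; rewrite (dotxx_ge0 dotp_norm). Qed.

Lemma gram_diag_le x : gram x x <= C * `|x| ^+ 2.
Proof.
rewrite -lee_fin; apply: le_trans (w_bound x); rewrite /gram /Rintegral fineK//.
exact: (integrable_fin_num mD (gram_integrable x x)).
Qed.

(** Positivity of [gram] on the diagonal at [x - y] and at [x + y]. *)
Lemma gram_norm_le x y : `|gram x y| <= C * (`|x| ^+ 2 + `|y| ^+ 2).
Proof.
have pos a : a = 1 \/ a = -1 -> a * gram x y <= C * (`|x| ^+ 2 + `|y| ^+ 2).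
  move=> a1; have := gram_ge0 (x + (- a) *: y); have := gram_diag_le x; have := gram_diag_le y.
  have -> : gram (x + (- a) *: y) (x + (- a) *: y) =
      gram x x + gram y y - (2 * a) * gram x y.
    have lin u v : gram u (x + (- a) *: v) = gram u x - a * gram u v.
      by rewrite addrC gram_linear; ring.
    have lin' u : gram (x + (- a) *: y) u = gram x u - a * gram y u.
      by rewrite gram_sym lin (gram_sym u x) (gram_sym u y).
    rewrite lin !lin' (gram_sym y x).
    by case: a1 => ->; ring.
  have := gram_ge0 x; have := gram_ge0 y; rewrite mulrDr.
  by nra.
have := pos 1 (or_introl erefl); have := pos (-1) (or_intror erefl).
by rewrite mul1r mulN1r ler_norml => h1 h2; rewrite lerNl h1 h2.
Qed.

Local Notation Q := (operator_integral dotp D F).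

(** For fixed [x] the form [gram x] is linear and bounded, so Riesz provides the vector that the
    weak integral is to choose. *)
Lemma operator_integralP x y : <<Q x, y>> = gram x y.
Proof.
suff : exists z, forall y, leb.-integrable D (fun r => (<<F r x, y>>)%:E) /\
    <<z, y>> = \int[leb]_(r in D) <<F r x, y>>.
  move=> /(xgetPex 0)/(_ y)[_ ->]; apply: eq_Rintegral => r /set_mem Dr; exact: FE.
have [||h|z zE] := @riesz R X dotp dotp_norm (gram x) (C * (`|x| ^+ 2 + 1)).
- exact: gram_linear.
- by rewrite mulr_ge0// addr_ge0// sqr_ge0.
- have [->|h0] := eqVneq h 0.
    by rewrite gram0 !normr0 mulr0.
  have nh : 0 < `|h| by rewrite normr_gt0.
  (* Normalising [h] turns a bound by a sum of squares into one that is linear in [|h|]. *)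
  have -> : gram x h = `|h| * gram x (`|h|^-1 *: h).
    have := gram_linear x `|h|^-1 h 0; rewrite addr0 => ->.
    by rewrite gram0 addr0 mulrA mulfV ?gt_eqF// mul1r.
  rewrite normrM normr_id mulrC ler_wpM2r//.
  rewrite (le_trans (gram_norm_le _ _))// normrZ normfV normr_id mulVf ?gt_eqF// expr1n//.
exists z => h; split.
  by have := gram_integrable x h; apply: eq_integrable => // r /set_mem Dr; rewrite /= FE.
by rewrite (dotC dotp) -zE; apply: eq_Rintegral => r /set_mem Dr; rewrite FE.
Qed.

Lemma operator_integral_sym x y : <<Q x, y>> = <<x, Q y>>.
Proof. by rewrite (dotC dotp x) !operator_integralP gram_sym. Qed.

Lemma operator_integral_ge0 x : 0 <= <<Q x, x>>.
Proof. by rewrite operator_integralP gram_ge0. Qed.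

Lemma operator_integral_bounded : bounded_operator Q.
Proof.
have linQ : linear Q.
  move=> a u v; apply: (dot_inj dotp_norm) => z.
  by rewrite (dotDl dotp) (dotZl dotp) !operator_integralP !(gram_sym _ z) gram_linear.
have sc a x : Q (a *: x) = a *: Q x by exact: linfZ.
apply: (@bounded_operator_of_norm R X Q (2 * C)) => // x.
have [->|x0] := eqVneq x 0; first by rewrite (linf0 linQ) !normr0 mulr0.
have [Qx0|Qx0] := eqVneq (Q x) 0; first by rewrite Qx0 normr0 mulr_ge0// mulr_ge0.
have nx : 0 < `|x| by rewrite normr_gt0.
have nQ : 0 < `|Q x| by rewrite normr_gt0.
have := gram_norm_le (`|x|^-1 *: x) (`|Q x|^-1 *: Q x).
rewrite -operator_integralP sc (dotZl dotp) (dotZr dotp) (dotxx dotp_norm) !normrZ !normfV !normr_id.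
rewrite !mulVf ?gt_eqF// expr1n => h.
have {}h : `|x|^-1 * `|Q x| <= 2 * C.
  have e : `|Q x|^-1 * `|Q x| ^+ 2 = `|Q x| by rewrite expr2 mulKf ?gt_eqF.
  by rewrite e in h; lra.
by rewrite -ler_pdivrMr// mulrC.
Qed.

End gram_operator.

Section evolution_covariance.
Context (R : realType) (X : completeNormedModType R).
Variable dotp : {dot X for idfun}.
Hypothesis dotp_norm : is_inner_product dotp.
Hypothesis Xsep : separable X.
Variables (U : R -> R -> X -> X) (B : R -> X -> X).
Hypothesis A1 : evolution_operator U.
Hypothesis A2 : bounded_measurable_family B.
Local Notation "<< x , y >>" := (dotp x y) (at level 0, format "<< x ,  y >>").
Local Notation leb := (@lebesgue_measure R).

Let bU t s : s <= t -> bounded_operator (U t s).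
Proof. by case: A1 => h _ _ _; exact: h. Qed.

Let bB t : bounded_operator (B t).
Proof. by case: A2. Qed.

Let B_bound : exists2 b : R, 0 <= b & forall r x, `|B r x| <= b * `|x|.
Proof.
have [_ sup _] := A2; set s := ereal_sup _ in sup.
have le1 r v : `|v| <= 1 -> (`|B r v|%:E <= s)%E.
  move=> v1; apply: le_trans (ereal_sup_ubound _); last by exists r.
  by apply: ereal_sup_ubound; exists v.
have sf : s \is a fin_num.
  rewrite fin_numElt sup andbT (lt_le_trans _ (le1 0 0 _)) ?ltNyr// normr0 ler01//.
have {}le1 r v : `|v| <= 1 -> `|B r v| <= fine s by move=> /(le1 r); rewrite -{1}(fineK sf) lee_fin.
exists (fine s) => [|r x]; first by apply: le_trans (le1 0 0 _); rewrite ?normr0.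
have [->|x0] := eqVneq x 0; first by have [l _] := bB r; rewrite (linf0 l) !normr0 mulr0.
have nx : 0 < `|x| by rewrite normr_gt0.
have [l _] := bB r; have := le1 r (`|x|^-1 *: x).
rewrite (linfZ l) !normrZ normfV normr_id mulVf ?gt_eqF// => /(_ (lexx _)).
by rewrite mulrC ler_pdivrMr.
Qed.

Let U_within t x : {within `]-oo, t], continuous (fun r => U t r x)}.
Proof.
have [_ cU _ _] := A1; apply/subspace_continuousP => r rt.
have /subspace_continuousP/(_ (r, t)) := cU x.
have rt' : r <= t by move: rt; rewrite /= in_itv.
move=> /(_ rt') h A /h hA.
have : (fun r' : R => (r', t)) @ nbhs r --> (r, t) by exact: (cvg_pair cvg_id (cvg_cst t)).
move=> c; have := c _ hA.
change (nbhs r (fun r' => r' <= t -> A (U t r' x)) ->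
  nbhs r (fun r' => r' \in `]-oo, t] -> A (U t r' x))).
by apply: filterS => r' h'; rewrite in_itv/=.
Qed.

Let mU t x y : measurable_fun (`]-oo, t]%classic : set (measurableTypeR R)) (fun r => <<U t r x, y>>).
Proof.
apply: subspace_continuous_measurable_fun => //.
apply/subspace_continuousP => r rt; have /subspace_continuousP/(_ r rt) h := @U_within t x.
exact: (cvg_comp _ _ h (continuous_dotl dotp_norm (y := y) (x := U t r x))).
Qed.

(** Strong continuity bounds each orbit on the compact segment; Banach-Steinhaus makes the bound
    uniform. *)
Let U_bound t s : exists2 M : R, 0 <= M &
  forall r, s <= r <= t -> forall x, `|U t r x| <= M * `|x|.
Proof.
pose F : set (X -> X) := [set U t r | r in `[s, t]%classic].
have bF f : F f -> bounded_fun_norm f /\ linear f.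
  move=> [r /= rst <-]; have [|l c] := bU (t := t) (s := r); first by move: rst; rewrite in_itv/= => /andP[].
  split => // c0; have [M M0 hM] := bounded_operator_norm (conj l c).
  by exists (M * c0) => x xc; rewrite (le_trans (hM x))// ler_wpM2l.
have pF : pointwise_bounded F.
  move=> x; have : compact [set U t r x | r in `[s, t]].
    apply: continuous_compact; last exact: segment_compact.
    apply: continuous_subspaceW (@U_within t x) => r /=.
    by rewrite !in_itv/= => /andP[].
  move=> /compact_bounded[M [_ hM]]; exists (M + 1) => f [r rst <-].
  by apply: (hM (M + 1)); [rewrite ltrDl | exists r].
have [M hM] := Banach_Steinhauss bF pF 1.
exists `|M| => // r rst x; have [l _] := bU (t := t) (s := r) ltac:(by case/andP: rst).
have [->|x0] := eqVneq x 0; first by rewrite (linf0 l) !normr0 mulr0.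
have nx : 0 < `|x| by rewrite normr_gt0.
have := hM (U t r) _ (`|x|^-1 *: x).
rewrite (linfZ l) !normrZ normfV normr_id mulVf ?gt_eqF// => h.
rewrite mulrC -ler_pdivrMl// (le_trans _ (ler_norm _))//.
by apply: h => //; exists r => //=; rewrite in_itv.
Qed.

(** The integrand of the covariance is the adjoint of this operator times the operator itself, which
    exhibits it as a Gram form. *)
Definition cov_factor t r x := adjoint dotp (B r) (adjoint dotp (U t r) x).

Lemma cov_factorE t r x e : r <= t -> <<cov_factor t r x, e>> = <<x, U t r (B r e)>>.
Proof.
move=> rt; rewrite (dotC dotp) -(adjointP dotp_norm (bB r)) -(adjointP dotp_norm (bU rt)).
exact: dotC.
Qed.

Lemma cov_integrandE t r x y : r <= t ->
  <<cov_integrand dotp U B t r x, y>> = <<cov_factor t r x, cov_factor t r y>>.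
Proof.
by move=> rt; rewrite /cov_integrand /= (adjointP dotp_norm (bU rt)) (adjointP dotp_norm (bB r)).
Qed.

Lemma cov_factor_linear t r : r <= t -> linear (cov_factor t r).
Proof.
move=> rt a u v; rewrite /cov_factor (adjoint_linear dotp_norm (bU rt)).
exact: (adjoint_linear dotp_norm (bB r)).
Qed.

(** Adjoints are moved to the other side: the coordinate along [e i] is [<U t r (B r (e i)), x>],
    and expanding [B r (e i)] in the basis separates the measurable family from the continuous
    one. *)
Lemma measurable_cov_factor t x y :
  measurable_fun (`]-oo, t]%classic : set (measurableTypeR R))
    (fun r => <<cov_factor t r x, cov_factor t r y>>).
Proof.
have [e onb _] := onb_seq_exists dotp_norm Xsep.
have mB z h : measurable_fun (`]-oo, t]%classic : set (measurableTypeR R)) (fun r => <<B r z, h>>).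
  apply: measurable_funTS; have [_ _ mB] := A2.
  exact: (measurableT_comp (@measurable_dot _ _ _ dotp_norm h) (mB z)).
have mw z i : measurable_fun (`]-oo, t]%classic : set (measurableTypeR R))
    (fun r => <<cov_factor t r z, e i>>).
  apply: (@measurable_fun_cvg _ _ _ _
    (fun n r => \sum_(j < n) <<B r (e i), e j>> * <<U t r (e j), z>>)) => [n|r /=].
    by apply: measurable_sum => j; apply: measurable_funM; [exact: mB | exact: mU].
  rewrite in_itv/= => rt; rewrite cov_factorE// (dotC dotp).
  have [l c] := bU rt.
  have E n : \sum_(j < n) <<B r (e i), e j>> * <<U t r (e j), z>> =
      <<U t r (onb_proj dotp e n (B r (e i))), z>>.
    rewrite /onb_proj; elim/big_ind2 : _ => [|a1 b1 a2 b2 h1 h2|j _].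
    - by rewrite (linf0 l) (dot0l dotp).
    - by rewrite (linfD l) (dotDl dotp) h1 h2.
    - by rewrite (linfZ l) (dotZl dotp).
  under eq_fun do rewrite E.
  apply: (cvg_dotl dotp_norm); apply: continuous_cvg; first exact: c.
  exact: onb_proj_cvg.
apply: (@measurable_fun_cvg _ _ _ _
  (fun n r => \sum_(i < n) <<cov_factor t r x, e i>> * <<cov_factor t r y, e i>>)) => [n|r _].
  by apply: measurable_sum => j; apply: measurable_funM; exact: mw.
exact: parseval_dot.
Qed.

Let mw_itv t s x y :
  measurable_fun (`[s, t]%classic : set (measurableTypeR R))
    (fun r => <<cov_factor t r x, cov_factor t r y>>).
Proof.
apply: (measurable_funS _ _ (@measurable_cov_factor t x y)) => // r /=.
by rewrite !in_itv/= => /andP[].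
Qed.

Let cov_factor_bound t s : s <= t -> exists2 C : R, 0 <= C & forall x,
  (\int[leb]_(r in `[s, t]) (<<cov_factor t r x, cov_factor t r x>>)%:E <= (C * `|x| ^+ 2)%:E)%E.
Proof.
move=> st; have [b b0 Bb] := B_bound; have [M M0 UM] := U_bound t s.
exists ((b * M) ^+ 2 * (t - s)); first by rewrite mulr_ge0 ?sqr_ge0// subr_ge0.
move=> x; apply: (@le_trans _ _ (\int[leb]_(r in `[s, t]) (cst ((b * M * `|x|) ^+ 2)%:E r))%E).
  apply: ge0_le_integral => //=.
  - by move=> r _; rewrite lee_fin (dotxx_ge0 dotp_norm).
  - by apply/measurable_EFinP; exact: mw_itv.
  - move=> r; rewrite in_itv/= => rst; rewrite lee_fin (dotxx dotp_norm) ler_sqr ?nnegrE ?mulr_ge0//.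
    have rt : r <= t by case/andP: rst.
    apply: le_trans (adjoint_norm dotp_norm (bB r) (Bb r) _) _.
    by rewrite -mulrA ler_wpM2l// (adjoint_norm dotp_norm (bU rt) (UM r rst)).
rewrite integral_cst//.
have lst : leb `[s, t]%classic = (t - s)%:E.
  apply: etrans (@lebesgue_measure_itv R `[s, t]) _; rewrite /= lte_fin.
  case: ltP => [_|ts]; first by rewrite -EFinB.
  by congr (_%:E); apply/eqP; rewrite eq_sym subr_eq0 eq_le st ts.
set m := (X in (_ * X <= _)%E); have -> : m = (t - s)%:E by exact: lst.
by rewrite -EFinM lee_fin !exprMn; nra.
Qed.

Let segment_integral_le t (f : R -> R) (c : R) :
  measurable_fun (`]-oo, t]%classic : set (measurableTypeR R)) f -> (forall r, 0 <= f r) ->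
  (forall s, (s < t)%R -> \int[leb]_(r in `[s, t]) (f r)%:E <= c%:E)%E ->
  (\int[leb]_(r in `]-oo, t]) (f r)%:E <= c%:E)%E.
Proof.
move=> mf f0 fc; pose F n : set (measurableTypeR R) := `[t - n.+1%:R, t]%classic.
have FU : `]-oo, t]%classic = \bigcup_n F n.
  apply/seteqP; split => r; last by move=> [n _]; rewrite /F /= !in_itv/= => /andP[].
  rewrite /= in_itv/= => rt; have [n _ /(_ n (leqnn n))/= h] := nbhs_infty_gtr (t - r).
  by exists n => //; rewrite /F /= in_itv/= rt andbT; rewrite -natr1; lra.
have tn n : t - n.+1%:R < t by rewrite ltrBlDr ltrDl ltr0Sn.
have c1 : ((\int[leb]_(r in F n) (f r)%:E)%E @[n --> \oo] -->
    (\int[leb]_(r in \bigcup_n F n) (f r)%:E)%E).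
  apply: ge0_nondecreasing_set_cvg_integral => [n m nm|n|n|n r _].
  - rewrite subsetEset => r; rewrite /F /= !in_itv/= => /andP[h ->]; rewrite andbT.
    by apply: le_trans h; rewrite lerD2l lerN2 ler_nat.
  - exact: measurable_itv.
  - apply/measurable_EFinP; apply: (measurable_funS _ _ mf) => //.
    by rewrite FU; exact: bigcup_sup.
  - by rewrite lee_fin.
rewrite FU -(cvg_lim _ c1)//; apply: lime_le; first by apply/cvg_ex; eexists; exact: c1.
by apply: nearW => n; exact: fc.
Qed.

Section segments.
Variables t s : R.
Hypothesis st : s <= t.

Let FE (r : R) x y : (`[s, t]%classic : set (measurableTypeR R)) r ->
  <<cov_integrand dotp U B t r x, y>> = <<cov_factor t r x, cov_factor t r y>>.
Proof. by rewrite /= in_itv/= => /andP[_]; exact: cov_integrandE. Qed.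

Let lin (r : R) : (`[s, t]%classic : set (measurableTypeR R)) r -> linear (cov_factor t r).
Proof. by rewrite /= in_itv/= => /andP[_]; exact: cov_factor_linear. Qed.

Let mD : measurable (`[s, t]%classic : set (measurableTypeR R)). Proof. exact: measurable_itv. Qed.

Lemma cov_bounded : bounded_operator (cov dotp U B t s).
Proof.
have [C C0 wC] := cov_factor_bound st.
exact: (operator_integral_bounded dotp_norm mD lin (@mw_itv t s) C0 wC FE).
Qed.

Lemma cov_sym x y : <<cov dotp U B t s x, y>> = <<x, cov dotp U B t s y>>.
Proof.
have [C C0 wC] := cov_factor_bound st.
exact: (operator_integral_sym dotp_norm mD lin (@mw_itv t s) C0 wC FE).
Qed.

Lemma cov_ge0 x : 0 <= <<cov dotp U B t s x, x>>.
Proof.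
have [C C0 wC] := cov_factor_bound st.
exact: (operator_integral_ge0 dotp_norm mD lin (@mw_itv t s) C0 wC FE).
Qed.

Lemma covE x y : <<cov dotp U B t s x, y>> = gram dotp `[s, t]%classic (cov_factor t) x y.
Proof.
have [C C0 wC] := cov_factor_bound st.
exact: (operator_integralP dotp_norm mD lin (@mw_itv t s) C0 wC FE).
Qed.

Lemma cov_integral x : (\int[leb]_(r in `[s, t]) (<<cov_factor t r x, cov_factor t r x>>)%:E)%E =
  (<<cov dotp U B t s x, x>>)%:E.
Proof.
have [C C0 wC] := cov_factor_bound st.
rewrite covE /gram /Rintegral fineK//; apply: (integrable_fin_num mD).
exact: (gram_integrable dotp_norm mD (@mw_itv t s) wC).
Qed.

End segments.

Variable e : nat -> X.
Hypothesis onb : onb_seq dotp e.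
Hypothesis e_trace : forall (Q : X -> X) (C : R), (forall x, 0 <= <<Q x, x>>) ->
  (trace dotp Q <= C%:E)%E -> forall n, \sum_(i < n) <<Q (e i), e i>> <= C.
Hypothesis A4 : stable_evolution dotp U B.

(** With [S] the root, [<Q x, x> = |S x|^2] is the sum of the [<x, S e_i>^2], hence at most [|x|^2]
    times the sum of the [|S e_i|^2]. *)
Let diag_le_trace (Q : X -> X) (C : R) : bounded_operator Q ->
  (forall x y, <<Q x, y>> = <<x, Q y>>) -> (forall x, 0 <= <<Q x, x>>) ->
  (forall n, \sum_(i < n) <<Q (e i), e i>> <= C) -> forall x, <<Q x, x>> <= C * `|x| ^+ 2.
Proof.
move=> bQ Qsym Q0 QC x; have [S [bS Ssym _ SS]] := nonneg_root_exists dotp_norm bQ Qsym Q0.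
have QE y : <<Q y, y>> = `|S y| ^+ 2 by rewrite -SS Ssym dotxx.
rewrite QE; apply: (cvgr_to_le (parseval dotp_norm onb (x := S x))); apply: nearW => n.
apply: (@le_trans _ _ (\sum_(i < n) `|x| ^+ 2 * <<Q (e i), e i>>)).
  apply: ler_sum => i _; rewrite QE Ssym -exprMn -real_normK ?num_real//.
  by rewrite ler_sqr ?nnegrE ?mulr_ge0// cauchy_schwarz.
by rewrite -mulr_sumr mulrC ler_wpM2r// sqr_ge0.
Qed.

Let cov_trace t : exists2 C : R, 0 <= C &
  forall s, s < t -> forall n, \sum_(i < n) <<cov dotp U B t s (e i), e i>> <= C.
Proof.
have [sup _] := A4 t; set z := ereal_sup _ in sup.
have le s : s < t -> (trace dotp (cov dotp U B t s) <= z)%E.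
  by move=> st; apply: ereal_sup_ubound; exists s.
have z0 : (0 <= z)%E.
  have h : t - 1 < t by rewrite ltrBlDr ltrDl ltr01.
  by apply: le_trans (le _ h); apply: esum_ge0 => x _; rewrite lee_fin cov_ge0// ltW.
have zf : z \is a fin_num by rewrite ge0_fin_numE.
exists (fine z); first exact: fine_ge0.
move=> s st; apply: e_trace; first by move=> x; rewrite cov_ge0// ltW.
by rewrite fineK//; exact: le.
Qed.

Section half_line.
Variable t : R.

Let D : set (measurableTypeR R) := `]-oo, t]%classic.

Let mD : measurable D. Proof. exact: measurable_itv. Qed.

Let FE (r : R) x y : D r ->
  <<cov_integrand dotp U B t r x, y>> = <<cov_factor t r x, cov_factor t r y>>.
Proof. by rewrite /D /= in_itv/=; exact: cov_integrandE. Qed.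

Let lin (r : R) : D r -> linear (cov_factor t r).
Proof. by rewrite /D /= in_itv/=; exact: cov_factor_linear. Qed.

(** Integrals over segments are bounded by traces, which (A4) bounds uniformly in the left endpoint;
    monotone convergence reaches the half-line. *)
Let bound : exists2 C : R, 0 <= C & forall x,
  (\int[leb]_(r in D) (<<cov_factor t r x, cov_factor t r x>>)%:E <= (C * `|x| ^+ 2)%:E)%E.
Proof.
have [C C0 hC] := cov_trace t; exists C => // x.
apply: segment_integral_le => [|r|s st]; first exact: measurable_cov_factor.
- exact: dotxx_ge0.
- rewrite (cov_integral (ltW st)) lee_fin; apply: diag_le_trace; [exact: cov_bounded (ltW st)| | |exact: hC].
  + exact: cov_sym (ltW st).
  + exact: cov_ge0 (ltW st).
Qed.

Lemma cov_ninfty_bounded : bounded_operator (cov_ninfty dotp U B t).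
Proof.
have [C C0 wC] := bound.
exact: (operator_integral_bounded dotp_norm mD lin (@measurable_cov_factor t) C0 wC FE).
Qed.

Lemma cov_ninfty_sym x y : <<cov_ninfty dotp U B t x, y>> = <<x, cov_ninfty dotp U B t y>>.
Proof.
have [C C0 wC] := bound.
exact: (operator_integral_sym dotp_norm mD lin (@measurable_cov_factor t) C0 wC FE).
Qed.

Lemma cov_ninfty_ge0 x : 0 <= <<cov_ninfty dotp U B t x, x>>.
Proof.
have [C C0 wC] := bound.
exact: (operator_integral_ge0 dotp_norm mD lin (@measurable_cov_factor t) C0 wC FE).
Qed.

Lemma cov_ninftyE x y : <<cov_ninfty dotp U B t x, y>> = gram dotp D (cov_factor t) x y.
Proof.
have [C C0 wC] := bound.
exact: (operator_integralP dotp_norm mD lin (@measurable_cov_factor t) C0 wC FE).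
Qed.

Lemma cov_ninfty_integrable x y :
  leb.-integrable D (EFin \o (fun r => <<cov_factor t r x, cov_factor t r y>>)).
Proof.
have [C C0 wC] := bound.
exact: (gram_integrable dotp_norm mD (@measurable_cov_factor t) wC).
Qed.

Lemma cov_ninfty_trace : exists C : R,
  forall n, \sum_(i < n) <<cov_ninfty dotp U B t (e i), e i>> <= C.
Proof.
have [C C0 hC] := cov_trace t; exists C => n.
have I (D' : set (measurableTypeR R)) : measurable D' -> D' `<=` D ->
    (\int[leb]_(r in D') (\sum_(i < n) <<cov_factor t r (e i), cov_factor t r (e i)>>)%:E =
    \sum_(i < n) \int[leb]_(r in D') (<<cov_factor t r (e i), cov_factor t r (e i)>>)%:E)%E.
  move=> mD' DD; under eq_integral do rewrite -sumEFin.
  rewrite ge0_integral_sum// => [i|i r _]; last by rewrite lee_fin dotxx_ge0.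
  by apply/measurable_EFinP; apply: (measurable_funS _ _ (@measurable_cov_factor t _ _)).
rewrite -lee_fin -sumEFin.
under eq_bigr => i _.
  rewrite cov_ninftyE /gram /Rintegral fineK; last exact: (integrable_fin_num mD (cov_ninfty_integrable _ _)).
  over.
rewrite -I//; apply: segment_integral_le => [|r|s st].
- by apply: measurable_sum => i; exact: measurable_cov_factor.
- by apply: sumr_ge0 => i _; exact: dotxx_ge0.
- rewrite I//; last by move=> r; rewrite /D /= !in_itv/= => /andP[].
  by under eq_bigr do rewrite (cov_integral (ltW st)); rewrite sumEFin lee_fin hC.
Qed.

End half_line.

(** The integral is cut at [s]. For [r <= s] the law [U t r = U t s U s r] makes [cov_factor t r]
    equal to [cov_factor s r] after the adjoint of [U t s]. *)
Lemma cov_ninfty_split t s x y : s < t ->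
  <<cov_ninfty dotp U B t x, y>> =
  <<cov_ninfty dotp U B s (adjoint dotp (U t s) x), adjoint dotp (U t s) y>> +
  <<cov dotp U B t s x, y>>.
Proof.
move=> st; have stl := ltW st.
rewrite !cov_ninftyE (covE stl) /gram.
have facE r z : r <= s -> cov_factor t r z = cov_factor s r (adjoint dotp (U t s) z).
  move=> rs; apply: (dot_inj dotp_norm) => h.
  rewrite !cov_factorE// ?(le_trans rs)// -[in RHS](dotC dotp) -(adjointP dotp_norm (bU stl)).
  by have [_ _ _ UU] := A1; rewrite UU// (dotC dotp).
have -> : \int[leb]_(r in `]-oo, s]) <<cov_factor s r (adjoint dotp (U t s) x),
      cov_factor s r (adjoint dotp (U t s) y)>> =
    \int[leb]_(r in `]-oo, s]) <<cov_factor t r x, cov_factor t r y>>.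
  by apply: eq_Rintegral => r; rewrite inE/= in_itv/= => rs; rewrite !facE.
have i := cov_ninfty_integrable t x y.
have DE : `]-oo, t]%classic = `]-oo, s]%classic `|` `]s, t]%classic :> set R.
  apply/seteqP; split => r /=; rewrite !in_itv/=.
    by move=> rt; have [rs|rs] := leP r s; [left | right; rewrite rt].
  by move=> [rs|/andP[]//]; exact: le_trans rs stl.
rewrite -(@Rintegral_itv_obnd_cbnd R s (BRight t)); last first.
  by apply: integrableS i => //; rewrite DE; exact: subsetUr.
rewrite {1}DE Rintegral_setU//; first by rewrite -DE.
apply/disj_set2P; apply/seteqP; split => r //= []; rewrite !in_itv/= => rs /andP[sr _].
by move: sr; rewrite ltNge rs.
Qed.

End evolution_covariance.

(** * Cameron-Martin spaces *)

Section ultrafilter_subsequences.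
Context (R : realType).

Lemma bounded_ultra_cvg (F : set_system nat) (FF : UltraFilter F) (u : nat -> R) (M : R) :
  (forall n, `|u n| <= M) -> exists l : R, u n @[n --> F] --> l.
Proof.
move=> uM; have cK := @segment_compact R (- M) M.
have : F (u @^-1` `[- M, M]%classic).
  by apply: filterE => n /=; rewrite in_itv/=; have := uM n; rewrite ler_norml.
move=> /(cK (u @ F) _)[l [_ cl]]; exists l => B Bl.
have [//|nB] := in_ultra_setVsetC (u @^-1` B) FF.
by have [x [nBx Bx]] := cl (~` B) B nB Bl.
Qed.

Lemma ultra_free_exists : exists2 F : set_system nat, UltraFilter F &
  forall N, F [set n | (N <= n)%N].
Proof.
have [F [UF sF]] := ultraFilterLemma (F := \oo) _.
by exists F => // N; apply: sF; exists N.
Qed.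

Lemma ultra_cauchy_coordinates (F : set_system nat) (FF : UltraFilter F) (a : nat -> nat -> R)
    (M : nat -> R) : (forall i n, `|a i n| <= M i) ->
  forall N (eps : R), 0 < eps -> exists2 S, F S &
    forall n m, S n -> S m -> forall i, (i < N)%N -> `|a i n - a i m| <= eps.
Proof.
move=> aM N eps eps0; elim: N => [|N [S FS hS]].
  by exists setT => //; exact: filterT.
have [l al] := bounded_ultra_cvg FF (aM N); have eps2 : 0 < eps / 2 by rewrite divr_gt0.
have /cvgr_distC_le/(_ _ eps2) FT := al.
exists (S `&` [set n | `|a N n - l| <= eps / 2]); first exact: filterI.
move=> n m [Sn Tn] [Sm Tm] i; rewrite ltnS leq_eqVlt => /orP[/eqP ->|]; last exact: hS.
have -> : a N n - a N m = (a N n - l) - (a N m - l) by rewrite opprB addrA subrK.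
by rewrite (splitr eps) (le_trans (ler_normB _ _))// lerD.
Qed.

(** [T i] is the intersection of the first sets [S j]; being in the ultrafilter it has points beyond
    any index, so [k (i+1)] is taken in it after [k i]. *)
Lemma ultra_cauchy_subsequence (F : set_system nat) (FF : UltraFilter F) (d : nat -> nat -> R) :
  (forall N, F [set n | (N <= n)%N]) ->
  (forall e : R, 0 < e -> exists2 S, F S & forall n m, S n -> S m -> d n m <= e) ->
  exists2 k : nat -> nat, increasing_seq k &
    forall i j, (i <= j)%N -> d (k i) (k j) <= 2^-1 ^+ i.
Proof.
move=> Fn Fd.
have /choice[S hS] : forall i, exists S, F S /\ forall n m, S n -> S m -> d n m <= 2^-1 ^+ i.
  by move=> i; have [|S FS hS] := Fd (2^-1 ^+ i); [rewrite exprn_gt0// invr_gt0 | exists S].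
pose T i := [set n | forall j, (j <= i)%N -> S j n].
have FT i : F (T i).
  elim: i => [|i IH].
    by apply: filterS (hS 0%N).1 => n Sn j; rewrite leqn0 => /eqP ->.
  apply: filterS (filterI IH (hS i.+1).1) => n [Tn Sn] j.
  by rewrite leq_eqVlt => /orP[/eqP ->//|]; rewrite ltnS => /Tn.
have /choice[f hf] : forall p : nat * nat, exists n, (p.2 < n)%N /\ T p.1 n.
  move=> p; have [n [? ?]] := @filter_ex _ _ _ _ (filterI (Fn p.2.+1) (FT p.1)).
  by exists n.
pose k := fix k i := if i is i'.+1 then f (i'.+1, k i') else f (0, 0)%N.
exists k.
  by apply/increasing_seqP => i; have [h _] := hf (i.+1, k i).
move=> i j ij; have kT l : T l (k l) by case: l => [|l]; [have [_] := hf (0, 0)%N | have [_] := hf (l.+1, k l)].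
by apply: (hS i).2; [exact: kT | exact: kT].
Qed.

End ultrafilter_subsequences.

Lemma cvg_sqr (R : realType) (u : nat -> R) (l : R) :
  u @ \oo --> l -> (fun n => u n ^+ 2) @ \oo --> l ^+ 2.
Proof. by move=> ul; under eq_fun do rewrite expr2; rewrite expr2; exact: (cvgM ul ul). Qed.

Section cameron_martin.
Context (R : realType) (X : completeNormedModType R).
Variable dotp : {dot X for idfun}.
Hypothesis dotp_norm : is_inner_product dotp.
Local Notation "<< x , y >>" := (dotp x y) (at level 0, format "<< x ,  y >>").

Lemma sqrt_operatorP (Q : X -> X) : bounded_operator Q ->
  (forall x y, <<Q x, y>> = <<x, Q y>>) -> (forall x, 0 <= <<Q x, x>>) ->
  nonneg_root dotp Q (sqrt_operator dotp Q).
Proof. by move=> bQ sQ Q0; apply: xgetPex; exact: nonneg_root_exists. Qed.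

Definition perp_ker (S : X -> X) z := forall k, S k = 0 -> <<z, k>> = 0.

Lemma perp_ker_lim (S : X -> X) (u : nat -> X) z : (forall x y, <<S x, y>> = <<x, S y>>) ->
  (fun n => S (u n)) @ \oo --> z -> perp_ker S z.
Proof.
move=> Ssym uz k Sk0; have c : (fun n => <<S (u n), k>>) @ \oo --> <<z, k>> by exact: cvg_dotl.
have c0 : (fun n => <<S (u n), k>>) @ \oo --> (0 : R).
  by under eq_fun do rewrite Ssym Sk0 (dot0r dotp); exact: cvg_cst.
exact: (etrans (esym (cvg_lim (@Rhausdorff R) c)) (cvg_lim (@Rhausdorff R) c0)).
Qed.

Lemma perp_ker_range (S : X -> X) z : (forall x y, <<S x, y>> = <<x, S y>>) -> perp_ker S (S z).
Proof. by move=> Ssym k Sk; rewrite Ssym Sk (dot0r dotp). Qed.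

Lemma perp_kerB (S : X -> X) y z : perp_ker S y -> perp_ker S z -> perp_ker S (y - z).
Proof. by move=> hy hz k Sk; rewrite (dotBl dotp) hy// hz// subr0. Qed.

Lemma inv_sqrtK (Q : X -> X) z : nonneg_root dotp Q (sqrt_operator dotp Q) ->
  perp_ker (sqrt_operator dotp Q) z -> inv_sqrt dotp Q (sqrt_operator dotp Q z) = z.
Proof.
move=> [[l _] _ _ _] pz; set S := sqrt_operator dotp Q in pz l *.
have [p e] : [set y | perp_ker S y /\ S y = S z] (inv_sqrt dotp Q (S z)).
  by apply: (@xgetPex _ 0 [set y | perp_ker S y /\ S y = S z]); exists z.
set y := inv_sqrt dotp Q (S z) in p e *; apply/eqP; rewrite -subr_eq0 -normr_eq0.
rewrite -sqrf_eq0 -(dotxx dotp_norm) (dotBl dotp) p ?pz ?subrr//.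
by rewrite (linfB l) e subrr.
by rewrite (linfB l) e subrr.
Qed.

(** [z] is the projection of [y] onto the closure of the range of the root, obtained from Riesz with
    the form [<S y, .>]. *)
Lemma perp_ker_rep (Q : X -> X) y : nonneg_root dotp Q (sqrt_operator dotp Q) ->
  exists z, [/\ perp_ker (sqrt_operator dotp Q) z,
    sqrt_operator dotp Q z = sqrt_operator dotp Q y & `|z| <= `|y|].
Proof.
move=> rQ; set S := sqrt_operator dotp Q; have [[linS _] Ssym _ _] := rQ.
have [| | |k|z [zE zy [u uz]]] := @variational_riesz R X dotp dotp_norm X S (fun k => <<S y, k>>) `|y|.
- exact: linS.
- by move=> a u v; rewrite (dotDr dotp) (dotZr dotp).
- exact: normr_ge0.
- by rewrite Ssym cauchy_schwarz.
exists z; split => //; first by apply: perp_ker_lim uz.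
by apply: (dot_inj dotp_norm) => k; rewrite zE Ssym; exact: dotC.
Qed.

Lemma cm_norm_root (Q : X -> X) z : nonneg_root dotp Q (sqrt_operator dotp Q) ->
  perp_ker (sqrt_operator dotp Q) z -> cm_norm dotp Q (sqrt_operator dotp Q z) = `|z|%:E.
Proof. by move=> rQ pz; rewrite /cm_norm inv_sqrtK. Qed.

Lemma cm_norm_le (Q : X -> X) y : nonneg_root dotp Q (sqrt_operator dotp Q) ->
  (cm_norm dotp Q (sqrt_operator dotp Q y) <= `|y|%:E)%E.
Proof.
by move=> rQ; have [z [pz <- zy]] := perp_ker_rep y rQ; rewrite cm_norm_root// lee_fin.
Qed.

Lemma cm_spaceP (Q : X -> X) h : nonneg_root dotp Q (sqrt_operator dotp Q) ->
  cm_space dotp Q h ->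
  exists z, [/\ perp_ker (sqrt_operator dotp Q) z, sqrt_operator dotp Q z = h &
    cm_norm dotp Q h = `|z|%:E].
Proof.
move=> rQ [y _ <-]; have [z [pz zy _]] := perp_ker_rep y rQ.
by exists z; rewrite -zy cm_norm_root.
Qed.

Section transfer.
Variables (A Qs Qt : X -> X).
Hypothesis bA : bounded_operator A.
Local Notation Ss := (sqrt_operator dotp Qs).
Local Notation St := (sqrt_operator dotp Qt).
Hypothesis rs : nonneg_root dotp Qs Ss.
Hypothesis rt : nonneg_root dotp Qt St.

Definition transfer h := Ss (adjoint dotp A h).
Local Notation kap := transfer.

Hypothesis kap_le : forall h, `|kap h| <= `|St h|.

Let linSs : linear Ss. Proof. by case: rs => [[]]. Qed.
Let linSt : linear St. Proof. by case: rt => [[]]. Qed.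
Let symSs x y : <<Ss x, y>> = <<x, Ss y>>. Proof. by case: rs. Qed.
Let symSt x y : <<St x, y>> = <<x, St y>>. Proof. by case: rt. Qed.

Lemma transfer_linear : linear kap.
Proof. by move=> a u v; rewrite /kap (adjoint_linear dotp_norm bA) linSs. Qed.

(** Riesz on the range of [St]: the form [St h |-> <z, kap h>] is bounded, and its representative
    [w] satisfies [St w = A (Ss z)]. Thus [w] is the image of [z] under U(t,s) once both
    Cameron-Martin spaces are pulled back to X. *)
Lemma transfer_dual (rho : R) : 0 <= rho -> (forall h, `|kap h| <= rho * `|St h|) ->
  forall z, exists w, [/\ perp_ker St w, St w = A (Ss z), `|w| <= rho * `|z|,
    forall h, <<w, St h>> = <<z, kap h>> &
    exists u : nat -> X, (fun n => St (u n)) @ \oo --> w].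
Proof.
move=> rho0 kr z.
have [||h|w [wE wz [u uw]]] := @variational_riesz R X dotp dotp_norm X St
  (fun h => <<z, kap h>>) (rho * `|z|) linSt.
- by move=> a u v; rewrite transfer_linear (dotDr dotp) (dotZr dotp).
- by rewrite mulr_ge0.
- rewrite (le_trans (cauchy_schwarz dotp_norm _ _))// -mulrA mulrCA ler_wpM2l//.
exists w; split => //; last 1 first.
  by exists u.
  by apply: perp_ker_lim uw.
  apply: (dot_inj dotp_norm) => h.
  by rewrite (adjointP dotp_norm bA) symSs -/(kap h) wE symSt; exact: dotC.
by move=> h; rewrite (dotC dotp) wE.
Qed.

(** U(t,s) : H_s -> H_t read on X through the two roots; it is the adjoint of [St h |-> kap h]. *)
Let dual z := inv_sqrt dotp Qt (A (Ss z)).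

Let dualP z : [/\ perp_ker St (dual z), St (dual z) = A (Ss z) &
  forall h, <<dual z, St h>> = <<z, kap h>>].
Proof.
have [|w [pw Sw _ wE _]] := transfer_dual ler01 _ z.
  by move=> h; rewrite mul1r.
by rewrite /dual -Sw inv_sqrtK.
Qed.

Let dual_norm z : cm_norm dotp Qt (A (Ss z)) = `|dual z|%:E.
Proof. by []. Qed.

Let dualB y z : dual (y - z) = dual y - dual z.
Proof.
have [py Sy _] := dualP y; have [pz Sz _] := dualP z.
have [linA _] := bA.
by rewrite {1}/dual (linfB linSs) (linfB linA) -Sy -Sz -(linfB linSt) inv_sqrtK//; exact: perp_kerB.
Qed.

Local Notation U_norm := (opnorm (cm_space dotp Qs) (cm_norm dotp Qs) (cm_norm dotp Qt) A).
Local Notation U_compact := (compact_operator (cm_space dotp Qs) (cm_norm dotp Qs)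
  (cm_space dotp Qt) (cm_norm dotp Qt) A).

Lemma opnorm_le (rho : R) : 0 <= rho -> (forall h, `|kap h| <= rho * `|St h|) ->
  (U_norm <= rho%:E)%E.
Proof.
move=> rho0 kr; apply: ub_ereal_sup => _ [v [Hv nv] <-].
have [z [pz zv nz]] := cm_spaceP rs Hv; rewrite -zv.
have [w [pw Sw wz _ _]] := transfer_dual rho0 kr z.
rewrite -Sw cm_norm_root// lee_fin (le_trans wz)//.
by move: nv; rewrite nz lee_fin; nra.
Qed.

Lemma opnorm_ge0 : (0 <= U_norm)%E.
Proof.
apply: (@le_trans _ _ (cm_norm dotp Qt (A (Ss 0)))); first by rewrite dual_norm lee_fin.
apply: ereal_sup_ubound; exists (Ss 0) => //; split; first by exists 0.
by rewrite cm_norm_root ?normr0 ?lee_fin// => k _; exact: (dot0l dotp).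
Qed.

(** Test at the unit vector [z] along [kap h], for which [<dual z, St h> = |kap h|]. *)
Lemma transfer_le (rho : R) : (U_norm <= rho%:E)%E -> forall h, `|kap h| <= rho * `|St h|.
Proof.
move=> Ur h; have rho0 : 0 <= rho by rewrite -lee_fin (le_trans opnorm_ge0).
have [->|k0] := eqVneq (kap h) 0; first by rewrite normr0 mulr_ge0.
have nk : 0 < `|kap h| by rewrite normr_gt0.
pose z := `|kap h|^-1 *: kap h.
have nz : `|z| = 1 by rewrite normrZ normfV normr_id mulVf// gt_eqF.
have pz : perp_ker Ss z by move=> k Sk; rewrite (dotZl dotp) (perp_ker_range _ symSs)// mulr0.
have [_ _ dE] := dualP z.
have dr : `|dual z| <= rho.
  rewrite -lee_fin -dual_norm (le_trans _ Ur)//; apply: ereal_sup_ubound.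
  by exists (Ss z) => //; split; [exists z | rewrite cm_norm_root// nz lee_fin].
have : `|kap h| = <<dual z, St h>>.
  by rewrite dE (dotZl dotp) (dotxx dotp_norm) expr2 mulKf// gt_eqF.
by move=> ->; rewrite (le_trans (dot_le dotp_norm _ _))// ler_wpM2r.
Qed.

Variable e : nat -> X.
Hypothesis onb : onb_seq dotp e.

(** Compactness of [St h |-> kap h] stated as an inequality. The same integer counts the coordinates
    and weighs them, so counterexamples for all [N] have, after normalisation, every fixed
    coordinate tending to 0. *)
Definition finite_rank_bound := forall eps : R, 0 < eps -> exists N : nat, forall h,
  `|kap h| ^+ 2 <= eps * `|St h| ^+ 2 + N%:R * \sum_(i < N) <<St h, e i>> ^+ 2.

(** The counterexamples [g n] are divided by [|kap (g n)|]: the term in [eps] then bounds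
    [St (h n)], the weight [n] drives each coordinate to 0, and both together give weak
    convergence. *)
Let weak_null (eps : R) : 0 < eps -> (forall N : nat, exists h,
    eps * `|St h| ^+ 2 + N%:R * \sum_(i < N) <<St h, e i>> ^+ 2 < `|kap h| ^+ 2) ->
  exists h : nat -> X, [/\ forall n, `|kap (h n)| = 1,
    exists M : R, forall n, `|St (h n)| <= M &
    forall y, (fun n => <<y, St (h n)>>) @ \oo --> (0 : R)].
Proof.
move=> eps0 /choice[g hg].
have g0 n : 0 < `|kap (g n)|.
  rewrite lt_neqAle normr_ge0 andbT eq_sym; apply/eqP => k0.
  have := hg n; rewrite k0 expr0n/= ltNge addr_ge0// mulr_ge0 ?sqr_ge0//; first exact: ltW.
  by apply: sumr_ge0 => i _; exact: sqr_ge0.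
pose h n := `|kap (g n)|^-1 *: g n.
have kh n : kap (h n) = `|kap (g n)|^-1 *: kap (g n) by rewrite (linfZ transfer_linear).
have Sh n : St (h n) = `|kap (g n)|^-1 *: St (g n) by rewrite (linfZ linSt).
have nh n : `|kap (h n)| = 1 by rewrite kh normrZ normfV normr_id mulVf// gt_eqF.
have hh n : eps * `|St (h n)| ^+ 2 + n%:R * \sum_(i < n) <<St (h n), e i>> ^+ 2 < 1.
  have -> : eps * `|St (h n)| ^+ 2 + n%:R * \sum_(i < n) <<St (h n), e i>> ^+ 2 =
     (eps * `|St (g n)| ^+ 2 + n%:R * \sum_(i < n) <<St (g n), e i>> ^+ 2) / `|kap (g n)| ^+ 2.
    rewrite Sh normrZ normfV normr_id exprMn exprVn mulrDl.
    congr (_ + _); first by rewrite mulrCA mulrC mulrA.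
    rewrite -mulrA; congr (_ * _); rewrite mulr_suml; apply: eq_bigr => i _.
    by rewrite (dotZl dotp) exprMn exprVn mulrC.
  by rewrite ltr_pdivrMr ?exprn_gt0// mul1r.
have sum0 m (y : X) : 0 <= \sum_(i < m) <<y, e i>> ^+ 2 by apply: sumr_ge0 => i _; exact: sqr_ge0.
pose M := Num.sqrt eps^-1.
have hM n : `|St (h n)| <= M.
  rewrite /M -ler_sqr ?nnegrE ?sqrtr_ge0// sqr_sqrtr ?invr_ge0 ?(ltW eps0)//.
  rewrite -[leLHS](mulKf (lt0r_neq0 eps0)) -[leRHS]mulr1 ler_wpM2l ?invr_ge0 ?(ltW eps0)//.
  by apply: le_trans (ltW (hh n)); rewrite lerDl mulr_ge0 ?sum0.
exists h; split => //; first by exists M.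
have M0 : 0 <= M := le_trans (normr_ge0 _) (hM 0%N).
move=> y; apply/cvgr0Pnorm_lt => d d0.
have M1 : 0 < M + 1 by rewrite ltr_pwDr.
have d2 : 0 < d / (2 * (M + 1)) by rewrite divr_gt0// mulr_gt0.
have /cvgrPdist_lt/(_ _ d2)[m _ hm] := onb_proj_cvg dotp_norm onb (x := y).
have coef i : (fun n => <<St (h n), e i>>) @ \oo --> (0 : R).
  apply/cvgr0Pnorm_lt => d' d'0; have d'2 : 0 < d' ^+ 2 by rewrite exprn_gt0.
  have [N0 _ hN0] := nbhs_infty_gtr (d' ^+ 2)^-1.
  exists (maxn N0 i.+1) => // n /=; rewrite geq_max => /andP[/hN0 /= n1 n2].
  have n0 : 0 < n%:R :> R by apply: lt_trans n1; rewrite invr_gt0.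
  rewrite -ltr_sqr ?nnegrE ?(ltW d'0)// real_normK ?num_real//.
  apply: (@le_lt_trans _ _ n%:R^-1); last by rewrite invf_plt ?posrE.
  rewrite -[leLHS](mulKf (lt0r_neq0 n0)) -[leRHS]mulr1 ler_wpM2l ?invr_ge0//.
  apply: le_trans (ltW (hh n)).
  apply: (@le_trans _ _ (n%:R * \sum_(j < n) <<St (h n), e j>> ^+ 2)).
    rewrite ler_wpM2l// (bigD1 (Ordinal n2))//= lerDl.
    by apply: sumr_ge0 => j _; exact: sqr_ge0.
  by rewrite lerDr mulr_ge0 ?sqr_ge0// ltW.
have : (fun n => \sum_(i < m) <<y, e i>> * <<St (h n), e i>>) @ \oo --> (0 : R).
  rewrite [X in _ --> X](_ : 0 = \sum_(i < m) <<y, e i>> * 0); last by rewrite big1// => i _; rewrite mulr0.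
  by apply: (cvg_big (op := +%R)) => [|i _]; [exact: add_continuous | apply: cvgMr; exact: coef].
have dh : 0 < d / 2 by rewrite divr_gt0.
move=> /cvgr0_norm_lt/(_ _ dh)[N _ hN]; exists N => // n /hN /=.
rewrite -onb_dot_proj => hn.
have -> : <<y, St (h n)>> = <<onb_proj dotp e m y, St (h n)>> + <<y - onb_proj dotp e m y, St (h n)>>.
  by rewrite -(dotDl dotp) subrKC.
rewrite (splitr d) (le_lt_trans (ler_normD _ _))// ltrD//.
rewrite (le_lt_trans (cauchy_schwarz dotp_norm _ _))//.
have := hm m (leqnn m); have := hM n; have := normr_ge0 (y - onb_proj dotp e m y) => /=.
rewrite ltr_pdivlMr ?mulr_gt0// ltr_pdivlMr//.
by nra.
Qed.

(** If the estimate fails, the normalised remainders [y N] are weakly null while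
    [|dual (y N)|^2 >= eps]. By compactness a subsequence of [dual (y N)] converges; its limit is
    orthogonal to the range and to the kernel of [St], hence zero. *)
Lemma tail_of_compact : U_compact -> forall eps : R, 0 < eps -> exists N : nat, forall h,
  `|kap h - onb_proj dotp e N (kap h)| ^+ 2 <= eps * `|St h| ^+ 2.
Proof.
move=> [_ cU] eps eps0; apply: contrapT => /forallNP no.
pose r N h := kap h - onb_proj dotp e N (kap h).
have /choice[h hh] : forall N : nat, exists h, eps * `|St h| ^+ 2 < `|r N h| ^+ 2.
  move=> N; apply: contrapT => /forallNP hN; apply: (no N) => h.
  by rewrite leNgt; apply/negP; exact: hN.
have r0 N : 0 < `|r N (h N)|.
  rewrite lt_neqAle normr_ge0 andbT eq_sym; apply/eqP => rN0; have := hh N.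
  by rewrite rN0 expr0n/= ltNge mulr_ge0// ?ltW// sqr_ge0.
have rproj N x y : <<x - onb_proj dotp e N x, onb_proj dotp e N y>> = 0.
  rewrite (dotC dotp) onb_dot_proj big1// => i _.
  by rewrite (dotBl dotp) onb_proj_coef// subrr mulr0.
pose y N := `|r N (h N)|^-1 *: r N (h N).
have ny N : `|y N| = 1 by rewrite normrZ normfV normr_id mulVf// gt_eqF.
have yk N : <<y N, kap (h N)>> = `|r N (h N)|.
  rewrite (dotZl dotp) -[kap (h N) in X in _ * X](subrK (onb_proj dotp e N (kap (h N)))).
  by rewrite (dotDr dotp) rproj addr0 (dotxx dotp_norm) expr2 mulKf// gt_eqF.
have dual_big N : eps <= `|dual (y N)| ^+ 2.
  have [_ _ dE] := dualP (y N).
  have S0 : 0 < `|St (h N)| ^+ 2.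
    rewrite exprn_gt0// lt_neqAle normr_ge0 andbT eq_sym; apply/eqP => S0; have := kap_le (h N).
    rewrite S0 normr_le0 => /eqP k0; have := yk N; rewrite k0 (dot0r dotp) => /esym/eqP.
    by rewrite gt_eqF.
  rewrite -(ler_pM2r S0) (le_trans (ltW (hh N)))// -yk -dE -real_normK ?num_real//.
  by rewrite -exprMn ler_sqr ?nnegrE ?mulr_ge0// cauchy_schwarz.
have ywk x : (fun N => <<y N, x>>) @ \oo --> (0 : R).
  apply/norm_cvg0P; apply: (@squeeze_cvgr _ _ _ _ (fun=> 0) (fun N => `|x - onb_proj dotp e N x|)).
  - apply: nearW => N; rewrite normr_ge0/= -[x in X in `|X|](subrK (onb_proj dotp e N x)).
    rewrite (dotDr dotp) (dotZl dotp _ _ (onb_proj _ _ _ _)) rproj mulr0 addr0.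
    by rewrite (le_trans (cauchy_schwarz dotp_norm _ _))// ny mul1r.
  - exact: cvg_cst.
  - have := onb_proj_cvg dotp_norm onb (x := x).
    by move=> /subr_cvg0/norm_cvg0P; under eq_fun do rewrite distrC.
have [||k inck [w [w' _ <-] cw]] := cU (fun n => Ss (y n)).
- by move=> n; exists (y n).
- by exists 1 => n; rewrite (le_trans (cm_norm_le _ rs))// ny.
have [z [pz zw _]] := perp_ker_rep w' rt.
have {}cw : (fun n => `|dual (y (k n)) - z|) @ \oo --> (0 : R).
  have E n : cm_norm dotp Qt (A (Ss (y (k n))) - St w') = `|dual (y (k n)) - z|%:E.
    have [pd <- _] := dualP (y (k n)); rewrite -zw -(linfB linSt) cm_norm_root//.
    exact: perp_kerB.
  move: cw; rewrite (_ : (fun n => cm_norm _ _ _) = (fun n => `|dual (y (k n)) - z|%:E)).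
    by move=> /fine_cvgP[_].
  by apply/funext => n; exact: E.
have {}cw : (fun n => dual (y (k n))) @ \oo --> z by apply/subr_cvg0/norm_cvg0P.
have Sz0 : St z = 0.
  apply: (dot_eq0 dotp_norm) => x; rewrite symSt.
  have c : (fun n => <<dual (y (k n)), St x>>) @ \oo --> <<z, St x>> by exact: cvg_dotl.
  have c0 : (fun n => <<dual (y (k n)), St x>>) @ \oo --> (0 : R).
    have -> : (fun n => <<dual (y (k n)), St x>>) = (fun n => <<y (k n), kap x>>).
      by apply/funext => n; have [_ _ ->] := dualP (y (k n)).
    exact: (cvg_comp _ _ (cvg_increasing_seq inck) (ywk (kap x))).
  exact: (etrans (esym (cvg_lim (@Rhausdorff R) c)) (cvg_lim (@Rhausdorff R) c0)).
have z0 : z = 0 by apply/eqP; rewrite -normr_eq0 -sqrf_eq0 -(dotxx dotp_norm); apply/eqP; exact: pz.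
have c2 : (fun n => `|dual (y (k n))| ^+ 2) @ \oo --> `|z| ^+ 2.
  by apply: cvg_sqr; exact: cvg_norm.
have : eps <= `|z| ^+ 2 by apply: (cvgr_to_ge c2); apply: nearW => n; exact: dual_big.
by rewrite z0 normr0 expr0n/= leNgt eps0.
Qed.

Hypothesis kap_compact : forall (h : nat -> X) (M : R), (forall n, `|St (h n)| <= M) ->
  exists2 k : nat -> nat, increasing_seq k & cvgn (fun n => kap (h (k n))).

(** Along a weakly null sequence with [|kap (h n)| = 1], a limit [z] of a subsequence of [kap (h n)]
    has norm 1, yet [<kap h, z> = <St h, dual z>] tends to 0 along it. *)
Let kap_finite_rank : finite_rank_bound.
Proof.
move=> eps eps0; apply: contrapT => /forallNP no.
have [N|h [nh [M hM] wh]] := weak_null eps0 _.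
  by apply: contrapT => /forallNP hN; apply: (no N) => h; rewrite leNgt; apply/negP; exact: hN.
have [k inck /cvg_ex[z cz]] := kap_compact hM.
have [_ _ dE] := dualP z.
have w0 : (fun n => <<kap (h (k n)), z>>) @ \oo --> (0 : R).
  under eq_fun do rewrite (dotC dotp) -dE.
  exact: (cvg_comp _ _ (cvg_increasing_seq inck) (wh (dual z))).
have w1 : (fun n => <<kap (h (k n)), z>>) @ \oo --> <<z, z>> by exact: cvg_dotl.
have zz : `|z| ^+ 2 = 0.
  by rewrite -(dotxx dotp_norm); exact: (etrans (esym (cvg_lim (@Rhausdorff R) w1)) (cvg_lim (@Rhausdorff R) w0)).
have nz : (fun n => `|kap (h (k n))|) @ \oo --> `|z| by exact: cvg_norm.
have : `|z| = 1.
  have nz1 : (fun n => `|kap (h (k n))|) @ \oo --> (1 : R).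
    have -> : (fun n => `|kap (h (k n))|) = (fun=> 1) by apply/funext => n.
    exact: cvg_cst.
  exact: (etrans (esym (cvg_lim (@Rhausdorff R) nz)) (cvg_lim (@Rhausdorff R) nz1)).
by move=> z1; move: zz; rewrite z1 expr1n => /eqP; rewrite oner_eq0.
Qed.

(** Schauder's theorem in quantitative form: the finite rank bound for [kap] is carried to its
    adjoint [dual], whose values become Cauchy as soon as finitely many of their coordinates are. *)
Lemma compact_of_transfer : U_compact.
Proof.
have [linA _] := bA.
split=> [v Hv|u Hu [M uM]].
  by have [z [_ <- _]] := cm_spaceP rs Hv; have [_ <- _] := dualP z; exists (dual z).
have /choice[z hz] : forall n, exists z, Ss z = u n /\ `|z| <= M.
  move=> n; have [z [_ zu nz]] := cm_spaceP rs (Hu n); exists z; split => //.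
  by have := uM n; rewrite nz lee_fin.
have M0 : 0 <= M := le_trans (normr_ge0 _) (hz 0%N).2.
have dn y : `|dual y| <= `|y| /\ exists v : nat -> X, (fun j => St (v j)) @ \oo --> dual y.
  have [|w [pw Sw wy _ ew]] := transfer_dual ler01 _ y; first by move=> h; rewrite mul1r.
  by move: wy; rewrite mul1r /dual -Sw inv_sqrtK.
have [F UF Fn] := ultra_free_exists.
have [|k inck hk] := ultra_cauchy_subsequence (d := fun n m => `|dual (z n) - dual (z m)|) UF Fn.
  move=> eps eps0; pose M1 := 2 * M + 1.
  have M10 : 0 < M1 by rewrite ltr_pwDr// mulr_ge0.
  (* [e1], and [e2] below, make each of the two terms of [key] at most [eps^4 / 2], all norms being
     bounded by [M1]. *)
  pose e1 := eps ^+ 4 / (2 * M1 ^+ 4).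
  have e10 : 0 < e1 by rewrite divr_gt0 ?mulr_gt0 ?exprn_gt0.
  have [N hN] := kap_finite_rank e10.
  pose e2 := eps ^+ 4 / (2 * M1 ^+ 2 * (N%:R * N%:R + 1)).
  have N1 : 0 < N%:R * N%:R + 1 :> R by rewrite ltr_pwDr// mulr_ge0.
  have e20 : 0 < e2 by rewrite divr_gt0 ?mulr_gt0 ?exprn_gt0.
  (* The minimum with 1 makes the squared coordinates at most [e2]. *)
  have [| |S FS hS] := @ultra_cauchy_coordinates R F UF (fun i n => <<dual (z n), e i>>)
      (fun i => M * `|e i|) _ N (Num.min 1 e2).
  - move=> i n; rewrite (le_trans (cauchy_schwarz dotp_norm _ _))// ler_wpM2r//.
    exact: le_trans (dn _).1 (hz n).2.
  - by rewrite lt_min ltr01.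
  exists S => // n m Sn Sm; rewrite -dualB; set y := z n - z m; set f := dual y.
  have yM : `|y| <= M1.
    rewrite (le_trans (ler_normB _ _))//; have [_ h1] := hz n; have [_ h2] := hz m.
    by rewrite /M1; lra.
  have [dy [v vd]] := dn y.
  (* [|f|^2] is the limit of [<St (v j), f> = <kap (v j), y>]; Cauchy-Schwarz and the finite rank
     bound at [v j] then pass to the limit. *)
  have key : (`|f| ^+ 2) ^+ 2 <=
      `|y| ^+ 2 * (e1 * `|f| ^+ 2 + N%:R * \sum_(i < N) <<f, e i>> ^+ 2).
    have cSv w : (fun j => <<St (v j), w>>) @ \oo --> <<f, w>> by exact: cvg_dotl.
    have cn : (fun j => `|St (v j)| ^+ 2) @ \oo --> `|f| ^+ 2.
      by apply: cvg_sqr; exact: cvg_norm.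
    have cl : (fun j => <<St (v j), f>> ^+ 2) @ \oo --> (`|f| ^+ 2) ^+ 2.
      by rewrite -(dotxx dotp_norm); apply: cvg_sqr; exact: cSv.
    have cr : (fun j => `|y| ^+ 2 * (e1 * `|St (v j)| ^+ 2 +
        N%:R * \sum_(i < N) <<St (v j), e i>> ^+ 2)) @ \oo -->
        `|y| ^+ 2 * (e1 * `|f| ^+ 2 + N%:R * \sum_(i < N) <<f, e i>> ^+ 2).
      apply: cvgMr; apply: cvgD; first exact: cvgMr.
      apply: cvgMr; apply: (cvg_big (op := +%R)) => [|i _]; first exact: add_continuous.
      by apply: cvg_sqr; exact: cSv.
    rewrite -(cvg_lim (@Rhausdorff R) cl) -(cvg_lim (@Rhausdorff R) cr).
    apply: ler_lim; [by apply/cvg_ex; eexists; exact: cl|by apply/cvg_ex; eexists; exact: cr|].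
    apply: nearW => j; rewrite (dotC dotp); have [_ _ ->] := dualP y.
    apply: le_trans (_ : (`|y| * `|kap (v j)|) ^+ 2 <= _).
      by rewrite -real_normK ?num_real// ler_sqr ?nnegrE ?mulr_ge0// cauchy_schwarz.
    by rewrite exprMn ler_wpM2l ?sqr_ge0.
  have sm : \sum_(i < N) <<f, e i>> ^+ 2 <= N%:R * e2.
    rewrite -[X in X%:R * _](card_ord N) -sum1_card natr_sum mulr_suml; apply: ler_sum => i _.
    rewrite mul1r -real_normK ?num_real//.
    have := hS n m Sn Sm i (ltn_ord i); rewrite -(dotBl dotp) -dualB -/y -/f le_min => /andP[h1 h2].
    by apply: le_trans h2; rewrite expr2 ler_piMl.
  have d0 := normr_ge0 f; have y0 := normr_ge0 y.
  rewrite -(ler_pXn2r (n := 4)) ?nnegrE ?(ltW eps0)//.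
  rewrite (exprM _ 2 2) (le_trans key)//.
  have y2 : `|y| ^+ 2 <= M1 ^+ 2 by rewrite ler_sqr ?nnegrE ?(ltW M10).
  have d2 : `|f| ^+ 2 <= M1 ^+ 2 by rewrite ler_sqr ?nnegrE ?(ltW M10)// (le_trans dy).
  apply: (@le_trans _ _ (M1 ^+ 2 * (e1 * M1 ^+ 2 + N%:R * (N%:R * e2)))).
    apply: ler_pM; rewrite ?sqr_ge0//.
    - apply: addr_ge0; first by rewrite mulr_ge0 ?sqr_ge0 ?(ltW e10).
      by apply: mulr_ge0 => //; apply: sumr_ge0 => i _; exact: sqr_ge0.
    - by rewrite lerD// ler_wpM2l// ltW.
  have E1 : M1 ^+ 2 * (e1 * M1 ^+ 2) = eps ^+ 4 / 2.
    by rewrite /e1; field; rewrite gt_eqF.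
  have E2 : M1 ^+ 2 * (N%:R * (N%:R * e2)) <= eps ^+ 4 / 2.
    rewrite (_ : M1 ^+ 2 * (N%:R * (N%:R * e2)) =
        eps ^+ 4 / 2 * (N%:R * N%:R / (N%:R * N%:R + 1))); last first.
      by rewrite /e2; field; rewrite !gt_eqF.
    rewrite ler_piMr ?divr_ge0 ?exprn_ge0 ?(ltW eps0)// ler_pdivrMr// mul1r lerDl//.
  by rewrite mulrDr E1; lra.
exists k => //.
have cl : cvgn (fun n => dual (z (k n))).
  apply: (@cvg_of_geometric_steps _ _ _ 1) => n; rewrite mul1r distrC.
  exact: hk.
set w := lim _ in cl.
have pl : perp_ker St w.
  move=> x Sx; have c : (fun n => <<dual (z (k n)), x>>) @ \oo --> <<w, x>> by exact: cvg_dotl.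
  have c0 : (fun n => <<dual (z (k n)), x>>) @ \oo --> (0 : R).
    have -> : (fun n => <<dual (z (k n)), x>>) = (fun=> 0).
      by apply/funext => n; have [p _ _] := dualP (z (k n)); exact: p.
    exact: cvg_cst.
  exact: (etrans (esym (cvg_lim (@Rhausdorff R) c)) (cvg_lim (@Rhausdorff R) c0)).
exists (St w); first by exists w.
have -> : (fun n => cm_norm dotp Qt (A (u (k n)) - St w)) = (fun n => `|dual (z (k n)) - w|%:E).
  apply/funext => n; have [<- _] := hz (k n); have [pd <- _] := dualP (z (k n)).
  by rewrite -(linfB linSt) cm_norm_root//; exact: perp_kerB.
apply: cvg_EFin; first exact: nearW.
by apply/norm_cvg0P/subr_cvg0.
Qed.

End transfer.
End cameron_martin.

(** * Second moments of trigonometric polynomials *)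

Section positive_kernels.
Context (R : realType) (T : Type).
Implicit Types (s : seq T) (c : T -> R) (M N : T -> T -> R).

Definition quad s c M := \sum_(i <- s) \sum_(j <- s) c i * c j * M i j.

Definition psd s M := forall c, 0 <= quad s c M.

Lemma eq_quad s c M N : (forall i j, M i j = N i j) -> quad s c M = quad s c N.
Proof. by move=> MN; apply: eq_bigr => i _; apply: eq_bigr => j _; rewrite MN. Qed.

Lemma quadD s c M N : quad s c (fun i j => M i j + N i j) = quad s c M + quad s c N.
Proof.
rewrite -big_split; apply: eq_bigr => i _; rewrite -big_split; apply: eq_bigr => j _.
by rewrite mulrDr.
Qed.

Lemma quadZ s c (a : R) M : quad s c (fun i j => a * M i j) = a * quad s c M.
Proof.
rewrite mulr_sumr; apply: eq_bigr => i _; rewrite mulr_sumr; apply: eq_bigr => j _.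
by rewrite mulrCA.
Qed.

Lemma quadB s c M N : quad s c (fun i j => M i j - N i j) = quad s c M - quad s c N.
Proof.
rewrite -[- quad s c N]mulN1r -quadZ -quadD; apply: eq_quad => i j; ring.
Qed.

Lemma quad_rank1 s c (w : T -> R) : quad s c (fun i j => w i * w j) = (\sum_(i <- s) c i * w i) ^+ 2.
Proof.
rewrite expr2 mulr_suml; apply: eq_bigr => i _; rewrite mulr_sumr; apply: eq_bigr => j _; ring.
Qed.

Lemma psdD s M N : psd s M -> psd s N -> psd s (fun i j => M i j + N i j).
Proof. by move=> hM hN c; rewrite quadD addr_ge0. Qed.

Lemma psdZ s (a : R) M : 0 <= a -> psd s M -> psd s (fun i j => a * M i j).
Proof. by move=> a0 hM c; rewrite quadZ mulr_ge0. Qed.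

Lemma eq_psd s M N : (forall i j, M i j = N i j) -> psd s M -> psd s N.
Proof. by move=> MN hM c; rewrite -(eq_quad s c MN). Qed.

End positive_kernels.

Section gram_kernels.
Context (R : realType) (X : completeNormedModType R).
Variable dotp : {dot X for idfun}.
Hypothesis dotp_norm : is_inner_product dotp.
Local Notation "<< x , y >>" := (dotp x y) (at level 0, format "<< x ,  y >>").
Variable e : nat -> X.
Hypothesis onb : onb_seq dotp e.
Context (T : Type) (s : seq T).
Implicit Types (u v : T -> X) (M : T -> T -> R).

Lemma quad_gram c u : quad s c (fun i j => <<u i, u j>>) = `|\sum_(i <- s) c i *: u i| ^+ 2.
Proof.
rewrite -(dotxx dotp_norm) (dot_suml dotp); apply: eq_bigr => i _.
rewrite (dotC dotp) (dot_suml dotp); apply: eq_bigr => j _.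
by rewrite (dotZl dotp) (dotZr dotp) (dotC dotp (u j)) mulrA [c i * c j]mulrC.
Qed.

Lemma psd_gram u : psd s (fun i j => <<u i, u j>>).
Proof. by move=> c; rewrite quad_gram sqr_ge0. Qed.

(* Expanding the Gram factor in the basis writes the Hadamard product as a limit
   of sums of congruences of M. *)
Lemma psd_schur M u : psd s M -> psd s (fun i j => M i j * <<u i, u j>>).
Proof.
move=> hM c.
have lim : (fun n => \sum_(k < n) quad s (fun i => c i * <<u i, e k>>) M) @ \oo -->
    quad s c (fun i j => M i j * <<u i, u j>>).
  have -> : (fun n => \sum_(k < n) quad s (fun i => c i * <<u i, e k>>) M) =
     (fun n => \sum_(i <- s) \sum_(j <- s) c i * c j * (M i j *
        \sum_(k < n) <<u i, e k>> * <<u j, e k>>)).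
    apply/funext => n; rewrite exchange_big; apply: eq_bigr => i _.
    rewrite exchange_big; apply: eq_bigr => j _.
    by rewrite !mulr_sumr; apply: eq_bigr => k _; ring.
  apply: (cvg_big (op := +%R)) => [|i _]; first exact: add_continuous.
  apply: (cvg_big (op := +%R)) => [|j _]; first exact: add_continuous.
  by apply: cvgMr; apply: cvgMr; exact: parseval_dot.
apply: (cvgr_to_ge lim); apply: nearW => n; apply: sumr_ge0 => k _; exact: hM.
Qed.

Lemma psd_schur_exp M u m : psd s M -> psd s (fun i j => M i j * <<u i, u j>> ^+ m).
Proof.
move=> hM; elim: m => [|m IH]; first by apply: eq_psd hM => i j; rewrite expr0 mulr1.
by apply: eq_psd (psd_schur u IH) => i j; rewrite exprSr mulrA.
Qed.

Lemma psd_gram_exp u m : psd s (fun i j => <<u i, u j>> ^+ m).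
Proof.
have h1 : psd s (fun _ _ : T => 1 : R).
  move=> c; rewrite (@eq_quad _ _ s c _ (fun i j => 1 * 1)) ?quad_rank1 ?sqr_ge0// => i j.
  by rewrite mulr1.
by apply: eq_psd (psd_schur_exp u m h1) => i j; rewrite mul1r.
Qed.

Section domination.
Variables (u v : T -> X) (r : R).
Hypothesis r0 : 0 <= r.
Hypothesis vu : psd s (fun i j => r * <<u i, u j>> - <<v i, v j>>).

(** With G and K the Gram kernels of [u] and [v], [r^(m+1) G^(m+1) - K^(m+1)] is
    [r^m G^m (r G - K) + (r^m G^m - K^m) K], and both summands are positive by Schur. *)
Lemma psd_exp_le m : psd s (fun i j => r ^+ m * <<u i, u j>> ^+ m - <<v i, v j>> ^+ m).
Proof.
elim: m => [|m IH].
  by move=> c; rewrite quadB (@eq_quad _ _ s c _ (fun i j => <<v i, v j>> ^+ 0)) ?subrr// => i j; rewrite mul1r.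
have h1 := psdZ (exprn_ge0 m r0) (psd_schur_exp u m vu).
have h2 := psd_schur v IH.
by apply: eq_psd (psdD h1 h2) => i j; rewrite !exprSr; ring.
Qed.

Variables (w : T -> X) (eps : R).
Hypothesis eps0 : 0 <= eps.
Hypothesis vw : forall i j, <<v i, v j>> - <<w i, w j>> = <<v i - w i, v j - w j>>.
Hypothesis tail : psd s (fun i j => eps * <<u i, u j>> - (<<v i, v j>> - <<w i, w j>>)).

(** With W the kernel of [w], [K^(m+1) - W^(m+1) = K^m (K - W) + (K^m - W^m) W]: each of the [m]
    factors exchanged costs one [eps] and leaves [r^(m-1)], whence the coefficient. *)
Lemma psd_exp_tail m : psd s (fun i j =>
  m%:R * eps * r ^+ m.-1 * <<u i, u j>> ^+ m - (<<v i, v j>> ^+ m - <<w i, w j>> ^+ m)).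
Proof.
elim: m => [|m IH].
  move=> c; rewrite (@eq_quad _ _ s c _ (fun i j => 0 * (1 : R))) ?quadZ ?mul0r// => i j.
  by rewrite !expr0; ring.
have wu : psd s (fun i j => r * <<u i, u j>> - <<w i, w j>>).
  by apply: eq_psd (psdD vu (psd_gram (fun i => v i - w i))) => i j; rewrite -vw; ring.
have h1 := psdZ (exprn_ge0 m r0) (psd_schur_exp u m tail).
have h2 := psd_schur (fun i => v i - w i) (psd_exp_le m).
have c0 : 0 <= m%:R * eps * r ^+ m.-1 by rewrite !mulr_ge0// exprn_ge0.
have h3 := psdZ c0 (psd_schur_exp u m wu).
have h4 := psd_schur w IH.
apply: eq_psd (psdD (psdD h1 h2) (psdD h3 h4)) => i j.
rewrite -vw -[m.+1]addn1 natrD; case: m {IH h1 h2 h3 h4 c0} => [|m]; first by rewrite /= !expr0; ring.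
by rewrite /= !addn1 !exprS; ring.
Qed.

End domination.

End gram_kernels.

Section finite_rank_weights.
Context (R : realType) (T : Type) (a : nat -> T -> R).

(** The ordered monomials of degree [m] in [a 0], ..., [a (n-1)], which appear when the power of a
    sum is expanded. *)
Fixpoint product_weights (n m : nat) : seq (T -> R) :=
  if m is m'.+1 then
    [seq (fun i => w i * a k i) | w <- product_weights n m', k <- iota 0 n]
  else [:: fun=> 1].

Lemma quad_product_weights (I : Type) (g : I -> T) s c n m :
  quad s c (fun i j => (\sum_(k < n) a k (g i) * a k (g j)) ^+ m) =
  \sum_(w <- product_weights n m) (\sum_(i <- s) c i * w (g i)) ^+ 2.
Proof.
elim: m c => [|m IH] c.
  by rewrite big_seq1 -quad_rank1; apply: eq_quad => i j; rewrite mulr1.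
transitivity (\sum_(k < n) quad s (fun i => c i * a k (g i)) (fun i j => (\sum_(k < n) a k (g i) * a k (g j)) ^+ m)).
  rewrite exchange_big; apply: eq_bigr => i _; rewrite exchange_big; apply: eq_bigr => j _.
  by rewrite exprSr mulrA mulr_sumr; apply: eq_bigr => k _; ring.
under eq_bigr do rewrite IH.
rewrite exchange_big /= big_allpairs_dep /=; apply: eq_bigr => w _.
have -> : iota 0 n = index_iota 0 n by rewrite /index_iota subn0.
rewrite big_mkord; apply: eq_bigr => k _; congr (_ ^+ 2); apply: eq_bigr => i _; ring.
Qed.

End finite_rank_weights.

Section trigonometric_second_moment.
Context (R : realType) (X : completeNormedModType R).
Variable dotp : {dot X for idfun}.
Hypothesis dotp_norm : is_inner_product dotp.
Local Notation "<< x , y >>" := (dotp x y) (at level 0, format "<< x ,  y >>").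
Local Notation tr := (trig (fun (h : X) (x : borel X) => <<x, h>>)).

Variables (g : probability (borel X) R) (S : X -> X).
Hypothesis linS : linear S.
Hypothesis g_cos : forall h, \int[g]_x cos <<x, h>> = expR (- `|S h| ^+ 2 / 2).
Hypothesis g_sin : forall h, \int[g]_x sin <<x, h>> = 0.

(** Coefficient of an entry in the m-th chaos: cosines live in even degrees, sines in odd ones, and
    the exponential is the Gaussian mean of the cosine. *)
Definition trig_coef (m : nat) (i : R * R * X) : R :=
  (if odd m then i.1.2 else i.1.1) * expR (- `|S i.2| ^+ 2 / 2).

Lemma expect_trig s : \int[g]_x tr s x = \sum_(i <- s) trig_coef 0 i.
Proof.
rewrite /trig expect_sum => [|i].
  apply: eq_bigr => i _.
  have mc : bmf (fun x : borel X => cos <<x, i.2>>) by apply: bmf_cos; exact: measurable_dot.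
  have ms : bmf (fun x : borel X => sin <<x, i.2>>) by apply: bmf_sin; exact: measurable_dot.
  by rewrite expectD ?expectZ ?g_cos ?g_sin ?mulr0 ?addr0//; exact: bmfZ.
by apply: bmfD; apply: bmfZ; [apply: bmf_cos | apply: bmf_sin]; exact: measurable_dot.
Qed.

(** Product-to-sum formulas leave [exp x] and [exp (- x)] with [x = <S h, S k>]; in the power series
    the sign [(-1)^m] retains the product of the cosine coefficients for even [m] and that of the
    sine coefficients for odd [m]. *)
Lemma trig_second_moment s :
  (fun M => \sum_(m < M) quad s (trig_coef m) (fun i j => <<S i.2, S j.2>> ^+ m) / m`!%:R)
    @ \oo --> \int[g]_x tr s x ^+ 2.
Proof.
have md h : measurable_fun [set: borel X] (fun x : borel X => <<x, h>>) by exact: measurable_dot.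
pose E (i j : R * R * X) :=
  (i.1.1 * j.1.1 + i.1.2 * j.1.2) / 2 * expR (- `|S i.2 - S j.2| ^+ 2 / 2) +
  (i.1.1 * j.1.1 - i.1.2 * j.1.2) / 2 * expR (- `|S i.2 + S j.2| ^+ 2 / 2).
have -> : \int[g]_x tr s x ^+ 2 = \sum_(i <- s) \sum_(j <- s) E i j.
  pose f (i j : R * R * X) (x : borel X) : R :=
    (i.1.1 * cos <<x, i.2>> + i.1.2 * sin <<x, i.2>>) *
    (j.1.1 * cos <<x, j.2>> + j.1.2 * sin <<x, j.2>>).
  have fE i j x : f i j x =
     (i.1.1 * j.1.1 + i.1.2 * j.1.2) / 2 * cos <<x, i.2 - j.2>> +
     (i.1.1 * j.1.1 - i.1.2 * j.1.2) / 2 * cos <<x, i.2 + j.2>> +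
     ((i.1.1 * j.1.2 + i.1.2 * j.1.1) / 2 * sin <<x, i.2 + j.2>> +
      (i.1.2 * j.1.1 - i.1.1 * j.1.2) / 2 * sin <<x, i.2 - j.2>>).
    by rewrite /f (dotBr dotp) (dotDr dotp) cosB cosD sinD sinB; field.
  have bc h : bmf (fun x : borel X => cos <<x, h>>) by exact: bmf_cos.
  have bs h : bmf (fun x : borel X => sin <<x, h>>) by exact: bmf_sin.
  have bf i j : bmf (f i j).
    by rewrite (funext (fE i j)); apply: bmfD; apply: bmfD; exact: bmfZ.
  have -> : (fun x => tr s x ^+ 2) = (fun x => \sum_(i <- s) \sum_(j <- s) f i j x).
    apply/funext => x; rewrite expr2 /trig mulr_suml; apply: eq_bigr => i _.
    by rewrite mulr_sumr.
  rewrite expect_sum => [|i]; last exact: bmf_sum.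
  apply: eq_bigr => i _; rewrite expect_sum => [|j //]; apply: eq_bigr => j _.
  rewrite (funext (fE i j)) expectD; [|by apply: bmfD; exact: bmfZ|by apply: bmfD; exact: bmfZ].
  rewrite !expectD; try exact: bmfZ.
  rewrite !expectZ// !g_cos !g_sin !mulr0 !addr0 /E.
  by rewrite (linfB linS) (linfD linS).
rewrite (_ : (fun M => _) = (fun M => \sum_(i <- s) \sum_(j <- s)
    \sum_(m < M) trig_coef m i * trig_coef m j * (<<S i.2, S j.2>> ^+ m / m`!%:R))); last first.
  apply/funext => M; transitivity (\sum_(m < M) \sum_(i <- s) \sum_(j <- s)
      trig_coef m i * trig_coef m j * (<<S i.2, S j.2>> ^+ m / m`!%:R)).
    apply: eq_bigr => m _; rewrite mulr_suml; apply: eq_bigr => i _.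
    by rewrite mulr_suml; apply: eq_bigr => j _; rewrite -[LHS]mulrA.
  by rewrite exchange_big; apply: eq_bigr => i _; rewrite exchange_big.
apply: (cvg_big (op := +%R)) => [|i _]; first exact: add_continuous.
apply: (cvg_big (op := +%R)) => [|j _]; first exact: add_continuous.
set x := <<S i.2, S j.2>>; set u := expR (- `|S i.2| ^+ 2 / 2); set v := expR (- `|S j.2| ^+ 2 / 2).
have -> : E i j = (i.1.1 * j.1.1 + i.1.2 * j.1.2) / 2 * u * v * expR x +
    (i.1.1 * j.1.1 - i.1.2 * j.1.2) / 2 * u * v * expR (- x).
  have e1 : expR (- `|S i.2 - S j.2| ^+ 2 / 2) = u * v * expR x.
    by rewrite /u /v -!expRD (normB_sqr dotp_norm) -/x; congr expR; field.
  have e2 : expR (- `|S i.2 + S j.2| ^+ 2 / 2) = u * v * expR (- x).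
    by rewrite /u /v -!expRD (normD_sqr dotp_norm) -/x; congr expR; field.
  by rewrite /E e1 e2 !mulrA.
rewrite (_ : (fun M => _) = (fun M =>
    (i.1.1 * j.1.1 + i.1.2 * j.1.2) / 2 * u * v * series (exp_coeff x) M +
    (i.1.1 * j.1.1 - i.1.2 * j.1.2) / 2 * u * v * series (exp_coeff (- x)) M)).
  by apply: cvgD; apply: cvgMr; exact: is_cvg_series_exp_coeff.
apply/funext => M; rewrite /series/= !big_mkord !mulr_sumr -big_split; apply: eq_bigr => m _ /=.
rewrite /exp_coeff/= exprNn /trig_coef -/u -/v -signr_odd.
by case: (odd m) => /=; rewrite ?expr1 ?expr0; field; rewrite pnatr_eq0 -lt0n fact_gt0.
Qed.

End trigonometric_second_moment.

Lemma cvgn_le (R : realType) (u v : nat -> R) (a b : R) :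
  u @ \oo --> a -> v @ \oo --> b -> (forall n, u n <= v n) -> a <= b.
Proof.
move=> ua vb uv; rewrite -(cvg_lim (@Rhausdorff R) ua) -(cvg_lim (@Rhausdorff R) vb).
apply: ler_lim; [by apply/cvg_ex; exists a | by apply/cvg_ex; exists b |].
by apply: nearW.
Qed.

(** [m r^(m-1) (1 - r)] is at most the geometric sum [1 - r^m]. This absorbs the factor [m] of
    [psd_exp_tail] uniformly in the degree. *)
Lemma geometric_derivative_le (R : realType) (r : R) m : 0 <= r <= 1 ->
  m%:R * (1 - r) * r ^+ m.-1 <= 1.
Proof.
move=> /andP[r0 r1]; suff : m%:R * (1 - r) * r ^+ m.-1 <= 1 - r ^+ m.
  by move/le_trans; apply; rewrite gerBl exprn_ge0.
elim: m => [|m IH]; first by rewrite !mul0r expr0 subrr.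
have h : m%:R * (1 - r) * r ^+ m <= 1 - r ^+ m.
  case: m IH => [|m] IH; first by rewrite !mul0r expr0 subrr.
  apply: le_trans IH; rewrite ler_wpM2l ?mulr_ge0 ?subr_ge0//= exprS ler_piMl// exprn_ge0//.
by rewrite /= -natr1 exprS; lra.
Qed.

Section shifted_characteristic_function.
Context (R : realType) (X : completeNormedModType R).
Variable dotp : {dot X for idfun}.
Hypothesis dotp_norm : is_inner_product dotp.
Variables (Q : X -> X) (g : probability (borel X) R).
Hypothesis Q0 : forall h, 0 <= dotp (Q h) h.
Hypothesis Gg : is_gaussian dotp 0 Q g.

Let bc0 h : bmf (fun y : borel X => cos (dotp y h)).
Proof. by apply: bmf_cos; exact: measurable_dot. Qed.

Let bs0 h : bmf (fun y : borel X => sin (dotp y h)).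
Proof. by apply: bmf_sin; exact: measurable_dot. Qed.

Lemma gaussian_cos_shift t h :
  \int[g]_y cos (t + dotp y h) = cos t * expR (- dotp (Q h) h / 2).
Proof.
under eq_Rintegral do rewrite cosD.
rewrite expectB ?expectZ//; try exact: bmfZ.
rewrite (gaussian_cos dotp_norm Q0 Gg) (gaussian_sin dotp_norm Q0 Gg).
by rewrite (dot0l dotp) cos0 sin0 mul1r mul0r mulr0 subr0.
Qed.

Lemma gaussian_sin_shift t h :
  \int[g]_y sin (t + dotp y h) = sin t * expR (- dotp (Q h) h / 2).
Proof.
under eq_Rintegral do rewrite sinD.
rewrite expectD ?expectZ//; try exact: bmfZ.
rewrite (gaussian_cos dotp_norm Q0 Gg) (gaussian_sin dotp_norm Q0 Gg).
by rewrite (dot0l dotp) cos0 sin0 mul1r mul0r mulr0 addr0.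
Qed.

End shifted_characteristic_function.

(** * The transition on trigonometric polynomials *)

Section ornstein_uhlenbeck.
Context (R : realType) (X : completeNormedModType R).
Variable dotp : {dot X for idfun}.
Hypothesis dotp_norm : is_inner_product dotp.
Local Notation "<< x , y >>" := (dotp x y) (at level 0, format "<< x ,  y >>").
Local Notation tr := (trig (fun (h : X) (x : borel X) => <<x, h>>)).

Variables (A Qs Qt Qn Ss St : X -> X) (gs gt nu : probability (borel X) R).
Hypothesis bA : bounded_operator A.
Hypothesis rs : nonneg_root dotp Qs Ss.
Hypothesis rt : nonneg_root dotp Qt St.
Hypothesis Qn0 : forall h, 0 <= <<Qn h, h>>.
Hypothesis Gs : is_gaussian dotp 0 Qs gs.
Hypothesis Gt : is_gaussian dotp 0 Qt gt.
Hypothesis Gn : is_gaussian dotp 0 Qn nu.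
Hypothesis split : forall x y,
  <<Qt x, y>> = <<Qs (adjoint dotp A x), adjoint dotp A y>> + <<Qn x, y>>.

Let kap h := Ss (adjoint dotp A h).

Let linSs : linear Ss. Proof. by case: rs => [[]]. Qed.
Let linSt : linear St. Proof. by case: rt => [[]]. Qed.

Let root_sqr (Q S : X -> X) h : nonneg_root dotp Q S -> <<Q h, h>> = `|S h| ^+ 2.
Proof. by move=> [_ sym _ SS]; rewrite -SS sym (dotxx dotp_norm). Qed.

Let centered_cos (Q S : X -> X) (g : probability (borel X) R) : nonneg_root dotp Q S ->
  is_gaussian dotp 0 Q g -> forall h, \int[g]_x cos <<x, h>> = expR (- `|S h| ^+ 2 / 2).
Proof.
move=> rQ Gg h; rewrite (gaussian_cos dotp_norm _ Gg).
  by rewrite (dot0l dotp) cos0 mul1r (root_sqr h rQ).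
by move=> k; rewrite (root_sqr k rQ) sqr_ge0.
Qed.

Let centered_sin (Q S : X -> X) (g : probability (borel X) R) : nonneg_root dotp Q S ->
  is_gaussian dotp 0 Q g -> forall h, \int[g]_x sin <<x, h>> = 0.
Proof.
move=> rQ Gg h; rewrite (gaussian_sin dotp_norm _ Gg).
  by rewrite (dot0l dotp) sin0 mul0r.
by move=> k; rewrite (root_sqr k rQ) sqr_ge0.
Qed.

Lemma transfer_sqr h : `|kap h| ^+ 2 = `|St h| ^+ 2 - <<Qn h, h>>.
Proof. by rewrite -!(root_sqr _ rs) -(root_sqr _ rt) split addrK. Qed.

Lemma transfer_contract h : `|kap h| <= `|St h|.
Proof. by rewrite -ler_sqr ?nnegrE// transfer_sqr gerBl. Qed.

(** Mehler form of the transition: the noise is centred and translated by [A x], so that Fubini on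
    [gs \x nu] applies. *)
Definition ou (f : borel X -> R) (x : borel X) : R := \int[nu]_y f (A x + y).

(** Frequencies move by the adjoint of [A], and the noise contributes its characteristic function as
    a damping factor. *)
Definition ou_seq (s : seq (R * R * X)) : seq (R * R * X) :=
  [seq (i.1.1 * expR (- <<Qn i.2, i.2>> / 2), i.1.2 * expR (- <<Qn i.2, i.2>> / 2),
        adjoint dotp A i.2) | i <- s].

Lemma ou_trig s x : ou (tr s) x = tr (ou_seq s) x.
Proof.
have bc t h : bmf (fun y : borel X => cos (t + <<y, h>>)).
  by apply: bmf_cos; apply: measurable_funD => //; exact: measurable_dot.
have bs t h : bmf (fun y : borel X => sin (t + <<y, h>>)).
  by apply: bmf_sin; apply: measurable_funD => //; exact: measurable_dot.
have ec := gaussian_cos_shift dotp_norm Qn0 Gn; have es := gaussian_sin_shift dotp_norm Qn0 Gn.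
rewrite /ou /trig /ou_seq big_map expect_sum => [|i]; last first.
  by under eq_fun do rewrite (dotDl dotp); apply: bmfD; exact: bmfZ.
apply: eq_bigr => i _ /=; under eq_Rintegral do rewrite (dotDl dotp).
rewrite expectD ?expectZ ?ec ?es//; try exact: bmfZ.
by rewrite -(adjointP dotp_norm bA) -!mulrA ![_ * expR _]mulrC.
Qed.

Let K (i j : R * R * X) := <<kap i.2, kap j.2>>.
Let G (i j : R * R * X) := <<St i.2, St j.2>>.

(** By [transfer_sqr] the damping factor turns [exp (- |kap h|^2 / 2)] into [exp (- |St h|^2 / 2)]:
    the chaos coefficients stay the same and only the Gram matrix changes. *)
Let quad_ou s m : quad (ou_seq s) (trig_coef Ss m) (fun i j => <<Ss i.2, Ss j.2>> ^+ m) =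
  quad s (trig_coef St m) (fun i j => K i j ^+ m).
Proof.
have cE (i : R * R * X) : trig_coef Ss m (i.1.1 * expR (- <<Qn i.2, i.2>> / 2),
    i.1.2 * expR (- <<Qn i.2, i.2>> / 2), adjoint dotp A i.2) = trig_coef St m i.
  rewrite /trig_coef /= -/(kap i.2) transfer_sqr.
  have -> : expR (- `|St i.2| ^+ 2 / 2) =
      expR (- <<Qn i.2, i.2>> / 2) * expR (- (`|St i.2| ^+ 2 - <<Qn i.2, i.2>>) / 2).
    by rewrite -expRD; congr expR; field.
  by case: (odd m); rewrite mulrA.
rewrite /quad /ou_seq !big_map; apply: eq_bigr => i _; rewrite big_map; apply: eq_bigr => j _.
by rewrite !cE.
Qed.

Let term s m (M : R * R * X -> R * R * X -> R) :=
  quad s (trig_coef St m) (fun i j => M i j ^+ m) / m`!%:R.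

Let second_moment_t s : (fun M => \sum_(m < M) term s m G) @ \oo --> \int[gt]_x tr s x ^+ 2.
Proof.
exact: (trig_second_moment dotp_norm linSt (centered_cos rt Gt) (centered_sin rt Gt)).
Qed.

Let second_moment_s s :
  (fun M => \sum_(m < M) term s m K) @ \oo --> \int[gs]_x tr (ou_seq s) x ^+ 2.
Proof.
have := trig_second_moment dotp_norm linSs (centered_cos rs Gs) (centered_sin rs Gs) (s := ou_seq s).
by under eq_fun do under eq_bigr do rewrite quad_ou.
Qed.

Let term0 s (M : R * R * X -> R * R * X -> R) : term s 0 M = (\int[gt]_x tr s x) ^+ 2.
Proof.
rewrite /term fact0 divr1 (expect_trig dotp_norm (centered_cos rt Gt) (centered_sin rt Gt)).
rewrite (@eq_quad _ _ s _ _ (fun i j => 1 * 1)) => [|i j]; last by rewrite mulr1.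
by rewrite quad_rank1; congr (_ ^+ 2); apply: eq_bigr => i _; rewrite mulr1.
Qed.

Variable e : nat -> X.
Hypothesis onb : onb_seq dotp e.

Let termG_ge0 s m : 0 <= term s m G.
Proof. by rewrite mulr_ge0//; exact: (psd_gram_exp dotp_norm onb). Qed.

Lemma expect_ou_trig s : \int[gs]_x tr (ou_seq s) x = \int[gt]_x tr s x.
Proof.
rewrite (expect_trig dotp_norm (centered_cos rs Gs) (centered_sin rs Gs)).
rewrite (expect_trig dotp_norm (centered_cos rt Gt) (centered_sin rt Gt)) /ou_seq big_map.
apply: eq_bigr => i _; rewrite /trig_coef /= -/(kap i.2) transfer_sqr -mulrA -expRD.
by congr (_ * expR _); field.
Qed.

Section contraction.
Variable rho : R.
Hypothesis rho0 : 0 <= rho.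
Hypothesis rho1 : rho <= 1.
Hypothesis kap_rho : forall h, `|kap h| <= rho * `|St h|.

Let linkap : linear kap.
Proof. by move=> a u v; rewrite /kap (adjoint_linear dotp_norm bA) linSs. Qed.

Let lin_sum (B : X -> X) s (c : R * R * X -> R) : linear B ->
  \sum_(i <- s) c i *: B i.2 = B (\sum_(i <- s) c i *: i.2).
Proof.
move=> linB; elim/big_ind2 : _ => [|? ? ? ? -> ->|i _]; first by rewrite (linf0 linB).
  by rewrite (linfD linB).
by rewrite (linfZ linB).
Qed.

Let domination s : psd s (fun i j => rho ^+ 2 * G i j - K i j).
Proof.
move=> c; rewrite quadB quadZ /G /K.
rewrite (quad_gram dotp_norm s c (fun i => St i.2)) (quad_gram dotp_norm s c (fun i => kap i.2)).
rewrite (lin_sum _ _ linSt) (lin_sum _ _ linkap) -exprMn subr_ge0.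
by rewrite ler_sqr ?nnegrE ?mulr_ge0.
Qed.

Let r0 : 0 <= rho ^+ 2. Proof. exact: sqr_ge0. Qed.
Let r1 : rho ^+ 2 <= 1. Proof. by rewrite expr_le1. Qed.

Let term_le s m : term s m K <= rho ^+ 2 ^+ m * term s m G.
Proof.
rewrite /term mulrA ler_wpM2r// -quadZ -subr_ge0 -quadB.
exact: (psd_exp_le dotp_norm onb (u := fun i => St i.2) (v := fun i => kap i.2) r0 (@domination s)).
Qed.

(** The degree 0 term is the squared mean on both sides; each degree [m >= 1] is contracted by
    [rho^(2m) <= rho^2]. *)
Lemma gebelein s :
  \int[gs]_x tr (ou_seq s) x ^+ 2 - (\int[gt]_x tr s x) ^+ 2 <=
  rho ^+ 2 * (\int[gt]_x tr s x ^+ 2 - (\int[gt]_x tr s x) ^+ 2).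
Proof.
pose m0 := (\int[gt]_x tr s x) ^+ 2; rewrite -/m0.
suff : \int[gs]_x tr (ou_seq s) x ^+ 2 <=
    rho ^+ 2 * \int[gt]_x tr s x ^+ 2 + (1 - rho ^+ 2) * m0 by lra.
have m00 : 0 <= m0 by exact: sqr_ge0.
apply: (cvgn_le (@second_moment_s s)); first last.
  move=> M; apply: (_ : _ <= rho ^+ 2 * \sum_(m < M) term s m G + (1 - rho ^+ 2) * m0).
  case: M => [|M]; first by rewrite !big_ord0 mulr0 add0r mulr_ge0// subr_ge0.
  rewrite !big_ord_recl !term0 -/m0 mulrDr.
  have h : \sum_(i < M) term s (lift ord0 i) K <= rho ^+ 2 * \sum_(i < M) term s (lift ord0 i) G.
    rewrite mulr_sumr; apply: ler_sum => i _; apply: le_trans (term_le _ _) _.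
    by rewrite ler_wpM2r// lift0 [_ ^+ i.+1]exprS ler_piMr// exprn_ile1.
  by lra.
by apply: cvgD; [apply: cvgMr; exact: second_moment_t | exact: cvg_cst].
Qed.

Hypothesis rho_lt1 : rho < 1.
Hypothesis tail : forall eps : R, 0 < eps -> exists N : nat, forall h,
  `|kap h - onb_proj dotp e N (kap h)| ^+ 2 <= eps * `|St h| ^+ 2.

Lemma finite_rank_estimate (eps : R) : 0 < eps ->
  exists n (l : nat -> seq (R * R * X) -> R) (C : R),
  [/\ forall i s t, l i (s ++ trig_scale (-1) t) = l i s - l i t,
      forall i s, (i < n)%N -> l i s ^+ 2 <= C * \int[gt]_x tr s x ^+ 2 &
      forall s, \int[gs]_x tr (ou_seq s) x ^+ 2 <=
        eps * \int[gt]_x tr s x ^+ 2 + \sum_(i < n) l i s ^+ 2].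
Proof.
move=> eps0; have r1' : rho ^+ 2 < 1 by rewrite expr_lt1.
have [M rM] : exists M, forall m, (M <= m)%N -> rho ^+ 2 ^+ m <= eps.
  have : (fun m => rho ^+ 2 ^+ m) @ \oo --> (0 : R).
    by apply: cvg_expr; rewrite ger0_norm.
  move=> /cvgr0_norm_le/(_ _ eps0)[M _ hM]; exists M => m /hM /=.
  by rewrite ger0_norm ?exprn_ge0.
(* The factor [1 - rho^2] is the one that [geometric_derivative_le] consumes. *)
have eps1 : 0 < eps * (1 - rho ^+ 2) by rewrite mulr_gt0// subr_gt0.
have [N hN] := tail eps1.
pose pk (i : R * R * X) := onb_proj dotp e N (kap i.2).
have pkE i j : <<pk i, pk j>> = \sum_(k < N) <<kap i.2, e k>> * <<kap j.2, e k>>.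
  by rewrite onb_dot_proj; apply: eq_bigr => k _; rewrite onb_proj_coef.
have pk1 i j : <<kap i.2, pk j>> = <<pk i, pk j>>.
  by rewrite pkE (dotC dotp) onb_dot_proj; apply: eq_bigr => k _; rewrite mulrC.
have pk2 i j : <<pk i, kap j.2>> = <<pk i, pk j>>.
  by rewrite (dotC dotp) pk1; exact: dotC.
have vw i j : <<kap i.2, kap j.2>> - <<pk i, pk j>> = <<kap i.2 - pk i, kap j.2 - pk j>>.
  by rewrite (dotBl dotp) !(dotBr dotp) pk1 pk2 subrr subr0.
have tl s : psd s (fun i j => eps * (1 - rho ^+ 2) * G i j - (K i j - <<pk i, pk j>>)).
  move=> c; rewrite quadB quadZ /G /K (eq_quad _ _ vw).
  rewrite (quad_gram dotp_norm s c (fun i => St i.2)) (quad_gram dotp_norm s c (fun i => kap i.2 - pk i)).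
  have -> : \sum_(i <- s) c i *: (kap i.2 - pk i) =
      kap (\sum_(i <- s) c i *: i.2) - onb_proj dotp e N (kap (\sum_(i <- s) c i *: i.2)).
    rewrite -(lin_sum s c linkap); under eq_bigr do rewrite scalerBr; rewrite sumrB; congr (_ - _).
    rewrite /onb_proj; under [RHS]eq_bigr do rewrite (dot_suml dotp) scaler_suml.
    rewrite exchange_big; apply: eq_bigr => i _; rewrite /pk /onb_proj scaler_sumr.
    by apply: eq_bigr => k _; rewrite (dotZl dotp) scalerA.
  by rewrite (lin_sum _ _ linSt) subr_ge0.
have tail_m s m : quad s (trig_coef St m) (fun i j => K i j ^+ m) <=
    eps * quad s (trig_coef St m) (fun i j => G i j ^+ m) +
    quad s (trig_coef St m) (fun i j => <<pk i, pk j>> ^+ m).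
  have := psd_exp_tail dotp_norm onb (u := fun i => St i.2) (v := fun i => kap i.2) r0
    (@domination s) (ltW eps1) vw (tl s) m (trig_coef St m).
  rewrite quadB quadB quadZ => h.
  have h2 : m%:R * (eps * (1 - rho ^+ 2)) * rho ^+ 2 ^+ m.-1 <= eps.
    have := geometric_derivative_le m (r := rho ^+ 2); rewrite r0 r1 => /(_ isT) h3.
    have -> : m%:R * (eps * (1 - rho ^+ 2)) * rho ^+ 2 ^+ m.-1 =
        eps * (m%:R * (1 - rho ^+ 2) * rho ^+ 2 ^+ m.-1) by ring.
    by rewrite -[leRHS]mulr1 ler_wpM2l ?(ltW eps0).
  have := psd_gram_exp dotp_norm onb s (fun i => St i.2) m (trig_coef St m) => h4.
  rewrite /K; have := ler_wpM2r h4 h2; rewrite /G; lra.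
pose a k (h : X) := <<kap h, e k>>.
pose L := flatten [seq [seq (m, w) | w <- product_weights a N m] | m <- iota 0 M].
pose ell (l : nat * (X -> R)) s := \sum_(i <- s) trig_coef St l.1 i * l.2 i.2.
pose x0 : nat * (X -> R) := (0%N, fun=> 0).
have sumL s : \sum_(i < size L) ell (nth x0 L i) s ^+ 2 =
    \sum_(m < M) quad s (trig_coef St m) (fun i j => <<pk i, pk j>> ^+ m).
  rewrite -(big_mkord xpredT (fun i => ell (nth x0 L i) s ^+ 2)).
  rewrite -(big_nth x0 xpredT (fun l => ell l s ^+ 2)) /L big_flatten big_map.
  have -> : iota 0 M = index_iota 0 M by rewrite /index_iota subn0.
  rewrite big_mkord; apply: eq_bigr => m _.
  rewrite big_map; apply: etrans (esym (quad_product_weights a snd s (trig_coef St m) N m)) _.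
  by apply: eq_quad => i j; rewrite pkE.
(* [M!] compensates for the weights [1/m!] of the series, which the functionals omit. *)
exists (size L), (fun i s => ell (nth x0 L i) s), M`!%:R; split.
- move=> i s t; rewrite /ell big_cat /trig_scale big_map /=; congr (_ + _).
  rewrite -sumrN; apply: eq_bigr => j _; rewrite /trig_coef /=.
  by case: ifP => _; ring.
- move=> i s iL; apply: (@le_trans _ _ (\sum_(i < size L) ell (nth x0 L i) s ^+ 2)).
    rewrite (bigD1 (Ordinal iL))//= lerDl; apply: sumr_ge0 => j _; exact: sqr_ge0.
  rewrite sumL; apply: (@le_trans _ _ (M`!%:R * \sum_(m < M) term s m G)).
    rewrite mulr_sumr; apply: ler_sum => m _.
    have wu : psd s (fun i j => rho ^+ 2 * <<St i.2, St j.2>> - <<pk i, pk j>>).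
      apply: eq_psd (psdD (@domination s) (psd_gram dotp_norm s (fun i => kap i.2 - pk i))) => j k.
      by rewrite -vw /G /K; ring.
    have := psd_exp_le dotp_norm onb (u := fun i => St i.2) (v := pk) r0 wu m (trig_coef St m).
    rewrite quadB quadZ subr_ge0 => /le_trans; apply.
    apply: (@le_trans _ _ (quad s (trig_coef St m) (fun i j => G i j ^+ m))).
      by rewrite ler_piMl ?exprn_ile1//; exact: (psd_gram_exp dotp_norm onb).
    rewrite /term mulrA ler_pdivlMr ?ltr0n ?fact_gt0// mulrC ler_wpM2r//.
      exact: (psd_gram_exp dotp_norm onb).
    by rewrite ler_nat; apply: leq_fact; exact: ltnW.
  rewrite ler_wpM2l//; apply: (cvgr_to_ge (@second_moment_t s)); exists M => // m /= Mm.
  rewrite [leRHS](bigID (fun i : 'I_m => (i < M)%N))/= (big_ord_widen _ (fun i => term s i G) Mm).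
  by rewrite lerDl sumr_ge0.
- move=> s; rewrite sumL.
  have c2 : (fun m => eps * \sum_(i < m) term s i G +
      \sum_(m < M) quad s (trig_coef St m) (fun i j => <<pk i, pk j>> ^+ m)) @ \oo -->
    eps * \int[gt]_x tr s x ^+ 2 +
      \sum_(m < M) quad s (trig_coef St m) (fun i j => <<pk i, pk j>> ^+ m).
    by apply: cvgD; [apply: cvgMr; exact: second_moment_t | exact: cvg_cst].
  apply: (cvgn_le (@second_moment_s s) c2) => n.
  have q0 m : 0 <= quad s (trig_coef St m) (fun i j => <<pk i, pk j>> ^+ m).
    exact: (psd_gram_exp dotp_norm onb).
  apply: (@le_trans _ _ (\sum_(i < n) (eps * term s i G + (if (i < M)%N then
      quad s (trig_coef St i) (fun j k => <<pk j, pk k>> ^+ i) else 0)))).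
    apply: ler_sum => i _; case: ifPn => [iM|]; last first.
      rewrite -leqNgt => /rM h; rewrite addr0; apply: le_trans (term_le _ _) _.
      by rewrite ler_wpM2r.
    rewrite /term mulrA -[X in _ + X](mulfK (lt0r_neq0 (_ : 0 < i`!%:R :> R))) ?ltr0n ?fact_gt0//.
    rewrite -mulrDl ler_wpM2r// (le_trans (tail_m _ _))// lerD2l.
    by rewrite ler_peMr// ler1n fact_gt0.
  rewrite big_split -mulr_sumr lerD2l//= -big_mkcond/=.
  have [nM|Mn] := leqP n M.
    rewrite (big_ord_widen_cond _ (fun i => (i < M)%N) (fun i => quad s (trig_coef St i) (fun j k => <<pk j, pk k>> ^+ i)) nM).
    by rewrite big_mkcond; apply: ler_sum => i _; case: ifP.
  by rewrite (big_ord_widen _ (fun i => quad s (trig_coef St i) (fun j k => <<pk j, pk k>> ^+ i)) (ltnW Mn)).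
Qed.

End contraction.
End ornstein_uhlenbeck.

(** * Hypercontractivity *)

Section expansion_of_powers.
Context (R : realType).

Lemma ge0_of_derive_sign (f g : R -> R) : (forall x : R, is_derive x (1 : R) f (g x)) ->
  (forall x, 0 <= g x * x) -> f 0 = 0 -> forall x, 0 <= f x.
Proof.
move=> fg gx f0 x.
have cf : continuous f.
  by move=> y; apply: differentiable_continuous; apply/derivable1_diffP; apply: ex_derive.
have [x0|x0|->] := ltgtP x 0; last by rewrite f0.
- have [c] := MVT x0 (fun x _ => fg x) (continuous_subspaceT cf).
  rewrite in_itv/= f0 => /andP[xc c0] e; have := gx c.
  rewrite nmulr_lge0// => gc; have : g c * (0 - x) <= 0 by rewrite mulr_le0_ge0//; lra.
  by lra.
- have [c] := MVT x0 (fun x _ => fg x) (continuous_subspaceT cf).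
  rewrite in_itv/= f0 => /andP[c0 cx] e; have := gx c.
  rewrite pmulr_lge0// => gc; have : 0 <= g c * (x - 0) by rewrite mulr_ge0//; lra.
  by lra.
Qed.

(** With [1 + u = exp z] and [E = exp z - 1], right side minus left side is a function of [z] that
    vanishes at 0 and has derivative [(1 + E)(1 - E + E^2) - 1 = E^3], of the sign of [z]. *)
Lemma ln_le_cubic (u : R) : -1 < u -> ln (1 + u) <= u - u ^+ 2 / 2 + u ^+ 3 / 3.
Proof.
move=> u1; pose E (z : R) : R := expR z - 1.
have dE (z : R) : is_derive z (1 : R) E (expR z).
  by apply: is_derive_eq; rewrite oppr0 addr0.
pose h := (E - (2^-1 : R) \*: (E ^+ 2) + (3^-1 : R) \*: (E ^+ 3) - id) : R -> R.
have dh (z : R) : is_derive z (1 : R) h (E z ^+ 3).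
  by apply: is_derive_eq; rewrite /E /GRing.scale /=; field.
have h0 : h 0 = 0 by rewrite /h /E !fctE/= expR0 subrr !expr0n/= /GRing.scale/= !mulr0; ring.
have sgn (z : R) : 0 <= E z ^+ 3 * z.
  have [z0|z0] := leP 0 z.
    by rewrite mulr_ge0// exprn_ge0// subr_ge0 -expR0 ler_expR.
  have Ez : E z <= 0 by rewrite subr_le0 -expR0 ler_expR ltW.
  by rewrite mulr_le0// ?(ltW z0)// exprS mulr_le0_ge0// sqr_ge0.
have := ge0_of_derive_sign dh sgn h0 (ln (1 + u)).
have u1' : 0 < 1 + u by lra.
rewrite /h /E !fctE/= lnK ?posrE// /GRing.scale/=.
by rewrite (_ : 1 + u - 1 = u); lra.
Qed.

(** Taylor's bound by iterating the mean value theorem; each round multiplies [exp T] by one more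
    [|t|]. *)
Lemma expR_le_cubic (t T : R) : `|t| <= T ->
  expR t <= 1 + t + t ^+ 2 / 2 + expR T * `|t| ^+ 3.
Proof.
move=> tT.
have eT (c : R) : `|c| <= T -> expR c <= expR T.
  by move=> cT; rewrite ler_expR (le_trans (ler_norm _)).
have K0 : 0 <= expR T := expR_ge0 T.
have d2 (c : R) : `|c| <= T -> `|expR c - 1| <= expR T * `|c|.
  move=> cT; have [x] := mean_value (f := expR) (g := expR) (fun x => is_derive_expR x) 0 c.
  rewrite !subr0 expR0 => xc ->; rewrite normrM ler_wpM2r//.
  by rewrite ger0_norm ?expR_ge0// eT// (le_trans xc).
have d1 (c : R) : `|c| <= T -> `|expR c - 1 - c| <= expR T * `|c| ^+ 2.
  move=> cT; pose f := (expR - cst 1 - id) : R -> R.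
  have [|x] := mean_value (f := f) (g := fun x => expR x - 1) _ 0 c.
    by move=> x; apply: is_derive_eq; rewrite subr0.
  rewrite /f !fctE/= !subr0 expR0 subrr subr0 => xc ->.
  rewrite normrM expr2 mulrA ler_wpM2r// (le_trans (d2 _ _)) ?(le_trans xc)//.
  by rewrite ler_wpM2l.
have d0 : `|expR t - 1 - t - t ^+ 2 / 2| <= expR T * `|t| ^+ 3.
  pose f := (expR - cst 1 - id - (2^-1 : R) \*: (id ^+ 2)) : R -> R.
  have [|x] := mean_value (f := f) (g := fun x => expR x - 1 - x) _ 0 t.
    by move=> x; apply: is_derive_eq; rewrite /GRing.scale/= expr1; field.
  rewrite /f !fctE/= /GRing.scale/= !subr0 expR0 subrr expr0n/= mulr0 !subr0 => xt e.
  rewrite (_ : _ - t ^+ 2 / 2 = (expR x - 1 - x) * t); last by rewrite -e; ring.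
  rewrite normrM exprSr mulrA ler_wpM2r// (le_trans (d1 _ (le_trans xt tT)))//.
  by rewrite ler_wpM2l// ler_sqr ?nnegrE.
by have := le_trans (ler_norm _) d0; lra.
Qed.

(** Only an upper bound is claimed, so [ln_le_cubic] serves down to [u] near -1, where the logarithm
    itself is unbounded; the cubic exponent that replaces it stays bounded and [expR_le_cubic]
    applies to it. *)
Lemma power_product_le (al be M : R) : 0 < al < 1 -> 0 < be < 1 -> 1 <= M ->
  exists2 C : R, 0 <= C & forall u v, -1 < u -> -1 < v -> `|u| <= M -> `|v| <= M ->
    expR (al * ln (1 + u) + be * ln (1 + v)) <=
    1 + (al * u + be * v) +
    (al * (al - 1) * u ^+ 2 + 2 * al * be * (u * v) + be * (be - 1) * v ^+ 2) / 2 +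
    C * (`|u| ^+ 3 + `|v| ^+ 3).
Proof.
move=> /andP[a0 a1] /andP[b0 b1] M1; pose c := 1 + M; pose T := (2 + c * M) * M.
pose C := 2 + c * (4 + c * M) + expR T * (2 + c * M) ^+ 3.
have c0 : 0 <= c by rewrite /c; lra.
have cM : 0 <= c * M by rewrite mulr_ge0//; lra.
have C0 : 0 <= C.
  by rewrite /C addr_ge0// ?mulr_ge0 ?expR_ge0 ?exprn_ge0// ?addr_ge0// ?mulr_ge0// addr_ge0.
exists C => // u v u1 v1 uM vM.
(* All errors are measured against [s]; [l], [r2], [r3] below are the parts of degree 1, 2 and 3 of
   the exponent, and [c = 1 + M] gives [|r2 + r3| <= c s^2]. *)
pose s := Num.max `|u| `|v|.
have us' : `|u| <= s by rewrite le_max lexx.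
have vs' : `|v| <= s by rewrite le_max lexx orbT.
have sM : s <= M by rewrite ge_max uM vM.
have s0 : 0 <= s := le_trans (normr_ge0 _) us'.
have s3 : s ^+ 3 <= `|u| ^+ 3 + `|v| ^+ 3.
  have [uv|vu] := leP `|u| `|v|.
    by rewrite /s max_r// lerDr exprn_ge0.
  by rewrite /s max_l ?(ltW vu)// lerDl exprn_ge0.
pose l := al * u + be * v.
pose r2 := - (al * u ^+ 2 + be * v ^+ 2) / 2.
pose r3 := (al * u ^+ 3 + be * v ^+ 3) / 3.
have us : - s <= u <= s by rewrite -ler_norml.
have vs : - s <= v <= s by rewrite -ler_norml.
have /andP[us1 us2] := us; have /andP[vs1 vs2] := vs.
have sq x : - s <= x -> x <= s -> 0 <= x ^+ 2 <= s ^+ 2.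
  by move=> h1 h2; rewrite sqr_ge0 -(real_normK (num_real x)) ler_sqr ?nnegrE// ler_norml h1 h2.
have cu x : - s <= x -> x <= s -> - s ^+ 3 <= x ^+ 3 <= s ^+ 3.
  move=> h1 h2; rewrite -ler_norml normrX lerXn2r ?nnegrE// ler_norml h1 h2//.
have /andP[u20 u2] := sq _ us1 us2; have /andP[v20 v2] := sq _ vs1 vs2.
have uc := cu _ us1 us2; have vc := cu _ vs1 vs2.
have sc (a x y : R) : 0 < a -> a < 1 -> - y <= x <= y -> - y <= a * x <= y.
  move=> a0' a1' xy; rewrite -ler_norml normrM gtr0_norm//.
  by rewrite -ler_norml in xy; rewrite (le_trans _ xy)// ler_piMl// ltW.
have /andP[au1 au2] := sc al u s a0 a1 us; have /andP[bv1 bv2] := sc be v s b0 b1 vs.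
have /andP[au3 au4] := sc al _ _ a0 a1 uc; have /andP[bv3 bv4] := sc be _ _ b0 b1 vc.
have au5 : 0 <= al * u ^+ 2 <= s ^+ 2 by rewrite mulr_ge0 ?(ltW a0)//= (le_trans _ u2)// ler_piMl// ltW.
have bv5 : 0 <= be * v ^+ 2 <= s ^+ 2 by rewrite mulr_ge0 ?(ltW b0)//= (le_trans _ v2)// ler_piMl// ltW.
move: au5 bv5 => /andP[au5 au6] /andP[bv5 bv6].
have l2 : - (2 * s) <= l <= 2 * s by rewrite /l; clear -au1 au2 bv1 bv2; apply/andP; split; lra.
have r2b : - s ^+ 2 <= r2 <= 0 by rewrite /r2; clear -au5 au6 bv5 bv6; apply/andP; split; lra.
have r3b : - s ^+ 3 <= r3 <= s ^+ 3 by rewrite /r3; clear -au3 au4 bv3 bv4; apply/andP; split; lra.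
have s32 : s ^+ 3 <= M * s ^+ 2 by rewrite exprS ler_wpM2r// sqr_ge0.
have sM2 : s ^+ 2 <= M * s by rewrite expr2 ler_wpM2r.
have rb : - (c * s ^+ 2) <= r2 + r3 <= c * s ^+ 2.
  rewrite /c; clear -r2b r3b s32; move: r2b r3b => /andP[? ?] /andP[? ?].
  by apply/andP; split; lra.
pose t := l + (r2 + r3).
have tb : `|t| <= (2 + c * M) * s.
  rewrite ler_norml; move: l2 rb => /andP[i i0] /andP[i1 i2].
  have h : c * s ^+ 2 <= c * M * s by rewrite -mulrA ler_wpM2l.
  by rewrite /t; clear -h i i0 i1 i2; apply/andP; split; lra.
have tT : `|t| <= T by apply: le_trans tb _; rewrite ler_wpM2l// addr_ge0.
have et : expR (al * ln (1 + u) + be * ln (1 + v)) <= expR t.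
  rewrite ler_expR; have := ln_le_cubic u1; have := ln_le_cubic v1.
  move=> hv hu; have := ler_wpM2l (ltW a0) hu; have := ler_wpM2l (ltW b0) hv.
  by rewrite /t /l /r2 /r3 => h1 h2; clear -h1 h2; lra.
apply: (le_trans et); apply: (le_trans (expR_le_cubic tT)).
have t3 : expR T * `|t| ^+ 3 <= expR T * (2 + c * M) ^+ 3 * s ^+ 3.
  rewrite -mulrA -exprMn ler_wpM2l ?expR_ge0// lerXn2r ?nnegrE// mulr_ge0//.
  by rewrite addr_ge0.
have tt : t ^+ 2 <= l ^+ 2 + 2 * (c * (4 + c * M)) * s ^+ 3.
  have -> : t ^+ 2 = l ^+ 2 + (r2 + r3) * (2 * l + (r2 + r3)) by rewrite /t; ring.
  rewrite lerD2l; apply: le_trans (ler_norm _) _; rewrite normrM.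
  have h1 : `|r2 + r3| <= c * s ^+ 2 by rewrite ler_norml.
  have h2 : `|2 * l + (r2 + r3)| <= (4 + c * M) * s.
    have h : c * s ^+ 2 <= c * M * s by rewrite -mulrA ler_wpM2l.
    rewrite ler_norml; move: l2 rb => /andP[i i0] /andP[i1 i2].
    by clear -h i i0 i1 i2; apply/andP; split; lra.
  apply: le_trans (ler_pM _ _ h1 h2) _ => //.
  have -> : c * s ^+ 2 * ((4 + c * M) * s) = c * (4 + c * M) * s ^+ 3 by ring.
  have h3 : 0 <= s ^+ 3 by rewrite exprn_ge0.
  have h4 : 0 <= c * (4 + c * M) by rewrite mulr_ge0// addr_ge0.
  by have h5 := mulr_ge0 h4 h3; clear -h5; lra.
have Cs : (2 + c * (4 + c * M) + expR T * (2 + c * M) ^+ 3) * s ^+ 3 <= C * (`|u| ^+ 3 + `|v| ^+ 3).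
  by rewrite ler_wpM2l.
move: r3b => /andP[_ r3b].
have -> : (al * (al - 1) * u ^+ 2 + 2 * al * be * (u * v) + be * (be - 1) * v ^+ 2) / 2 =
  r2 + l ^+ 2 / 2 by rewrite /r2 /l; field.
have h3 : 0 <= s ^+ 3 by rewrite exprn_ge0.
have -> : 1 + t + t ^+ 2 / 2 = 1 + l + (r2 + l ^+ 2 / 2) + (r3 + (t ^+ 2 - l ^+ 2) / 2).
  by rewrite /t; field.
rewrite -/l -!addrA !lerD2l.
by apply: le_trans Cs; clear -t3 tt r3b h3; lra.
Qed.

End expansion_of_powers.

Section square_distance.
Context (R : realType).

Lemma sqr_dist_le (x y : R) : 0 <= x <= 1 -> 0 <= y <= 1 -> `|x ^+ 2 - y ^+ 2| <= 2 * `|x - y|.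
Proof.
move=> /andP[x0 x1] /andP[y0 y1].
by rewrite subr_sqr normrM mulrC ler_wpM2r// ger0_norm; lra.
Qed.

Lemma expect_sqr_dist d (T : measurableType d) (P : probability T R) (f g : T -> R) :
  bmf f -> bmf g -> (forall x, 0 <= f x <= 1) -> (forall x, 0 <= g x <= 1) ->
  `|\int[P]_x f x ^+ 2 - \int[P]_x g x ^+ 2| <= 2 * \int[P]_x `|f x - g x|.
Proof.
move=> bf bg f01 g01; have bn := bmf_norm (bmfB bf bg).
have bB := bmfB (bmfX 2 bf) (bmfX 2 bg).
rewrite -expectB; [|exact: bmfX|exact: bmfX]; rewrite -expectZ//.
apply: (le_trans (expect_norm _ bB)); apply: expect_le => [||x].
- exact: bmf_norm.
- exact: bmfZ.
- exact: sqr_dist_le.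
Qed.

End square_distance.

Section ou_bounded.
Context (R : realType) (X : completeNormedModType R).
Variable dotp : {dot X for idfun}.
Hypothesis dotp_norm : is_inner_product dotp.
Hypothesis Xsep : separable X.
Local Notation "<< x , y >>" := (dotp x y) (at level 0, format "<< x ,  y >>").
Implicit Types f g : borel X -> R.
Local Notation tr := (trig (fun (h : X) (x : borel X) => <<x, h>>)).

Lemma borel_trig_dense (P Q : probability (borel X) R) (g : borel X -> R) :
  measurable_fun [set: borel X] g -> (forall x, 0 <= g x <= 1) ->
  forall e : R, 0 < e -> exists s, [/\ forall x, 0 <= tr s x <= 1,
    \int[P]_x `|tr s x - g x| < e & \int[Q]_x `|tr s x - g x| < e].
Proof.
apply: trig_dense => //.
- exact: measurable_dot.
- by move=> a u v x; rewrite (dotDr dotp) (dotZr dotp).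
- exact: borel_generated.
Qed.

Lemma bmf_borel_trig s : bmf (tr s).
Proof. by apply: bmf_trig => h; exact: measurable_dot. Qed.

Definition halfsum (x y : X) : X := (Num.sqrt 2)^-1 *: (x + y).

Lemma measurable_pair_to_borel (f : borel X * borel X -> X) :
  (forall h, measurable_fun [set: borel X * borel X] (fun z => <<f z, h>>)) ->
  measurable_fun [set: borel X * borel X] (f : _ -> borel X).
Proof. exact: measurable_to_borel. Qed.

Lemma measurable_dot_fst h : measurable_fun [set: borel X * borel X] (fun z : borel X * borel X => <<z.1, h>>).
Proof. exact: (measurableT_comp (@measurable_dot _ _ _ dotp_norm h) measurable_fst). Qed.

Lemma measurable_dot_snd h : measurable_fun [set: borel X * borel X] (fun z : borel X * borel X => <<z.2, h>>).
Proof. exact: (measurableT_comp (@measurable_dot _ _ _ dotp_norm h) measurable_snd). Qed.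

Lemma measurable_halfsum :
  measurable_fun [set: borel X * borel X] (fun z => halfsum z.1 z.2 : borel X).
Proof.
apply: measurable_pair_to_borel => h; under eq_fun do rewrite /halfsum (dotZl dotp) (dotDl dotp).
by apply: measurable_funM => //; apply: measurable_funD; [exact: measurable_dot_fst | exact: measurable_dot_snd].
Qed.

(** By characteristic functions: each of the two independent copies contributes half of the
    quadratic form. *)
Lemma gaussian_halfsum (Q : X -> X) (g : probability (borel X) R) (f : borel X -> R) :
  linear Q -> (forall h, 0 <= <<Q h, h>>) -> is_gaussian dotp 0 Q g -> bmf f ->
  \int[g]_x f x = \int[g]_x \int[g]_y f (halfsum x y).
Proof.
move=> linQ Q0 Gg bf.
have bF := bmf_comp measurable_halfsum bf.
rewrite -(expect_prod1 g g bF) -(expect_law (g \x g)%E measurable_halfsum bf).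
apply: expect_eq_measure => E mE.
set P := law _ _; suff h : forall E, measurable E -> g E = P E by exact: h.
have gP : is_gaussian dotp 0 Q P.
  have gc := gaussian_cos_shift dotp_norm Q0 Gg; have gsn := gaussian_sin_shift dotp_norm Q0 Gg.
  have b1 h : bmf (fun z : borel X * borel X => cos <<halfsum z.1 z.2, h>>).
    apply: bmf_cos; exact: (measurableT_comp (@measurable_dot _ _ _ dotp_norm h) measurable_halfsum).
  have b2 h : bmf (fun z : borel X * borel X => sin <<halfsum z.1 z.2, h>>).
    apply: bmf_sin; exact: (measurableT_comp (@measurable_dot _ _ _ dotp_norm h) measurable_halfsum).
  have bc h : bmf (fun x : borel X => cos <<x, h>>) by apply: bmf_cos; exact: measurable_dot.
  have bs h : bmf (fun x : borel X => sin <<x, h>>) by apply: bmf_sin; exact: measurable_dot.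
  pose c : R := (Num.sqrt 2)^-1.
  have c2 : c ^+ 2 = 2^-1 by rewrite /c exprVn sqr_sqrtr.
  have hE x y h : <<halfsum x y, h>> = <<x, c *: h>> + <<y, c *: h>>.
    by rewrite /halfsum (dotZl dotp) (dotDl dotp) mulrDr !(dotZr dotp).
  have q2 h : expR (- <<Q (c *: h), c *: h>> / 2) * expR (- <<Q (c *: h), c *: h>> / 2) =
      expR (- <<Q h, h>> / 2).
    rewrite -expRD; congr expR; rewrite (linfZ linQ) (dotZl dotp) (dotZr dotp) mulrA -expr2 c2.
    by field.
  apply: (is_gaussian_of_cf dotp_norm linQ Q0) => h.
  - rewrite (expect_law (g \x g)%E measurable_halfsum (bc h)) (expect_prod1 g g (b1 h)).
    transitivity (\int[g]_x (expR (- <<Q (c *: h), c *: h>> / 2) * cos (0 + <<x, c *: h>>))).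
      apply: eq_Rintegral => x _; rewrite mulrC add0r -gc.
      by apply: eq_Rintegral => y _; rewrite hE.
    rewrite expectZ; last by under eq_fun do rewrite add0r.
    by rewrite gc (dot0l dotp) cos0 !mul1r q2.
  - rewrite (expect_law (g \x g)%E measurable_halfsum (bs h)) (expect_prod1 g g (b2 h)).
    transitivity (\int[g]_x (expR (- <<Q (c *: h), c *: h>> / 2) * sin (0 + <<x, c *: h>>))).
      apply: eq_Rintegral => x _; rewrite mulrC add0r -gsn.
      by apply: eq_Rintegral => y _; rewrite hE.
    rewrite expectZ; last by under eq_fun do rewrite add0r.
    by rewrite gsn (dot0l dotp) sin0 !mul0r mulr0.
exact: (gaussian_unique dotp_norm Xsep Q0 Gg gP).
Qed.

Variables (A Qs Qt Qn Ss St : X -> X) (gs gt nu : probability (borel X) R).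
Hypothesis bA : bounded_operator A.
Hypothesis rs : nonneg_root dotp Qs Ss.
Hypothesis rt : nonneg_root dotp Qt St.
Hypothesis Qn0 : forall h, 0 <= <<Qn h, h>>.
Hypothesis Gs : is_gaussian dotp 0 Qs gs.
Hypothesis Gt : is_gaussian dotp 0 Qt gt.
Hypothesis Gn : is_gaussian dotp 0 Qn nu.
Hypothesis split : forall x y,
  <<Qt x, y>> = <<Qs (adjoint dotp A x), adjoint dotp A y>> + <<Qn x, y>>.
Variable e : nat -> X.
Hypothesis onb : onb_seq dotp e.
Local Notation P := (ou A nu).

Lemma measurable_ou_map :
  measurable_fun [set: borel X * borel X] (fun z : borel X * borel X => A z.1 + z.2 : borel X).
Proof.
apply: measurable_pair_to_borel => h; under eq_fun do rewrite (dotDl dotp) (adjointP dotp_norm bA).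
by apply: measurable_funD; [exact: measurable_dot_fst | exact: measurable_dot_snd].
Qed.

Lemma bmf_ou_map f : bmf f -> bmf (fun z : borel X * borel X => f (A z.1 + z.2)).
Proof. by move=> bf; exact: (bmf_comp measurable_ou_map bf). Qed.

Lemma bmf_ou_section f x : bmf f -> bmf (fun y : borel X => f (A x + y)).
Proof. by move=> bf; exact: (bmf_section1 (bmf_ou_map bf) x). Qed.

Lemma bmf_ou f : bmf f -> bmf (P f).
Proof. by move=> bf; exact: (bmf_expect1 gs nu (bmf_ou_map bf)). Qed.

Lemma ouB f g x : bmf f -> bmf g -> P (fun z => f z - g z) x = P f x - P g x.
Proof. by move=> bf bg; rewrite /ou expectB//; exact: bmf_ou_section. Qed.

Lemma ouZ f c x : bmf f -> P (fun z => c * f z) x = c * P f x.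
Proof. by move=> bf; rewrite /ou expectZ//; exact: bmf_ou_section. Qed.

Lemma ou_cst (c : R) x : P (fun=> c) x = c.
Proof. by rewrite /ou expect_cst. Qed.

Lemma ou_norm_le f x : bmf f -> `|P f x| <= P (fun z => `|f z|) x.
Proof. by move=> bf; apply: expect_norm; exact: bmf_ou_section. Qed.

(** The image of [gs \x nu] under [(x, y) |-> A x + y] is [gt], as trigonometric polynomials
    show. *)
Lemma expect_ou f : bmf f -> \int[gs]_x P f x = \int[gt]_x f x.
Proof.
move=> bf; have bF := bmf_ou_map bf.
rewrite -(expect_prod1 gs nu bF) -(expect_law (gs \x nu)%E measurable_ou_map bf).
apply: expect_eq_measure => E mE.
set Q := law _ _; suff h : forall E, measurable E -> Q E = gt E by exact: h.
have key s : \int[Q]_x tr s x = \int[gt]_x tr s x.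
  rewrite (expect_law (gs \x nu)%E measurable_ou_map (bmf_borel_trig s)).
  rewrite (expect_prod1 gs nu (bmf_ou_map (bmf_borel_trig s))).
  rewrite -(expect_ou_trig dotp_norm rs rt Gs Gt split).
  by apply: eq_Rintegral => x _; rewrite -(ou_trig dotp_norm bA Qn0 Gn).
apply: (borel_unique dotp_norm Xsep) => h.
- have := key [:: (1, 0, h)]; rewrite /trig.
  by under eq_Rintegral do rewrite big_seq1/= mul1r mul0r addr0;
     under [RHS]eq_Rintegral do rewrite big_seq1/= mul1r mul0r addr0.
- have := key [:: (0, 1, h)]; rewrite /trig.
  by under eq_Rintegral do rewrite big_seq1/= mul1r mul0r add0r;
     under [RHS]eq_Rintegral do rewrite big_seq1/= mul1r mul0r add0r.
Qed.

Lemma expect_norm_ou_le f : bmf f -> \int[gs]_x `|P f x| <= \int[gt]_x `|f x|.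
Proof.
move=> bf; rewrite -(expect_ou (bmf_norm bf)); apply: expect_le => [||x].
- by apply: bmf_norm; exact: bmf_ou.
- by apply: bmf_ou; exact: bmf_norm.
- exact: ou_norm_le.
Qed.

Section contraction.
Variable rho : R.
Hypothesis rho0 : 0 <= rho.
Hypothesis rho1 : rho <= 1.
Hypothesis kap_rho : forall h, `|Ss (adjoint dotp A h)| <= rho * `|St h|.

Let gebelein01 f : bmf f -> (forall x, 0 <= f x <= 1) ->
  \int[gs]_x P f x ^+ 2 - (\int[gt]_x f x) ^+ 2 <=
  rho ^+ 2 * (\int[gt]_x f x ^+ 2 - (\int[gt]_x f x) ^+ 2).
Proof.
move=> bf f01; apply/ler_addgt0Pr => d d0; have d8 : 0 < d / 8 by lra.
have [s [s01 sf _]] := borel_trig_dense gt gt (proj1 bf) f01 d8.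
have bs := bmf_borel_trig s; have bsf : bmf (fun x => tr s x - f x) := bmfB bs bf.
have P01 k : bmf k -> (forall x, 0 <= k x <= 1) -> forall x, 0 <= P k x <= 1.
  move=> bk k01 x; apply/andP; split.
    by apply: expect_ge_cst => [|y]; [exact: bmf_ou_section | case/andP: (k01 (A x + y))].
  by apply: expect_le_cst => [|y]; [exact: bmf_ou_section | case/andP: (k01 (A x + y))].
have a1 := expect_sqr_dist gs (bmf_ou bs) (bmf_ou bf) (P01 _ bs s01) (P01 _ bf f01).
have a2 := expect_sqr_dist gt bs bf s01 f01.
have PB : \int[gs]_x `|P (tr s) x - P f x| <= \int[gt]_x `|tr s x - f x|.
  apply: le_trans (expect_norm_ou_le bsf).
  by under eq_Rintegral do rewrite -ouB//.
have a3 : `|\int[gt]_x tr s x - \int[gt]_x f x| <= \int[gt]_x `|tr s x - f x|.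
  by rewrite -expectB//; exact: expect_norm.
have i01 k : bmf k -> (forall x, 0 <= k x <= 1) -> 0 <= \int[gt]_x k x <= 1.
  move=> bk k01; apply/andP; split.
    by apply: expect_ge_cst => // y; case/andP: (k01 y).
  by apply: expect_le_cst => // y; case/andP: (k01 y).
have a4 := sqr_dist_le (i01 _ bs s01) (i01 _ bf f01).
have G := gebelein dotp_norm bA rs rt Gs Gt split onb rho0 rho1 kap_rho s.
have PsE : \int[gs]_x P (tr s) x ^+ 2 = \int[gs]_x tr (ou_seq dotp A Qn s) x ^+ 2.
  by apply: eq_Rintegral => x _; rewrite (ou_trig dotp_norm bA Qn0 Gn).
rewrite PsE in a1.
have r2 : 0 <= rho ^+ 2 <= 1 by rewrite sqr_ge0/= expr_le1.
move: a1 a2 a4; rewrite !ler_norml => /andP[b1 b2] /andP[b3 b4] /andP[b5 b6].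
move: r2 => /andP[r20 r21].
set V := \int[gt]_x f x ^+ 2 - _; set W := \int[gt]_x tr s x ^+ 2 - _ in G.
have WV : W <= V + d / 2 by rewrite /W /V; lra.
have h1 : rho ^+ 2 * W <= rho ^+ 2 * V + rho ^+ 2 * (d / 2) by rewrite -mulrDr ler_wpM2l.
have h2 : rho ^+ 2 * (d / 2) <= d / 2 by rewrite ler_piMl// ltW// divr_gt0.
by lra.
Qed.

(** Both sides are built from variances, which ignore translations and are quadratic under scaling,
    so values in [0, 1] suffice. *)
Lemma gebelein_bmf f : bmf f ->
  \int[gs]_x P f x ^+ 2 - (\int[gt]_x f x) ^+ 2 <=
  rho ^+ 2 * (\int[gt]_x f x ^+ 2 - (\int[gt]_x f x) ^+ 2).
Proof.
move=> bf; have [mf [M0 fM0]] := bf; pose M := M0 + 1.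
have M00 : 0 <= M0 := le_trans (normr_ge0 _) (fM0 0).
have M1 : 0 < M by rewrite /M; lra.
pose g x := (2 * M)^-1 * (f x + M).
have bg : bmf g by apply: bmfZ; apply: bmfD => //; exact: bmf_cst.
have g01 x : 0 <= g x <= 1.
  have := fM0 x; rewrite ler_norml => /andP[h1 h2].
  by rewrite /g mulrC ler_pdivlMr ?ler_pdivrMr ?mulr_gt0// mul0r mul1r /M; apply/andP; split; lra.
have fE : f = fun x => 2 * M * g x - M.
  by apply/funext => x; rewrite /g mulrA mulfV ?mul1r ?addrK// gt_eqF// mulr_gt0.
have bZ : bmf (fun x => 2 * M * g x) := bmfZ (2 * M) bg.
have bPg : bmf (P g) := bmf_ou bg.
have PfE : P f = fun x => 2 * M * P g x - M.
  by apply/funext => x; rewrite [in LHS]fE (ouB _ bZ (bmf_cst _ M)) ouZ// ou_cst.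
have sqE (Pr : probability (borel X) R) (k : borel X -> R) : bmf k ->
    \int[Pr]_x (2 * M * k x - M) ^+ 2 =
    4 * M ^+ 2 * \int[Pr]_x k x ^+ 2 - 4 * M ^+ 2 * \int[Pr]_x k x + M ^+ 2.
  move=> bk; have bk2 := bmfZ (4 * M ^+ 2) (bmfX 2 bk); have bk1 := bmfZ (4 * M ^+ 2) bk.
  transitivity (\int[Pr]_x (4 * M ^+ 2 * k x ^+ 2 - 4 * M ^+ 2 * k x + M ^+ 2)).
    by apply: eq_Rintegral => x _; ring.
  rewrite (expectD Pr (bmfB bk2 bk1) (bmf_cst _ (M ^+ 2))) (expectB Pr bk2 bk1).
  by rewrite (expectZ Pr _ (bmfX 2 bk)) (expectZ Pr _ bk) expect_cst.
have mE (k : borel X -> R) : bmf k -> \int[gt]_x (2 * M * k x - M) = 2 * M * \int[gt]_x k x - M.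
  by move=> bk; rewrite (expectB gt (bmfZ (2 * M) bk) (bmf_cst _ M)) (expectZ gt _ bk) expect_cst.
rewrite PfE {1 2 3}fE !sqE// mE// (expect_ou bg).
by have := gebelein01 bg g01; have := sqr_ge0 M; nra.
Qed.

End contraction.
End ou_bounded.

(** * Third moments of functions with a cylindrical modulus of continuity *)

Section cubic_moments.
Context (R : realType) (X : completeNormedModType R).
Variable dotp : {dot X for idfun}.
Hypothesis dotp_norm : is_inner_product dotp.
Local Notation "<< x , y >>" := (dotp x y) (at level 0, format "<< x ,  y >>").
Variables (Q S : X -> X) (g : probability (borel X) R).
Hypothesis rQ : nonneg_root dotp Q S.
Hypothesis Gg : is_gaussian dotp 0 Q g.

(** Shape of the modulus of continuity of a trigonometric polynomial; it depends on finitely many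
    directions, so it has moments under a Gaussian measure, and it is homogeneous. *)
Definition seminorm (H : seq (R * X)) (w : X) : R := \sum_(i <- H) `|i.1| * `|<<w, i.2>>|.

Lemma seminorm_ge0 H w : 0 <= seminorm H w.
Proof. by apply: sumr_ge0 => i _; rewrite mulr_ge0. Qed.

Lemma seminormZ H (c : R) w : 0 <= c -> seminorm H (c *: w) = c * seminorm H w.
Proof.
move=> c0; rewrite mulr_sumr; apply: eq_bigr => i _.
by rewrite (dotZl dotp) normrM ger0_norm// mulrCA.
Qed.

Lemma measurable_seminorm H : measurable_fun [set: borel X] (seminorm H : borel X -> R).
Proof.
apply: measurable_sum => i; apply: measurable_funM => //.
by apply: (measurableT_comp (@normr_measurable R setT)); exact: measurable_dot.
Qed.

Let dot_cube h : (\int[g]_w (`|<<w, h>>| ^+ 3)%:E < +oo)%E.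
Proof.
have [_ sym _ SS] := rQ; have Q0 : 0 <= <<Q h, h>> by rewrite -SS sym (dotxx_ge0 dotp_norm).
have mh := @measurable_dot _ _ _ dotp_norm h.
have mc : measurable_fun [set: R] (fun y : R => (`|y| ^+ 3)%:E).
  by apply/measurable_EFinP; apply: measurable_funX; exact: normr_measurable.
have E := ge0_integral_normal (v := <<Q h, h>>) (m := 0) mh Q0 _ mc.
rewrite E => [|A mA|y]; last 2 first.
- by have := Gg h mA; rewrite (dot0l dotp).
- by rewrite lee_fin exprn_ge0.
set q := Num.sqrt _.
have : (@gauss1 R).-integrable setT (EFin \o (fun y => `|0 + q * y| ^+ 3)).
  apply: (@gauss1_integrable _ _ (`|q| ^+ 3)) => [|y].
    apply: measurable_funX; apply: (measurableT_comp (@normr_measurable R setT)).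
    by apply: measurable_funD => //; exact: measurable_funM.
  rewrite add0r normrX normr_id normrM exprMn ler_wpM2l ?exprn_ge0//.
  have y0 := normr_ge0 y; rewrite -[y ^+ 4]ger0_norm ?normrX; last by rewrite (exprM _ 2 2) sqr_ge0.
  have [y1|y1] := leP `|y| 1.
    by rewrite (le_trans (exprn_ile1 3 y0 y1))// lerDl exprn_ge0.
  rewrite exprS; have h3 : 0 <= `|y| ^+ 3 by rewrite exprn_ge0.
  by rewrite [`|y| ^+ 4]exprS; nra.
move/integrable_fin_num => /(_ measurableT); rewrite ge0_fin_numE//.
by apply: integral_ge0 => y _; rewrite lee_fin exprn_ge0.
Qed.

Lemma seminorm_cube H : exists2 K : R, 0 <= K &
  (\int[g]_w (seminorm H w ^+ 3)%:E <= K%:E)%E.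
Proof.
have mc H' : measurable_fun [set: borel X] (fun w : borel X => (seminorm H' w ^+ 3)%:E).
  by apply/measurable_EFinP; apply: measurable_funX; exact: measurable_seminorm.
have pos H' : (0 <= \int[g]_w (seminorm H' w ^+ 3)%:E)%E.
  by apply: integral_ge0 => w _; rewrite lee_fin exprn_ge0// seminorm_ge0.
suff fin : (\int[g]_w (seminorm H w ^+ 3)%:E < +oo)%E.
  exists (fine (\int[g]_w (seminorm H w ^+ 3)%:E)%E); first exact: fine_ge0.
  by rewrite fineK// ge0_fin_numE.
elim: H => [|[c h] H IH].
  under eq_integral do rewrite /seminorm big_nil expr0n/=.
  by rewrite integral0 ltry.
have md : measurable_fun [set: borel X] (fun w : borel X => (`|<<w, h>>| ^+ 3)%:E).
  apply/measurable_EFinP; apply: measurable_funX; apply: (measurableT_comp (@normr_measurable R setT)).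
  exact: measurable_dot.
apply: (@le_lt_trans _ _ (\int[g]_w ((4 * `|c| ^+ 3)%:E * (`|<<w, h>>| ^+ 3)%:E +
    4%:E * (seminorm H w ^+ 3)%:E))%E).
  apply: ge0_le_integral => //=.
  - by move=> w _; rewrite lee_fin exprn_ge0// seminorm_ge0.
  - by apply: emeasurable_funD; apply: emeasurable_funM => //; exact: (mc H).
  - move=> w _; rewrite -!EFinM -EFinD lee_fin /seminorm big_cons /= -/(seminorm H w).
    rewrite -mulrA -exprMn; have := seminorm_ge0 H w.
    have : 0 <= `|c| * `|<<w, h>>| by rewrite mulr_ge0.
    move: (`|c| * _) (seminorm _ _) => a b a0 b0.
    (* [4 (a^3 + b^3) - (a + b)^3 = 3 (a + b) (a - b)^2]. *)
    have : 0 <= (a + b) * (a - b) ^+ 2 by rewrite mulr_ge0 ?addr_ge0 ?sqr_ge0.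
    by rewrite -mulrDr; lra.
have pc w : [set: borel X] w -> (0 <= (`|<<w, h>>| ^+ 3)%:E)%E by rewrite lee_fin exprn_ge0.
have pH w : [set: borel X] w -> (0 <= (seminorm H w ^+ 3)%:E)%E.
  by rewrite lee_fin exprn_ge0// seminorm_ge0.
have c0 : (0 <= (4 * `|c| ^+ 3)%:E)%E by rewrite lee_fin mulr_ge0// exprn_ge0.
rewrite (ge0_integralD _ measurableT (fun w Tw => mule_ge0 c0 (pc w Tw))
  (emeasurable_funM (measurable_cst _) md) (fun w Tw => mule_ge0 (ler0n _ 4 : (0 <= 4%:E)%E) (pH w Tw))
  (emeasurable_funM (measurable_cst _) (mc H))).
rewrite (ge0_integralZl _ measurableT md pc c0) (ge0_integralZl _ measurableT (mc H) pH)//.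
apply: lte_add_pinfty; apply: lte_mul_pinfty => //; exact: dot_cube.
Qed.

Definition modulus H (lam : R) (F : borel X -> R) :=
  forall w w' : X, `|F w - F w'| <= lam * seminorm H (w - w').

(** The centred third moment is of order [lam^3] with a constant depending on [H] alone. Each later
    doubling divides [lam] by sqrt 2, so cubic errors shrink faster than their number grows. *)
Lemma modulus_cube H : exists2 K : R, 0 <= K & forall F lam, bmf F -> 0 <= lam ->
  modulus H lam F -> \int[g]_w `|F w - \int[g]_z F z| ^+ 3 <= K * lam ^+ 3.
Proof.
have [K K0 NK] := seminorm_cube H; exists (8 * K); first by rewrite mulr_ge0.
move=> F lam bF lam0 FH; pose f w := F w - F 0.
have bf : bmf f by apply: bmfB => //; exact: bmf_cst.
have bn := bmf_norm bf; have b3 := bmfX 3 bn.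
have fc : \int[g]_w `|f w| ^+ 3 <= lam ^+ 3 * K.
  rewrite -lee_fin EFin_expect//; apply: (@le_trans _ _ (\int[g]_w ((lam ^+ 3)%:E * (seminorm H w ^+ 3)%:E))%E).
    apply: ge0_le_integral => //=.
    - by apply/measurable_EFinP; case: b3.
    - apply: emeasurable_funM => //; apply/measurable_EFinP; apply: measurable_funX.
      exact: measurable_seminorm.
    - move=> w _; rewrite -EFinM lee_fin -exprMn lerXn2r ?nnegrE ?mulr_ge0 ?seminorm_ge0//.
      by have := FH w 0; rewrite subr0.
  have mN : measurable_fun [set: borel X] (fun w : borel X => (seminorm H w ^+ 3)%:E).
    by apply/measurable_EFinP; apply: measurable_funX; exact: measurable_seminorm.
  have pN w : [set: borel X] w -> (0 <= (seminorm H w ^+ 3)%:E)%E.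
    by rewrite lee_fin exprn_ge0// seminorm_ge0.
  have l0 : (0 <= (lam ^+ 3)%:E)%E by rewrite lee_fin exprn_ge0.
  by rewrite (ge0_integralZl _ measurableT mN pN l0) [X in (_ <= X)%E]EFinM; apply: lee_wpmul2l.
pose m := \int[g]_w `|f w|.
have m0 : 0 <= m by apply: expect_ge_cst.
(* Jensen, through the tangent line of the cube at m *)
have jensen : m ^+ 3 <= \int[g]_w `|f w| ^+ 3.
  have -> : m ^+ 3 = \int[g]_w (3 * m ^+ 2 * `|f w| - 2 * m ^+ 3).
    by rewrite (expectB g (bmfZ _ bn) (bmf_cst _ _)) (expectZ g _ bn) expect_cst -/m; ring.
  apply: expect_le => // [|w]; first by apply: bmfB; [exact: bmfZ | exact: bmf_cst].
  move: (normr_ge0 (f w)) => w0; have : 0 <= (`|f w| + 2 * m) * (`|f w| - m) ^+ 2.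
    by rewrite mulr_ge0 ?sqr_ge0// addr_ge0// mulr_ge0.
  by lra.
have fE w : F w - \int[g]_z F z = f w - \int[g]_z f z.
  by rewrite /f (expectB g bF (bmf_cst _ _)) expect_cst; ring.
apply: (@le_trans _ _ (\int[g]_w (4 * `|f w| ^+ 3 + 4 * m ^+ 3))).
  apply: expect_le => [||w].
  - apply: bmfX; apply: bmf_norm; apply: bmfB => //; exact: bmf_cst.
  - by apply: bmfD; [exact: bmfZ | exact: bmf_cst].
  - rewrite fE; have h1 : `|f w - \int[g]_z f z| <= `|f w| + m.
      by rewrite (le_trans (ler_normB _ _))// lerD2l; exact: expect_norm.
    apply: (@le_trans _ _ ((`|f w| + m) ^+ 3)); first by rewrite lerXn2r ?nnegrE ?addr_ge0.
    have w0 := normr_ge0 (f w).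
    have : 0 <= (`|f w| + m) * (`|f w| - m) ^+ 2 by rewrite mulr_ge0 ?addr_ge0 ?sqr_ge0.
    by lra.
rewrite (expectD g (bmfZ _ b3) (bmf_cst _ _)) (expectZ g _ b3) expect_cst.
by lra.
Qed.

End cubic_moments.

(** * The two-function inequality by doubling *)

Section hypercontractivity.
Context (R : realType) (X : completeNormedModType R).
Variable dotp : {dot X for idfun}.
Hypothesis dotp_norm : is_inner_product dotp.
Hypothesis Xsep : separable X.
Local Notation "<< x , y >>" := (dotp x y) (at level 0, format "<< x ,  y >>").
Local Notation tr := (trig (fun (h : X) (x : borel X) => <<x, h>>)).
Implicit Types F G f g : borel X -> R.
Variables (A Qs Qt Qn Ss St Sn : X -> X) (gs gt nu : probability (borel X) R).
Hypothesis bA : bounded_operator A.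
Hypothesis rs : nonneg_root dotp Qs Ss.
Hypothesis rt : nonneg_root dotp Qt St.
Hypothesis rn : nonneg_root dotp Qn Sn.
Hypothesis Gs : is_gaussian dotp 0 Qs gs.
Hypothesis Gt : is_gaussian dotp 0 Qt gt.
Hypothesis Gn : is_gaussian dotp 0 Qn nu.
Hypothesis split : forall x y,
  <<Qt x, y>> = <<Qs (adjoint dotp A x), adjoint dotp A y>> + <<Qn x, y>>.
Variable e : nat -> X.
Hypothesis onb : onb_seq dotp e.
Local Notation P := (ou A nu).

Variables (rho al be eps M : R).
Hypothesis rho0 : 0 <= rho.
Hypothesis rho1 : rho <= 1.
Hypothesis kap_rho : forall h, `|Ss (adjoint dotp A h)| <= rho * `|St h|.
Hypothesis al01 : 0 < al < 1.
Hypothesis be01 : 0 < be < 1.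
Hypothesis albe : al * be * rho ^+ 2 <= (1 - al) * (1 - be).

Let root_nonneg (Q S : X -> X) : nonneg_root dotp Q S -> forall h, 0 <= <<Q h, h>>.
Proof. by move=> [_ sym _ SS] h; rewrite -SS sym (dotxx_ge0 dotp_norm). Qed.

Let root_linear (Q S : X -> X) : nonneg_root dotp Q S -> linear Q.
Proof. by move=> [[l _] _ _ SS] a x y; rewrite -!SS !l. Qed.

Let linA : linear A. Proof. by case: bA. Qed.
Let Qn0 : forall h, 0 <= <<Qn h, h>> := root_nonneg rn.

Let expect_ou_eq F : bmf F -> \int[gs]_x P F x = \int[gt]_x F x.
Proof. exact: (expect_ou dotp_norm Xsep bA rs rt Qn0 Gs Gt Gn split). Qed.

Let bmf_ou_eq F : bmf F -> bmf (P F).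
Proof. exact: (bmf_ou dotp_norm Xsep gs nu bA). Qed.

Definition power_product (a b : R) : R := expR (al * ln a + be * ln b).
Local Notation J := power_product.

Let L F G : R := \int[gs]_x \int[nu]_y J (F (A x + y)) (G x).

Section bounded_away.
Hypothesis eps0 : 0 < eps.
Hypothesis M1 : 1 <= M.

Definition between f := bmf f /\ forall x, eps <= f x <= M.
Local Notation in_range := between.

Lemma power_product_bound a b : eps <= a <= M -> eps <= b <= M -> 0 <= J a b <= M ^+ 2.
Proof.
move=> /andP[a1 a2] /andP[b1 b2]; rewrite expR_ge0 /J.
have a0 : 0 < a := lt_le_trans eps0 a1; have b0 : 0 < b := lt_le_trans eps0 b1.
have lM : 0 <= ln M by exact: ln_ge0.
have M0 : 0 < M by lra.
have la : ln a <= ln M by rewrite ler_ln ?posrE.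
have lb : ln b <= ln M by rewrite ler_ln ?posrE.
move: al01 be01 => /andP[al0 al1] /andP[be0 be1].
rewrite (le_trans (y := expR (ln M + ln M)))//.
  by rewrite ler_expR lerD//; [apply: le_trans (ler_wpM2l (ltW al0) la) _ |
    apply: le_trans (ler_wpM2l (ltW be0) lb) _]; rewrite ler_piMl// ltW.
by rewrite expRD lnK ?posrE// expr2.
Qed.

Lemma bmf_power_product d (T : measurableType d) (u v : T -> R) :
  measurable_fun [set: T] u -> measurable_fun [set: T] v ->
  (forall x, eps <= u x <= M) -> (forall x, eps <= v x <= M) -> bmf (fun x => J (u x) (v x)).
Proof.
move=> mu mv u1 v1; split; last first.
  exists (M ^+ 2) => x; rewrite ger0_norm ?expR_ge0//.
  by case/andP: (power_product_bound (u1 x) (v1 x)).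
apply: (measurableT_comp (@measurable_expR R)); apply: measurable_funD; apply: measurable_funM => //.
  exact: (measurableT_comp (@measurable_ln R) mu).
exact: (measurableT_comp (@measurable_ln R) mv).
Qed.

Let pairJ F G (z : borel X * borel X) := J (F (A z.1 + z.2)) (G z.1).

Let bmf_pairJ F G : in_range F -> in_range G -> bmf (pairJ F G).
Proof.
move=> [[mF _] F1] [[mG _] G1]; apply: bmf_power_product => [|| z|z]; last 2 first.
- exact: F1.
- exact: G1.
- exact: (measurableT_comp mF (measurable_ou_map dotp_norm Xsep bA)).
- exact: (measurableT_comp mG measurable_fst).
Qed.

Let expect_range (Pr : probability (borel X) R) F : in_range F -> eps <= \int[Pr]_x F x <= M.
Proof.
move=> [bF F1]; apply/andP; split.
  by apply: expect_ge_cst => // x; case/andP: (F1 x).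
by apply: expect_le_cst => // x; case/andP: (F1 x).
Qed.

(* The quadratic part of the expansion is nonpositive by the Gebelein inequality:
   this is where the condition on the exponents is used. *)
Lemma power_product_step : exists2 C : R, 0 <= C & forall F G, in_range F -> in_range G ->
  L F G <= J (\int[gt]_x F x) (\int[gs]_x G x) +
    C * (\int[gt]_x `|F x - \int[gt]_z F z| ^+ 3 + \int[gs]_x `|G x - \int[gs]_z G z| ^+ 3).
Proof.
have M00 : 0 <= M := le_trans ler01 M1.
have M'1 : 1 <= M / eps + 1 by rewrite lerDr divr_ge0 ?(ltW eps0).
have [C0 C00 hC] := power_product_le al01 be01 M'1.
have C0e : 0 <= M ^+ 2 * (C0 / eps ^+ 3).
  by rewrite mulr_ge0 ?sqr_ge0// divr_ge0// exprn_ge0// ltW.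
exists (M ^+ 2 * (C0 / eps ^+ 3)) => // F G rF rG.
set a := \int[gt]_x F x; set b := \int[gs]_x G x.
have ra : eps <= a <= M := expect_range gt rF; have rb : eps <= b <= M := expect_range gs rG.
have a0 : 0 < a by case/andP: ra => + _; exact: lt_le_trans.
have b0 : 0 < b by case/andP: rb => + _; exact: lt_le_trans.
have [bF F1] := rF; have [bG G1] := rG.
pose u x := a^-1 * (F x - a); pose v x := b^-1 * (G x - b).
have bu : bmf u by apply: bmfZ; apply: bmfB => //; exact: bmf_cst.
have bv : bmf v by apply: bmfZ; apply: bmfB => //; exact: bmf_cst.
have Eu : \int[gt]_x u x = 0.
  by rewrite (expectZ gt _ (bmfB bF (bmf_cst _ a))) (expectB gt bF (bmf_cst _ a)) expect_cst subrr mulr0.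
have Ev : \int[gs]_x v x = 0.
  by rewrite (expectZ gs _ (bmfB bG (bmf_cst _ b))) (expectB gs bG (bmf_cst _ b)) expect_cst subrr mulr0.
have uE x : 1 + u x = F x / a by rewrite /u; field; rewrite gt_eqF.
have vE x : 1 + v x = G x / b by rewrite /v; field; rewrite gt_eqF.
have norm_le (c y : R) : eps <= c <= M -> eps <= y <= M -> -1 < c^-1 * (y - c) /\
    `|c^-1 * (y - c)| <= M / eps + 1.
  move=> /andP[c1 c2] /andP[y1 y2]; have c0 : 0 < c := lt_le_trans eps0 c1.
  have y0 : 0 < y := lt_le_trans eps0 y1.
  have yc : 0 < y / c by rewrite divr_gt0.
  have E : c^-1 * (y - c) = y / c - 1 by field; rewrite gt_eqF.
  have yM : y / c <= M / eps.
    by rewrite ler_pM ?invr_ge0 ?(ltW y0) ?(ltW c0)// lef_pV2 ?posrE.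
  by rewrite E; split; [lra | rewrite ler_norml; apply/andP; split; lra].
have u1 x : -1 < u x := (norm_le _ _ ra (F1 x)).1.
have uM x : `|u x| <= M / eps + 1 := (norm_le _ _ ra (F1 x)).2.
have v1 x : -1 < v x := (norm_le _ _ rb (G1 x)).1.
have vM x : `|v x| <= M / eps + 1 := (norm_le _ _ rb (G1 x)).2.
have JE x y : J (F x) (G y) = J a b * expR (al * ln (1 + u x) + be * ln (1 + v y)).
  have F0 : 0 < F x by case/andP: (F1 x) => + _; exact: lt_le_trans.
  have G0 : 0 < G y by case/andP: (G1 y) => + _; exact: lt_le_trans.
  rewrite uE vE !ln_div ?posrE// /J -expRD; congr expR; ring.
pose q x := al * (al - 1) * u x ^+ 2; pose r x := be * (be - 1) * v x ^+ 2.
have bu2 := bmfX 2 bu; have bv2 := bmfX 2 bv.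
have bu3 := bmfX 3 (bmf_norm bu); have bv3 := bmfX 3 (bmf_norm bv).
pose phi x := 1 + be * v x + (r x / 2 + C0 * `|v x| ^+ 3).
pose psi x := al * u x + (q x / 2 + C0 * `|u x| ^+ 3).
have bphi : bmf phi.
  apply: bmfD; first by apply: bmfD; [exact: bmf_cst | exact: bmfZ].
  apply: bmfD; last exact: bmfZ.
  by rewrite /r; under eq_fun do rewrite mulrC; apply: bmfZ; exact: bmfZ.
have bpsi : bmf psi.
  apply: bmfD; first exact: bmfZ.
  apply: bmfD; last exact: bmfZ.
  by rewrite /q; under eq_fun do rewrite mulrC; apply: bmfZ; exact: bmfZ.
have bPu : bmf (P u) := bmf_ou_eq bu.
have ptw x y : J (F (A x + y)) (G x) <=
    J a b * (phi x + (psi (A x + y) + al * be * v x * u (A x + y))).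
  rewrite JE ler_wpM2l ?expR_ge0// (le_trans (hC _ _ (u1 _) (v1 _) (uM _) (vM _)))//.
  by rewrite /phi /psi /q /r le_eqVlt; apply/orP; left; apply/eqP; field.
have step1 x : \int[nu]_y J (F (A x + y)) (G x) <=
    J a b * (phi x + (P psi x + al * be * v x * P u x)).
  have b1 := bmf_ou_section dotp_norm Xsep bA x bpsi.
  have b2 := bmf_ou_section dotp_norm Xsep bA x bu.
  have b3 : bmf (fun y : borel X => phi x + (psi (A x + y) + al * be * v x * u (A x + y))).
    by apply: bmfD; [exact: bmf_cst | apply: bmfD => //; exact: bmfZ].
  have b4 : bmf (fun y : borel X => psi (A x + y) + al * be * v x * u (A x + y)).
    by apply: bmfD => //; exact: bmfZ.
  apply: le_trans (expect_le nu (bmf_section1 (bmf_pairJ rF rG) x) (bmfZ (J a b) b3) (ptw x)) _.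
  rewrite (expectZ nu _ b3) (expectD nu (bmf_cst _ _) b4) (expectD nu b1 (bmfZ _ b2)).
  by rewrite (expectZ nu _ b2) expect_cst.
have bPpsi : bmf (P psi) := bmf_ou_eq bpsi.
have bvu : bmf (fun x => al * be * v x * P u x).
  by under eq_fun do rewrite -mulrA; apply: bmfZ; exact: bmfM.
have bPv : bmf (fun x => P psi x + al * be * v x * P u x) by exact: bmfD.
have step2 : L F G <= J a b * (\int[gs]_x phi x + (\int[gt]_x psi x + \int[gs]_x (al * be * v x * P u x))).
  apply: le_trans (expect_le gs (bmf_expect1 gs nu (bmf_pairJ rF rG)) (bmfZ (J a b) (bmfD bphi bPv)) step1) _.
  rewrite (expectZ gs _ (bmfD bphi bPv)) (expectD gs bphi bPv) (expectD gs bPpsi bvu).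
  by rewrite (expect_ou_eq bpsi).
have Ephi : \int[gs]_x phi x = 1 + be * (be - 1) / 2 * \int[gs]_x v x ^+ 2 + C0 * \int[gs]_x `|v x| ^+ 3.
  transitivity (\int[gs]_x ((1 + be * v x) + (be * (be - 1) / 2 * v x ^+ 2 + C0 * `|v x| ^+ 3))).
    by apply: eq_Rintegral => x _; rewrite /phi /r; field.
  rewrite (expectD gs (bmfD (bmf_cst _ 1) (bmfZ _ bv)) (bmfD (bmfZ _ bv2) (bmfZ _ bv3))).
  rewrite (expectD gs (bmf_cst _ 1) (bmfZ _ bv)) (expectD gs (bmfZ _ bv2) (bmfZ _ bv3)).
  rewrite expect_cst (expectZ gs _ bv) (expectZ gs _ bv2) (expectZ gs _ bv3).
  by rewrite Ev mulr0 addr0 addrA.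
have Epsi : \int[gt]_x psi x = al * (al - 1) / 2 * \int[gt]_x u x ^+ 2 + C0 * \int[gt]_x `|u x| ^+ 3.
  transitivity (\int[gt]_x (al * u x + (al * (al - 1) / 2 * u x ^+ 2 + C0 * `|u x| ^+ 3))).
    by apply: eq_Rintegral => x _; rewrite /psi /q; field.
  rewrite (expectD gt (bmfZ _ bu) (bmfD (bmfZ _ bu2) (bmfZ _ bu3))).
  rewrite (expectD gt (bmfZ _ bu2) (bmfZ _ bu3)) (expectZ gt _ bu) (expectZ gt _ bu2).
  by rewrite (expectZ gt _ bu3) Eu mulr0 add0r.
have /andP[al0 al1] := al01; have /andP[be0 be1] := be01.
have cross : \int[gs]_x (al * be * v x * P u x) <=
    al * (1 - al) / 2 * \int[gt]_x u x ^+ 2 + be * (1 - be) / 2 * \int[gs]_x v x ^+ 2.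
  have G' := gebelein_bmf dotp_norm Xsep bA rs rt Qn0 Gs Gt Gn split onb rho0 rho1 kap_rho bu.
  rewrite Eu expr0n/= !subr0 in G'.
  (* Weight in [2 x y <= x^2 + y^2]: it leaves exactly [be (1 - be) / 2] on the square of [v], and
     the condition on the exponents becomes [k rho^2 <= al (1 - al)]. *)
  pose k := al ^+ 2 * be / (1 - be).
  have be1' : 0 < 1 - be by lra.
  have k0 : 0 <= k by rewrite /k divr_ge0 ?mulr_ge0 ?sqr_ge0// ltW.
  have kE : k * (1 - be) = al ^+ 2 * be by rewrite /k; field; rewrite gt_eqF.
  apply: (@le_trans _ _ (k / 2 * \int[gs]_x P u x ^+ 2 + be * (1 - be) / 2 * \int[gs]_x v x ^+ 2)).
    rewrite -!(expectZ gs)//; last exact: bmfX.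
    rewrite -(expectD gs (bmfZ _ (bmfX 2 bPu)) (bmfZ _ bv2)).
    apply: expect_le => //; first by apply: bmfD; apply: bmfZ => //; exact: bmfX.
    move=> x; have : 0 <= be * (1 - be)^-1 * (al * P u x - (1 - be) * v x) ^+ 2.
      by rewrite mulr_ge0 ?sqr_ge0// mulr_ge0 ?invr_ge0// ltW.
    have -> : be * (1 - be)^-1 * (al * P u x - (1 - be) * v x) ^+ 2 =
      k * P u x ^+ 2 + be * (1 - be) * v x ^+ 2 - 2 * (al * be * v x * P u x).
      by rewrite /k; field; rewrite gt_eqF.
    by move=> ?; lra.
  rewrite lerD2r; apply: (@le_trans _ _ (k / 2 * (rho ^+ 2 * \int[gt]_x u x ^+ 2))).
    by rewrite ler_wpM2l// divr_ge0.
  have u20 : 0 <= \int[gt]_x u x ^+ 2 by apply: expect_ge_cst => // x; exact: sqr_ge0.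
  rewrite mulrA ler_wpM2r// mulrAC ler_wpM2r ?invr_ge0//.
  rewrite -(ler_pM2r be1') mulrAC kE.
  have -> : al ^+ 2 * be * rho ^+ 2 = al * (al * be * rho ^+ 2) by ring.
  by rewrite -[leRHS]mulrA ler_wpM2l// ltW.
have u3 : \int[gt]_x `|u x| ^+ 3 <= (eps ^+ 3)^-1 * \int[gt]_x `|F x - a| ^+ 3.
  have bb := bmfX 3 (bmf_norm (bmfB bF (bmf_cst _ a))).
  rewrite -(expectZ gt _ bb); apply: expect_le => //; first exact: bmfZ.
  move=> x; rewrite /u normrM exprMn ler_wpM2r ?exprn_ge0// -exprVn.
  rewrite lerXn2r ?nnegrE ?invr_ge0 ?(ltW eps0)// normfV gtr0_norm// lef_pV2 ?posrE//.
  by case/andP: ra.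
have v3 : \int[gs]_x `|v x| ^+ 3 <= (eps ^+ 3)^-1 * \int[gs]_x `|G x - b| ^+ 3.
  have bb := bmfX 3 (bmf_norm (bmfB bG (bmf_cst _ b))).
  rewrite -(expectZ gs _ bb); apply: expect_le => //; first exact: bmfZ.
  move=> x; rewrite /v normrM exprMn ler_wpM2r ?exprn_ge0// -exprVn.
  rewrite lerXn2r ?nnegrE ?invr_ge0 ?(ltW eps0)// normfV gtr0_norm// lef_pV2 ?posrE//.
  by case/andP: rb.
apply: (le_trans step2); rewrite Ephi Epsi.
set fu := \int[gt]_x `|F x - a| ^+ 3 in u3 *; set gv := \int[gs]_x `|G x - b| ^+ 3 in v3 *.
have fu0 : 0 <= fu + gv.
  by apply: addr_ge0; apply: expect_ge_cst => [|x]; rewrite ?exprn_ge0//;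
    apply: bmfX; apply: bmf_norm; apply: bmfB => //; exact: bmf_cst.
apply: (@le_trans _ _ (J a b * (1 + C0 / eps ^+ 3 * (fu + gv)))).
  rewrite ler_wpM2l ?expR_ge0//.
  have := ler_wpM2l C00 u3; have := ler_wpM2l C00 v3; lra.
have /andP[J0 JM] := power_product_bound ra rb.
by rewrite mulrDr mulr1 lerD2l mulrA ler_wpM2r// ler_wpM2r// divr_ge0 ?exprn_ge0 ?(ltW eps0).
Qed.

Let Qs0 := root_nonneg rs.
Let Qt0 := root_nonneg rt.
Let hs_t F : bmf F -> \int[gt]_x F x = \int[gt]_x \int[gt]_y F (halfsum x y).
Proof. exact: (gaussian_halfsum dotp_norm Xsep (root_linear rt) Qt0 Gt). Qed.
Let hs_s F : bmf F -> \int[gs]_x F x = \int[gs]_x \int[gs]_y F (halfsum x y).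
Proof. exact: (gaussian_halfsum dotp_norm Xsep (root_linear rs) Qs0 Gs). Qed.
Let hs_n F : bmf F -> \int[nu]_x F x = \int[nu]_x \int[nu]_y F (halfsum x y).
Proof. exact: (gaussian_halfsum dotp_norm Xsep (root_linear rn) Qn0 Gn). Qed.

Let bmf_hs F : bmf F -> bmf (fun z : borel X * borel X => F (halfsum z.1 z.2)).
Proof. by move=> bF; exact: (bmf_comp (measurable_halfsum dotp_norm Xsep) bF). Qed.

Let half F (w z : borel X) : R := F (halfsum w z).

Let half_range F w : in_range F -> in_range (half F w).
Proof. by move=> [bF F1]; split => [|z]; [exact: (bmf_section1 (bmf_hs bF) w) | exact: F1]. Qed.

Let averaged (Pr : probability (borel X) R) F (w : borel X) : R := \int[Pr]_z half F w z.

Let averaged_range Pr F : in_range F -> in_range (averaged Pr F).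
Proof.
move=> rF; split; first by case: rF => bF _; exact: (bmf_expect1 Pr Pr (bmf_hs bF)).
by move=> w; apply: expect_range; exact: half_range.
Qed.

Let measurable_hs d (T : measurableType d) (f1 f2 : T -> borel X) :
  measurable_fun [set: T] f1 -> measurable_fun [set: T] f2 ->
  measurable_fun [set: T] (fun z => halfsum (f1 z) (f2 z) : borel X).
Proof.
move=> m1 m2; have m12 : measurable_fun [set: T] (fun z => (f1 z, f2 z)).
  by apply/measurable_fun_pairP.
exact: (measurableT_comp (measurable_halfsum dotp_norm Xsep) m12).
Qed.

Let ou_halfsum x x' y y' : A (halfsum x x') + halfsum y y' = halfsum (A x + y) (A x' + y').
Proof. by rewrite /halfsum (linfZ linA) (linfD linA) -scalerDr addrACA. Qed.

(** Each of [gs] and [nu] is replaced by the half-sum of two copies, and [(x, y) |-> A x + y]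
    commutes with half-sums by linearity; Fubini then isolates the second pair in an inner [L]. *)
Let L_double F G : in_range F -> in_range G ->
  L F G = \int[gs]_x \int[nu]_y L (half F (A x + y)) (half G x).
Proof.
move=> rF rG; have bJ := bmf_pairJ rF rG.
pose Psi x := \int[nu]_y J (F (A x + y)) (G x).
have bPsi : bmf (Psi : borel X -> R) := bmf_expect1 gs nu bJ.
have E1 x : Psi x = \int[nu]_y \int[nu]_y' pairJ F G (x, halfsum y y').
  by rewrite -(hs_n (bmf_section1 bJ x)).
transitivity (\int[gs]_x \int[gs]_x' Psi (halfsum x x')); first exact: hs_s.
apply: eq_Rintegral => x _.
pose H (z : borel X * borel X) := \int[nu]_y' pairJ F G (halfsum x z.1, halfsum z.2 y').
have bH : bmf H.
  have m1 : measurable_fun [set: (borel X * borel X) * borel X]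
      (fun z => halfsum x z.1.1 : borel X).
    apply: (measurable_hs (f1 := fun=> x)) => //.
    exact: (measurableT_comp measurable_fst measurable_fst).
  have m2 : measurable_fun [set: (borel X * borel X) * borel X]
      (fun z => halfsum z.1.2 z.2 : borel X).
    by apply: measurable_hs => //; exact: (measurableT_comp measurable_snd measurable_fst).
  have m12 : measurable_fun [set: (borel X * borel X) * borel X]
      (fun z => (halfsum x z.1.1 : borel X, halfsum z.1.2 z.2 : borel X)).
    by apply/measurable_fun_pairP.
  exact: (bmf_expect1 (gs \x nu)%E nu (bmf_comp m12 bJ)).
transitivity (\int[gs]_x' \int[nu]_y H (x', y)).
  by apply: eq_Rintegral => x' _; rewrite E1.
rewrite -(expect_prod1 gs nu bH) (expect_prod2 gs nu bH).
apply: eq_Rintegral => y _; apply: eq_Rintegral => x' _; apply: eq_Rintegral => y' _.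
by rewrite /pairJ /= ou_halfsum.
Qed.

Let c : R := (Num.sqrt 2)^-1.
Let c0 : 0 < c. Proof. by rewrite invr_gt0 sqrtr_gt0. Qed.
Let cc : c ^+ 2 = 2^-1. Proof. by rewrite /c exprVn sqr_sqrtr. Qed.

Let half_modulus H lam F w : modulus dotp H lam F -> modulus dotp H (lam * c) (half F w).
Proof.
move=> mF z z'; apply: le_trans (mF _ _) _.
rewrite (_ : halfsum w z - halfsum w z' = c *: (z - z')); last first.
  by rewrite /halfsum -scalerBr opprD addrACA subrr add0r.
by rewrite seminormZ ?(ltW c0)// mulrA.
Qed.

Let averaged_modulus Pr H lam F : in_range F -> modulus dotp H lam F ->
  modulus dotp H (lam * c) (averaged Pr F).
Proof.
move=> rF mF w w'; have bw z := (half_range z rF).1.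
rewrite /averaged -(expectB Pr (bw w) (bw w')); apply: (le_trans (expect_norm Pr (bmfB (bw w) (bw w')))).
apply: expect_le_cst; first by apply: bmf_norm; apply: bmfB.
move=> z; apply: le_trans (mF _ _) _.
rewrite (_ : halfsum w z - halfsum w' z = c *: (w - w')); last first.
  by rewrite /halfsum -scalerBr opprD addrACA subrr addr0.
by rewrite seminormZ ?(ltW c0)// mulrA.
Qed.

(** The induction hypothesis is used for the inner pair and for the averaged pair, both with modulus
    [lam c]; the two errors add up to [2 (lam c)^3 c^m = lam^3 c^(m+1)], up to the constant, since
    [c^2 = 1/2]. The functions stay fixed while [m] grows. *)
Lemma doubling_bound H1 H2 : exists2 C : R, 0 <= C & forall m F G lam, 0 <= lam ->
  in_range F -> in_range G -> modulus dotp H1 lam F -> modulus dotp H2 lam G ->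
  L F G <= J (\int[gt]_x F x) (\int[gs]_x G x) + C * lam ^+ 3 * c ^+ m.
Proof.
have [C C0 hC] := power_product_step.
have [K1 K10 hK1] := modulus_cube dotp_norm rt Gt H1.
have [K2 K20 hK2] := modulus_cube dotp_norm rs Gs H2.
exists (C * (K1 + K2)); first by rewrite mulr_ge0// addr_ge0.
elim=> [|m IH] F G lam lam0 rF rG mF mG.
  rewrite expr0 mulr1 (le_trans (hC _ _ rF rG))// lerD2l -mulrA ler_wpM2l//.
  by rewrite mulrDl lerD//; [apply: hK1 | apply: hK2] => //; [case: rF | case: rG].
have l0 : 0 <= lam * c by rewrite mulr_ge0// ltW.
set D := C * (K1 + K2) in IH *.
have D0 : 0 <= D by rewrite mulr_ge0// addr_ge0.
pose err := D * (lam * c) ^+ 3 * c ^+ m.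
have bJ := bmf_pairJ (averaged_range gt rF) (averaged_range gs rG).
have inner x y : L (half F (A x + y)) (half G x) <= pairJ (averaged gt F) (averaged gs G) (x, y) + err.
  by apply: IH => //; [exact: half_range | exact: half_range | exact: half_modulus | exact: half_modulus].
have outer : L (averaged gt F) (averaged gs G) <= J (\int[gt]_x F x) (\int[gs]_x G x) + err.
  rewrite (hs_t rF.1) (hs_s rG.1).
  by apply: IH => //; [exact: averaged_range | exact: averaged_range |
    exact: averaged_modulus | exact: averaged_modulus].
have bL : bmf (fun z : borel X * borel X => L (half F (A z.1 + z.2)) (half G z.1)).
  pose K4 (z : (borel X * borel X) * (borel X * borel X)) :=
    pairJ F G (halfsum z.1.1 z.2.1, halfsum z.1.2 z.2.2).
  have m1 : measurable_fun [set: (borel X * borel X) * (borel X * borel X)]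
      (fun z => halfsum z.1.1 z.2.1 : borel X).
    by apply: measurable_hs; apply: (measurableT_comp measurable_fst);
      [exact: measurable_fst | exact: measurable_snd].
  have m2 : measurable_fun [set: (borel X * borel X) * (borel X * borel X)]
      (fun z => halfsum z.1.2 z.2.2 : borel X).
    by apply: measurable_hs; apply: (measurableT_comp measurable_snd);
      [exact: measurable_fst | exact: measurable_snd].
  have m12 : measurable_fun [set: (borel X * borel X) * (borel X * borel X)]
      (fun z => (halfsum z.1.1 z.2.1 : borel X, halfsum z.1.2 z.2.2 : borel X)).
    by apply/measurable_fun_pairP.
  have bK4 : bmf K4 := bmf_comp m12 (bmf_pairJ rF rG).
  have := bmf_expect1 (gs \x nu)%E (gs \x nu)%E bK4; congr bmf; apply/funext => -[x y].
  rewrite (expect_prod1 gs nu (bmf_section1 bK4 (x, y))).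
  apply: eq_Rintegral => x' _; apply: eq_Rintegral => y' _.
  by rewrite /K4 /pairJ /= /half ou_halfsum.
have : L F G <= L (averaged gt F) (averaged gs G) + err.
  rewrite (L_double rF rG); apply: (@le_trans _ _ (\int[gs]_x (\int[nu]_y pairJ (averaged gt F) (averaged gs G) (x, y) + err))).
    apply: expect_le => [||x].
    - exact: (bmf_expect1 gs nu bL).
    - by apply: bmfD; [exact: (bmf_expect1 gs nu bJ) | exact: bmf_cst].
    - rewrite -[err](expect_cst nu) -(expectD nu (bmf_section1 bJ x) (bmf_cst _ err)).
      apply: expect_le => [||y]; first exact: (bmf_section1 bL x).
      + by apply: bmfD; [exact: (bmf_section1 bJ x) | exact: bmf_cst].
      + exact: inner.
  by rewrite (expectD gs (bmf_expect1 gs nu bJ) (bmf_cst _ err)) expect_cst.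
move=> h; apply: (le_trans h); apply: (le_trans (lerD outer (lexx err))).
rewrite -addrA lerD2l le_eqVlt; apply/orP; left; apply/eqP.
have c3 : c ^+ 3 = c / 2 by rewrite exprS cc.
by rewrite /err exprMn c3 [c ^+ m.+1]exprS; field.
Qed.

Lemma power_product_modulus F G H1 H2 lam : 0 <= lam -> in_range F -> in_range G ->
  modulus dotp H1 lam F -> modulus dotp H2 lam G ->
  L F G <= J (\int[gt]_x F x) (\int[gs]_x G x).
Proof.
move=> lam0 rF rG mF mG; have [C C0 hC] := doubling_bound H1 H2.
set j := J _ _.
have lim : (fun m => j + C * lam ^+ 3 * c ^+ m) @ \oo --> j.
  rewrite -[X in _ --> X]addr0 -[X in _ --> _ + X](mulr0 (C * lam ^+ 3)).
  apply: cvgD; first exact: cvg_cst.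
  apply: cvgMr; apply: cvg_expr; rewrite gtr0_norm//.
  by rewrite -(expr_lt1 (n := 2))// ?(ltW c0)// cc; lra.
by apply: (cvgr_to_ge lim); apply: nearW => m; exact: hC.
Qed.

Lemma trig_modulus s : modulus dotp [seq (`|i.1.1| + `|i.1.2|, i.2) | i <- s] 1 (tr s).
Proof.
move=> w w'; rewrite mul1r /seminorm big_map /trig -sumrB.
apply: le_trans (ler_norm_sum _ _ _) _; apply: ler_sum => i _ /=.
rewrite (ger0_norm (addr_ge0 (normr_ge0 _) (normr_ge0 _))) mulrDl.
have -> : i.1.1 * cos <<w, i.2>> + i.1.2 * sin <<w, i.2>> -
    (i.1.1 * cos <<w', i.2>> + i.1.2 * sin <<w', i.2>>) =
  i.1.1 * (cos <<w, i.2>> - cos <<w', i.2>>) + i.1.2 * (sin <<w, i.2>> - sin <<w', i.2>>) by ring.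
rewrite (le_trans (ler_normD _ _))// !normrM (dotBl dotp).
by rewrite lerD// ler_wpM2l// ?cos_lip ?sin_lip.
Qed.

Hypothesis epsM : 1 + eps <= M.

Let shift f (x : borel X) : R := eps + f x.

Let shift_range f : bmf f -> (forall x, 0 <= f x <= 1) -> in_range (shift f).
Proof.
move=> bf f01; split; first by apply: bmfD => //; exact: bmf_cst.
move=> x; have /andP[f0 f1] := f01 x; rewrite /shift lerDl f0 /=.
by apply: le_trans epsM; rewrite addrC lerD2r.
Qed.

(** Convexity of the exponential: [exp l - exp l' <= exp l (l - l')]; on the range, the logarithm is
    Lipschitz with constant [1/eps]. *)
Let power_product_lip a b a' b' : eps <= a <= M -> eps <= b <= M -> eps <= a' <= M ->
  eps <= b' <= M -> J a b <= J a' b' + M ^+ 2 / eps * (`|a - a'| + `|b - b'|).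
Proof.
move=> ra rb ra' rb'; have /andP[J0 JM] := power_product_bound ra rb.
have lnd x y : eps <= x <= M -> eps <= y <= M -> ln x - ln y <= eps^-1 * `|x - y|.
  move=> /andP[x1 _] /andP[y1 _]; have x0 : 0 < x := lt_le_trans eps0 x1.
  have y0 : 0 < y := lt_le_trans eps0 y1.
  rewrite -ln_div ?posrE// -(subrKC 1 (x / y)).
  apply: le_trans (le_ln1Dx _) _.
    by rewrite ltrBrDl addrN divr_gt0.
  have -> : x / y - 1 = y^-1 * (x - y) by field; rewrite gt_eqF.
  apply: le_trans (ler_wpM2l _ (ler_norm _)) _; first by rewrite invr_ge0 ltW.
  by rewrite ler_wpM2r// lef_pV2 ?posrE.
have /andP[al0 al1] := al01; have /andP[be0 be1] := be01.
set l := al * ln a + be * ln b; set l' := al * ln a' + be * ln b'.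
have ll : l - l' <= eps^-1 * (`|a - a'| + `|b - b'|).
  have h1 := lnd _ _ ra ra'; have h2 := lnd _ _ rb rb'.
  have n1 : 0 <= eps^-1 * `|a - a'| by rewrite mulr_ge0// invr_ge0 ltW.
  have n2 : 0 <= eps^-1 * `|b - b'| by rewrite mulr_ge0// invr_ge0 ltW.
  have -> : l - l' = al * (ln a - ln a') + be * (ln b - ln b') by rewrite /l /l'; ring.
  rewrite [leRHS]mulrDr lerD//.
    by apply: le_trans (ler_wpM2l (ltW al0) h1) _; rewrite ler_piMl// ltW.
  by apply: le_trans (ler_wpM2l (ltW be0) h2) _; rewrite ler_piMl// ltW.
have : J a b - J a' b' <= J a b * (l - l').
  have := expR_ge1Dx (l' - l); rewrite -(ler_pM2l (expR_gt0 l)) -expRD subrKC /J -/l -/l'.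
  lra.
have n0 : 0 <= eps^-1 * (`|a - a'| + `|b - b'|) by rewrite mulr_ge0 ?invr_ge0 ?(ltW eps0)// addr_ge0.
have h3 := ler_wpM2l J0 ll; have h4 := ler_wpM2r n0 JM.
by rewrite -mulrA => h5; lra.
Qed.

(** Trigonometric polynomials have a modulus; density in L^1 and the Lipschitz bound for [J] pass to
    [f] and [g]. On the left the error in [f] is integrated over [gs \x nu], which is its integral
    under [gt]. *)
Lemma power_product_shift f g : bmf f -> bmf g -> (forall x, 0 <= f x <= 1) ->
  (forall x, 0 <= g x <= 1) ->
  L (shift f) (shift g) <= J (eps + \int[gt]_x f x) (eps + \int[gs]_x g x).
Proof.
move=> bf bg f01 g01; apply/ler_addgt0Pr => d d0.
have shiftB (x y : R) : eps + x - (eps + y) = x - y by ring.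
have K0 : 0 < M ^+ 2 / eps by rewrite divr_gt0// exprn_gt0// (lt_le_trans ltr01).
have d4 : 0 < d / (4 * (M ^+ 2 / eps)) by rewrite divr_gt0// mulr_gt0.
have [s [s01 sf _]] := borel_trig_dense dotp_norm Xsep gt gt bf.1 f01 d4.
have [t [t01 tg _]] := borel_trig_dense dotp_norm Xsep gs gs bg.1 g01 d4.
have bs := bmf_borel_trig dotp_norm s; have bt := bmf_borel_trig dotp_norm t.
have rs' := shift_range bs s01; have rt' := shift_range bt t01.
have rf := shift_range bf f01; have rg := shift_range bg g01.
have main : L (shift (tr s)) (shift (tr t)) <= J (eps + \int[gt]_x tr s x) (eps + \int[gs]_x tr t x).
  rewrite -[eps in X in _ <= J X _](expect_cst gt) -(expectD gt (bmf_cst _ eps) bs).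
  rewrite -[eps in X in _ <= J _ X](expect_cst gs) -(expectD gs (bmf_cst _ eps) bt).
  apply: (power_product_modulus ler01 rs' rt').
    by move=> w w'; rewrite /shift shiftB; exact: trig_modulus.
  by move=> w w'; rewrite /shift shiftB; exact: trig_modulus.
have dF := bmf_norm (bmfB bf bs); have dG := bmf_norm (bmfB bg bt).
have distL : L (shift f) (shift g) <= L (shift (tr s)) (shift (tr t)) +
    M ^+ 2 / eps * (\int[gt]_x `|f x - tr s x| + \int[gs]_x `|g x - tr t x|).
  have b1 := bmf_pairJ rf rg; have b2 := bmf_pairJ rs' rt'.
  rewrite -(expect_ou_eq dF) -(expectD gs (bmf_ou_eq dF) dG) -(expectZ gs _ (bmfD (bmf_ou_eq dF) dG)).
  rewrite -(expectD gs (bmf_expect1 gs nu b2) (bmfZ _ (bmfD (bmf_ou_eq dF) dG))).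
  apply: expect_le => [||x]; first exact: (bmf_expect1 gs nu b1).
    by apply: bmfD; [exact: (bmf_expect1 gs nu b2) | apply: bmfZ; apply: bmfD => //; exact: bmf_ou_eq].
  have b3 := bmf_ou_section dotp_norm Xsep bA x dF.
  have b4 := bmfZ (M ^+ 2 / eps) (bmfD b3 (bmf_cst _ `|g x - tr t x|)).
  have -> : \int[nu]_y pairJ (shift (tr s)) (shift (tr t)) (x, y) +
      M ^+ 2 / eps * (P (fun z => `|f z - tr s z|) x + `|g x - tr t x|) =
    \int[nu]_y (pairJ (shift (tr s)) (shift (tr t)) (x, y) +
      M ^+ 2 / eps * (`|f (A x + y) - tr s (A x + y)| + `|g x - tr t x|)).
    rewrite (expectD nu (bmf_section1 b2 x) b4) (expectZ nu _ (bmfD b3 (bmf_cst _ _))).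
    by rewrite (expectD nu b3 (bmf_cst _ _)) expect_cst.
  apply: expect_le => [||y]; first exact: (bmf_section1 b1 x).
    by apply: bmfD => //; exact: (bmf_section1 b2 x).
  have := power_product_lip (rf.2 (A x + y)) (rg.2 x) (rs'.2 (A x + y)) (rt'.2 x).
  by rewrite /pairJ /= /shift !shiftB.
have intR (Pr : probability (borel X) R) k : bmf k -> (forall x, 0 <= k x <= 1) ->
    eps <= eps + \int[Pr]_x k x <= M.
  move=> bk k01; have := expect_range Pr (shift_range bk k01).
  by rewrite /shift (expectD Pr (bmf_cst _ eps) bk) expect_cst.
have lip := power_product_lip (intR gt _ bs s01) (intR gs _ bt t01) (intR gt _ bf f01) (intR gs _ bg g01).
rewrite !shiftB in lip.
have n1 : `|\int[gt]_x tr s x - \int[gt]_x f x| <= \int[gt]_x `|tr s x - f x|.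
  by rewrite -(expectB gt bs bf); apply: expect_norm; exact: bmfB.
have n2 : `|\int[gs]_x tr t x - \int[gs]_x g x| <= \int[gs]_x `|tr t x - g x|.
  by rewrite -(expectB gs bt bg); apply: expect_norm; exact: bmfB.
have sym1 : \int[gt]_x `|f x - tr s x| = \int[gt]_x `|tr s x - f x|.
  by apply: eq_Rintegral => x _; rewrite distrC.
have sym2 : \int[gs]_x `|g x - tr t x| = \int[gs]_x `|tr t x - g x|.
  by apply: eq_Rintegral => x _; rewrite distrC.
rewrite sym1 sym2 in distL.
set K := M ^+ 2 / eps in K0 d4 sf tg distL lip *.
set I1 := \int[gt]_x `|tr s x - f x| in sf n1 distL *.
set I2 := \int[gs]_x `|tr t x - g x| in tg n2 distL *.
have i1 : K * I1 <= d / 4.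
  by rewrite mulrC -ler_pdivlMr// (le_trans (ltW sf))// invfM mulrA.
have i2 : K * I2 <= d / 4.
  by rewrite mulrC -ler_pdivlMr// (le_trans (ltW tg))// invfM mulrA.
have n1' := ler_wpM2l (ltW K0) n1; have n2' := ler_wpM2l (ltW K0) n2.
rewrite !mulrDr in lip distL.
by apply: le_trans distL _; lra.
Qed.

End bounded_away.
End hypercontractivity.

Section powers.
Context (R : realType).

Lemma powR_le1 (x a : R) : 0 <= a -> 0 <= x <= 1 -> 0 <= x `^ a <= 1.
Proof.
move=> a0 /andP[x0 x1]; rewrite powR_ge0/=.
by have := ge0_ler_powR a0 (x := x) (y := 1); rewrite powR1; apply; rewrite ?nnegrE.
Qed.

Lemma bmf_powR d (T : measurableType d) (f : T -> R) a : 0 <= a -> bmf f ->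
  (forall x, 0 <= f x <= 1) -> bmf (fun x => f x `^ a).
Proof.
move=> a0 [mf _] f01; split; last first.
  exists 1 => x; have /andP[h1 h2] := powR_le1 a0 (f01 x).
  by rewrite ger0_norm.
exact: (measurableT_comp (@measurable_powR R a) mf).
Qed.

Lemma powR_right_cvg (x a : R) : 0 < a -> 0 <= x ->
  (e + x) `^ a @[e --> 0^'+] --> x `^ a.
Proof.
move=> a0; rewrite le_eqVlt => /orP[/eqP <-|x0].
  rewrite powR0 ?gt_eqF//; under eq_fun do rewrite addr0; exact: powR_cvg0.
have ca : {for x, continuous ((@powR R) ^~ a)}.
  apply: differentiable_continuous; apply/derivable1_diffP.
  by have [] := is_derive1_powR a x0.
have : (e + x) @[e --> 0^'+] --> x.
  rewrite -[X in _ --> X]add0r; apply: cvgD; last exact: cvg_cst.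
  by apply: cvg_at_right_filter; exact: cvg_id.
by move=> h; exact: (cvg_comp _ _ h ca).
Qed.

End powers.

Section hypercontractive_norms.
Context (R : realType) (X : completeNormedModType R).
Variable dotp : {dot X for idfun}.
Hypothesis dotp_norm : is_inner_product dotp.
Hypothesis Xsep : separable X.
Local Notation "<< x , y >>" := (dotp x y) (at level 0, format "<< x ,  y >>").
Implicit Types f g : borel X -> R.
Variables (A Qs Qt Qn Ss St Sn : X -> X) (gs gt nu : probability (borel X) R).
Hypothesis bA : bounded_operator A.
Hypothesis rs : nonneg_root dotp Qs Ss.
Hypothesis rt : nonneg_root dotp Qt St.
Hypothesis rn : nonneg_root dotp Qn Sn.
Hypothesis Gs : is_gaussian dotp 0 Qs gs.
Hypothesis Gt : is_gaussian dotp 0 Qt gt.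
Hypothesis Gn : is_gaussian dotp 0 Qn nu.
Hypothesis split : forall x y,
  <<Qt x, y>> = <<Qs (adjoint dotp A x), adjoint dotp A y>> + <<Qn x, y>>.
Variable e : nat -> X.
Hypothesis onb : onb_seq dotp e.
Local Notation P := (ou A nu).
Variable rho : R.
Hypothesis rho0 : 0 <= rho.
Hypothesis rho1 : rho <= 1.
Hypothesis kap_rho : forall h, `|Ss (adjoint dotp A h)| <= rho * `|St h|.

Let bmf_P f : bmf f -> bmf (P f).
Proof. exact: (bmf_ou dotp_norm Xsep gs nu bA). Qed.

(** The shift by [eps] tends to 0 on the right; on the left powers are monotone, so the unshifted
    integrand is the smaller one. *)
Lemma hypercontractive_pairing (al be : R) f g : 0 < al < 1 -> 0 < be < 1 ->
  al * be * rho ^+ 2 <= (1 - al) * (1 - be) -> bmf f -> bmf g ->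
  (forall x, 0 <= f x <= 1) -> (forall x, 0 <= g x <= 1) ->
  \int[gs]_x (P (fun z => f z `^ al) x * g x `^ be) <=
  (\int[gt]_x f x) `^ al * (\int[gs]_x g x) `^ be.
Proof.
move=> al01 be01 albe bf bg f01 g01.
have /andP[al0 al1] := al01; have /andP[be0 be1] := be01.
have Ef0 : 0 <= \int[gt]_x f x by apply: expect_ge_cst => // x; case/andP: (f01 x).
have Eg0 : 0 <= \int[gs]_x g x by apply: expect_ge_cst => // x; case/andP: (g01 x).
have lim : ((eps + \int[gt]_x f x) `^ al * (eps + \int[gs]_x g x) `^ be) @[eps --> 0^'+] -->
    (\int[gt]_x f x) `^ al * (\int[gs]_x g x) `^ be.
  by apply: cvgM; exact: powR_right_cvg.
have bfa := bmf_powR (ltW al0) bf f01; have bgb := bmf_powR (ltW be0) bg g01.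
apply: (cvgr_to_ge lim); near=> eps.
have eps0 : 0 < eps by near: eps; exact: nbhs_right_gt.
have M1 : 1 <= 1 + eps by rewrite lerDl ltW.
have := power_product_shift dotp_norm Xsep bA rs rt rn Gs Gt Gn split onb rho0 rho1 kap_rho al01 be01
  albe eps0 M1 (lexx _) bf bg f01 g01.
have pp (a b : R) : 0 < a -> 0 < b -> power_product al be a b = a `^ al * b `^ be.
  by move=> a0 b0; rewrite /power_product expRD /powR !gt_eqF.
rewrite pp; [|lra|lra]; apply: le_trans.
have shift_bmf k : bmf k -> bmf (fun x => eps + k x) by move=> bk; apply: bmfD => //; exact: bmf_cst.
have shift01 k : (forall x, 0 <= k x <= 1) -> forall x : borel X, eps <= eps + k x <= 1 + eps.
  by move=> k01 x; have /andP[h1 h2] := k01 x; rewrite lerDl h1 [1 + _]addrC lerD2l.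
have bJ : bmf (fun z : borel X * borel X =>
    power_product al be (eps + f (A z.1 + z.2)) (eps + g z.1)).
  apply: (bmf_power_product al01 be01 eps0 M1).
  - by apply: measurable_funD => //; exact: (bmf_ou_map dotp_norm Xsep bA bf).1.
  - by apply: measurable_funD => //; exact: (measurableT_comp bg.1 measurable_fst).
  - by move=> z; exact: shift01.
  - by move=> z; exact: shift01.
apply: expect_le => [||x]; first by apply: bmfM => //; exact: bmf_P.
  exact: (bmf_expect1 gs nu bJ).
have bs := bmf_ou_section dotp_norm Xsep bA x bfa.
rewrite mulrC /ou -(expectZ nu _ bs); apply: expect_le => [||y]; first exact: bmfZ.
  exact: (bmf_section1 bJ x).
have /andP[g0 _] := g01 x; have /andP[f0 _] := f01 (A x + y).
rewrite pp; [|lra|lra]; rewrite mulrC ler_pM ?powR_ge0//.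
  by apply: ge0_ler_powR; rewrite ?nnegrE ?(ltW al0)//; lra.
by apply: ge0_ler_powR; rewrite ?nnegrE ?(ltW be0)//; lra.
Unshelve. all: by end_near. Qed.

(** Duality with the extremal function: for [F = f^p], [G = (P f)^q] and exponents [1/p], [1 - 1/q],
    the pairing is the integral [I] of [(P f)^q], and the inequality simplifies to
    [I^(1/q) <= N^(1/p)]. *)
Lemma hypercontractivity (p q : R) f : 1 < p -> 1 < q -> (q - 1) * rho ^+ 2 <= p - 1 ->
  bmf f -> (forall x, 0 <= f x <= 1) ->
  \int[gs]_x P f x `^ q <= (\int[gt]_x f x `^ p) `^ (q / p).
Proof.
move=> p1 q1 pq bf f01.
have p0 : 0 < p by lra. have q0 : 0 < q by lra.
have bPf := bmf_P bf.
have Pf01 x : 0 <= P f x <= 1.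
  have b := bmf_ou_section dotp_norm Xsep bA x bf.
  by apply/andP; split; [apply: expect_ge_cst | apply: expect_le_cst] => // y; case/andP: (f01 (A x + y)).
pose F x := f x `^ p; pose G x := P f x `^ q.
have bF : bmf F := bmf_powR (ltW p0) bf f01.
have bG : bmf G := bmf_powR (ltW q0) bPf Pf01.
have F01 x : 0 <= F x <= 1 := powR_le1 (ltW p0) (f01 x).
have G01 x : 0 <= G x <= 1 := powR_le1 (ltW q0) (Pf01 x).
have pV : 0 < p^-1 < 1 by rewrite invr_gt0 p0 invf_lt1.
have qV : 0 < q^-1 < 1 by rewrite invr_gt0 q0 invf_lt1.
have bee : 0 < 1 - q^-1 < 1 by move: qV => /andP[? ?]; apply/andP; split; lra.
have cond : p^-1 * (1 - q^-1) * rho ^+ 2 <= (1 - p^-1) * (1 - (1 - q^-1)).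
  have -> : p^-1 * (1 - q^-1) * rho ^+ 2 = (p * q)^-1 * ((q - 1) * rho ^+ 2).
    by field; rewrite !gt_eqF.
  have -> : (1 - p^-1) * (1 - (1 - q^-1)) = (p * q)^-1 * (p - 1) by field; rewrite !gt_eqF.
  by rewrite ler_wpM2l// invr_ge0 mulr_ge0// ltW.
have := hypercontractive_pairing pV bee cond bF bG F01 G01.
have -> : (fun z => F z `^ p^-1) = f.
  apply/funext => z; rewrite /F -powRrM mulfV ?gt_eqF// powRr1//.
  by case/andP: (f01 z).
have -> : \int[gs]_x (P f x * G x `^ (1 - q^-1)) = \int[gs]_x G x.
  apply: eq_Rintegral => x _; have /andP[P0 _] := Pf01 x.
  rewrite /G -powRrM (_ : q * (1 - q^-1) = q - 1); last by field; rewrite gt_eqF.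
  by rewrite mulr_powRB1.
set I := \int[gs]_x G x; set N := \int[gt]_x F x => h.
have I0 : 0 <= I by apply: expect_ge_cst => // x; case/andP: (G01 x).
have [->|I1] := eqVneq I 0; first exact: powR_ge0.
have Ipos : 0 < I by rewrite lt_neqAle eq_sym I1.
have Iq : I `^ q^-1 <= N `^ p^-1.
  have E : I = I `^ q^-1 * I `^ (1 - q^-1).
    by rewrite -powRD ?I1 ?implybT// addrC subrK powRr1.
  by rewrite -(ler_pM2r (powR_gt0 (1 - q^-1) Ipos)) -E.
have -> : I = (I `^ q^-1) `^ q by rewrite -powRrM mulVf ?gt_eqF// powRr1.
have -> : N `^ (q / p) = (N `^ p^-1) `^ q by rewrite -powRrM mulrC.
by apply: ge0_ler_powR; rewrite ?nnegrE ?powR_ge0 ?(ltW q0).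
Qed.

End hypercontractive_norms.

(** * Lebesgue norms *)

Lemma limn_einf_le (R : realType) (u : (\bar R)^nat) (c : \bar R) :
  (forall n, u n <= c)%E -> (limn_einf u <= c)%E.
Proof.
move=> uc; rewrite limn_einf_lim; apply: lime_le; first exact: is_cvg_einfs.
by apply: nearW => n; apply: le_trans (uc n); apply: ereal_inf_lbound; exists n => /=.
Qed.

Lemma cvg_powR_norm (R : realType) (u : nat -> R) (l p : R) : 0 < p ->
  u @ \oo --> l -> `|u n| `^ p @[n --> \oo] --> `|l| `^ p.
Proof.
move=> p0 ul; have [l0|l0] := eqVneq l 0; last first.
  have ca : {for `|l|, continuous ((@powR R) ^~ p)}.
    apply: differentiable_continuous; apply/derivable1_diffP.
    have l1 : 0 < `|l| by rewrite normr_gt0.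
    by have [] := is_derive1_powR p l1.
  have : `|u n| @[n --> \oo] --> `|l| by exact: cvg_norm.
  by move=> h; exact: (cvg_comp _ _ h ca).
rewrite l0 in ul *; rewrite normr0 powR0 ?gt_eqF//; apply/cvgr0Pnorm_le => e e0.
have d0 : 0 < e `^ p^-1 by rewrite powR_gt0.
move/cvgr0Pnorm_le : ul => /(_ _ d0); apply: filterS => n un.
rewrite ger0_norm ?powR_ge0//.
have -> : e = (e `^ p^-1) `^ p by rewrite -powRrM mulVf ?gt_eqF// powRr1// ltW.
by apply: ge0_ler_powR; rewrite ?nnegrE ?powR_ge0//; exact: ltW.
Qed.

Section lebesgue_norms.
Context d (T : measurableType d) (R : realType) (P : probability T R).
Implicit Types (f g h : T -> R) (p q c a b : R).
Local Notation N := (Lp_norm P).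

Lemma measurable_powR_norm p f : measurable_fun [set: T] f ->
  measurable_fun [set: T] (fun x => (`|f x| `^ p)%:E).
Proof.
move=> mf; apply/measurable_EFinP.
apply: (measurableT_comp (@measurable_powR R p)).
exact: measurableT_comp.
Qed.

Lemma Lp_norm_leP p c f : 0 < p -> 0 <= c ->
  (N p f <= c%:E)%E = (\int[P]_x (`|f x| `^ p)%:E <= (c `^ p)%:E)%E.
Proof.
move=> p0 c0; have h := poweR_Lnorm P (EFin \o f) (lt0r_neq0 p0).
have -> : (\int[P]_x (`|f x| `^ p)%:E)%E = (N p f `^ p)%E by rewrite h.
have N0 : (0 <= N p f)%E by exact: Lnorm_ge0.
apply/idP/idP => [le_c|le_c].
  rewrite -poweR_EFin; apply: gt0_ler_poweR => //; [exact: ltW| |];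
    by rewrite in_itv/= ?leey ?lee_fin ?andbT.
have := @gt0_ler_poweR R p^-1 _ (N p f `^ p)%E (c `^ p)%:E.
rewrite -poweRrM mulfV ?gt_eqF// poweRe1// poweR_EFin -powRrM mulfV ?gt_eqF// powRr1//; apply => //.
- by rewrite invr_ge0 ltW.
- by rewrite in_itv/= poweR_ge0 leey.
- by rewrite in_itv/= leey lee_fin powR_ge0.
Qed.

Lemma eq_Lp_norm p f g : f =1 g -> N p f = N p g.
Proof. by move=> /funext ->. Qed.

Lemma Lp_norm_ge0 p f : (0 <= N p f)%E.
Proof. exact: Lnorm_ge0. Qed.

Lemma Lp_norm_bound_ge0 p f c : (N p f <= c%:E)%E -> 0 <= c.
Proof. by move=> h; have := le_trans (Lp_norm_ge0 p f) h; rewrite lee_fin. Qed.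

Lemma Lp_normN p f : N p (fun x => - f x) = N p f.
Proof. by rewrite /Lp_norm -[RHS]oppe_Lnorm; congr Lnorm. Qed.

Lemma Lp_normC p f g : N p (fun x => f x - g x) = N p (fun x => g x - f x).
Proof. by rewrite -Lp_normN; apply: eq_Lp_norm => x; rewrite opprB. Qed.

Lemma Lp_normD_le p a b f g : 1 <= p ->
  measurable_fun [set: T] f -> measurable_fun [set: T] g ->
  (N p f <= a%:E)%E -> (N p g <= b%:E)%E -> (N p (fun x => f x + g x)%R <= (a + b)%:E)%E.
Proof.
move=> p1 mf mg fa gb; rewrite EFinD.
exact: le_trans (minkowski_EFin P mf mg p1) (leeD fa gb).
Qed.

Lemma Lp_normB_le p a b f g : 1 <= p ->
  measurable_fun [set: T] f -> measurable_fun [set: T] g ->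
  (N p f <= a%:E)%E -> (N p g <= b%:E)%E -> (N p (fun x => f x - g x)%R <= (a + b)%:E)%E.
Proof.
move=> p1 mf mg fa gb; apply: (@Lp_normD_le p a b f (fun x => - g x)) => //.
  exact: measurableT_comp.
by rewrite Lp_normN.
Qed.

Lemma Lp_norm_dist_triangle p a b f g h : 1 <= p ->
  measurable_fun [set: T] f -> measurable_fun [set: T] g -> measurable_fun [set: T] h ->
  (N p (fun x => f x - g x)%R <= a%:E)%E -> (N p (fun x => g x - h x)%R <= b%:E)%E ->
  (N p (fun x => f x - h x)%R <= (a + b)%:E)%E.
Proof.
move=> p1 mf mg mh fa gb.
rewrite (_ : N p _ = N p (fun x => (f x - g x) + (g x - h x))).
  by apply: Lp_normD_le => //; exact: measurable_funB.
by apply: eq_Lp_norm => x; rewrite addrA subrK.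
Qed.

Lemma Lp_norm1_le p f c : 1 <= p -> measurable_fun [set: T] f ->
  (N p f <= c%:E)%E -> (N 1 f <= c%:E)%E.
Proof.
rewrite le_eqVlt => /orP[/eqP <- //|p1] mf; apply: le_trans.
have p0 : 0 < p by apply: lt_trans p1.
have q0 : 0 < p / (p - 1) by rewrite divr_gt0// subr_gt0.
have PT : (P : {measure set T -> \bar R}) [set: T] = 1%E by exact: probability_setT.
have pq : p^-1 + (p / (p - 1))^-1 = 1.
  by rewrite invf_div -[X in X + _]mul1r -mulrDl addrC subrK mulfV ?gt_eqF.
have := hoelder P mf (@measurable_cst _ _ T R setT 1) p0 q0 pq.
rewrite (_ : EFin \o cst 1 = cst 1%E)// Lnorm_cst1 PT.
rewrite poweR1r mule1 (_ : f \* cst 1 = f)//; apply/funext => x /=; exact: mulr1.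
Qed.

Lemma Lp_norm_fatou p c (u : nat -> T -> R) f (A : set T) : 0 < p ->
  measurable A -> P A = 1%E -> (forall n, measurable_fun [set: T] (u n)) ->
  measurable_fun [set: T] f -> (forall x, A x -> u n x @[n --> \oo] --> f x) ->
  (forall n, (N p (u n) <= c%:E)%E) -> (N p f <= c%:E)%E.
Proof.
move=> p0 mA PA mu mf uf uc; have c0 := Lp_norm_bound_ge0 (uc 0%N).
rewrite Lp_norm_leP//.
have PAC : P (~` A) = 0%E by rewrite probability_setC// PA subee.
have restr g : measurable_fun [set: T] g ->
    (\int[P]_x (`|g x| `^ p)%:E = \int[P]_(x in A) (`|g x| `^ p)%:E)%E.
  move=> mg; rewrite (@ge0_negligible_integral _ _ _ P setT (~` A))//.
  - by rewrite setTD setCK.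
  - exact: measurableC.
  - exact: measurable_powR_norm.
rewrite restr//.
have -> : (\int[P]_(x in A) (`|f x| `^ p)%:E =
    \int[P]_(x in A) limn_einf (fun n => (`|u n x| `^ p)%:E))%E.
  apply: eq_integral => x; rewrite inE => Ax; apply/esym.
  apply: (cvg_limn_einf_sup _).1; apply: cvg_EFin; first exact: nearW.
  apply: cvg_powR_norm => //; exact: uf.
apply: le_trans (fatou P mA _ _) _.
- by move=> n; apply: measurable_funTS; exact: measurable_powR_norm.
- by move=> n x _; rewrite lee_fin powR_ge0.
by apply: limn_einf_le => n; rewrite -restr// -Lp_norm_leP.
Qed.

(** Cut at a level [L]: [|f|^q] is at most [L^(q-1) |f|] below it and [L^(q-q0) |f|^q0] above. [L]
    is large enough for the second part to cost at most [e^q / 2]; then [del] settles the first. *)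
Lemma Lp_norm_interpolation q q0 C e : 1 <= q -> q < q0 -> 0 <= C -> 0 < e ->
  exists2 del, 0 < del & forall f, measurable_fun [set: T] f ->
    (N 1 f <= del%:E)%E -> (N q0 f <= C%:E)%E -> (N q f <= e%:E)%E.
Proof.
move=> q1 qq0 C0 e0.
have q_gt0 : 0 < q by exact: lt_le_trans q1.
have q0_gt0 : 0 < q0 by exact: lt_trans qq0.
have eq0 : 0 < e `^ q by rewrite powR_gt0.
pose D := 2 * (C `^ q0 + 1) / e `^ q.
have Cq : 0 <= C `^ q0 by exact: powR_ge0.
have D0 : 0 < D by rewrite divr_gt0// mulr_gt0// ltr_wpDl.
pose L := D `^ (q0 - q)^-1.
have L0 : 0 < L by rewrite powR_gt0.
have LE : L `^ (q - q0) = D^-1.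
  rewrite -opprB powRN -powRrM mulVf ?powRr1 ?(ltW D0)//.
  by rewrite subr_eq0 gt_eqF.
have small : L `^ (q - q0) * C `^ q0 <= e `^ q / 2.
  rewrite LE /D invf_div -mulrA ler_wpM2l ?(ltW eq0)//.
  by rewrite invfM -mulrA ler_piMr ?invr_ge0//= mulrC ler_pdivrMr ?mul1r; lra.
have M0 : 0 < L `^ (q - 1) by rewrite powR_gt0.
exists (e `^ q / 2 / L `^ (q - 1)); first by rewrite !divr_gt0.
move=> f mf f1 fC; rewrite Lp_norm_leP ?(ltW e0)//.
rewrite Lp_norm_leP// ?divr_ge0 ?(ltW eq0) ?(ltW M0)// in f1; rewrite Lp_norm_leP// in fC.
rewrite powRr1 ?divr_ge0 ?(ltW eq0) ?(ltW M0)// in f1.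
have pw x : `|f x| `^ q <= L `^ (q - 1) * `|f x| `^ 1 + L `^ (q - q0) * `|f x| `^ q0.
  have fx0 : 0 <= `|f x| by [].
  have [fxL|Lfx] := leP `|f x| L.
    rewrite -[leLHS]addr0 lerD// ?mulr_ge0 ?powR_ge0//.
    have [->|fx1] := eqVneq `|f x| 0; first by rewrite !powR0 ?gt_eqF ?mulr0.
    rewrite -[X in `|f x| `^ X](subrK 1) (@powRD _ _ (q - 1) 1) ?fx1 ?implybT//.
    rewrite ler_wpM2r ?powR_ge0// ge0_ler_powR ?nnegrE ?(ltW L0)//; lra.
  rewrite -[leLHS]add0r lerD// ?mulr_ge0 ?powR_ge0 ?(ltW M0)//.
  have fx1 : 0 < `|f x| by apply: lt_trans Lfx.
  rewrite -[X in `|f x| `^ X](subrK q0) (@powRD _ _ (q - q0) q0) ?(gt_eqF fx1) ?implybT//.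
  rewrite ler_wpM2r ?powR_ge0// -opprB !powRN lef_pV2 ?posrE ?powR_gt0//.
  by rewrite ge0_ler_powR ?nnegrE ?(ltW L0)//; lra.
have m1 := measurable_powR_norm 1 mf; have m2 := measurable_powR_norm q0 mf.
have mq := measurable_powR_norm q mf.
have n1 x : (0 <= (`|f x| `^ 1)%:E)%E by rewrite lee_fin powR_ge0.
have n2 x : (0 <= (`|f x| `^ q0)%:E)%E by rewrite lee_fin powR_ge0.
apply: (@le_trans _ _ (\int[P]_x ((L `^ (q - 1))%:E * (`|f x| `^ 1)%:E +
    (L `^ (q - q0))%:E * (`|f x| `^ q0)%:E))%E).
  apply: ge0_le_integral => //.
  - by apply: emeasurable_funD; exact: measurable_funeM.
  - by move=> x _; rewrite -!EFinM -EFinD lee_fin.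
rewrite ge0_integralD//; last 4 first.
- by move=> x _; rewrite mule_ge0// lee_fin powR_ge0.
- exact: measurable_funeM.
- by move=> x _; rewrite mule_ge0// lee_fin powR_ge0.
- exact: measurable_funeM.
rewrite (ge0_integralZl P measurableT m1 (fun x _ => n1 x)) ?lee_fin ?powR_ge0//.
rewrite (ge0_integralZl P measurableT m2 (fun x _ => n2 x)) ?lee_fin ?powR_ge0//.
have -> : (e `^ q = e `^ q / 2 + e `^ q / 2)%R by rewrite -splitr.
rewrite EFinD; apply: leeD.
  apply: le_trans (lee_wpmul2l _ f1) _; first by rewrite lee_fin ltW.
  by rewrite -EFinM lee_fin mulrC divfK ?gt_eqF.
apply: le_trans (lee_wpmul2l _ fC) _; first by rewrite lee_fin powR_ge0.
by rewrite -EFinM lee_fin.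
Qed.

Lemma cvg_of_fast_L1 (u : nat -> T -> R) f : (forall n, measurable_fun [set: T] (u n)) ->
  measurable_fun [set: T] f ->
  (forall n, (N 1 (fun x => u n x - f x)%R <= (4^-1 ^+ n)%:E)%E) ->
  exists A, [/\ measurable A, P A = 1%E & forall x, A x -> u n x @[n --> \oo] --> f x].
Proof.
move=> mu mf uf.
have pow2 n : 2 ^+ n * 4^-1 ^+ n = 2^-1 ^+ n :> R by rewrite -exprMn; congr (_ ^+ _); lra.
have [||||A [mA PA bA]] := @bounded_of_summable_integrals _ T R P
    (fun n x => 2 ^+ n * `|u n x - f x|) (fun n => 2^-1 ^+ n) 2.
- move=> n; apply: measurable_funM => //; apply: measurableT_comp => //.
  exact: measurable_funB.
- by move=> n x; rewrite mulr_ge0 ?exprn_ge0.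
- move=> n; under eq_integral do rewrite EFinM.
  have mn : measurable_fun [set: T] (fun x => `|u n x - f x|%:E).
    by apply/measurable_EFinP; apply: measurableT_comp => //; exact: measurable_funB.
  rewrite (ge0_integralZl P measurableT mn) ?lee_fin ?exprn_ge0//.
  rewrite -pow2 EFinM lee_wpmul2l ?lee_fin ?exprn_ge0//.
  by have := uf n; rewrite /Lp_norm Lnorm1.
- by move=> n; rewrite geometric_half_sum gerBl mulr_ge0 ?exprn_ge0.
exists A; split => // x /bA[M hM]; apply/cvgrPdist_le => e e0.
have := @cvg_geometric R (M) (2^-1); rewrite ger0_norm// => /(_ _)/wrap[|h0]; first lra.
move/cvgr0Pnorm_le : h0 => /(_ _ e0); apply: filterS => n /= hn.
apply: le_trans hn; rewrite distrC; apply: le_trans (ler_norm _).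
have := hM n; rewrite exprVn ler_pdivlMr ?exprn_gt0// mulrC; exact.
Qed.

(** Approximants chosen at speed [4^-n] in L^1 converge almost everywhere, and Fatou applies. *)
Lemma Lp_norm_lsc q C f : 0 < q -> measurable_fun [set: T] f ->
  (forall e, 0 < e -> exists h, [/\ measurable_fun [set: T] h,
     (N 1 (fun x => h x - f x)%R <= e%:E)%E & (N q h <= (C + e)%:E)%E]) ->
  (N q f <= C%:E)%E.
Proof.
move=> q0 mf hf; apply/lee_addgt0Pr => eta eta0; rewrite -EFinD.
have pos n : 0 < Num.min eta (4^-1 ^+ n) by rewrite lt_min eta0 exprn_gt0.
have [u hu] := choice (fun n => hf _ (pos n)).
have mu n : measurable_fun [set: T] (u n) by have [] := hu n.
have [n|A [mA PA uf]] := cvg_of_fast_L1 mu mf.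
  by have [_ h _] := hu n; apply: le_trans h _; rewrite lee_fin ge_min lexx orbT.
apply: (Lp_norm_fatou q0 mA PA mu mf uf) => n; have [_ _ h] := hu n.
by apply: le_trans h _; rewrite lee_fin lerD2l ge_min lexx.
Qed.

(** Almost everywhere convergence comes from the L^1 distances; Fatou applied to [u i - u (i + n)]
    gives the rates in L^q. *)
Lemma Lp_complete q (u : nat -> T -> R) C : 1 <= q ->
  (forall n, measurable_fun [set: T] (u n)) -> (N q (u 0%N) <= C%:E)%E ->
  (forall i j, (i <= j)%N -> (N q (fun x => u i x - u j x)%R <= (4^-1 ^+ i)%:E)%E) ->
  exists g, [/\ measurable_fun [set: T] g, (N q g <= (C + 1)%:E)%E &
    forall i, (N q (fun x => u i x - g x)%R <= (4^-1 ^+ i)%:E)%E].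
Proof.
move=> q1 mu u0 uu; have q0 : 0 < q by exact: lt_le_trans q1.
have pow2 n : 2 ^+ n * 4^-1 ^+ n = 2^-1 ^+ n :> R by rewrite -exprMn; congr (_ ^+ _); lra.
have mB i j : measurable_fun [set: T] (fun x => u i x - u j x) by exact: measurable_funB.
have [||||A [mA PA bA]] := @bounded_of_summable_integrals _ T R P
    (fun n x => 2 ^+ n * `|u n x - u n.+1 x|) (fun n => 2^-1 ^+ n) 2.
- by move=> n; apply: measurable_funM => //; apply: measurableT_comp.
- by move=> n x; rewrite mulr_ge0 ?exprn_ge0.
- move=> n; under eq_integral do rewrite EFinM.
  have mn : measurable_fun [set: T] (fun x => `|u n x - u n.+1 x|%:E).
    by apply/measurable_EFinP; apply: measurableT_comp.
  rewrite (ge0_integralZl P measurableT mn) ?lee_fin ?exprn_ge0//.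
  rewrite -pow2 EFinM lee_wpmul2l ?lee_fin ?exprn_ge0//.
  have := Lp_norm1_le q1 (mB n n.+1) (uu _ _ (leqnSn n)).
  by rewrite /Lp_norm Lnorm1.
- by move=> n; rewrite geometric_half_sum gerBl mulr_ge0 ?exprn_ge0.
have cvA x : A x -> cvgn (fun n => u n x).
  move=> /bA[M hM]; apply: (@cvg_of_geometric_steps R R^o _ M) => n.
  have := hM n; rewrite exprVn ler_pdivlMr ?exprn_gt0// mulrC distrC; exact.
pose v n x := \1_A x * u n x : R.
have mv n : measurable_fun [set: T] (v n) by apply: measurable_funM => //; exact: measurable_indic.
pose g x := limn (v ^~ x).
have vg x : v n x @[n --> \oo] --> g x.
  rewrite /g; suff : cvgn (v ^~ x) by [].
  rewrite /v indicE; have [/set_mem Ax|_] := boolP (x \in A).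
    by under eq_fun do rewrite mul1r; exact: cvA.
  by under eq_fun do rewrite mul0r; exact: is_cvg_cst.
have mg : measurable_fun [set: T] g by apply: (measurable_fun_cvg mv) => x _; exact: vg.
have ug x : A x -> u n x @[n --> \oo] --> g x.
  move=> Ax; have := vg x; rewrite /v indicE (mem_set Ax).
  by under eq_fun do rewrite mul1r.
have key i : (N q (fun x => u i x - g x)%R <= (4^-1 ^+ i)%:E)%E.
  apply: (@Lp_norm_fatou q _ (fun n x => u i x - u (i + n)%N x) _ A) => //.
  - exact: measurable_funB.
  - move=> x Ax; apply: cvgB; first exact: cvg_cst.
    have := ug x Ax; rewrite -(cvg_shiftn i).
    by under eq_fun do rewrite addnC.
  - by move=> n; apply: uu; exact: leq_addr.
exists g; split => //.
rewrite (_ : N q g = N q (fun x => u 0%N x - (u 0%N x - g x))).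
  by apply: Lp_normB_le => //; exact: measurable_funB.
by apply: eq_Lp_norm => x; rewrite opprB addrC subrK.
Qed.

Definition clip (K x : R) : R := Num.max (- K) (Num.min K x).

Lemma clip_le K x : 0 <= K -> `|clip K x| <= K.
Proof.
move=> K0; rewrite ler_norml /clip le_max lexx/= ge_max ge_min lexx/= andbT; lra.
Qed.

Lemma clip_id K x : `|x| <= K -> clip K x = x.
Proof.
rewrite ler_norml /clip => /andP[h1 h2].
by rewrite (min_idPr h2) (max_idPr h1).
Qed.

Lemma clip_dist K x : 0 <= K -> `|clip K x - x| <= `|x|.
Proof.
move=> K0; rewrite /clip; have [h|h] := leP K x.
  have -> : Num.max (- K) K = K by apply/max_idPr; lra.
  by rewrite (@ger0_norm _ x) ?(@ler0_norm _ (K - x)); lra.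
have [h2|h2] := leP (- K) x; first by rewrite subrr normr0.
by rewrite (@ler0_norm _ x) ?(@ger0_norm _ (- K - x)); lra.
Qed.

Lemma measurable_clip K f : measurable_fun [set: T] f ->
  measurable_fun [set: T] (fun x => clip K (f x)).
Proof.
move=> mf; apply: measurable_maxr; first exact: measurable_cst.
by apply: measurable_minr => //; exact: measurable_cst.
Qed.

Lemma bmf_clip K f : 0 <= K -> measurable_fun [set: T] f -> bmf (fun x => clip K (f x)).
Proof. by move=> K0 mf; split; [exact: measurable_clip | exists K => x; exact: clip_le]. Qed.

Lemma bmf_Lp_dense p f C e : 0 < p -> measurable_fun [set: T] f -> (N p f <= C%:E)%E ->
  0 < e -> exists2 phi, bmf phi & (N p (fun x => phi x - f x)%R <= e%:E)%E.
Proof.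
move=> p0 mf fC e0; have C0 := Lp_norm_bound_ge0 fC.
rewrite Lp_norm_leP// in fC.
have mc n : measurable_fun [set: T] (fun x => clip n%:R (f x) - f x).
  by apply: measurable_funB => //; exact: measurable_clip.
have lim : (\int[P]_x (`|clip n%:R (f x) - f x| `^ p)%:E)%E @[n --> \oo] --> 0%E.
  rewrite -(integral0 P setT).
  apply: (@dominated_cvg _ _ _ P setT measurableT _ _ (fun x => (`|f x| `^ p)%:E)) => //.
  - by move=> n; exact: measurable_powR_norm.
  - move=> x _; apply: cvg_near_cst; exists (Num.truncn `|f x|).+1 => // n /= hn.
    rewrite clip_id ?subrr ?normr0 ?powR0 ?gt_eqF//.
    by apply: ltW; apply: lt_le_trans (truncnS_gt _) _; rewrite ler_nat.
  - apply/integrableP; split; first exact: measurable_powR_norm.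
    apply: le_lt_trans (ltry (C `^ p)); apply: le_trans fC; apply: ge0_le_integral => //.
    + by apply: measurableT_comp => //; exact: measurable_powR_norm.
    + exact: measurable_powR_norm.
    + by move=> x _; rewrite /= ger0_norm ?powR_ge0.
  - move=> n x _; rewrite /= lee_fin ger0_norm ?powR_ge0//.
    by rewrite ge0_ler_powR ?nnegrE ?(ltW p0) ?clip_dist.
have [finl lim'] := (fine_cvgP _ _).1 lim.
move/cvgr0Pnorm_le : lim' => /(_ _ (powR_gt0 p e0)) lim'.
near \oo => n; exists (fun x => clip n%:R (f x)); first exact: bmf_clip.
rewrite Lp_norm_leP ?(ltW e0)//.
have fn : (\int[P]_x (`|clip n%:R (f x) - f x| `^ p)%:E)%E \is a fin_num by near: n.
rewrite -(fineK fn) lee_fin; apply: le_trans (ler_norm _) _; near: n; exact: lim'.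
Unshelve. all: by end_near. Qed.

(** An exponent above 1 makes the ball uniformly integrable: [|clip K f - f| <= K^(1-p) |f|^p]. *)
Lemma clip_L1_dist p C del : 1 < p -> 0 <= C -> 0 < del -> exists2 K, 0 < K &
  forall f, measurable_fun [set: T] f -> (N p f <= C%:E)%E ->
    (N 1 (fun x => clip K (f x) - f x)%R <= del%:E)%E.
Proof.
move=> p1 C0 del0; have p0 : 0 < p by exact: lt_trans p1.
pose D := C `^ p / del + 1.
have D0 : 0 < D by rewrite ltr_wpDl// divr_ge0 ?powR_ge0// ltW.
pose K := D `^ (p - 1)^-1.
have K0 : 0 < K by rewrite powR_gt0.
have KE : K `^ (1 - p) = D^-1.
  rewrite -opprB powRN -powRrM mulVf ?powRr1 ?(ltW D0)//.
  by rewrite subr_eq0 gt_eqF.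
exists K => // f mf fC; rewrite /Lp_norm Lnorm1.
rewrite Lp_norm_leP// in fC.
have pw x : `|clip K (f x) - f x| <= D^-1 * `|f x| `^ p.
  have [fxK|Kfx] := leP `|f x| K.
    by rewrite clip_id// subrr normr0 mulr_ge0 ?powR_ge0// invr_ge0 ltW.
  apply: le_trans (clip_dist _ (ltW K0)) _.
  have fx1 : 0 < `|f x| by apply: lt_trans Kfx.
  rewrite -{1}[`|f x|]powRr1// -[X in `|f x| `^ X <= _](subrK p) (@powRD _ _ (1 - p) p) ?(gt_eqF fx1) ?implybT//.
  rewrite ler_wpM2r ?powR_ge0// -KE -opprB !powRN lef_pV2 ?posrE ?powR_gt0//.
  by rewrite ge0_ler_powR ?nnegrE ?(ltW K0)//; lra.
have mp := measurable_powR_norm p mf.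
have n2 x : (0 <= (`|f x| `^ p)%:E)%E by rewrite lee_fin powR_ge0.
apply: (@le_trans _ _ (\int[P]_x ((D^-1)%R%:E * (`|f x| `^ p)%:E))%E).
  apply: ge0_le_integral => //.
  - apply/measurable_EFinP; apply: measurableT_comp => //.
    by apply: measurable_funB => //; exact: measurable_clip.
  - exact: measurable_funeM.
  - by move=> x _; rewrite -EFinM lee_fin.
rewrite (ge0_integralZl P measurableT mp (fun x _ => n2 x)) ?lee_fin ?invr_ge0 ?(ltW D0)//.
apply: le_trans (lee_wpmul2l _ fC) _; first by rewrite lee_fin invr_ge0 ltW.
rewrite -EFinM lee_fin mulrC ler_pdivrMr// /D mulrDr mulr1 mulrC divfK ?gt_eqF//.
by rewrite lerDl ltW.
Qed.

Lemma bmf_Lp_leP p c f : 0 < p -> 0 <= c -> bmf f -> bmf (fun x => `|f x| `^ p) ->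
  (N p f <= c%:E)%E = (\int[P]_x `|f x| `^ p <= c `^ p).
Proof. by move=> p0 c0 bf bp; rewrite Lp_norm_leP// -EFin_expect// lee_fin. Qed.

Lemma bmf_L1E f : bmf f -> N 1 f = (\int[P]_x `|f x|)%:E.
Proof. by move=> bf; rewrite /Lp_norm Lnorm1 EFin_expect//; exact: bmf_norm. Qed.

Lemma bmf_L2_leP c f : 0 <= c -> bmf f -> (N 2 f <= c%:E)%E = (\int[P]_x f x ^+ 2 <= c ^+ 2).
Proof.
move=> c0 bf; rewrite Lp_norm_leP// powR_mulrn// -lee_fin EFin_expect; last exact: bmfX.
congr (_ <= _)%E; apply: eq_integral => x _.
by rewrite powR_mulrn// -normrX ger0_norm// sqr_ge0.
Qed.

Lemma bmf_Lp_fin p f : 0 < p -> bmf f -> exists C, (N p f <= C%:E)%E.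
Proof.
move=> p0 [mf [M fM]]; have M0 : 0 <= `|M| by [].
exists `|M|; rewrite Lp_norm_leP//.
have -> : ((`|M| `^ p)%:E = \int[P]_x (`|M| `^ p)%:E)%E.
  have PT : (P : {measure set T -> \bar R}) [set: T] = 1%E by exact: probability_setT.
  by rewrite integral_cst// PT mule1.
apply: ge0_le_integral => //.
- exact: measurable_powR_norm.
- move=> x _; rewrite lee_fin ge0_ler_powR ?nnegrE ?(ltW p0)//.
  exact: le_trans (fM x) (ler_norm _).
Qed.

Lemma Lfun_leP p f : 1 <= p -> f \in Lfun P p%:E <->
  measurable_fun [set: T] f /\ exists C, (N p f <= C%:E)%E.
Proof.
move=> p1; split => [|[mf [C fC]]].
  rewrite inE => /andP[mf]; rewrite inE => fin; split; first by move: mf; rewrite inE.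
  have fn : N p f \is a fin_num by rewrite ge0_fin_numE// Lp_norm_ge0.
  by exists (fine (N p f)); rewrite fineK.
rewrite inE; apply/andP; split; rewrite inE//=.
by rewrite /finite_norm; exact: le_lt_trans fC (ltry _).
Qed.

End lebesgue_norms.

(** * Extension of the transition operator *)

Section null_sequences.
Context (R : realType).
Implicit Type u : (\bar R)^nat.

Lemma cvge0_le u (e : R) : u @ \oo --> 0%E -> 0 < e -> \forall n \near \oo, (u n <= e%:E)%E.
Proof.
move=> /fine_cvgP[fin /cvgr0Pnorm_le lim] e0; near=> n.
have fn : u n \is a fin_num by near: n.
rewrite -(fineK fn) lee_fin; apply: le_trans (ler_norm _) _; near: n; exact: lim.
Unshelve. all: by end_near. Qed.

Lemma cvge0_of_le u : (forall n, 0 <= u n)%E ->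
  (forall e : R, 0 < e -> \forall n \near \oo, (u n <= e%:E)%E) -> u @ \oo --> 0%E.
Proof.
move=> u0 ue; apply/fine_cvgP; split.
  have := ue 1 ltr01; apply: filterS => n un.
  by rewrite ge0_fin_numE//; apply: le_lt_trans un (ltry _).
apply/cvgr0Pnorm_le => e e0; have := ue e e0; apply: filterS => n un /=.
have fn : u n \is a fin_num by rewrite ge0_fin_numE//; apply: le_lt_trans un (ltry _).
by rewrite ger0_norm ?fine_ge0// -lee_fin fineK.
Qed.

Lemma geometric_small (e : R) : 0 < e -> \forall n \near \oo, (4^-1 : R) ^+ n <= e.
Proof.
move=> e0; have h : `|4^-1 : R| < 1 by rewrite ger0_norm; lra.
move/cvgr0Pnorm_le : (cvg_expr h) => /(_ _ e0); apply: filterS => n.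
by rewrite ger0_norm.
Qed.

End null_sequences.

Section extension_by_density.
Context d (T : measurableType d) (R : realType) (gs gt : probability T R).
Variables (P : (T -> R) -> T -> R) (p : R).
Hypothesis p1 : 1 <= p.
Hypothesis bmf_P : forall f, bmf f -> bmf (P f).
Hypothesis PB : forall f g x, bmf f -> bmf g -> P (fun z => f z - g z) x = P f x - P g x.
Implicit Types f g phi : T -> R.

Definition norm_decreasing (q : R) := forall phi c, bmf phi ->
  (Lp_norm gt p phi <= c%:E)%E -> (Lp_norm gs q (P phi) <= c%:E)%E.

Hypothesis P_contraction : norm_decreasing p.

Definition Lp_limit f g := g \in Lfun gs p%:E /\
    exists phi : nat -> T -> R,
      [/\ forall n, measurable_fun [set: T] (phi n) /\ exists M : R, forall x, `|phi n x| <= M,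
          Lp_norm gt p (phi n - f) @[n --> \oo] --> 0%E &
          Lp_norm gs p (P (phi n) - g) @[n --> \oo] --> 0%E].

(** The same choice as in [ou_transition_Lp], for an abstract operator on bounded functions, so that
    the Mehler form can be put in its place. *)
Definition Lp_extension f : T -> R := xget 0 [set g | Lp_limit f g].

Let p0 : 0 < p. Proof. exact: lt_le_trans p1. Qed.

Let norm_PB q phi psi c : norm_decreasing q -> bmf phi -> bmf psi ->
  (Lp_norm gt p (fun x => phi x - psi x)%R <= c%:E)%E ->
  (Lp_norm gs q (fun x => P phi x - P psi x)%R <= c%:E)%E.
Proof.
move=> dec b1 b2 /(dec _ _ (bmfB b1 b2)); congr (_ <= _)%E; apply: eq_Lp_norm => x.
exact: PB.
Qed.

Lemma Lp_extensionP f : f \in Lfun gt p%:E -> Lp_limit f (Lp_extension f).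
Proof.
move=> /(Lfun_leP gt f p1)[mf [C fC]].
apply: (@xgetPex _ _ [set g | Lp_limit f g]) => /=.
have pos n : 0 < 4^-1 ^+ n / 2 :> R by rewrite divr_gt0 ?exprn_gt0.
have dense n : exists phi, bmf phi /\
    (Lp_norm gt p (fun x => phi x - f x)%R <= (4^-1 ^+ n / 2)%:E)%E.
  by have [phi b h] := bmf_Lp_dense p0 mf fC (pos n); exists phi.
have [phi hphi] := choice dense.
have bphi n : bmf (phi n) by have [] := hphi n.
have phif n : (Lp_norm gt p (fun x => phi n x - f x)%R <= (4^-1 ^+ n / 2)%:E)%E by have [] := hphi n.
have PP i j : (i <= j)%N ->
    (Lp_norm gs p (fun x => P (phi i) x - P (phi j) x)%R <= (4^-1 ^+ i)%:E)%E.
  move=> ij; apply: norm_PB => //; apply: (@le_trans _ _ (4^-1 ^+ i / 2 + 4^-1 ^+ j / 2)%:E).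
    have [m1 _] := bphi i; have [m2 _] := bphi j.
    by apply: (Lp_norm_dist_triangle p1 m1 mf m2 (phif i)); rewrite Lp_normC.
  have h : (4^-1 : R) ^+ j <= 4^-1 ^+ i.
    by apply: ler_wiXn2l ij; rewrite ?invr_ge0// invf_le1// ler1n.
  by rewrite lee_fin [leRHS]splitr lerD2l ler_pM2r.
have mP n : measurable_fun [set: T] (P (phi n)) by have [] := bmf_P (bphi n).
have [C0 h0] := bmf_Lp_fin gs p0 (bmf_P (bphi 0%N)).
have [g [mg gC gP]] := Lp_complete p1 mP h0 PP.
exists g; split; first by apply/(Lfun_leP gs g p1); split => //; exists (C0 + 1).
exists phi; split => //.
  apply: cvge0_of_le => [n|e e0]; first exact: Lp_norm_ge0.
  have := geometric_small e0; apply: filterS => n ne.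
  apply: le_trans (phif n) _; by rewrite lee_fin; apply: le_trans ne; rewrite ler_piMr ?exprn_ge0// invf_le1// ler1n.
apply: cvge0_of_le => [n|e e0]; first exact: Lp_norm_ge0.
have := geometric_small e0; apply: filterS => n ne.
by apply: le_trans (gP n) _; rewrite lee_fin.
Qed.

Lemma measurable_Lp_extension f : f \in Lfun gt p%:E -> measurable_fun [set: T] (Lp_extension f).
Proof. by case/Lp_extensionP => /(Lfun_leP gs _ p1)[]. Qed.

Lemma Lp_extension_approx f e : f \in Lfun gt p%:E -> 0 < e -> exists phi,
  [/\ bmf phi, (Lp_norm gt p (fun x => phi x - f x)%R <= e%:E)%E &
      (Lp_norm gs p (fun x => P phi x - Lp_extension f x)%R <= e%:E)%E].
Proof.
case/Lp_extensionP => _ [phi [bphi /cvge0_le l1 /cvge0_le l2]] e0.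
near \oo => n; exists (phi n); split => //; near: n; [exact: l1 | exact: l2].
Unshelve. all: by end_near. Qed.

(** The approximants converge in L^p only, while [q] may be larger: lower semicontinuity of the L^q
    norm carries the bound to the limit. *)
Lemma Lp_extension_norm q f c : 1 <= q -> norm_decreasing q -> f \in Lfun gt p%:E ->
  (Lp_norm gt p f <= c%:E)%E -> (Lp_norm gs q (Lp_extension f) <= c%:E)%E.
Proof.
move=> q1 dec Lf fc; have [mf _] := (Lfun_leP gt f p1).1 Lf.
have mF := measurable_Lp_extension Lf.
apply: Lp_norm_lsc => [|//|e e0]; first exact: lt_le_trans q1.
have [phi [bphi phi1 phi2]] := Lp_extension_approx Lf e0.
have [mphi _] := bphi; have [mP _] := bmf_P bphi.
exists (P phi); split => //.
  by apply: (Lp_norm1_le p1) => //; exact: measurable_funB.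
apply: dec => //; rewrite (_ : Lp_norm gt p phi = Lp_norm gt p (fun x => f x + (phi x - f x))).
  by apply: Lp_normD_le => //; exact: measurable_funB.
by apply: eq_Lp_norm => x; rewrite addrC subrK.
Qed.

Lemma Lp_extension_dist q f g c : 1 <= q -> norm_decreasing q ->
  f \in Lfun gt p%:E -> g \in Lfun gt p%:E ->
  (Lp_norm gt p (fun x => f x - g x)%R <= c%:E)%E ->
  (Lp_norm gs q (fun x => Lp_extension f x - Lp_extension g x)%R <= c%:E)%E.
Proof.
move=> q1 dec Lf Lg fg; have [mf _] := (Lfun_leP gt f p1).1 Lf.
have [mg _] := (Lfun_leP gt g p1).1 Lg.
have mF := measurable_Lp_extension Lf; have mG := measurable_Lp_extension Lg.
apply: Lp_norm_lsc; first exact: lt_le_trans q1.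
  exact: measurable_funB.
move=> e e0; have e2 : 0 < e / 2 by lra.
have [phi [bphi phi1 phi2]] := Lp_extension_approx Lf e2.
have [psi [bpsi psi1 psi2]] := Lp_extension_approx Lg e2.
have bP := bmf_P bphi; have bQ := bmf_P bpsi.
exists (fun x => P phi x - P psi x); split; first by case: (bmfB bP bQ).
  rewrite (_ : Lp_norm gs 1 _ = Lp_norm gs 1 (fun x =>
      (P phi x - Lp_extension f x) - (P psi x - Lp_extension g x))); last first.
    by apply: eq_Lp_norm => x; ring.
  have m1 : measurable_fun [set: T] (fun x => P phi x - Lp_extension f x).
    by apply: measurable_funB => //; case: bP.
  have m2 : measurable_fun [set: T] (fun x => P psi x - Lp_extension g x).
    by apply: measurable_funB => //; case: bQ.
  rewrite [e in (_ <= e%:E)%E]splitr.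
  by apply: Lp_normB_le => //; exact: (Lp_norm1_le p1).
apply: norm_PB => //.
have [mphi _] := bphi; have [mpsi _] := bpsi.
rewrite (_ : c + e = e / 2 + (c + e / 2)); last by lra.
apply: (Lp_norm_dist_triangle p1 mphi mf mpsi phi1).
by apply: (Lp_norm_dist_triangle p1 mf mg mpsi fg); rewrite Lp_normC.
Qed.

(** The chosen limit may come from another approximating sequence, so agreement with [P] holds only
    up to norm 0. *)
Lemma Lp_extension_bmf phi : bmf phi ->
  (Lp_norm gs p (fun x => P phi x - Lp_extension phi x)%R <= 0%:E)%E.
Proof.
move=> bphi; have [C hC] := bmf_Lp_fin gt p0 bphi; have [mphi _] := bphi.
have L : phi \in Lfun gt p%:E by apply/(Lfun_leP gt phi p1); split => //; exists C.
apply/lee_addgt0Pr => e e0; rewrite add0e.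
have e2 : 0 < e / 2 by lra.
have [psi [bpsi psi1 psi2]] := Lp_extension_approx L e2.
have [m1 _] := bmf_P bphi; have [m2 _] := bmf_P bpsi.
rewrite [e]splitr; apply: (Lp_norm_dist_triangle p1 m1 m2 (measurable_Lp_extension L) _ psi2).
by apply: norm_PB => //; rewrite Lp_normC.
Qed.

End extension_by_density.

(** * Sufficiency *)

Lemma Lp_norm_dominated d (T : measurableType d) (R : realType) (P : probability T R)
  (q K c : R) (f g : T -> R) : 0 < q -> 0 <= K -> measurable_fun [set: T] f ->
  measurable_fun [set: T] g -> (forall x, `|g x| <= K * `|f x|) ->
  (Lp_norm P q f <= c%:E)%E -> (Lp_norm P q g <= (K * c)%:E)%E.
Proof.
move=> q0 K0 mf mg gf fc; have c0 := Lp_norm_bound_ge0 fc.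
rewrite Lp_norm_leP ?mulr_ge0//; rewrite Lp_norm_leP// in fc.
have mp := measurable_powR_norm q mf.
have n2 x : (0 <= (`|f x| `^ q)%:E)%E by rewrite lee_fin powR_ge0.
apply: (@le_trans _ _ (\int[P]_x ((K `^ q)%:E * (`|f x| `^ q)%:E))%E).
  apply: ge0_le_integral => //.
  - exact: measurable_powR_norm.
  - exact: measurable_funeM.
  - move=> x _; rewrite -EFinM lee_fin -powRM//.
    by rewrite ge0_ler_powR ?nnegrE ?mulr_ge0 ?(ltW q0).
rewrite (ge0_integralZl P measurableT mp (fun x _ => n2 x)) ?lee_fin ?powR_ge0//.
by rewrite powRM// EFinM lee_wpmul2l// lee_fin powR_ge0.
Qed.

Section compactness_of_the_transition.
Context (R : realType) (X : completeNormedModType R).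
Variable dotp : {dot X for idfun}.
Hypothesis dotp_norm : is_inner_product dotp.
Hypothesis Xsep : separable X.
Local Notation "<< x , y >>" := (dotp x y) (at level 0, format "<< x ,  y >>").
Local Notation tr := (trig (fun (h : X) (x : borel X) => <<x, h>>)).
Implicit Types f g : borel X -> R.
Variables (A Qs Qt Qn Ss St Sn : X -> X) (gs gt nu : probability (borel X) R).
Hypothesis bA : bounded_operator A.
Hypothesis rs : nonneg_root dotp Qs Ss.
Hypothesis rt : nonneg_root dotp Qt St.
Hypothesis rn : nonneg_root dotp Qn Sn.
Hypothesis Gs : is_gaussian dotp 0 Qs gs.
Hypothesis Gt : is_gaussian dotp 0 Qt gt.
Hypothesis Gn : is_gaussian dotp 0 Qn nu.
Hypothesis split : forall x y,
  <<Qt x, y>> = <<Qs (adjoint dotp A x), adjoint dotp A y>> + <<Qn x, y>>.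
Variable e : nat -> X.
Hypothesis onb : onb_seq dotp e.
Local Notation P := (ou A nu).
Variable rho : R.
Hypothesis rho0 : 0 <= rho.
Hypothesis rho1 : rho <= 1.
Hypothesis kap_rho : forall h, `|Ss (adjoint dotp A h)| <= rho * `|St h|.

Let bmf_P f : bmf f -> bmf (P f).
Proof. exact: (bmf_ou dotp_norm Xsep gs nu bA). Qed.

Let Qn0 h : 0 <= <<Qn h, h>>.
Proof. by case: rn => _ sym _ <-; rewrite sym dotp_norm sqr_ge0. Qed.

(** [hypercontractivity] concerns functions with values in [0, 1]: it is applied to [f = |phi| / K],
    and [|P phi| <= K P f] by positivity. *)
Lemma ou_hypercontractive (p q : R) : 1 < p -> 1 < q -> (q - 1) * rho ^+ 2 <= p - 1 ->
  norm_decreasing gs gt P p q.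
Proof.
move=> p1 q1 pq phi c bphi phic; have c0 := Lp_norm_bound_ge0 phic.
have p0 : 0 < p by exact: lt_trans p1.
have q0 : 0 < q by exact: lt_trans q1.
have [mphi [M phiM]] := bphi; pose K := `|M| + 1.
have K0 : 0 < K by rewrite ltr_wpDl.
have Kphi x : `|phi x| <= K.
  by apply: le_trans (phiM x) _; apply: le_trans (ler_norm _) _; rewrite lerDl.
pose f x := K^-1 * `|phi x|.
have bf : bmf f by apply: bmfZ; exact: bmf_norm.
have f01 x : 0 <= f x <= 1.
  by rewrite /f mulr_ge0 ?invr_ge0 ?(ltW K0)//= mulrC ler_pdivrMr// mul1r.
have bPf := bmf_P bf; have bPphi := bmf_P bphi.
have [mf _] := bf; have [mPf _] := bPf; have [mPphi _] := bPphi.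
have Pf01 x : 0 <= P f x <= 1.
  have b := bmf_ou_section dotp_norm Xsep bA x bf.
  by apply/andP; split; [apply: expect_ge_cst | apply: expect_le_cst] => // y; case/andP: (f01 (A x + y)).
have fc : (Lp_norm gt p f <= (K^-1 * c)%:E)%E.
  apply: (@Lp_norm_dominated _ _ _ _ _ _ _ phi) => //; first by rewrite invr_ge0 ltW.
  by move=> x; rewrite ger0_norm//; case/andP: (f01 x).
have abs01 g : (forall x, 0 <= g x <= 1) -> (fun x => `|g x|) = g.
  by move=> g01; apply/funext => x; rewrite ger0_norm//; case/andP: (g01 x).
have Kc0 : 0 <= K^-1 * c by rewrite mulr_ge0// invr_ge0 ltW.
have bfp : bmf (fun x => `|f x| `^ p).
  by apply: bmf_powR; rewrite ?(ltW p0) ?abs01//; move=> x; rewrite ger0_norm//; case/andP: (f01 x).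
have bgp : bmf (fun x => `|P f x| `^ q).
  by apply: bmf_powR; rewrite ?(ltW q0) ?abs01//; move=> x; rewrite ger0_norm//; case/andP: (Pf01 x).
have Pfc : (Lp_norm gs q (P f) <= (K^-1 * c)%:E)%E.
  rewrite (bmf_Lp_leP gs q0 Kc0 bPf bgp).
  rewrite (bmf_Lp_leP gt p0 Kc0 bf bfp) in fc.
  have h := hypercontractivity dotp_norm Xsep bA rs rt rn Gs Gt Gn split onb rho0 rho1 kap_rho
    p1 q1 pq bf f01.
  under eq_Rintegral => x _ do (rewrite ger0_norm; last by case/andP: (Pf01 x)).
  apply: le_trans h _.
  have -> : (K^-1 * c) `^ q = ((K^-1 * c) `^ p) `^ (q / p).
    by rewrite -powRrM mulrCA mulfV ?gt_eqF// mulr1.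
  have E : \int[gt]_x f x `^ p = \int[gt]_x `|f x| `^ p.
    by apply: eq_Rintegral => x _; rewrite ger0_norm//; case/andP: (f01 x).
  rewrite E; apply: ge0_ler_powR => //; rewrite ?nnegrE ?powR_ge0 ?divr_ge0 ?(ltW p0) ?(ltW q0)//.
  by apply: expect_ge_cst => // x; exact: powR_ge0.
rewrite (_ : c = K * (K^-1 * c)); last by rewrite mulrA mulfV ?mul1r ?gt_eqF.
apply: (Lp_norm_dominated q0 (ltW K0) mPf mPphi _ Pfc) => x.
apply: le_trans (ou_norm_le dotp_norm Xsep nu bA x bphi) _.
rewrite ger0_norm; last by case/andP: (Pf01 x).
rewrite -(ouZ dotp_norm Xsep nu bA K x bf) le_eqVlt; apply/orP; left; apply/eqP.
by congr (P _ x); apply/funext => z; rewrite /f mulrA mulfV ?gt_eqF// mul1r.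
Qed.

Lemma ou_L1_contraction : norm_decreasing gs gt P 1 1.
Proof.
move=> phi c bphi; rewrite !bmf_L1E//; last exact: bmf_P.
apply: le_trans; rewrite lee_fin.
exact: (expect_norm_ou_le dotp_norm Xsep bA rs rt Qn0 Gs Gt Gn split bphi).
Qed.

Variable p : R.
Hypothesis p1 : 1 < p.
Local Notation ext := (Lp_extension gs gt P p).

Lemma ou_contraction : norm_decreasing gs gt P p p.
Proof.
apply: ou_hypercontractive => //; rewrite ler_piMr//; first by rewrite subr_ge0 ltW.
by rewrite expr_le1.
Qed.

Let PB f g x : bmf f -> bmf g -> P (fun z => f z - g z) x = P f x - P g x.
Proof. exact: ouB. Qed.

(** Truncation at a level [K] that serves the whole ball, then affine rescaling. The polynomials
    stay in [0, 1], so they are bounded in L^2 although the ball is bounded only in L^p, and the L^2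
    estimate applies to them. *)
Lemma trig_approximation (M del : R) : 0 <= M -> 0 < del -> exists2 K : R, 0 < K &
  forall f, f \in Lfun gt p%:E -> (Lp_norm gt p f <= M%:E)%E -> exists2 s,
    forall x : borel X, 0 <= tr s x <= 1 &
    (Lp_norm gs 1 (fun x => (2 * K * tr (ou_seq dotp A Qn s) x - K) - ext f x)%R <= del%:E)%E.
Proof.
move=> M0 del0; have M10 : 0 <= M + 1 by rewrite addr_ge0.
have d4 : 0 < del / 4 by lra.
have [K K0 clipK] := clip_L1_dist gt p1 M10 d4.
exists K => // f Lf fM; have [mf _] := (Lfun_leP gt f (ltW p1)).1 Lf.
have e0 : 0 < Num.min 1 (del / 4) by rewrite lt_min ltr01.
have [phi [bphi phi1 phi2]] := Lp_extension_approx (ltW p1) bmf_P PB ou_contraction Lf e0.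
have [mphi _] := bphi; have bPphi := bmf_P bphi.
have phiM : (Lp_norm gt p phi <= (M + 1)%:E)%E.
  rewrite addrC (_ : Lp_norm gt p phi = Lp_norm gt p (fun x => (phi x - f x) + f x)); last first.
    by apply: eq_Lp_norm => x; rewrite subrK.
  apply: Lp_normD_le => //; [exact: ltW | exact: measurable_funB |].
  by apply: le_trans phi1 _; rewrite lee_fin ge_min lexx.
pose tau x := (2 * K)^-1 * (clip K (phi x) + K).
have K2 : 0 < 2 * K by rewrite mulr_gt0.
have bc := bmf_clip (ltW K0) mphi.
have btau : bmf tau by apply: bmfZ; apply: bmfD => //; exact: bmf_cst.
have tau01 x : 0 <= tau x <= 1.
  have := clip_le (phi x) (ltW K0); rewrite ler_norml => /andP[h1 h2].
  rewrite /tau mulrC ler_pdivrMr// mul1r divr_ge0 ?(ltW K2)//; lra.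
have d8 : 0 < del / 4 / (2 * K) by rewrite divr_gt0.
have [mtau _] := btau.
have [s [s01 s_close _]] := borel_trig_dense dotp_norm Xsep gt gt mtau tau01 d8.
exists s => //.
have btr := bmf_borel_trig dotp_norm s.
pose psi x := 2 * K * tr s x - K.
have bpsi : bmf psi by apply: bmfB; [exact: bmfZ | exact: bmf_cst].
have psi_clip : (Lp_norm gt 1 (fun x => psi x - clip K (phi x))%R <= (del / 4)%:E)%E.
  rewrite bmf_L1E ?lee_fin; last exact: bmfB.
  have -> : \int[gt]_x `|psi x - clip K (phi x)| = 2 * K * \int[gt]_x `|tr s x - tau x|.
    rewrite -(expectZ gt _ (bmf_norm (bmfB btr btau))); apply: eq_Rintegral => x _.
    rewrite -[X in X * `|_|](gtr0_norm K2) -normrM; congr `|_|.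
    by rewrite /psi /tau; field; rewrite gt_eqF.
  by rewrite mulrC -ler_pdivlMr// ltW.
have psi_phi : (Lp_norm gt 1 (fun x => psi x - phi x)%R <= (del / 4 + del / 4)%:E)%E.
  have [mpsi _] := bpsi; have [mc _] := bc.
  exact: (Lp_norm_dist_triangle (lexx 1) mpsi mc mphi psi_clip (clipK _ mphi phiM)).
have P_psi_phi := ou_L1_contraction (bmfB bpsi bphi) psi_phi.
have Ppsi x : P psi x = 2 * K * tr (ou_seq dotp A Qn s) x - K.
  rewrite /psi (ouB dotp_norm Xsep nu bA x (bmfZ (2 * K) btr) (bmf_cst _ K)).
  by rewrite (ouZ dotp_norm Xsep nu bA (2 * K) x btr) ou_cst (ou_trig dotp_norm bA Qn0 Gn).
have [mPpsi _] := bmf_P bpsi; have [mPphi _] := bPphi.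
rewrite (_ : del = (del / 4 + del / 4) + del / 2); last by lra.
rewrite (_ : Lp_norm gs 1 _ = Lp_norm gs 1 (fun x => P psi x - ext f x)); last first.
  by apply: eq_Lp_norm => x; rewrite Ppsi.
have mext := measurable_Lp_extension (ltW p1) bmf_P PB ou_contraction Lf.
apply: (Lp_norm_dist_triangle (lexx 1) mPpsi mPphi mext).
  rewrite (_ : Lp_norm gs 1 _ = Lp_norm gs 1 (P (fun x => psi x - phi x))) //.
  by apply: eq_Lp_norm => x; exact/esym/PB.
apply: (Lp_norm1_le (ltW p1)); first exact: measurable_funB.
apply: le_trans phi2 _; rewrite lee_fin ge_min; apply/orP; right; lra.
Qed.

Hypothesis rho_lt1 : rho < 1.
Hypothesis tail : forall eps : R, 0 < eps -> exists N : nat, forall h,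
  `|Ss (adjoint dotp A h) - onb_proj dotp e N (Ss (adjoint dotp A h))| ^+ 2 <=
  eps * `|St h| ^+ 2.

(** [finite_rank_estimate] for the difference of two terms, which is bounded by 1: the small
    multiple contributes [eta^2 / 2], and the finitely many functionals, bounded on the sequence,
    are Cauchy along the ultrafilter. *)
Lemma trig_ultra_cauchy (F : set_system nat) (FF : UltraFilter F) (s : nat -> seq (R * R * X)) eta :
  (forall n (x : borel X), 0 <= tr (s n) x <= 1) -> 0 < eta ->
  exists2 S : set nat, F S & forall n m, S n -> S m ->
    (Lp_norm gs 1 (fun x => tr (ou_seq dotp A Qn (s n)) x - tr (ou_seq dotp A Qn (s m)) x)%R
      <= eta%:E)%E.
Proof.
move=> s01 eta0; have eps0 : 0 < eta ^+ 2 / 2 by rewrite divr_gt0 ?exprn_gt0.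
have [n [l [C [lB lC est]]]] := finite_rank_estimate dotp_norm bA rs rt Gs Gt split onb
  rho0 rho1 kap_rho rho_lt1 tail eps0.
have btr r := bmf_borel_trig dotp_norm r.
have sq01 r : (forall x : borel X, `|tr r x| <= 1) -> \int[gt]_x tr r x ^+ 2 <= 1.
  move=> r1; apply: expect_le_cst; first by apply: bmfX; exact: btr.
  by move=> x; rewrite -real_normK ?num_real// expr_le1.
have C0 : 0 <= `|C| by [].
have lbound i k : (i < n)%N -> `|l i (s k)| <= `|C| + 1.
  move=> ltin; have h1 : l i (s k) ^+ 2 <= `|C|.
    apply: le_trans (lC _ _ ltin) _.
    have I0 : 0 <= \int[gt]_x tr (s k) x ^+ 2.
      by apply: expect_ge_cst => [|x]; [apply: bmfX; exact: btr | exact: sqr_ge0].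
    apply: (@le_trans _ _ (`|C| * \int[gt]_x tr (s k) x ^+ 2)); first by rewrite ler_wpM2r// ler_norm.
    rewrite ler_piMr//; apply: sq01 => x; have /andP[h2 h3] := s01 k x.
    by rewrite ger0_norm.
  rewrite -(@ler_pXn2r _ 2) ?nnegrE ?addr_ge0// real_normK ?num_real//.
  by apply: le_trans h1 _; rewrite sqrrD1; nra.
pose a i k := if (i < n)%N then l i (s k) else 0.
have abound i k : `|a i k| <= (fun=> `|C| + 1) i.
  by rewrite /a; case: ifP => [/lbound //|_]; rewrite normr0 addr_ge0.
(* With this tolerance the [n] squares add up to at most [eta^2 / 4]. *)
have th0 : 0 < eta / (2 * n.+1%:R) by rewrite divr_gt0// mulr_gt0.
have [S FS Scauchy] := @ultra_cauchy_coordinates R F FF a (fun=> `|C| + 1) abound n _ th0.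
exists S => // k m Sk Sm.
pose r := s k ++ trig_scale (-1) (s m).
have trr x : tr r x = tr (s k) x - tr (s m) x.
  by rewrite /r trig_cat trig_scaleE mulN1r.
have r1 (x : borel X) : `|tr r x| <= 1.
  have := s01 k x; have := s01 m x; move=> /andP[? ?] /andP[? ?].
  by rewrite trr ler_norml; apply/andP; split; lra.
have Pr x : tr (ou_seq dotp A Qn r) x =
    tr (ou_seq dotp A Qn (s k)) x - tr (ou_seq dotp A Qn (s m)) x.
  rewrite -!(ou_trig dotp_norm bA Qn0 Gn) -(ouB dotp_norm Xsep nu bA x (btr _) (btr _)).
  by congr (P _ x); apply/funext => z; exact: trr.
rewrite (_ : Lp_norm gs 1 _ = Lp_norm gs 1 (fun x => tr (ou_seq dotp A Qn r) x)); last first.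
  by apply: eq_Lp_norm => x; rewrite Pr.
have [mr _] := btr (ou_seq dotp A Qn r).
apply: (Lp_norm1_le (p := 2)) => //; first by rewrite ler1n.
rewrite bmf_L2_leP ?(ltW eta0)//; apply: le_trans (est r) _.
rewrite [leRHS](splitr (eta ^+ 2)); apply: lerD; first by rewrite ler_piMr ?(ltW eps0)// sq01.
apply: (@le_trans _ _ (\sum_(i < n) (eta / (2 * n.+1%:R)) ^+ 2)).
  apply: ler_sum => i _; rewrite lB -real_normK ?num_real//.
  rewrite ler_pXn2r ?nnegrE ?(ltW th0)//.
  by have := Scauchy _ _ Sk Sm i (ltn_ord i); rewrite /a ltn_ord.
rewrite sumr_const card_ord -[X in X <= _]mulr_natl.
have n1 : 0 < n.+1%:R :> R by [].
have nle : n%:R <= n.+1%:R ^+ 2 :> R by rewrite -natrX ler_nat; apply: leq_trans (leqnSn n) _; rewrite -mulnn leq_pmulr.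
have -> : n%:R * (eta / (2 * n.+1%:R)) ^+ 2 = eta ^+ 2 * (n%:R / (4 * n.+1%:R ^+ 2)).
  by field; rewrite gt_eqF.
rewrite ler_wpM2l ?sqr_ge0// ler_pdivrMr; last by rewrite mulr_gt0// exprn_gt0.
have h0 : 0 <= n.+1%:R ^+ 2 :> R by exact: sqr_ge0.
apply: le_trans nle _; lra.
Qed.

Lemma extension_L1_ultra_cauchy (F : set_system nat) (FF : UltraFilter F) (u : nat -> borel X -> R) M del :
  (forall n, u n \in Lfun gt p%:E) -> (forall n, (Lp_norm gt p (u n) <= M%:E)%E) -> 0 < del ->
  exists2 S : set nat, F S & forall n m, S n -> S m ->
    (Lp_norm gs 1 (fun x => ext (u n) x - ext (u m) x)%R <= del%:E)%E.
Proof.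
move=> Lu uM del0; have M0 := Lp_norm_bound_ge0 (uM 0%N).
have d4 : 0 < del / 4 by lra.
have [K K0 approx] := trig_approximation M0 d4.
have ap n : exists s, (forall x : borel X, 0 <= tr s x <= 1) /\
    (Lp_norm gs 1 (fun x => (2 * K * tr (ou_seq dotp A Qn s) x - K) - ext (u n) x)%R <= (del / 4)%:E)%E.
  by have [s s01 h] := approx _ (Lu n) (uM n); exists s.
have [s hs] := choice ap.
have K2 : 0 < 2 * K by rewrite mulr_gt0.
have eta0 : 0 < del / 2 / (2 * K) by rewrite !divr_gt0.
have [S FS Sc] := trig_ultra_cauchy FF (fun n => (hs n).1) eta0.
exists S => // n m hn hm.
pose g k x := 2 * K * tr (ou_seq dotp A Qn (s k)) x - K.
have bg k : bmf (g k).
  by apply: bmfB; [apply: bmfZ; exact: (bmf_borel_trig dotp_norm) | exact: bmf_cst].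
have [mgn _] := bg n; have [mgm _] := bg m.
have mext k := measurable_Lp_extension (ltW p1) bmf_P PB ou_contraction (Lu k).
rewrite (_ : del = del / 4 + (del / 2 + del / 4)); last by lra.
apply: (Lp_norm_dist_triangle (lexx 1) (mext n) mgn (mext m)).
  by rewrite Lp_normC; exact: (hs n).2.
apply: (Lp_norm_dist_triangle (lexx 1) mgn mgm (mext m) _ (hs m).2).
have [mn _] := bmf_borel_trig dotp_norm (ou_seq dotp A Qn (s n)).
have [mm _] := bmf_borel_trig dotp_norm (ou_seq dotp A Qn (s m)).
rewrite (_ : del / 2 = 2 * K * (del / 2 / (2 * K))); last by field; rewrite gt_eqF.
apply: (Lp_norm_dominated ltr01 (ltW K2) _ _ _ (Sc n m hn hm)).
- exact: measurable_funB.
- exact: measurable_funB.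
move=> x; rewrite -[X in X * `|_|](gtr0_norm K2) -normrM le_eqVlt; apply/orP; left; apply/eqP.
by congr `|_|; rewrite /g; ring.
Qed.

(** Differences are small in L^1 on a set of the ultrafilter and bounded in L^q0, hence small in L^q
    by interpolation; a fast subsequence then converges by completeness. *)
Lemma extension_compact (q q0 : R) : 1 <= q -> q < q0 -> (q0 - 1) * rho ^+ 2 <= p - 1 ->
  compact_operator [set f | f \in Lfun gt p%:E] (Lp_norm gt p)
    [set g | g \in Lfun gs q%:E] (Lp_norm gs q) ext.
Proof.
move=> q1 qq0 hq0; have q01 : 1 < q0 by exact: le_lt_trans qq0.
have dec : norm_decreasing gs gt P p q0 by exact: ou_hypercontractive.
have mext f Lf := @measurable_Lp_extension _ _ _ gs gt P p (ltW p1) bmf_P PB ou_contraction f Lf.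
have Lsub g : g \in Lfun gs q0%:E -> g \in Lfun gs q%:E.
  apply: Lfun_subset; rewrite ?lee_fin ?(ltW q01) ?(ltW qq0)//.
  by have -> : (gs : {measure set borel X -> \bar R}) [set: borel X] = 1%E by exact: probability_setT.
split => [f /= Lf|u Lu [M uM]].
  have [mf [C fC]] := (Lfun_leP gt f (ltW p1)).1 Lf.
  apply: Lsub; apply/(Lfun_leP gs _ (ltW q01)); split; first exact: mext.
  by exists C; exact: (Lp_extension_norm (ltW p1) bmf_P PB ou_contraction (ltW q01) dec Lf fC).
have [F UF Ftail] := ultra_free_exists.
have M0 := Lp_norm_bound_ge0 (uM 0%N).
have mu n : measurable_fun [set: borel X] (u n) by have [] := (Lfun_leP gt (u n) (ltW p1)).1 (Lu n).
have mg n : measurable_fun [set: borel X] (ext (u n)) by exact: (mext _ (Lu n)).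
have bound n m : (Lp_norm gs q0 (fun x => ext (u n) x - ext (u m) x)%R <= (M + M)%:E)%E.
  apply: (Lp_extension_dist (ltW p1) bmf_P PB ou_contraction (ltW q01) dec (Lu n) (Lu m)).
  by apply: Lp_normB_le => //; exact: ltW.
have cauchy eta : 0 < eta -> exists2 S : set nat, F S & forall n m, S n -> S m ->
    (Lp_norm gs q (fun x => ext (u n) x - ext (u m) x)%R <= eta%:E)%E.
  move=> eta0; have [del del0 hdel] := Lp_norm_interpolation gs q1 qq0 (addr_ge0 M0 M0) eta0.
  have [S FS Sc] := extension_L1_ultra_cauchy UF Lu uM del0.
  exists S => // n m hn hm; apply: hdel; [exact: measurable_funB | exact: Sc | exact: bound].
pose D n m := Lp_norm gs q (fun x => ext (u n) x - ext (u m) x).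
have fin f : f \in Lfun gs q0%:E -> Lp_norm gs q f \is a fin_num.
  move=> /Lsub/(Lfun_leP gs _ q1)[_ [C hC]].
  by rewrite ge0_fin_numE ?Lp_norm_ge0//; exact: le_lt_trans hC (ltry _).
have Dfin n m : D n m \is a fin_num.
  apply: fin; apply/(Lfun_leP gs _ (ltW q01)); split; first exact: measurable_funB.
  by exists (M + M); exact: bound.
have [eps eps0|k k_incr kD] := @ultra_cauchy_subsequence R F UF (fun n m => fine (D n m)) Ftail.
  have [S FS Sc] := cauchy eps eps0; exists S => // n m hn hm.
  by rewrite -lee_fin fineK//; exact: Sc.
(* Doubling the index turns the rate [2^-i] into the rate [4^-i] that [Lp_complete] asks for. *)
pose k2 n := k (2 * n)%N.
have k2_incr : increasing_seq k2.
  by move=> n m; rewrite /k2 k_incr leq_pmul2l.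
have kD2 i j : (i <= j)%N -> (D (k2 i) (k2 j) <= (4^-1 ^+ i)%:E)%E.
  move=> ij; rewrite -(fineK (Dfin _ _)) lee_fin; apply: le_trans (kD _ _ _) _.
    by rewrite leq_pmul2l.
  by rewrite exprM le_eqVlt; apply/orP; left; apply/eqP; congr (_ ^+ _); field.
have start : (Lp_norm gs q (ext (u (k2 0%N))) <= (fine (Lp_norm gs q (ext (u (k2 0%N)))))%:E)%E.
  rewrite fineK//; apply: fin; apply/(Lfun_leP gs _ (ltW q01)); split => //; exists M.
  exact: (Lp_extension_norm (ltW p1) bmf_P PB ou_contraction (ltW q01) dec (Lu _) (uM _)).
have [g [mgg gC lim]] := Lp_complete q1 (fun n => mg (k2 n)) start kD2.
exists k2 => //; exists g => /=.
  by apply/(Lfun_leP gs g q1); split => //; exists (fine (Lp_norm gs q (ext (u (k2 0%N)))) + 1).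
apply: cvge0_of_le => [n|eps eps0]; first exact: Lp_norm_ge0.
have := geometric_small eps0; apply: filterS => n ne.
by apply: le_trans (lim n) _; rewrite lee_fin.
Qed.

End compactness_of_the_transition.

(** * Necessity *)

Section necessity.
Context (R : realType) (X : completeNormedModType R).
Variable dotp : {dot X for idfun}.
Hypothesis dotp_norm : is_inner_product dotp.
Hypothesis Xsep : separable X.
Local Notation "<< x , y >>" := (dotp x y) (at level 0, format "<< x ,  y >>").
Local Notation tr := (trig (fun (h : X) (x : borel X) => <<x, h>>)).
Implicit Types f g : borel X -> R.
Variables (A Qs Qt Qn Ss St Sn : X -> X) (gs gt nu : probability (borel X) R).
Hypothesis bA : bounded_operator A.
Hypothesis rs : nonneg_root dotp Qs Ss.
Hypothesis rt : nonneg_root dotp Qt St.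
Hypothesis rn : nonneg_root dotp Qn Sn.
Hypothesis Gs : is_gaussian dotp 0 Qs gs.
Hypothesis Gt : is_gaussian dotp 0 Qt gt.
Hypothesis Gn : is_gaussian dotp 0 Qn nu.
Hypothesis split : forall x y,
  <<Qt x, y>> = <<Qs (adjoint dotp A x), adjoint dotp A y>> + <<Qn x, y>>.
Local Notation P := (ou A nu).
Local Notation kap := (fun h => Ss (adjoint dotp A h)).
Variable e : nat -> X.
Hypothesis onb : onb_seq dotp e.

Let bmf_P f : bmf f -> bmf (P f).
Proof. exact: (bmf_ou dotp_norm Xsep gs nu bA). Qed.

Let PB f g x : bmf f -> bmf g -> P (fun z => f z - g z) x = P f x - P g x.
Proof. exact: ouB. Qed.

Let Qn0 h : 0 <= <<Qn h, h>>.
Proof. by case: rn => _ sym _ <-; rewrite sym dotp_norm sqr_ge0. Qed.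

Let Qs_sqr h : <<Qs h, h>> = `|Ss h| ^+ 2.
Proof. by case: rs => _ sym _ <-; rewrite sym dotp_norm. Qed.

Let Qt_sqr h : <<Qt h, h>> = `|St h| ^+ 2.
Proof. by case: rt => _ sym _ <-; rewrite sym dotp_norm. Qed.

Let kap_sqr h : `|kap h| ^+ 2 = `|St h| ^+ 2 - <<Qn h, h>>.
Proof. by rewrite -Qs_sqr -Qt_sqr split addrK. Qed.

Let kap_le h : `|kap h| <= 1 * `|St h|.
Proof.
by rewrite mul1r -(@ler_pXn2r _ 2) ?nnegrE// kap_sqr gerBl.
Qed.

Let linSs : linear Ss. Proof. by case: rs => -[]. Qed.
Let linSt : linear St. Proof. by case: rt => -[]. Qed.

Variable p : R.
Hypothesis p1 : 1 < p.
Local Notation ext := (Lp_extension gs gt P p).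

Let contraction : norm_decreasing gs gt P p p.
Proof.
exact: (ou_contraction dotp_norm Xsep bA rs rt rn Gs Gt Gn split onb ler01 (lexx 1) kap_le p1).
Qed.

(** Uniformly bounded functions are bounded in L^p, and there [ext] agrees with [P] up to norm 0, so
    compactness of [ext] is read on [P]. The comparison of norms carries that norm 0 from L^p to
    L^q. *)
Lemma compact_bounded_cauchy (q : R) (phi : nat -> borel X -> R) (B : R) : 1 <= q ->
  (forall f c, measurable_fun [set: borel X] f -> (Lp_norm gs p f <= c%:E)%E -> (Lp_norm gs q f <= c%:E)%E) ->
  compact_operator [set f | f \in Lfun gt p%:E] (Lp_norm gt p)
    [set g | g \in Lfun gs q%:E] (Lp_norm gs q) ext ->
  (forall n, measurable_fun [set: borel X] (phi n)) -> (forall n x, `|phi n x| <= B) ->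
  exists2 k : nat -> nat, increasing_seq k & forall eps, 0 < eps -> exists N, forall n m,
    (N <= n)%N -> (N <= m)%N ->
    (Lp_norm gs q (fun x => P (phi (k n)) x - P (phi (k m)) x)%R <= eps%:E)%E.
Proof.
move=> q1 qp [_ cpt] mphi phiB; have p0 : 0 < p by exact: lt_trans p1.
have bphi n : bmf (phi n) by split => //; exists B => x; exact: phiB.
have B0 : 0 <= B by apply: le_trans (phiB 0%N 0).
have one : (Lp_norm gt p (cst 1%R) <= 1%:E)%E.
  rewrite /Lp_norm (_ : EFin \o cst 1 = cst 1%E)// Lnorm_cst1.
  have -> : (gt : {measure set borel X -> \bar R}) [set: borel X] = 1%E by exact: probability_setT.
  by rewrite poweR1r.
have NB n : (Lp_norm gt p (phi n) <= (B * 1)%:E)%E.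
  apply: (Lp_norm_dominated p0 B0 _ (mphi n) _ one); first exact: measurable_cst.
  by move=> x; rewrite normr1 mulr1.
have Lphi n : phi n \in Lfun gt p%:E.
  by apply/(Lfun_leP gt _ (ltW p1)); split => //; exists (B * 1).
have [k k_incr [w /= Lw /cvge0_le lim]] := cpt phi Lphi (ex_intro _ _ NB).
have [mw _] := (Lfun_leP gs w q1).1 Lw.
exists k => // eps eps0; have e2 : 0 < eps / 2 by lra.
have [N _ hN] := lim _ e2; exists N => n m Nn Nm.
have [mPn _] := bmf_P (bphi (k n)); have [mPm _] := bmf_P (bphi (k m)).
have mext i := measurable_Lp_extension (ltW p1) bmf_P PB contraction (Lphi i).
have near_w i : (N <= i)%N ->
    (Lp_norm gs q (fun x => P (phi (k i)) x - w x)%R <= (eps / 2)%:E)%E.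
  move=> Ni; have [mPi _] := bmf_P (bphi (k i)).
  rewrite -[eps / 2]add0r; apply: (Lp_norm_dist_triangle q1 mPi (mext (k i)) mw _ (hN i Ni)).
  apply: qp; first exact: measurable_funB.
  exact: (Lp_extension_bmf (ltW p1) bmf_P PB contraction (bphi _)).
rewrite [eps]splitr; apply: (Lp_norm_dist_triangle q1 mPn mw mPm (near_w n Nn)).
by rewrite Lp_normC; exact: near_w.
Qed.

(** The amplitudes cancel the Gaussian factor of the first chaos coefficients, which become 1 and
    -1; the degree 1 term is then [|Ss a - Ss b|^2] and all other terms are nonnegative. *)
Lemma sin_dist_ge a b (s := [:: (0, expR (`|Ss a| ^+ 2 / 2), a); (0, - expR (`|Ss b| ^+ 2 / 2), b)]) :
  `|Ss a - Ss b| ^+ 2 <= \int[gs]_x tr s x ^+ 2.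
Proof.
have Q0 h : 0 <= <<Qs h, h>> by rewrite Qs_sqr sqr_ge0.
have gcos h : \int[gs]_x cos <<x, h>> = expR (- `|Ss h| ^+ 2 / 2).
  by rewrite (gaussian_cos dotp_norm Q0 Gs) Qs_sqr (dot0l dotp) cos0 mul1r.
have gsin h : \int[gs]_x sin <<x, h>> = 0.
  by rewrite (gaussian_sin dotp_norm Q0 Gs) (dot0l dotp) sin0 mul0r.
have lim := trig_second_moment dotp_norm linSs gcos gsin (s := s).
have term_ge0 m : 0 <= quad s (trig_coef Ss m) (fun i j => <<Ss i.2, Ss j.2>> ^+ m) / m`!%:R.
  by rewrite divr_ge0//; exact: (psd_gram_exp dotp_norm onb s (fun i => Ss i.2) m (trig_coef Ss m)).
have c1 : trig_coef Ss 1 (0, expR (`|Ss a| ^+ 2 / 2), a) = 1.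
  by rewrite /trig_coef /= -expRD mulNr subrr expR0.
have c2 : trig_coef Ss 1 (0, - expR (`|Ss b| ^+ 2 / 2), b) = - 1.
  by rewrite /trig_coef /= mulNr -expRD mulNr subrr expR0.
have term1 : quad s (trig_coef Ss 1) (fun i j => <<Ss i.2, Ss j.2>> ^+ 1) / 1`!%:R = `|Ss a - Ss b| ^+ 2.
  rewrite divr1 (eq_quad _ _ (N := fun i j => <<Ss i.2, Ss j.2>>)); last by move=> i j; rewrite expr1.
  rewrite (quad_gram dotp_norm) /s !big_cons big_nil c1 c2 scale1r scaleN1r addr0.
  by [].
rewrite -(cvg_lim (@Rhausdorff R) lim); apply: limr_ge; first by apply/cvg_ex; eexists; exact: lim.
exists 2%N => // M /= M2.
rewrite (bigD1 (Ordinal M2))//= term1 lerDl; apply: sumr_ge0 => i _; exact: term_ge0.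
Qed.

Lemma transfer_compact_of_extension :
  compact_operator [set f | f \in Lfun gt p%:E] (Lp_norm gt p)
    [set g | g \in Lfun gs 1%:E] (Lp_norm gs 1) ext ->
  forall (h : nat -> X) (M : R), (forall n, `|St (h n)| <= M) ->
  exists2 k : nat -> nat, increasing_seq k & cvgn (fun n => kap (h (k n))).
Proof.
move=> cpt h M hM.
pose s n := [:: (0, expR (`|St (h n)| ^+ 2 / 2), h n)] : seq (R * R * X).
pose B := expR (M ^+ 2 / 2).
have trs n x : tr (s n) x = expR (`|St (h n)| ^+ 2 / 2) * sin <<x, h n>>.
  by rewrite /trig /s big_cons big_nil /= mul0r add0r addr0.
have ous n : ou_seq dotp A Qn (s n) = [:: (0, expR (`|kap (h n)| ^+ 2 / 2), adjoint dotp A (h n))].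
  by rewrite /ou_seq /s /= mul0r -expRD kap_sqr; congr [:: (_, expR _, _)]; lra.
have M2 n : `|St (h n)| ^+ 2 <= M ^+ 2.
  by rewrite ler_pXn2r ?nnegrE//; apply: le_trans (hM n).
have sB n (x : borel X) : `|tr (s n) x| <= B.
  rewrite trs normrM ger0_norm ?expR_ge0// -[leRHS]mulr1 ler_pM ?expR_ge0//.
    by rewrite ler_expR ler_pM2r.
  exact: sin_max.
have Pn n x : P (tr (s n)) x = tr (ou_seq dotp A Qn (s n)) x.
  exact: (ou_trig dotp_norm bA Qn0 Gn).
have B0 : 0 < B by exact: expR_gt0.
have PB' n (x : borel X) : `|P (tr (s n)) x| <= B.
  rewrite Pn ous /trig big_cons big_nil /= mul0r add0r addr0.
  rewrite normrM ger0_norm ?expR_ge0// -[leRHS]mulr1 ler_pM ?expR_ge0//; last exact: sin_max.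
  rewrite ler_expR ler_pM2r//; apply: le_trans (M2 n); rewrite kap_sqr gerBl; exact: Qn0.
have btr n := bmf_borel_trig dotp_norm (s n).
have [k k_incr cauchy] := compact_bounded_cauchy (lexx 1)
  (fun f c mf => Lp_norm1_le (ltW p1) mf) cpt (fun n => (btr n).1) sB.
exists k => //.
suff main eps : 0 < eps -> exists N, forall n m, (N <= n)%N -> (N <= m)%N ->
    `|kap (h (k n)) - kap (h (k m))| <= eps.
  apply/cauchy_cvgP/cauchyP => eps eps0; have e2 : 0 < eps / 2 by lra.
  have [N hN] := main _ e2.
  exists (kap (h (k N))); exists N => // n /= Nn; rewrite -ball_normE /ball_ /=.
  by apply: le_lt_trans (hN _ _ (leqnn N) Nn) _; lra.
(* The square of a function bounded by [2 B] is at most [2 B] times its modulus; this fixes the L^1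
   tolerance. *)
move=> eps0; have d0 : 0 < eps ^+ 2 / (2 * B) by rewrite divr_gt0 ?mulr_gt0 ?exprn_gt0.
have [N hN] := cauchy _ d0; exists N => n m Nn Nm.
rewrite -(@ler_pXn2r _ 2) ?nnegrE ?(ltW eps0)//.
have b := bmfB (bmf_P (btr (k n))) (bmf_P (btr (k m))).
have := hN n m Nn Nm; rewrite bmf_L1E// lee_fin ler_pdivlMr ?mulr_gt0// => small.
apply: le_trans (sin_dist_ge _ _) _; apply: le_trans small.
rewrite [leRHS]mulrC -(expectZ gs (2 * B) (bmf_norm b)); apply: expect_le.
- by apply: bmfX; exact: (bmf_borel_trig dotp_norm).
- by apply: bmfZ; exact: bmf_norm.
move=> x; have -> : tr [:: (0, expR (`|kap (h (k n))| ^+ 2 / 2), adjoint dotp A (h (k n)));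
    (0, - expR (`|kap (h (k m))| ^+ 2 / 2), adjoint dotp A (h (k m)))] x =
    P (tr (s (k n))) x - P (tr (s (k m))) x.
  by rewrite !Pn !ous /trig !big_cons !big_nil /= !mul0r !add0r !addr0 mulNr.
rewrite -real_normK ?num_real// expr2 ler_wpM2r//.
apply: le_trans (ler_normB _ _) _; rewrite mulr_natl mulr2n lerD//; exact: PB'.
Qed.

Lemma extension_compact_L1 :
  compact_operator [set f | f \in Lfun gt p%:E] (Lp_norm gt p)
    [set g | g \in Lfun gs p%:E] (Lp_norm gs p) ext ->
  compact_operator [set f | f \in Lfun gt p%:E] (Lp_norm gt p)
    [set g | g \in Lfun gs 1%:E] (Lp_norm gs 1) ext.
Proof.
have L1 g : g \in Lfun gs p%:E -> g \in Lfun gs 1%:E.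
  move=> /(Lfun_leP gs g (ltW p1))[mg [C gC]]; apply/(Lfun_leP gs g (lexx 1)); split => //.
  by exists C; exact: (Lp_norm1_le (ltW p1)).
move=> [into cpt]; split => [f /into /= /L1 //|u Lu bu].
have [k k_incr [w Lw lim]] := cpt u Lu bu; exists k => //; exists w => /=; first exact: L1.
apply: cvge0_of_le => [n|eps eps0]; first exact: Lp_norm_ge0.
have := cvge0_le lim eps0; apply: filterS => n; apply: (Lp_norm1_le (ltW p1)).
have [mw _] := (Lfun_leP gs w (ltW p1)).1 Lw.
have [mu _] := (Lfun_leP gs _ (ltW p1)).1 (into _ (Lu (k n))).
exact: measurable_funB.
Qed.

Let ou_cos h x : P (tr [:: (1, 0, h)]) x =
  expR (- <<Qn h, h>> / 2) * cos <<x, adjoint dotp A h>>.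
Proof.
rewrite (ou_trig dotp_norm bA Qn0 Gn) /ou_seq /trig /= big_cons big_nil /=.
by rewrite !mul1r !mul0r !addr0.
Qed.

Let Qs0 h : 0 <= <<Qs h, h>>. Proof. by rewrite Qs_sqr sqr_ge0. Qed.

Let gcos h : \int[gs]_x cos <<x, h>> = expR (- `|Ss h| ^+ 2 / 2).
Proof. by rewrite (gaussian_cos dotp_norm Qs0 Gs) Qs_sqr (dot0l dotp) cos0 mul1r. Qed.

Lemma expect_cosM a b : \int[gs]_x (cos <<x, a>> * cos <<x, b>>) =
  (expR (- `|Ss a - Ss b| ^+ 2 / 2) + expR (- `|Ss a + Ss b| ^+ 2 / 2)) / 2.
Proof.
have bc h : bmf (fun x : borel X => cos <<x, h>>).
  by apply: bmf_cos; exact: (@measurable_dot _ _ _ dotp_norm h).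
have -> : Ss a - Ss b = Ss (a - b).
  by rewrite [a - b]addrC -(scaleN1r b) linSs scaleN1r addrC.
have -> : Ss a + Ss b = Ss (a + b).
  by have := linSs 1 a b; rewrite !scale1r.
rewrite -!gcos -(expectD gs (bc _) (bc _)) mulrC -(expectZ gs _ (bmfD (bc _) (bc _))).
apply: eq_Rintegral => x _.
by rewrite (dotBr dotp) (dotDr dotp) cosB cosD; field.
Qed.

(** Each square contributes at least 1/2 times 1/2. The cross term is at most 2/9, since vectors of
    norm at least 4 give [exp (- 8) <= 1/9]; what remains, 5/18, exceeds 1/4. *)
Lemma ou_cos_dist a b : 4 <= `|kap a| - `|kap b| ->
  <<Qn a, a>> <= 1 / 2 -> <<Qn b, b>> <= 1 / 2 ->
  1 / 4 < \int[gs]_x (P (tr [:: (1, 0, a)]) x - P (tr [:: (1, 0, b)]) x) ^+ 2.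
Proof.
move=> far qa qb.
have bc h : bmf (fun x : borel X => cos <<x, h>>).
  by apply: bmf_cos; exact: (@measurable_dot _ _ _ dotp_norm h).
pose ca := expR (- <<Qn a, a>> / 2); pose cb := expR (- <<Qn b, b>> / 2).
pose a' := adjoint dotp A a; pose b' := adjoint dotp A b.
have E : \int[gs]_x (P (tr [:: (1, 0, a)]) x - P (tr [:: (1, 0, b)]) x) ^+ 2 =
    ca ^+ 2 * \int[gs]_x (cos <<x, a'>> * cos <<x, a'>>) +
    cb ^+ 2 * \int[gs]_x (cos <<x, b'>> * cos <<x, b'>>) -
    2 * ca * cb * \int[gs]_x (cos <<x, a'>> * cos <<x, b'>>).
  have b1 := bmfM (bc a') (bc a'); have b2 := bmfM (bc b') (bc b'); have b3 := bmfM (bc a') (bc b').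
  rewrite -(expectZ gs _ b1) -(expectZ gs _ b2) -(expectZ gs _ b3).
  rewrite -(expectD gs (bmfZ _ b1) (bmfZ _ b2)) -(expectB gs (bmfD (bmfZ _ b1) (bmfZ _ b2)) (bmfZ _ b3)).
  by apply: eq_Rintegral => x _; rewrite !ou_cos -/ca -/cb -/a' -/b'; ring.
have csq h : <<Qn h, h>> <= 1 / 2 -> 1 / 2 <= expR (- <<Qn h, h>> / 2) ^+ 2 <= 1.
  move=> hh; rewrite -expRM_natl; have := Qn0 h => h0; apply/andP; split.
    by apply: le_trans (expR_ge1Dx _); lra.
  by rewrite -[leRHS]expR0 ler_expR; lra.
have half h : 1 / 2 <= \int[gs]_x (cos <<x, h>> * cos <<x, h>>).
  rewrite expect_cosM subrr normr0 expr0n/= oppr0 mul0r expR0.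
  by have := expR_ge0 (- `|Ss h + Ss h| ^+ 2 / 2); lra.
have cross : \int[gs]_x (cos <<x, a'>> * cos <<x, b'>>) <= 1 / 9.
  rewrite expect_cosM; have small y : 4 <= `|y : X| -> expR (- `|y| ^+ 2 / 2) <= 1 / 9.
    move=> y4; rewrite mulNr expRN mul1r lef_pV2 ?posrE ?expR_gt0//.
    by apply: le_trans (expR_ge1Dx _); nra.
  have n1 := small (Ss a' - Ss b') (le_trans far (lerB_dist _ _)).
  have n2 : expR (- `|Ss a' + Ss b'| ^+ 2 / 2) <= 1 / 9.
    apply: small; rewrite -[Ss b']opprK; apply: le_trans (lerB_dist _ _).
    by rewrite normrN.
  lra.
have := csq _ qa; have := csq _ qb; rewrite -/ca -/cb E => /andP[cb1 cb2] /andP[ca1 ca2].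
have ca0 : 0 < ca := expR_gt0 _; have cb0 : 0 < cb := expR_gt0 _.
have ha := half a'; have hb := half b'.
have t1 : 1 / 4 <= ca ^+ 2 * \int[gs]_x (cos <<x, a'>> * cos <<x, a'>>) by nra.
have t2 : 1 / 4 <= cb ^+ 2 * \int[gs]_x (cos <<x, b'>> * cos <<x, b'>>) by nra.
have cab : 0 <= 2 * ca * cb <= 2 by apply/andP; split; nra.
have t3 : 2 * ca * cb * \int[gs]_x (cos <<x, a'>> * cos <<x, b'>>) <= 2 / 9.
  have [I0|I0] := leP 0 (\int[gs]_x (cos <<x, a'>> * cos <<x, b'>>)).
    by move: cab => /andP[c1 c2]; nra.
  by move: cab => /andP[c1 c2]; nra.
lra.
Qed.

(* If no rho < 1 works, there are h_n of unit norm on which kap is almost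
   isometric; the images of cos<., c_n h_n> then keep their L^2-norms, and are
   nearly orthogonal as soon as the frequencies c_n are far apart. *)
Lemma strict_contraction_of_extension :
  compact_operator [set f | f \in Lfun gt p%:E] (Lp_norm gt p)
    [set g | g \in Lfun gs p%:E] (Lp_norm gs p) ext -> p = 2 ->
  exists rho, [/\ 0 <= rho, rho < 1 & forall h, `|kap h| <= rho * `|St h|].
Proof.
move=> cpt p_eq2; apply/not_existsP => no_rho.
(* Steps of 5 leave a gap of 4 between the norms of [kap], each of which may fall short of [c n] by
   1. *)
pose c n : R := 5 * n.+1%:R.
have c5 n : 5 <= c n by rewrite ler_peMr// ler1n.
have ex n : exists h, [/\ `|St h| = c n, c n - 1 <= `|kap h| & <<Qn h, h>> <= 1 / 2].
  (* With this [r], [c^2 - (r c)^2 <= 1/2], which bounds the noise, and [r c >= c - 1]. *)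
  have cn := c5 n; pose r := 1 - (4 * c n ^+ 2)^-1.
  have c2 : 25 <= c n ^+ 2 by nra.
  have d0 : 0 < (4 * c n ^+ 2)^-1 by rewrite invr_gt0; lra.
  have d1 : (4 * c n ^+ 2)^-1 <= 1 by rewrite invf_le1; lra.
  have r0 : 0 <= r by rewrite /r; lra.
  have r1 : r < 1 by rewrite /r; lra.
  have [h] : exists h, r * `|St h| < `|kap h|.
    apply: contrapT => /forallNP far; apply: (no_rho r); split => // h.
    by rewrite leNgt; apply/negP; exact: far.
  move=> big; have Sh0 : 0 < `|St h|.
    rewrite normr_gt0; apply/eqP => S0; move: big; have := kap_le h.
    by rewrite S0 normr0 !mulr0; move=> h1 /lt_le_trans/(_ h1); rewrite ltxx.
  have scal (y : X -> X) t : linear y -> y (t *: h) = t *: y h.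
    move=> lin; have y0 : y 0 = 0.
      by have := lin (- 1) 0 0; rewrite scaler0 addr0 scaleN1r addNr.
    by have := lin t h 0; rewrite !addr0 y0 addr0.
  pose t := c n / `|St h|.
  have t0 : 0 < t by rewrite divr_gt0//; lra.
  have nS : `|St (t *: h)| = c n by rewrite scal// normrZ gtr0_norm// /t divfK ?gt_eqF.
  have nK : r * c n < `|kap (t *: h)|.
    have [linA _] := bA.
    have -> : kap (t *: h) = t *: kap h.
      by rewrite (scal (fun h => Ss (adjoint dotp A h))) // => a x y; rewrite (adjoint_linear dotp_norm bA) linSs.
    by rewrite normrZ (gtr0_norm t0) -{1}nS scal// normrZ (gtr0_norm t0) mulrCA ltr_pM2l.
  exists (t *: h); split => //.
    apply: ltW; apply: le_lt_trans nK; rewrite /r mulrBl mul1r lerD2l lerN2.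
    rewrite invfM -mulrA expr2 invfM -mulrA mulVf ?mulr1; last by rewrite gt_eqF//; lra.
    have : (c n)^-1 <= 1 by rewrite invf_le1; lra.
    have : 0 <= (c n)^-1 by rewrite invr_ge0; lra.
    lra.
  have := kap_sqr (t *: h); rewrite nS => hk.
  have : (r * c n) ^+ 2 <= `|kap (t *: h)| ^+ 2.
    by rewrite ler_pXn2r ?nnegrE ?(ltW nK)// mulr_ge0//; lra.
  have E : (r * c n) ^+ 2 = c n ^+ 2 - 1 / 2 + (4 * c n ^+ 2)^-1 / 4.
    by rewrite /r; field; rewrite gt_eqF//; lra.
  by rewrite E hk; lra.
have [h hh] := choice ex.
pose f n := tr [:: (1, 0, h n)].
have fE n x : f n x = cos <<x, h n>>.
  by rewrite /f /trig big_cons big_nil /= mul1r mul0r !addr0.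
have bf n : bmf (f n) by exact: (bmf_borel_trig dotp_norm).
have [k k_incr cauchy] := compact_bounded_cauchy (ltW p1) (fun f c _ h => h) cpt
  (fun n => (bf n).1) (fun n x => eq_ind_r (fun y => `|y| <= 1) (cos_max _) (fE n x)).
have [|N hN] := cauchy (1 / 2); first by lra.
have := hN N.+1 N (leqnSn N) (leqnn N).
have b := bmfB (bmf_P (bf (k N.+1))) (bmf_P (bf (k N))); have [mb _] := b.
have hf : 0 <= 1 / 2 :> R by lra.
move=> small; have : (Lp_norm gs 2 (fun x => P (f (k N.+1)) x - P (f (k N)) x)%R <= (1 / 2)%:E)%E.
  by rewrite -[X in Lp_norm gs X]p_eq2.
rewrite bmf_L2_leP//; apply/negP; rewrite -ltNge.
have [S1 K1 Q1] := hh (k N.+1); have [S2 K2 Q2] := hh (k N).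
have -> : (1 / 2) ^+ 2 = 1 / 4 :> R by field.
apply: ou_cos_dist => //.
have kk : (k N).+1%:R + 1 <= (k N.+1).+1%:R :> R.
  by rewrite natr1 ler_nat ltnS ltnNge -leEnat k_incr ltnn.
have kN : `|kap (h (k N))| <= c (k N) by have := kap_le (h (k N)); rewrite mul1r S2.
have : c (k N) + 5 <= c (k N.+1) by rewrite /c; lra.
lra.
Qed.

End necessity.

(** * Identification of the transition with its Mehler form *)

Lemma eq_Lp_extension d (T : measurableType d) (R : realType) (gs gt : probability T R)
    (P P' : (T -> R) -> T -> R) (p : R) (f : T -> R) :
  (forall phi, bmf phi -> P phi = P' phi) ->
  Lp_extension gs gt P p f = Lp_extension gs gt P' p f.
Proof.
move=> PP'; congr (xget 0); apply/funext => g; apply/propext.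
split=> -[Lg [phi [bphi lim1 lim2]]]; split; [exact: Lg| |exact: Lg|].
  exists phi; split; [exact: bphi | exact: lim1 |].
  by under eq_fun => n do rewrite -(PP' _ (bphi n)).
exists phi; split; [exact: bphi | exact: lim1 |].
by under eq_fun => n do rewrite (PP' _ (bphi n)).
Qed.

Section gaussian_translation.
Context (R : realType) (X : completeNormedModType R).
Variable dotp : {dot X for idfun}.
Hypothesis dotp_norm : is_inner_product dotp.
Hypothesis Xsep : separable X.
Local Notation "<< x , y >>" := (dotp x y) (at level 0, format "<< x ,  y >>").

(** Translation shifts the phase of the characteristic function by [a]; uniqueness of Gaussian
    measures identifies the two laws. *)
Lemma expect_gaussian_translate (a : X) (Q : X -> X) (nu : probability (borel X) R)
    (f : borel X -> R) : linear Q -> (forall h, 0 <= <<Q h, h>>) ->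
  is_gaussian dotp 0 Q nu -> is_gaussian dotp a Q (gaussian dotp a Q) -> bmf f ->
  \int[gaussian dotp a Q]_y f y = \int[nu]_y f (a + y).
Proof.
move=> linQ Q0 Gnu Ga bf.
have mt : measurable_fun [set: borel X] (fun y : borel X => a + y : borel X).
  apply: (measurable_to_borel dotp_norm Xsep) => h; under eq_fun do rewrite (dotDl dotp).
  apply: measurable_funD; first exact: measurable_cst.
  exact: (@measurable_dot _ _ _ dotp_norm h).
rewrite -(expect_law nu mt bf); apply: expect_eq_measure => E mE.
apply: (gaussian_unique dotp_norm Xsep Q0 Ga) => //.
have bc h : bmf (fun x : borel X => cos <<x, h>>).
  by apply: bmf_cos; exact: (@measurable_dot _ _ _ dotp_norm h).
have bs h : bmf (fun x : borel X => sin <<x, h>>).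
  by apply: bmf_sin; exact: (@measurable_dot _ _ _ dotp_norm h).
apply: (is_gaussian_of_cf dotp_norm linQ Q0) => h.
  rewrite (expect_law nu mt (bc h)) -(gaussian_cos_shift dotp_norm Q0 Gnu).
  by apply: eq_Rintegral => y _; rewrite (dotDl dotp).
rewrite (expect_law nu mt (bs h)) -(gaussian_sin_shift dotp_norm Q0 Gnu).
by apply: eq_Rintegral => y _; rewrite (dotDl dotp).
Qed.

End gaussian_translation.

Theorem corollary5p7 (R : realType) (X : completeNormedModType R)
  (dotp : {dot X for idfun}) (U : R -> R -> X -> X) (B : R -> X -> X)
  (dotp_norm : is_inner_product dotp) (X_separable : separable X)
  (A1 : evolution_operator U) (A2 : bounded_measurable_family B)
  (A3 : finite_trace_cov dotp U B) (A4 : stable_evolution dotp U B)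
  (s t : R) (s_lt_t : s < t)
  (U_neq0 : exists2 h, H dotp U B s h & U t s h <> 0) :
  [/\ U_H_compact dotp U B t s -> (U_H_norm dotp U B t s < 1)%E ->
        forall p q : R, 1 < p -> 1 <= q ->
          q < 1 + (p - 1) * (fine (U_H_norm dotp U B t s)) ^- 2 ->
          P_compact dotp U B s t p q,
      (exists2 p : R, 1 < p & P_compact dotp U B s t p 1) ->
        U_H_compact dotp U B t s &
      P_compact dotp U B s t 2 2 ->
        U_H_compact dotp U B t s /\ (U_H_norm dotp U B t s < 1)%E].
Proof.
have [e onb e_trace] := onb_seq_exists dotp_norm X_separable.
have bA : bounded_operator (U t s) by case: A1 => bU _ _ _; apply: bU; exact: ltW.
have root r : nonneg_root dotp (cov_ninfty dotp U B r) (sqrt_operator dotp (cov_ninfty dotp U B r)).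
  apply: (sqrt_operatorP dotp_norm).
  - exact: (cov_ninfty_bounded dotp_norm X_separable A1 A2 onb e_trace A4).
  - exact: (cov_ninfty_sym dotp_norm X_separable A1 A2 onb e_trace A4).
  - exact: (cov_ninfty_ge0 dotp_norm X_separable A1 A2 onb e_trace A4).
have bn := cov_bounded dotp_norm X_separable A1 A2 (ltW s_lt_t).
have Qn0 := cov_ge0 dotp_norm X_separable A1 A2 (ltW s_lt_t).
have rn : nonneg_root dotp (cov dotp U B t s) (sqrt_operator dotp (cov dotp U B t s)).
  by apply: (sqrt_operatorP dotp_norm) => //; exact: (cov_sym dotp_norm X_separable A1 A2 (ltW s_lt_t)).
have [C traceC] : exists C : R, forall n, \sum_(i < n) dotp (cov dotp U B t s (e i)) (e i) <= C.
  have fin : trace dotp (cov dotp U B t s) \is a fin_num.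
    rewrite ge0_fin_numE; first exact: A3.
    by apply: esum_ge0 => x _; rewrite lee_fin.
  by exists (fine (trace dotp (cov dotp U B t s))); apply: e_trace => //; rewrite fineK.
have Ga a := gaussianP dotp_norm X_separable a rn onb traceC.
have Ggamma r : is_gaussian dotp 0 (cov_ninfty dotp U B r) (gamma dotp U B r).
  have [C' h] := cov_ninfty_trace dotp_norm X_separable A1 A2 onb e_trace A4 r.
  exact: (gaussianP dotp_norm X_separable 0 (root r) onb h).
have split x y := @cov_ninfty_split _ _ _ dotp_norm X_separable _ _ A1 A2 _ onb e_trace A4 t s x y s_lt_t.
have kap_le := transfer_contract dotp_norm (root s) (root t) Qn0 split.
(* Agreement on bounded measurable functions is enough, since the extension to L^p evaluates the
   operator on these alone. *)
have ouE phi : bmf phi -> ou_transition dotp U B s t phi =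
    ou (U t s) (gaussian dotp 0 (cov dotp U B t s)) phi.
  move=> bphi; apply/funext => x.
  by apply: (expect_gaussian_translate dotp_norm X_separable _ _ (Ga 0) (Ga _) bphi) => //; case: bn.
have extE p f : ou_transition_Lp dotp U B s t p f =
    Lp_extension (gamma dotp U B s) (gamma dotp U B t)
      (ou (U t s) (gaussian dotp 0 (cov dotp U B t s))) p f.
  exact: (eq_Lp_extension (gamma dotp U B s) (gamma dotp U B t) p f ouE).
have P_compactE p q : P_compact dotp U B s t p q <->
    compact_operator [set f | f \in Lfun (gamma dotp U B t) p%:E] (Lp_norm (gamma dotp U B t) p)
      [set g | g \in Lfun (gamma dotp U B s) q%:E] (Lp_norm (gamma dotp U B s) q)
      (Lp_extension (gamma dotp U B s) (gamma dotp U B t)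
      (ou (U t s) (gaussian dotp 0 (cov dotp U B t s))) p).
  by rewrite /P_compact; have -> : ou_transition_Lp dotp U B s t p = _ := funext (extE p).
have necessary p : 1 < p -> P_compact dotp U B s t p 1 -> U_H_compact dotp U B t s.
  move=> p1 /P_compactE cpt.
  apply: (compact_of_transfer dotp_norm bA (root s) (root t) kap_le onb).
  exact: (transfer_compact_of_extension dotp_norm X_separable bA (root s) (root t) rn
    (Ggamma s) (Ggamma t) (Ga 0) split onb p1 cpt).
split => [Ucpt Unorm p q p1 q1|[p p1]|cpt22].
- set rho := fine _ => qlt; apply/P_compactE.
  have U0 := opnorm_ge0 dotp_norm (U t s) (cov_ninfty dotp U B t) (root s).
  have Ufin : U_H_norm dotp U B t s \is a fin_num.
    by rewrite ge0_fin_numE//; exact: lt_trans Unorm (ltry _).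
  have rho0 : 0 <= rho by exact: fine_ge0.
  have rho_lt1 : rho < 1 by rewrite -lte_fin /rho fineK.
  have kap_rho : forall h, `|transfer dotp (U t s) (cov_ninfty dotp U B s) h| <=
      rho * `|sqrt_operator dotp (cov_ninfty dotp U B t) h|.
    by apply: (transfer_le dotp_norm bA (root s) (root t) kap_le); rewrite /rho fineK.
  have tail := tail_of_compact dotp_norm bA (root s) (root t) kap_le onb Ucpt.
  (* The inverse of 0 is 0, so for [rho = 0] the bound on [q] would read [q < 1], against
     [1 <= q]. *)
  have rho_neq0 : rho != 0.
    by apply/eqP => r0; move: qlt; rewrite r0 expr0n invr0 mulr0 addr0 ltNge q1.
  (* [q0] is the critical exponent itself, for which the hypercontractivity condition is an
     equality; [q] lies strictly below it. *)
  apply: (extension_compact dotp_norm X_separable bA (root s) (root t) rn (Ggamma s) (Ggamma t)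
    (Ga 0) split onb rho0 (ltW rho_lt1) kap_rho p1 rho_lt1 tail q1 qlt).
  by rewrite addrAC subrr add0r divfK// sqrf_eq0.
- exact: necessary.
have p2 : (1 : R) < 2 by rewrite ltr1n.
have cpt := (P_compactE 2 2).1 cpt22.
split.
  apply: (necessary _ p2); apply/P_compactE.
  exact: (extension_compact_L1 p2 cpt).
have [rho [rho0 rho_lt1 kap_rho]] := strict_contraction_of_extension dotp_norm X_separable bA
  (root s) (root t) rn (Ggamma s) (Ggamma t) (Ga 0) split onb p2 cpt erefl.
by apply: le_lt_trans (opnorm_le dotp_norm bA (root s) (root t) rho0 kap_rho) _; rewrite lte_fin.
Qed.
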